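(* Let $1<p<\infty$ and $T(a)+H(b)\in\mathcal F_{TH}^p(-2,2)$ with subordinated pair $(c,d)$, and let $d=\boldsymbol\sigma(d)d_+t^{-2}\tilde d_+^{-1}$ be the Wiener–Hopf factorization of $d$ in $L^p$. Define $$\omega^{a,b,\pm}:=T^{-1}(ct^{-2})\,T(\tilde a^{-1}t^{-1})\big(d_+^{-1}\pm\boldsymbol\sigma(d)d_+^{-1}t\big)\in H^p$$ (here $T(ct^{-2})$ is invertible on $H^p$), and let $\hat\omega_0^{a,b,\pm}$ be its zeroth Fourier coefficient. The pair $(\bar a,\widetilde{\bar b})$ is a matching pair with $T(\bar a)+H(\widetilde{\bar b})\in\mathcal F^q_{TH}(-2,2)$, and $\hat\omega_0^{\bar a,\widetilde{\bar b},\pm}$ are defined in the same way with $p$ replaced by $q=p/(p-1)$. Then: (a) $T(a)+H(b)$ (resp. $T(a)-H(b)$) is left-invertible iff $\hat\omega_0^{a,b,+}\ne0$ (resp. $\hat\omega_0^{a,b,-}\ne0$); (b) $T(a)+H(b)$ (resp. $T(a)-H(b)$) is right-invertible iff $\hat\omega_0^{\bar a,\widetilde{\bar b},+}\ne0$ (resp. $\hat\omega_0^{\bar a,\widetilde{\bar b},-}\ne0$); (c) $T(a)+H(b)$ (resp. $T(a)-H(b)$) is invertible iff $\hat\omega_0^{a,b,+}\ne0$ and $\hat\omega_0^{\bar a,\widetilde{\bar b},+}\ne0$ (resp. $\hat\omega_0^{a,b,-}\ne0$ and $\hat\omega_0^{\bar a,\widetilde{\bar b},-}\ne0$); (d) if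 $\hat\omega_0^{a,b,+}\ne0$ and $\hat\omega_0^{a,b,-}\ne0$, then both $T(a)+H(b)$ and $T(a)-H(b)$ are invertible.
   Context: $\mathbb T$ is the unit circle, $1<p<\infty$, $1/p+1/q=1$; $H^p=\{f\in L^p(\mathbb T):\hat f_n=0\ \forall n<0\}$, $\overline{H^p}=\{f\in L^p:\hat f_n=0\ \forall n>0\}$; $P$ is the Riesz projection onto $H^p$, $Q=I-P$, $(Jf)(t)=t^{-1}f(t^{-1})$, $\tilde a(t)=a(1/t)$, $\bar a$ is the complex conjugate; $t$ denotes $t\mapsto t$. On $H^p$: $T(a)f=P(af)$, $H(a)f=P(aQJf)$. A pair $(a,b)$ with $a\in GL^\infty(\mathbb T)$ (invertible in $L^\infty$) and $b\in L^\infty(\mathbb T)$ is a matching pair if $a\tilde a=b\tilde b$; the subordinated pair is $(c,d)$, $c:=a/b$, $d:=a/\tilde b$, with $c\tilde c=d\tilde d=1$. We write $T(a)+H(b)\in\mathcal F_{TH}^p(\kappa_1,\kappa_2)$ if $(a,b)$ is a matching pair whose subordinated operators $T(c),T(d)$ are Fredholm on $H^p$ with $\operatorname{ind}T(c)=\kappa_1$, $\operatorname{ind}T(d)=\kappa_2$. A Wiener–Hopf factorization of $a\in L^\infty$ in $L^p$ is $a=a_-t^ma_+$ with $m\in\mathbb Z$, $a_+\in H^q$, $a_+^{-1}\in H^p$, $a_-\in\overline{H^p}$, $a_-^{-1}\in\overline{H^q}$, and $\|a_+^{-1}P(a_+\varphi)\|_p\le c_p\|\varphi\|_p$ for all trigonometric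 polynomials $\varphi$. If $g$ satisfies $g\tilde g=1$ and $T(g)$ is Fredholm on $H^p$ with index $n$, its Wiener–Hopf factorization normalized by $g_-(\infty)=1$ has the form $g=\boldsymbol\sigma(g)g_+t^{-n}\tilde g_+^{-1}$ with $\boldsymbol\sigma(g)=g_+(0)\in\{-1,1\}$ (the factorization signature) and plus factor $g_+$. *)

(* Defs.v *)
From HB Require Import structures.
From mathcomp Require Import all_boot all_order all_algebra.
From mathcomp Require Import all_classical all_reals all_analysis.
From mathcomp Require Import complex.

Set Implicit Arguments.
Unset Strict Implicit.
Unset Printing Implicit Defensive.

Import Order.TTheory GRing.Theory Num.Theory.
Import numFieldNormedType.Exports.

Local Open Scope classical_set_scope.
Local Open Scope ring_scope.

(* A function on the unit circle T is represented by its values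
   f(e^{i theta}) for theta in [0, 2 pi] (parametrization by angle);
   the measure is Lebesgue measure on [0, 2 pi]. *)

Section Circle.
Variable R : realType.

Notation C := (R[i]).
Definition fT := R -> C.

Definition dom : set R := [set x | 0 <= x <= 2 * pi].
Definition mu := (@lebesgue_measure R).

Definition cabs (z : C) : R := Num.sqrt (complex.Re z ^+ 2 + complex.Im z ^+ 2).

Definition tpow (k : int) : fT :=
  fun x => Complex (cos (k%:~R * x)) (sin (k%:~R * x)).

(* f~(t) = f(1/t) : e^{-i theta} = e^{i (2 pi - theta)} *)
Definition tilde (f : fT) : fT := fun x => f (2 * pi - x).
Definition Jop (f : fT) : fT := fun x => tpow (-1) x * f (2 * pi - x).
Definition conjf (f : fT) : fT := fun x => conjc (f x).
Definition finv (f : fT) : fT := fun x => (f x)^-1.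
Definition fmul (f g : fT) : fT := fun x => f x * g x.
Definition fadd (f g : fT) : fT := fun x => f x + g x.
Definition fsub (f g : fT) : fT := fun x => f x - g x.
Definition fscale (z : C) (f : fT) : fT := fun x => z * f x.
Definition f0 : fT := fun _ => 0.

Definition cmeas (f : fT) :=
  measurable_fun dom (fun x => complex.Re (f x)) /\
  measurable_fun dom (fun x => complex.Im (f x)).

Definition pint (r : R) (f : fT) : \bar R :=
  (\int[mu]_(x in dom) ((cabs (f x)) `^ r)%:E)%E.

Definition Lp (r : R) (f : fT) := cmeas f /\ (pint r f < +oo)%E.

Definition Linf (f : fT) :=
  cmeas f /\ exists M : R, {ae mu, forall x, dom x -> cabs (f x) <= M}.

Definition GLinf (f : fT) := Linf f /\ Linf (finv f).

Definition aeq (f g : fT) := {ae mu, forall x, dom x -> f x = g x}.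

Definition fc (f : fT) (n : int) : C :=
  Complex ((2 * pi)^-1) 0 *
  Complex (Rintegral mu dom (fun x => complex.Re (f x * tpow (- n) x)))
          (Rintegral mu dom (fun x => complex.Im (f x * tpow (- n) x))).

Definition Hp (r : R) (f : fT) := Lp r f /\ forall n : int, n < 0 -> fc f n = 0.
Definition Hbar (r : R) (f : fT) := Lp r f /\ forall n : int, 0 < n -> fc f n = 0.

Definition trigpoly (f : fT) :=
  exists s : seq (int * C), forall x, f x = \sum_(kc <- s) kc.2 * tpow kc.1 x.

(* Riesz projection: P f is the (a.e. unique) integrable function whose
   Fourier coefficients are those of f for n >= 0 and 0 for n < 0. *)
Definition Pr (f : fT) : fT :=
  xget f0 [set g : fT | Lp 1 g /\
     forall n : int, fc g n = if (0 <= n)%R then fc f n else 0].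
Definition Qr (f : fT) : fT := fsub f (Pr f).

Definition Top (a : fT) (f : fT) : fT := Pr (fmul a f).
Definition Hop (b : fT) (f : fT) : fT := Pr (fmul b (Qr (Jop f))).
Definition THop (a b : fT) (f : fT) : fT := fadd (Top a f) (Hop b f).
Definition THmop (a b : fT) (f : fT) : fT := fsub (Top a f) (Hop b f).

Definition bop (r : R) (L : fT -> fT) :=
  [/\ forall f, Hp r f -> Hp r (L f),
      forall f g, Hp r f -> Hp r g -> aeq (L (fadd f g)) (fadd (L f) (L g)),
      forall (z : C) f, Hp r f -> aeq (L (fscale z f)) (fscale z (L f)),
      forall f g, Hp r f -> Hp r g -> aeq f g -> aeq (L f) (L g)
    & (exists M : R, forall f, Hp r f -> (pint r (L f) <= M%:E * pint r f)%E)].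

Definition left_invertible (r : R) (A : fT -> fT) :=
  exists L, bop r L /\ forall f, Hp r f -> aeq (L (A f)) f.
Definition right_invertible (r : R) (A : fT -> fT) :=
  exists B, bop r B /\ forall f, Hp r f -> aeq (A (B f)) f.
Definition invertible (r : R) (A : fT -> fT) :=
  exists B, bop r B /\ forall f, Hp r f -> aeq (B (A f)) f /\ aeq (A (B f)) f.

Definition dimker (r : R) (A : fT -> fT) (n : nat) :=
  exists v : 'I_n -> fT,
  [/\ forall i, Hp r (v i) /\ aeq (A (v i)) f0,
      forall cs : 'I_n -> C,
        aeq (fun x => \sum_i cs i * v i x) f0 -> forall i, cs i = 0
    & forall f, Hp r f -> aeq (A f) f0 ->
        exists cs : 'I_n -> C, aeq f (fun x => \sum_i cs i * v i x)].

Definition codimran (r : R) (A : fT -> fT) (m : nat) :=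
  exists w : 'I_m -> fT,
  [/\ forall i, Hp r (w i),
      forall g, Hp r g -> exists f (cs : 'I_m -> C),
        Hp r f /\ aeq g (fun x => A f x + \sum_i cs i * w i x)
    & forall f (cs : 'I_m -> C), Hp r f ->
        aeq (A f) (fun x => \sum_i cs i * w i x) -> forall i, cs i = 0].

Definition closed_range (r : R) (A : fT -> fT) :=
  forall g, Hp r g ->
    (forall e : R, 0 < e -> exists f, Hp r f /\ (pint r (fsub (A f) g) < e%:E)%E) ->
    exists f, Hp r f /\ aeq (A f) g.

Definition fredholm_index (r : R) (A : fT -> fT) (k : int) :=
  [/\ bop r A, closed_range r A &
     (exists n m : nat, [/\ dimker r A n, codimran r A m & k = n%:Z - m%:Z])].

Definition matching (a b : fT) :=
  [/\ GLinf a, Linf b & aeq (fmul a (tilde a)) (fmul b (tilde b))].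
Definition csub (a b : fT) : fT := fmul a (finv b).
Definition dsub (a b : fT) : fT := fmul a (finv (tilde b)).

Definition FTH (r : R) (a b : fT) (k1 k2 : int) :=
  [/\ matching a b, fredholm_index r (Top (csub a b)) k1
    & fredholm_index r (Top (dsub a b)) k2].

Definition hconj (r : R) : R := r / (r - 1).

Definition WHfact (r : R) (g gm : fT) (m : int) (gp : fT) :=
  [/\ aeq g (fun x => gm x * tpow m x * gp x),
      Hp (hconj r) gp /\ Hp r (finv gp), Hbar r gm /\ Hbar (hconj r) (finv gm)
    & (exists cp : R, forall phi, trigpoly phi ->
        (pint r (fmul (finv gp) (Pr (fmul gp phi))) <= cp%:E * pint r phi)%E)].

(* factorization signature sigma(g) = g_+(0) *)
Definition fsig (gp : fT) : C := fc gp 0.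

(* g = sigma(g) g_+ t^{-2} g~_+^{-1} is the Wiener-Hopf factorization of g
   in L^r normalized by g_-(oo) = 1 (g_- := sigma(g) g~_+^{-1}) *)
Definition WHsig2 (r : R) (g gp : fT) :=
  let gm := fscale (fsig gp) (finv (tilde gp)) in
  WHfact r g gm (-2) gp /\ fc gm 0 = 1.

Definition omega_rhs (a b dp : fT) (s : bool) : fT :=
  Top (fmul (finv (tilde a)) (tpow (-1)))
      (fun x => (dp x)^-1 + (if s then 1 else -1) * fsig dp * (dp x)^-1 * tpow 1 x).
Definition omega (r : R) (a b dp : fT) (s : bool) : fT :=
  xget f0 [set w : fT | Hp r w /\
    aeq (Top (fmul (csub a b) (tpow (-2))) w) (omega_rhs a b dp s)].

End Circle.

(* Main.v *)
(** A function f of H^p satisfies (T(a)+H(b)) f = psi iff a f + b J f = psi + J k for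
    some k in H^p. Applying J and eliminating J f with a a~ = b b~ splits this into
    d k - J k = psi - d J psi and c f + J f = (k + J psi) / a~. The operator T(d t^2)
    is invertible, so the first equation is solvable, and its homogeneous solutions
    are the multiples of d_+^-1 +- sigma(d) d_+^-1 t. The operator T(c t^-2) is
    invertible as well, and the second equation is solvable iff the solution w of
    T(c t^-2) w = P (t^-1 (k + J psi) / a~) has w_0 = 0, in which case f = t^-1 w.
    Hence if the coefficient omega_0 is nonzero the free multiple in k can be adjusted
    in exactly one way and T(a)+H(b) is invertible, while if it vanishes,
    t^-1 omega is a nonzero element of the kernel. Right invertibility is the same
    dichotomy for the adjoint T(conj a) + H((conj b)~), and surjectivity of either
    operator makes the other one injective.

    Boundedness of the Riesz projection on L^r comes from comparing, for an analytic
    polynomial F = u + i v with u >= 0, the means of F + l and of its inverse for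
    dyadic l; r > 2 follows by duality. *)
Require Import Defs.
From mathcomp Require Import all_boot all_order all_algebra.
From mathcomp Require Import all_classical all_reals all_analysis.
From mathcomp Require Import measurable_realfun.
From mathcomp Require Import complex.
From mathcomp Require Import ring lra zify.
(* Makes [finv] refer to the pointwise inverse again, not to that of fingraph. *)
Import Defs.
Set Implicit Arguments.
Unset Strict Implicit.
Unset Printing Implicit Defensive.
Import Order.TTheory GRing.Theory Num.Theory.
Import numFieldNormedType.Exports.
Local Open Scope classical_set_scope.
Local Open Scope ring_scope.

(** * Complex absolute value and the characters t^k *)

Section Cabs.
Variable R : realType.
Notation C := (R[i]).
Implicit Types (z w : C) (x y : R).

(** Two factorizations are given: of d in L^p, and in L^q of the second subordinated function of the
    adjoint pair, which is conj c. The first yields the inverse of T(d t^2) on H^p. The inverse of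
    T(c t^-2) on H^p has to come from L^q: this operator is the adjoint of T(conj c t^2), and the
    boundedness clause of the factorization is dualized.

    The step from w to f rests on a symmetry. The right-hand side rho of the c-equation satisfies c
    J rho = rho, and uniqueness for T(c t^-2) then upgrades an equation between projections to an
    identity on the circle. Only such an identity can be multiplied by t or evaluated at 1/t.

    An inverse must be bounded, so every solution is built together with an estimate; no open
    mapping argument is made. [Pr] is a choice of a function with prescribed coefficients,
    meaningful only once an integrable candidate exists. Hence its boundedness, the completeness of
    L^r and the uniqueness of Fourier coefficients come before any operator, and equations under P
    are compared through the coefficients of index n >= 0. *)

Lemma cabsE z : cabs z = ComplexField.Normc.normc z.
Proof. by case: z. Qed.
Lemma cabs_ge0 z : 0 <= cabs z.
Proof. exact: sqrtr_ge0. Qed.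
Lemma cabsM z w : cabs (z * w) = cabs z * cabs w.
Proof. by rewrite !cabsE ComplexField.Normc.normcM. Qed.
Lemma cabsD z w : cabs (z + w) <= cabs z + cabs w.
Proof. by rewrite !cabsE; exact: le_normcD. Qed.
Lemma cabsN z : cabs (- z) = cabs z.
Proof. by rewrite !cabsE normcN. Qed.
Lemma cabsV z : cabs z^-1 = (cabs z)^-1.
Proof. by rewrite !cabsE ComplexField.Normc.normcV. Qed.
Lemma cabs0 : cabs (0 : C) = 0.
Proof. by rewrite !cabsE ComplexField.Normc.normc0. Qed.
Lemma cabs1 : cabs (1 : C) = 1.
Proof. by rewrite !cabsE ComplexField.Normc.normc1. Qed.
Lemma cabs_eq0 z : (cabs z == 0) = (z == 0).
Proof.
apply/eqP/eqP => [|->]; last exact: cabs0.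
by rewrite cabsE; exact: ComplexField.Normc.eq0_normc.
Qed.

Lemma cabs_sqr z : cabs z ^+ 2 = complex.Re z ^+ 2 + complex.Im z ^+ 2.
Proof. by rewrite sqr_sqrtr// addr_ge0 ?sqr_ge0. Qed.
Lemma cabsJ z : cabs (conjc z) = cabs z.
Proof. by case: z => u v; rewrite /cabs /= sqrrN. Qed.
Lemma cabs_real x : cabs (Complex x 0) = `|x|.
Proof. by rewrite /cabs /= expr0n /= addr0 sqrtr_sqr. Qed.
Lemma Re_le_cabs z : `|complex.Re z| <= cabs z.
Proof.
rewrite -ler_sqr ?nnegrE ?cabs_ge0// cabs_sqr -normrX ger0_norm ?sqr_ge0//.
by rewrite lerDl sqr_ge0.
Qed.

Lemma Im_le_cabs z : `|complex.Im z| <= cabs z.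
Proof.
rewrite -ler_sqr ?nnegrE ?cabs_ge0// cabs_sqr -normrX ger0_norm ?sqr_ge0//.
by rewrite lerDr sqr_ge0.
Qed.

Lemma cabs_le_ReIm z : cabs z <= `|complex.Re z| + `|complex.Im z|.
Proof.
rewrite -ler_sqr ?nnegrE ?cabs_ge0 ?addr_ge0// cabs_sqr sqrrD -!normrX.
rewrite !(ger0_norm (sqr_ge0 _)).
have : 0 <= `|complex.Re z| * `|complex.Im z| by rewrite mulr_ge0.
lra.
Qed.

Lemma cabsB z w : cabs (z - w) <= cabs z + cabs w.
Proof. by rewrite -(cabsN w); exact: cabsD. Qed.
Lemma cabs_sum (I : Type) (s : seq I) (P : pred I) (F : I -> C) :
  cabs (\sum_(i <- s | P i) F i) <= \sum_(i <- s | P i) cabs (F i).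
Proof.
elim/big_rec2: _ => [|i y z _ h]; first by rewrite cabs0.
by rewrite (le_trans (cabsD _ _))// lerD2l.
Qed.

Lemma cabsX z n : cabs (z ^+ n) = cabs z ^+ n.
Proof. by elim: n => [|n IH]; rewrite ?expr0 ?cabs1// !exprS cabsM IH. Qed.

Lemma ReD z w : complex.Re (z + w) = complex.Re z + complex.Re w.
Proof. by case: z; case: w. Qed.
Lemma ImD z w : complex.Im (z + w) = complex.Im z + complex.Im w.
Proof. by case: z; case: w. Qed.
Lemma ReN z : complex.Re (- z) = - complex.Re z.
Proof. by case: z. Qed.
Lemma ImN z : complex.Im (- z) = - complex.Im z.
Proof. by case: z. Qed.
Lemma ReM z w : complex.Re (z * w) =
  complex.Re z * complex.Re w - complex.Im z * complex.Im w.
Proof. by case: z; case: w. Qed.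
Lemma ImM z w : complex.Im (z * w) =
  complex.Re z * complex.Im w + complex.Im z * complex.Re w.
Proof. by case: z => a b; case: w => c d /=. Qed.
Lemma ReJ z : complex.Re (conjc z) = complex.Re z.
Proof. by case: z. Qed.
Lemma ImJ z : complex.Im (conjc z) = - complex.Im z.
Proof. by case: z. Qed.
Lemma ReV z : complex.Re z^-1 =
  complex.Re z / (complex.Re z ^+ 2 + complex.Im z ^+ 2).
Proof. by case: z. Qed.
Lemma ImV z : complex.Im z^-1 =
  - complex.Im z / (complex.Re z ^+ 2 + complex.Im z ^+ 2).
Proof. by case: z => a b /=; rewrite mulNr. Qed.
Lemma complexP z w :
  complex.Re z = complex.Re w -> complex.Im z = complex.Im w -> z = w.
Proof. by case: z => a b; case: w => c d /= -> ->. Qed.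

Lemma tpowE k x :
  tpow k x = Complex (cos (k%:~R * x)) (sin (k%:~R * x)) :> C.
Proof. by []. Qed.
Lemma tpow0 x : tpow 0 x = 1 :> C.
Proof. by rewrite tpowE mul0r cos0 sin0. Qed.
Lemma tpowD k l x : tpow (k + l) x = tpow k x * tpow l x :> C.
Proof.
rewrite !tpowE intrD mulrDl cosD sinD; apply: complexP; rewrite ?ReM ?ImM/=//.
by rewrite addrC [in RHS]addrC addrC.
Qed.

Lemma conj_tpow k x : conjc (tpow k x) = tpow (- k) x :> C.
Proof. by rewrite !tpowE intrN mulNr cosN sinN. Qed.
Lemma cabs_tpow k x : cabs (tpow k x : C) = 1.
Proof. by rewrite /cabs /= cos2Dsin2 sqrtr1. Qed.
Lemma tpow_neq0 k x : tpow k x != 0 :> C.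
Proof. by rewrite -cabs_eq0 cabs_tpow oner_eq0. Qed.
Lemma tpowN k x : tpow (- k) x = (tpow k x)^-1 :> C.
Proof.
by apply: (mulIf (tpow_neq0 k x)); rewrite mulVf ?tpow_neq0// -tpowD addNr tpow0.
Qed.

Lemma tpow_natX (n : nat) x : tpow n x = (tpow 1 x) ^+ n :> C.
Proof.
elim: n => [|n IH]; first by rewrite tpow0.
by rewrite exprS -IH -tpowD.
Qed.

(** The identity holds at every point, not just almost everywhere: 2 pi is a period because [k] is
    an integer. The case k = 1 is raised to powers. *)
Lemma tpow_shift k (x : R) : tpow k (2 * pi - x) = tpow (- k) x :> C.
Proof.
have key (n : nat) y : tpow n (2 * pi - y) = tpow (- n%:Z) y :> C.
  rewrite tpow_natX tpowN tpow_natX -exprVn -tpowN; congr (_ ^+ _).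
  rewrite !tpowE mul1r intrN mulN1r.
  by rewrite mulr_natl -[_ - y]addrC cosD2pi sinD2pi.
case: (intP k) => [|n|n]; first by rewrite oppr0 !tpow0.
  exact: key.
by rewrite opprK tpowN key tpowN invrK.
Qed.

Lemma conjcM z w : conjc (z * w) = conjc z * conjc w.
Proof. by rewrite (rmorphM (@conjc R)). Qed.
Lemma conjcD z w : conjc (z + w) = conjc z + conjc w.
Proof. by rewrite (raddfD (@conjc R)). Qed.
Lemma conjcR x : conjc (Complex x 0) = Complex x 0.
Proof. by rewrite /= oppr0. Qed.
End Cabs.

(** * Integration over the circle *)
Section RealInt.
Variable R : realType.
Notation mu0 := (@lebesgue_measure R).
Notation D := (@dom R).

Definition aed (P : R -> Prop) := {ae mu0, forall x, D x -> P x}.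

Lemma ae_filter : Filter (nbhs (almost_everywhere mu0)).
Proof.
exact: (@ae_filter_ringOfSetsType _ _ _
  (mu0 : {measure set (measurableTypeR R) -> \bar R})).
Qed.

Lemma aedW (P : R -> Prop) : (forall x, D x -> P x) -> aed P.
Proof. by move=> h; apply: aeW. Qed.
Lemma aedS (P Q : R -> Prop) :
  (forall x, D x -> P x -> Q x) -> aed P -> aed Q.
Proof. by move=> h; rewrite /aed; have F := ae_filter; apply: filterS => x hx dx; apply: h => //; apply: hx. Qed.
Lemma aedS2 (P1 P2 Q : R -> Prop) :
  (forall x, D x -> P1 x -> P2 x -> Q x) -> aed P1 -> aed P2 -> aed Q.
Proof.
by move=> h; rewrite /aed; have F := ae_filter; apply: filterS2 => x h1 h2 dx; apply: h => //; [apply: h1|apply: h2].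
Qed.

Lemma aedS3 (P1 P2 P3 Q : R -> Prop) :
  (forall x, D x -> P1 x -> P2 x -> P3 x -> Q x) ->
  aed P1 -> aed P2 -> aed P3 -> aed Q.
Proof.
by move=> h; rewrite /aed; have F := ae_filter; apply: filterS3 => x h1 h2 h3 dx; apply: h => //;
  [apply: h1|apply: h2|apply: h3].
Qed.

Lemma domE : D = `[0, 2 * pi]%classic.
Proof. by rewrite /dom; apply/seteqP; split=> x /=; rewrite in_itv. Qed.
Lemma mdom : measurable (D : set (measurableTypeR R)).
Proof. by rewrite domE; exact: measurable_itv. Qed.
Hint Resolve mdom : core.
Lemma twopi_gt0 : 0 < 2 * pi :> R.
Proof. by rewrite mulr_gt0// pi_gt0. Qed.
Lemma two_le_2pi : 2 <= 2 * pi :> R.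
Proof. by have := @pi_ge2 R; lra. Qed.
Lemma mudom : mu0 D = (2 * pi)%:E.
Proof. by rewrite domE lebesgue_measure_itv/= lte_fin twopi_gt0 sube0. Qed.
Lemma domR x : D x -> D (2 * pi - x).
Proof. by rewrite /dom/= => /andP[h1 h2]; rewrite subr_ge0 h2 lerBlDr lerDl. Qed.

Definition rmi (h : R -> R) := mu0.-integrable D (EFin \o h).
Definition rint (h : R -> R) : R := Rintegral mu0 D h.

Lemma rmi_meas (h : R -> R) : rmi h -> measurable_fun D h.
Proof. by move=> /integrableP[/measurable_EFinP]. Qed.
Lemma rmi_cst c : rmi (fun=> c).
Proof.
apply: measurable_bounded_integrable => //.
- by rewrite [X in (X < _)%E]mudom ltry.
- by exists `|c|; split=> // y cy x _; exact: ltW.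
Qed.

Lemma rmiD (h k : R -> R) : rmi h -> rmi k -> rmi (fun x => h x + k x).
Proof. by move=> H K; have := integrableD mdom H K. Qed.
Lemma rmiB (h k : R -> R) : rmi h -> rmi k -> rmi (fun x => h x - k x).
Proof. by move=> H K; have := integrableB mdom H K. Qed.
Lemma rmiZ c (h : R -> R) : rmi h -> rmi (fun x => c * h x).
Proof. by move=> H; have := integrableZl mdom c H. Qed.
Lemma rmi_sum (I : Type) (s : seq I) (h : I -> R -> R) :
  (forall i, rmi (h i)) -> rmi (fun x => \sum_(i <- s) h i x).
Proof.
move=> H; elim: s => [|i s IH].
  by under eq_fun do rewrite big_nil; exact: rmi_cst.
by under eq_fun do rewrite big_cons; apply: rmiD.
Qed.

Lemma rmi_le (h k : R -> R) : measurable_fun D h ->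
  aed (fun x => `|h x| <= k x) -> rmi k -> rmi h.
Proof.
move=> mh hk /integrableP[mk ik]; apply/integrableP; split.
  exact/measurable_EFinP.
apply: le_lt_trans ik; apply: ae_ge0_le_integral => //.
- by do 2 apply: measurableT_comp => //; exact/measurable_EFinP.
- by apply: measurableT_comp.
apply: (aedS _ hk) => x _ hx /=; rewrite lee_fin.
by apply: (le_trans hx); rewrite ler_norm.
Qed.

Lemma rintD (h k : R -> R) : rmi h -> rmi k -> rint (fun x => h x + k x) = rint h + rint k.
Proof. by move=> H K; rewrite /rint RintegralD. Qed.
Lemma rintB (h k : R -> R) : rmi h -> rmi k -> rint (fun x => h x - k x) = rint h - rint k.
Proof. by move=> H K; rewrite /rint RintegralB. Qed.
Lemma rintZ c (h : R -> R) : rmi h -> rint (fun x => c * h x) = c * rint h.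
Proof. by move=> H; rewrite /rint RintegralZl. Qed.
Lemma rint_cst c : rint (fun=> c) = c * (2 * pi).
Proof.
by transitivity (c * fine (mu0 D)); [exact: Rintegral_cst|rewrite mudom].
Qed.

Lemma rint_sum (I : Type) (s : seq I) (h : I -> R -> R) :
  (forall i, rmi (h i)) ->
  rint (fun x => \sum_(i <- s) h i x) = \sum_(i <- s) rint (h i).
Proof.
move=> H; elim: s => [|i s IH].
  under [in LHS]eq_fun do rewrite big_nil.
  by rewrite big_nil rint_cst mul0r.
under [in LHS]eq_fun do rewrite big_cons.
by rewrite big_cons rintD// ?IH//; exact: rmi_sum.
Qed.

Lemma rint_ge0 (h : R -> R) : (forall x, D x -> 0 <= h x) -> 0 <= rint h.
Proof. by move=> H; apply: Rintegral_ge0. Qed.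
Lemma rint_abs (h : R -> R) : rmi h -> `|rint h| <= rint (fun x => `|h x|).
Proof. by move=> H; exact: le_normr_Rintegral. Qed.
Lemma rmi_abs (h : R -> R) : rmi h -> rmi (fun x => `|h x|).
Proof. by move=> H; exact: (integrable_norm H). Qed.
Lemma rint_EFin (h : R -> R) : rmi h -> (\int[mu0]_(x in D) (h x)%:E)%E = (rint h)%:E.
Proof. by move=> H; rewrite /rint /Rintegral fineK//; exact: integrable_fin_num. Qed.
Lemma rint_ae (h k : R -> R) : measurable_fun D h -> measurable_fun D k ->
  aed (fun x => h x = k x) -> rint h = rint k.
Proof.
move=> mh mk hk; rewrite /rint /Rintegral; congr fine.
apply: ae_eq_integral => //; try exact/measurable_EFinP.
by apply: (aedS _ hk) => x _ hx /=; rewrite hx.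
Qed.

Lemma rint_le (h k : R -> R) : rmi h -> rmi k -> aed (fun x => h x <= k x) ->
  rint h <= rint k.
Proof.
move=> H K hk.
have mm := measurable_maxr (rmi_meas H) (rmi_meas K).
have K' : rmi (h \max k)%R.
  apply: (rmi_le (k := fun x => `|h x| + `|k x|)) => //.
    apply: aedW => x _ /=; rewrite /Order.max; case: ifP => _.
      by rewrite lerDr.
    by rewrite lerDl.
  by apply: rmiD; exact: rmi_abs.
(* Replacing [k] by the maximum, equal to it almost everywhere, makes the inequality hold at every
   point. *)
have -> : rint k = rint (h \max k)%R.
  apply: rint_ae => //; first exact: rmi_meas K.
  by apply: aedS hk => x _ hx /=; rewrite max_r.
apply: le_Rintegral => // x _ /=; by rewrite le_max lexx.
Qed.

Lemma rint_le_nonneg (h k : R -> R) : measurable_fun D h -> rmi k ->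
  aed (fun x => 0 <= h x <= k x) -> rmi h /\ rint h <= rint k.
Proof.
move=> mh K hk.
have H : rmi h.
  apply: rmi_le K => //; apply: aedS hk => x _ /andP[h0 h1].
  by rewrite ger0_norm.
split=> //; apply: rint_le => //; apply: aedS hk => x _ /andP[] //.
Qed.

Definition refl (x : R) : R := 2 * pi - x.
Lemma mrefl : measurable_fun [set: measurableTypeR R]
  (refl : measurableTypeR R -> measurableTypeR R).
Proof.
apply: continuous_measurable_fun => x; rewrite /refl.
by apply: cvgB; [exact: cvg_cst|exact: cvg_id].
Qed.

(** Lebesgue measure is determined by the lengths of the intervals ]a, b], and their preimages [2 pi
    - b, 2 pi - a[ have the same length. *)
Lemma lebesgue_measure_refl (A : set (measurableTypeR R)) : measurable A ->
  pushforward mu0 (refl : measurableTypeR R -> measurableTypeR R) A = mu0 A.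
Proof.
move=> mA; apply/esym/lebesgue_measure_unique => //=; first exact: mrefl.
move=> mr _ [[a b]] _ <-.
rewrite /pushforward.
have -> : refl @^-1` `]a, b] = `[2 * pi - b, 2 * pi - a[%classic :> set R.
  apply/seteqP; split => x /=; rewrite /refl !in_itv /=; lra.
rewrite !lebesgue_measure_itv/= !lte_fin.
have -> : (2 * pi - b < 2 * pi - a) = (a < b) by lra.
by case: ifP => // _; rewrite -!EFinB; congr EFin; ring.
Qed.

Lemma integral_refl_measure (k : R -> \bar R) :
  (\int[pushforward mu0 (refl : measurableTypeR R -> measurableTypeR R)]_(x in D)
     k x = \int[mu0]_(x in D) k x)%E.
Proof.
apply: eq_measure_integral; first exact: mrefl.
by move=> mr A mA _; exact: lebesgue_measure_refl.
Qed.

Lemma reflK x : refl (refl x) = x.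
Proof. rewrite /refl; ring. Qed.
Lemma refl_dom : refl @^-1` D = D.
Proof.
apply/seteqP; split => x; last exact: domR.
by move=> /domR; rewrite -[2 * pi - _]/(refl (refl x)) reflK.
Qed.

Lemma aed_refl (P : R -> Prop) : aed P -> aed (fun x => P (refl x)).
Proof.
move=> [N [mN N0 hN]]; exists (refl @^-1` N); split.
- by rewrite -[X in measurable X]setTI; exact: mrefl.
- by have := lebesgue_measure_refl mN; rewrite /pushforward N0.
- move=> x /= h; apply: hN => /= h'; apply: h => dx.
  apply: h'; exact: domR.
Qed.

Lemma meas_refl (h : R -> R) : measurable_fun D h ->
  measurable_fun D (fun x => h (refl x)).
Proof.
move=> mh; apply: (measurable_comp (F := D)) => //.
  by move=> _ [x dx <-]; exact: domR.
by apply: measurable_funTS; exact: mrefl.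
Qed.

Lemma rmi_refl (h : R -> R) : rmi h -> rmi (fun x => h (refl x)).
Proof.
move=> H; apply/integrableP; split.
  by apply/measurable_EFinP; apply: meas_refl; exact: rmi_meas.
have /integrableP[mh] := H.
rewrite (_ : (\int[_]_(x in _) _ < _)%E =
  (\int[pushforward mu0 (refl : measurableTypeR R -> measurableTypeR R)]_(x in D)
     `|(EFin \o h) x| < +oo)%E).
  rewrite ge0_integral_pushforward //; last exact: measurableT_comp.
  by rewrite refl_dom.
  exact: mrefl.
by rewrite integral_refl_measure.
Qed.

Lemma rint_refl (h : R -> R) : rmi h -> rint (fun x => h (refl x)) = rint h.
Proof.
move=> H; rewrite /rint /Rintegral; congr fine.
have mh : measurable_fun [set: measurableTypeR R] ((EFin \o h) \_ D).
  apply/(measurable_restrictT _ _).1 => //.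
  by have /integrableP[] := H.
have E (k : R -> \bar R) : (\int[mu0]_(x in D) (k \_ D) x = \int[mu0]_(x in D) k x)%E.
  by apply: eq_integral => x xD; rewrite patchE xD.
rewrite -[RHS]E.
rewrite -[RHS]integral_refl_measure.
rewrite (integral_pushforward mrefl mh) ?refl_dom//.
  apply: eq_integral => x xD /=; rewrite patchE.
  by rewrite (_ : refl x \in D = true) //; apply/mem_set/domR/set_mem.
apply: eq_integrable (rmi_refl H) => // x xD /=.
rewrite patchE.
by rewrite (_ : refl x \in D = true) //; apply/mem_set/domR/set_mem.
Qed.
End RealInt.
#[global] Hint Resolve mdom : core.

(** * L^r classes and complex integrals *)

Section CInt.
Variable R : realType.
Notation C := (R[i]).
Notation D := (@dom R).
Implicit Types (f g : fT R) (r : R).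

Lemma cmeasD f g : cmeas f -> cmeas g -> cmeas (fun x => f x + g x).
Proof.
move=> [f1 f2] [g1 g2]; split.
  by under eq_fun do rewrite ReD; apply: measurable_funD.
by under eq_fun do rewrite ImD; apply: measurable_funD.
Qed.

Lemma cmeasM f g : cmeas f -> cmeas g -> cmeas (fun x => f x * g x).
Proof.
move=> [f1 f2] [g1 g2]; split.
  by under eq_fun do rewrite ReM; apply: measurable_funB; apply: measurable_funM.
by under eq_fun do rewrite ImM; apply: measurable_funD; apply: measurable_funM.
Qed.

Lemma cmeas_real (h : R -> R) : measurable_fun D h -> cmeas (fun x => Complex (h x) 0).
Proof. by move=> mh; split => //=; exact: measurable_cst. Qed.
Lemma cmeas_cst (z : C) : cmeas (fun=> z).
Proof. by split; exact: measurable_cst. Qed.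
Lemma cmeasN f : cmeas f -> cmeas (fun x => - f x).
Proof.
move=> h; have := cmeasM (cmeas_cst (-1)) h.
by under eq_fun do rewrite mulN1r.
Qed.

Lemma cmeasB f g : cmeas f -> cmeas g -> cmeas (fun x => f x - g x).
Proof. by move=> h k; apply: cmeasD => //; exact: cmeasN. Qed.
Lemma cmeas_conj f : cmeas f -> cmeas (conjf f).
Proof.
rewrite /conjf => -[f1 f2]; split; first by under eq_fun do rewrite ReJ.
under eq_fun do rewrite ImJ -mulN1r.
by apply: measurable_funM => //; exact: measurable_cst.
Qed.

Lemma meas_continuous (h : R -> R) : continuous h -> measurable_fun D h.
Proof. by move=> ch; apply: measurable_funTS; exact: continuous_measurable_fun. Qed.
Lemma cmeas_tpow k : cmeas (tpow k : fT R).
Proof.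
split; apply: meas_continuous => x /=.
  apply: (continuous_comp (f := fun y : R => k%:~R * y)); last exact: continuous_cos.
  by apply: mulrl_continuous.
apply: (continuous_comp (f := fun y : R => k%:~R * y)); last exact: continuous_sin.
by apply: mulrl_continuous.
Qed.

Lemma meas_inv_ge0 (h : R -> R) : (forall x, 0 <= h x) -> measurable_fun D h ->
  measurable_fun D (fun x => (h x)^-1).
Proof.
move=> h0 mh; under eq_fun do rewrite -powR_inv1//.
by apply: (measurableT_comp (f := fun x : R => x `^ (-1))) => //; exact: measurable_powR.
Qed.

Lemma meas_sqr (h : R -> R) : measurable_fun D h -> measurable_fun D (fun x => h x ^+ 2).
Proof. by move=> mh; under eq_fun do rewrite expr2; apply: measurable_funM. Qed.
Lemma cmeas_inv f : cmeas f -> cmeas (finv f).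
Proof.
move=> [f1 f2]; rewrite /finv; split.
  under eq_fun do rewrite ReV; apply: measurable_funM => //.
  by apply: meas_inv_ge0 => [x|]; [rewrite addr_ge0 ?sqr_ge0|apply: measurable_funD; exact: meas_sqr].
under eq_fun do rewrite ImV mulNr -mulN1r; apply: measurable_funM; first exact: measurable_cst.
apply: measurable_funM => //.
by apply: meas_inv_ge0 => [x|]; [rewrite addr_ge0 ?sqr_ge0|apply: measurable_funD; exact: meas_sqr].
Qed.

Lemma cmeas_refl f : cmeas f -> cmeas (tilde f).
Proof. by move=> [f1 f2]; split; [exact: (meas_refl f1)|exact: (meas_refl f2)]. Qed.
Lemma cmeas_sum (I : Type) (s : seq I) (F : I -> fT R) :
  (forall i, cmeas (F i)) -> cmeas (fun x => \sum_(i <- s) F i x).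
Proof.
move=> H; elim: s => [|i s IH].
  by under eq_fun do rewrite big_nil; exact: cmeas_cst.
by under eq_fun do rewrite big_cons; apply: cmeasD.
Qed.

Lemma meas_cabs f : cmeas f -> measurable_fun D (fun x => cabs (f x)).
Proof.
move=> [f1 f2]; rewrite /cabs.
under eq_fun do rewrite -powR12_sqrt ?addr_ge0 ?sqr_ge0//.
apply: (measurableT_comp (f := fun x : R => x `^ (2^-1))); first exact: measurable_powR.
by apply: measurable_funD; exact: meas_sqr.
Qed.

Lemma meas_cabs_powR r f : cmeas f -> measurable_fun D (fun x => cabs (f x) `^ r).
Proof.
move=> mf; apply: (measurableT_comp (f := fun x : R => x `^ r)).
  exact: measurable_powR.
exact: meas_cabs.
Qed.

(* The r-th power of the L^r norm. Constants play no role, so the crude inequality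
   |x + y|^r <= 2^r (|x|^r + |y|^r) replaces Minkowski's throughout. *)
Definition nr r f : R := rint (fun x => cabs (f x) `^ r).

Lemma nr_ge0 r f : 0 <= nr r f.
Proof. by apply: rint_ge0 => x _; rewrite powR_ge0. Qed.
Lemma Lp_rmi r f : Lp r f -> rmi (fun x => cabs (f x) `^ r).
Proof.
move=> [mf pf]; apply/integrableP; split.
  by apply/measurable_EFinP; exact: meas_cabs_powR.
apply: le_lt_trans pf; rewrite /pint.
rewrite le_eqVlt; apply/orP; left; apply/eqP; apply: eq_integral => x _ /=.
by rewrite ger0_norm ?powR_ge0.
Qed.

Lemma rmi_Lp r f : cmeas f -> rmi (fun x => cabs (f x) `^ r) -> Lp r f.
Proof.
move=> mf /integrableP[_ h]; split=> //; apply: le_lt_trans h; rewrite /pint.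
rewrite le_eqVlt; apply/orP; left; apply/eqP; apply: eq_integral => x _ /=.
by rewrite ger0_norm ?powR_ge0.
Qed.

Lemma pintE r f : Lp r f -> pint r f = (nr r f)%:E.
Proof. by move=> /Lp_rmi H; rewrite /pint /mu rint_EFin. Qed.
Lemma Lp_cmeas r f : Lp r f -> cmeas f. Proof. by case. Qed.
Lemma Lp_le r f (k : R -> R) : cmeas f -> rmi k ->
  aed (fun x => cabs (f x) `^ r <= k x) -> Lp r f /\ nr r f <= rint k.
Proof.
move=> mf K fk.
have [|H le] := rint_le_nonneg (meas_cabs_powR r mf) K.
  by apply: aedS fk => x _ h; rewrite powR_ge0.
by split=> //; exact: rmi_Lp.
Qed.

Lemma Linf_bound f : Linf f ->
  exists2 M : R, 0 <= M & aed (fun x => cabs (f x) <= M).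
Proof.
move=> [_ [M h]]; exists `|M| => //.
by apply: (aedS _ h) => x _ hx; apply: le_trans hx _; exact: ler_norm.
Qed.

Lemma Linf_cmeas f : Linf f -> cmeas f. Proof. by case. Qed.
Lemma ler_powR2 (x y r : R) : 0 <= r -> 0 <= x -> x <= y -> x `^ r <= y `^ r.
Proof.
by move=> r0 x0 xy; apply: ge0_ler_powR; rewrite ?nnegrE// (le_trans x0).
Qed.

Lemma Linf_Lp r f : 0 <= r -> Linf f -> Lp r f.
Proof.
move=> r0 Lf; have [M M0 h] := Linf_bound Lf.
have [] // := @Lp_le r f (fun=> M `^ r) (Linf_cmeas Lf) (rmi_cst _).
by apply: aedS h => x _ hx; apply: ler_powR2 => //; exact: cabs_ge0.
Qed.

Lemma powR_Dle r (x y : R) : 0 <= r -> 0 <= x -> 0 <= y ->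
  (x + y) `^ r <= 2 `^ r * (x `^ r + y `^ r).
Proof.
move=> r0 x0 y0; wlog xy : x y x0 y0 / x <= y.
  move=> H; case: (leP x y) => [/H|/ltW /H]; first exact.
  by move=> h; rewrite addrC [x `^ r + _]addrC; exact: h.
apply: (@le_trans _ _ ((2 * y) `^ r)).
  by apply: ler_powR2 => //; [rewrite addr_ge0|lra].
by rewrite powRM// ler_wpM2l ?powR_ge0// lerDr powR_ge0.
Qed.

Lemma LpD r f g : 0 <= r -> Lp r f -> Lp r g ->
  Lp r (fadd f g) /\ nr r (fadd f g) <= 2 `^ r * (nr r f + nr r g).
Proof.
move=> r0 Hf Hg.
have K : rmi (fun x => 2 `^ r * (cabs (f x) `^ r + cabs (g x) `^ r)).
  by apply: rmiZ; apply: rmiD; exact: Lp_rmi.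
have mfg : cmeas (fadd f g).
  by apply: cmeasD; [exact: Lp_cmeas Hf|exact: Lp_cmeas Hg].
have hk : aed (fun x => cabs (fadd f g x) `^ r <=
                 2 `^ r * (cabs (f x) `^ r + cabs (g x) `^ r)).
  apply: aedW => x _; apply: (le_trans (ler_powR2 r0 (cabs_ge0 _) (cabsD _ _))).
  by apply: powR_Dle => //; exact: cabs_ge0.
have [H le] := Lp_le mfg K hk.
split => //; apply: le_trans le _.
rewrite rintZ; last by apply: rmiD; exact: Lp_rmi.
by rewrite rintD//; exact: Lp_rmi.
Qed.

Lemma LpZ r f z : Lp r f ->
  Lp r (fscale z f) /\ nr r (fscale z f) = cabs z `^ r * nr r f.
Proof.
move=> Hf.
have E : (fun x => cabs (fscale z f x) `^ r) =
         (fun x => cabs z `^ r * cabs (f x) `^ r).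
  by apply/funext => x; rewrite cabsM powRM ?cabs_ge0.
split; last by rewrite /nr E rintZ//; exact: Lp_rmi.
apply: rmi_Lp; last by rewrite E; apply: rmiZ; exact: Lp_rmi.
by apply: cmeasM; [exact: cmeas_cst|exact: Lp_cmeas Hf].
Qed.

Lemma LpB r f g : 0 <= r -> Lp r f -> Lp r g ->
  Lp r (fsub f g) /\ nr r (fsub f g) <= 2 `^ r * (nr r f + nr r g).
Proof.
move=> r0 Hf Hg; have [Hg' Eg] := LpZ (-1) Hg.
rewrite cabsN cabs1 powR1 mul1r in Eg.
have := LpD r0 Hf Hg'; rewrite Eg.
have -> : fadd f (fscale (-1) g) = fsub f g; last by [].
by apply/funext => x; rewrite /fadd /fscale mulN1r.
Qed.

Lemma LpM r f g (M : R) : 0 <= r -> cmeas f -> 0 <= M ->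
  aed (fun x => cabs (f x) <= M) -> Lp r g ->
  Lp r (fmul f g) /\ nr r (fmul f g) <= M `^ r * nr r g.
Proof.
move=> r0 mf M0 h Hg; have K := rmiZ (M `^ r) (Lp_rmi Hg).
have mfg : cmeas (fmul f g) by apply: cmeasM => //; exact: Lp_cmeas Hg.
have hk : aed (fun x => cabs (fmul f g x) `^ r <= M `^ r * cabs (g x) `^ r).
  apply: aedS h => x _ hx; rewrite cabsM powRM ?cabs_ge0//.
  by rewrite ler_wpM2r ?powR_ge0//; apply: ler_powR2 => //; exact: cabs_ge0.
have [H le] := Lp_le mfg K hk.
by split => //; rewrite -rintZ//; exact: Lp_rmi.
Qed.

Lemma LpMinf r f : 0 <= r -> Linf f -> exists2 M : R, 0 <= M & forall g, Lp r g ->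
  Lp r (fmul f g) /\ nr r (fmul f g) <= M * nr r g.
Proof.
move=> r0 Hf; have [M M0 h] := Linf_bound Hf; exists (M `^ r).
  exact: powR_ge0.
by move=> g Hg; apply: LpM => //; exact: Linf_cmeas.
Qed.

Lemma Lp_refl r f : Lp r f -> Lp r (tilde f) /\ nr r (tilde f) = nr r f.
Proof.
move=> H; split; last exact: (rint_refl (Lp_rmi H)).
apply: rmi_Lp; last exact: (rmi_refl (Lp_rmi H)).
by apply: cmeas_refl; exact: Lp_cmeas H.
Qed.

Lemma Lp_conj r f : Lp r f -> Lp r (conjf f) /\ nr r (conjf f) = nr r f.
Proof.
move=> H; have E : (fun x => cabs (conjf f x) `^ r) = (fun x => cabs (f x) `^ r).
  by apply/funext => x; rewrite /conjf cabsJ.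
split; last by rewrite /nr E.
apply: rmi_Lp; last by rewrite E; exact: Lp_rmi.
by apply: cmeas_conj; exact: Lp_cmeas H.
Qed.

Lemma Lp_tpow r k f : Lp r f ->
  Lp r (fmul (tpow k) f) /\ nr r (fmul (tpow k) f) = nr r f.
Proof.
move=> H; have E : (fun x => cabs (fmul (tpow k) f x) `^ r) = (fun x => cabs (f x) `^ r).
  by apply/funext => x; rewrite /fmul cabsM cabs_tpow mul1r.
split; last by rewrite /nr E.
apply: rmi_Lp; last by rewrite E; exact: Lp_rmi.
by apply: cmeasM; [exact: cmeas_tpow|exact: Lp_cmeas H].
Qed.

Lemma JopE f : Jop f = fmul (tpow (-1)) (tilde f).
Proof. by []. Qed.
Lemma Lp_Jop r f : Lp r f -> Lp r (Jop f) /\ nr r (Jop f) = nr r f.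
Proof.
move=> /Lp_refl[H E]; have [H' E'] := Lp_tpow (-1) H.
by rewrite JopE; split; [exact: H'|rewrite E'].
Qed.

Lemma Lp_f0 r : 0 < r -> Lp r (@f0 R) /\ nr r (@f0 R) = 0.
Proof.
move=> r0; have H : Lp r (@f0 R).
  apply: Linf_Lp; first exact: ltW.
  by split; [exact: cmeas_cst|exists 0; apply: aedW => x _; rewrite cabs0].
split=> //; rewrite /nr (_ : (fun=> _) = fun=> 0); first by rewrite rint_cst mul0r.
by apply/funext => x; rewrite cabs0 powR0// gt_eqF.
Qed.

Lemma powR_le1D (s r x : R) : 0 <= s -> s <= r -> 0 <= x -> x `^ s <= 1 + x `^ r.
Proof.
move=> s0 sr x0; case: (leP x 1) => x1.
  apply: (@le_trans _ _ 1); last by rewrite lerDl powR_ge0.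
  by have := ler_powR2 s0 x0 x1; rewrite powR1.
by apply: (@le_trans _ _ (x `^ r)); [apply: ler_powR => //; exact: ltW|rewrite lerDr].
Qed.

(** The measure is finite, so x^s <= 1 + x^r can be integrated. *)
Lemma Lp_sub (s r : R) f : 0 <= s -> s <= r -> Lp r f ->
  Lp s f /\ nr s f <= 2 * pi + nr r f.
Proof.
move=> s0 sr Hf.
have K := rmiD (rmi_cst 1) (Lp_rmi Hf).
have [|H le] := @Lp_le s f _ (Lp_cmeas Hf) K.
  by apply: aedW => x _; apply: powR_le1D => //; exact: cabs_ge0.
split=> //; apply: (le_trans le).
by rewrite rintD ?rint_cst ?mul1r//; [exact: rmi_cst|exact: Lp_rmi].
Qed.

Lemma nr1E f : nr 1 f = rint (fun x => cabs (f x)).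
Proof. by rewrite /nr; congr rint; apply/funext => x; rewrite powRr1// cabs_ge0. Qed.
Lemma Lp1_rmi f : Lp 1 f -> rmi (fun x => cabs (f x)).
Proof.
move=> /Lp_rmi; congr (rmi _); apply/funext => x; by rewrite powRr1// cabs_ge0.
Qed.

Lemma rmi_Re f : Lp 1 f -> rmi (fun x => complex.Re (f x)).
Proof.
move=> H; apply: (rmi_le _ _ (Lp1_rmi H)); first by case: H => -[].
by apply: aedW => x _; exact: Re_le_cabs.
Qed.

Lemma rmi_Im f : Lp 1 f -> rmi (fun x => complex.Im (f x)).
Proof.
move=> H; apply: (rmi_le _ _ (Lp1_rmi H)); first by case: H => -[].
by apply: aedW => x _; exact: Im_le_cabs.
Qed.

Definition cint f : C :=
  Complex (rint (fun x => complex.Re (f x))) (rint (fun x => complex.Im (f x))).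

Lemma cintD f g : Lp 1 f -> Lp 1 g -> cint (fun x => f x + g x) = cint f + cint g.
Proof.
move=> Hf Hg; apply: complexP; rewrite ?ReD ?ImD /cint /=.
  by under eq_fun do rewrite ReD; rewrite rintD//; exact: rmi_Re.
by under eq_fun do rewrite ImD; rewrite rintD//; exact: rmi_Im.
Qed.

Lemma cintZ (z : C) f : Lp 1 f -> cint (fun x => z * f x) = z * cint f.
Proof.
move=> Hf; apply: complexP; rewrite ?ReM ?ImM /cint /=.
  under eq_fun do rewrite ReM; rewrite rintB ?rintZ//; try apply: rmiZ;
  try exact: rmi_Re; exact: rmi_Im.
under eq_fun do rewrite ImM; rewrite rintD ?rintZ//; try apply: rmiZ;
  try exact: rmi_Re; exact: rmi_Im.
Qed.

(** The factor 2 comes from bounding the real and imaginary parts separately. In [fc_abs] it is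
    absorbed by 1 / (2 pi). *)
Lemma cint_abs f : Lp 1 f -> cabs (cint f) <= 2 * nr 1 f.
Proof.
move=> H; apply: (le_trans (cabs_le_ReIm _)); rewrite nr1E /cint /= mulr_natl mulr2n.
have K := Lp1_rmi H.
apply: lerD.
  apply: (le_trans (rint_abs (rmi_Re H))); apply: rint_le => //.
    by apply: rmi_abs; exact: rmi_Re.
  by apply: aedW => x _; exact: Re_le_cabs.
apply: (le_trans (rint_abs (rmi_Im H))); apply: rint_le => //.
  by apply: rmi_abs; exact: rmi_Im.
by apply: aedW => x _; exact: Im_le_cabs.
Qed.

Lemma cint_ae f g : cmeas f -> cmeas g -> aed (fun x => f x = g x) -> cint f = cint g.
Proof.
move=> [f1 f2] [g1 g2] h; rewrite /cint; congr Complex; apply: rint_ae => //.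
  by apply: aedS h => x _ ->.
by apply: aedS h => x _ ->.
Qed.

Lemma cint_refl f : Lp 1 f -> cint (tilde f) = cint f.
Proof.
move=> H; rewrite /cint; congr Complex; first exact: (rint_refl (rmi_Re H)).
exact: (rint_refl (rmi_Im H)).
Qed.

Lemma cint_conj f : Lp 1 f -> cint (conjf f) = conjc (cint f).
Proof.
move=> H; apply: complexP; rewrite ?ReJ ?ImJ /cint /conjf /=.
  by congr rint; apply/funext => x; rewrite ReJ.
under eq_fun do rewrite ImJ -mulN1r.
by rewrite rintZ ?mulN1r//; exact: rmi_Im.
Qed.

Lemma cint_cst (z : C) : cint (fun=> z) = Complex (2 * pi) 0 * z.
Proof.
by case: z => u v; rewrite /cint /= !rint_cst; apply: complexP; rewrite ?ReM ?ImM /=; ring.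
Qed.

Lemma Lp_sum r (I : Type) (s : seq I) (F : I -> fT R) : 0 < r ->
  (forall i, Lp r (F i)) -> Lp r (fun x => \sum_(i <- s) F i x).
Proof.
move=> r0 H; elim: s => [|j s IH].
  by under eq_fun do rewrite big_nil; have [] := Lp_f0 r0.
under eq_fun do rewrite big_cons.
by have [] := @LpD r _ _ (ltW r0) (H j) IH.
Qed.

Lemma cint_sum (I : Type) (s : seq I) (F : I -> fT R) :
  (forall i, Lp 1 (F i)) ->
  cint (fun x => \sum_(i <- s) F i x) = \sum_(i <- s) cint (F i).
Proof.
have L0 : Lp 1 (@f0 R) by have [] := @Lp_f0 1 ltr01.
move=> H; elim: s => [|i s IH].
  under [in LHS]eq_fun do rewrite big_nil; rewrite big_nil.
  by rewrite cint_cst mulr0.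
under [in LHS]eq_fun do rewrite big_cons.
rewrite big_cons cintD; [by rewrite IH|exact: H|].
by apply: Lp_sum => //; exact: ltr01.
Qed.

(** This and the following restatements, true by conversion, are the interface to definitions that
    are opaque from the end of this section on. *)
Lemma cintE f : cint f =
  Complex (rint (fun x => complex.Re (f x))) (rint (fun x => complex.Im (f x))).
Proof. by []. Qed.
Lemma aedE (P : R -> Prop) : aed P ->
  {ae (@lebesgue_measure R), forall x, D x -> P x}.
Proof. by []. Qed.
Lemma aed_ae (P : R -> Prop) : {ae (@lebesgue_measure R), forall x, D x -> P x} -> aed P.
Proof. by []. Qed.
Lemma rmi_integrable (h : R -> R) : rmi h ->
  (@lebesgue_measure R).-integrable D (EFin \o h).
Proof. by []. Qed.
Lemma integrable_rmi (h : R -> R) :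
  (@lebesgue_measure R).-integrable D (EFin \o h) -> rmi h.
Proof. by []. Qed.
Lemma nrE r f : nr r f = rint (fun x => cabs (f x) `^ r).
Proof. by []. Qed.
Lemma aeqP f g : aeq f g <-> aed (fun x => f x = g x).
Proof. by []. Qed.
Lemma Linf_intro f (M : R) : cmeas f -> aed (fun x => cabs (f x) <= M) -> Linf f.
Proof. by move=> mf h; split=> //; exists M. Qed.
Lemma fcE f n :
  fc f n = Complex ((2 * pi)^-1) 0 * cint (fun x => f x * tpow (- n) x).
Proof. by []. Qed.
Lemma LpP r f : Lp r f <-> cmeas f /\ (pint r f < +oo)%E.
Proof. by []. Qed.
End CInt.
#[global] Opaque nr rint rmi cint pint Lp aed cabs tpow pi cos sin powR.

(** * Fourier coefficients and trigonometric polynomials *)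
Section Fourier.
Variable R : realType.
Notation C := (R[i]).
Notation D := (@dom R).
Implicit Types (f g : fT R) (r : R) (n k : int).

Lemma aeq_sym f g : aeq f g -> aeq g f.
Proof. by move=> /aeqP h; apply/aeqP; apply: aedS h. Qed.
Lemma aeq_trans g f h : aeq f g -> aeq g h -> aeq f h.
Proof. by move=> /aeqP h1 /aeqP h2; apply/aeqP; apply: (aedS2 _ h1 h2) => x _ -> ->. Qed.

Lemma Lp_mtpow r k f : Lp r f -> Lp r (fun x => f x * tpow k x).
Proof.
move=> H; have [H' _] := Lp_tpow k H; move: H'; congr (Lp r _).
by apply/funext => x; rewrite /fmul mulrC.
Qed.

Lemma fcD f g n : Lp 1 f -> Lp 1 g -> fc (fadd f g) n = fc f n + fc g n.
Proof.
move=> Hf Hg; rewrite !fcE -mulrDr -cintD; try exact: Lp_mtpow.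
by congr (_ * cint _); apply/funext => x; rewrite mulrDl.
Qed.

Lemma fcZ z f n : Lp 1 f -> fc (fscale z f) n = z * fc f n.
Proof.
move=> Hf; rewrite !fcE mulrCA -(cintZ z (Lp_mtpow (- n) Hf)).
by congr (_ * cint _); apply/funext => x; rewrite /fscale mulrA.
Qed.

Lemma fc0 n : fc (@f0 R) n = 0.
Proof.
rewrite fcE (_ : (fun x => _) = fun=> 0) ?cint_cst ?mulr0//.
by apply/funext => x; rewrite mul0r.
Qed.

Lemma fcB f g n : Lp 1 f -> Lp 1 g -> fc (fsub f g) n = fc f n - fc g n.
Proof.
move=> Hf Hg; have [Hg' _] := LpZ (-1) Hg.
have -> : fsub f g = fadd f (fscale (-1) g).
  by apply/funext => x; rewrite /fadd /fscale mulN1r.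
by rewrite fcD// fcZ// mulN1r.
Qed.

Lemma fc_ae f g n : cmeas f -> cmeas g -> aeq f g -> fc f n = fc g n.
Proof.
move=> mf mg /aeqP h; rewrite !fcE; congr (_ * _); apply: cint_ae.
- by apply: cmeasM => //; exact: cmeas_tpow.
- by apply: cmeasM => //; exact: cmeas_tpow.
- by apply: aedS h => x _ ->.
Qed.

Lemma fc_abs f n : Lp 1 f -> cabs (fc f n) <= nr 1 f.
Proof.
move=> Hf; rewrite fcE cabsM cabs_real ger0_norm; last first.
  by rewrite invr_ge0 ltW// twopi_gt0.
have H' := cint_abs (Lp_mtpow (- n) Hf).
have E : nr 1 (fun x => f x * tpow (- n) x) = nr 1 f.
  by rewrite !nr1E; congr rint; apply/funext => x; rewrite cabsM cabs_tpow mulr1.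
rewrite E in H'.
rewrite ler_pdivrMl; last exact: twopi_gt0.
apply: (le_trans H'); rewrite ler_wpM2r; [by []|exact: nr_ge0|].
exact: two_le_2pi.
Qed.

Lemma fc_shift k f n : fc (fmul (tpow k) f) n = fc f (n - k).
Proof.
rewrite !fcE; congr (_ * cint _); apply/funext => x; rewrite /fmul opprB tpowD.
ring.
Qed.

Lemma fc_tilde f n : Lp 1 f -> fc (tilde f) n = fc f (- n).
Proof.
move=> Hf; rewrite !fcE opprK -(cint_refl (Lp_mtpow n Hf)).
congr (_ * cint _); apply/funext => x; rewrite /tilde.
by rewrite tpow_shift.
Qed.

Lemma fc_conj f n : Lp 1 f -> fc (conjf f) n = conjc (fc f (- n)).
Proof.
move=> Hf; rewrite !fcE conjcM opprK conjcR.
rewrite -[in RHS](cint_conj (Lp_mtpow n Hf)); congr (_ * cint _).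
by apply/funext => x; rewrite /conjf conjcM conj_tpow.
Qed.

Lemma fc_Jop f n : Lp 1 f -> fc (Jop f) n = fc f (- n - 1).
Proof.
move=> Hf; rewrite JopE fc_shift fc_tilde//; congr fc.
lia.
Qed.

Lemma cint_fc f : cint f = Complex (2 * pi) 0 * fc f 0.
Proof.
rewrite fcE mulrA.
have -> : Complex (2 * pi) 0 * Complex (2 * pi)^-1 0 = 1 :> C.
  apply: complexP; rewrite ?ReM ?ImM /= ?mulr0 ?mul0r ?subr0 ?addr0//.
  by rewrite divff// gt_eqF// twopi_gt0.
rewrite mul1r; congr cint; apply/funext => x.
by rewrite oppr0 tpow0 mulr1.
Qed.

Lemma rint_cos_int k : k != 0 -> rint (fun x => cos (k%:~R * x)) = 0 :> R.
Proof.
move=> k0; have kR : k%:~R != 0 :> R by rewrite intr_eq0.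
pose F (x : R) := k%:~R^-1 * sin (k%:~R * x).
have dF (x : R) : is_derive x 1 F (cos (k%:~R * x)).
  have d1 : is_derive x 1 (fun y : R => k%:~R * y) k%:~R.
    have := is_deriveZ (k%:~R : R) (is_derive_id x (1 : R)).
    by rewrite /GRing.scale /= mulr1.
  have d2 := is_derive1_comp (is_derive_sin (k%:~R * x)) d1.
  have := is_deriveZ k%:~R^-1 d2.
  by rewrite /GRing.scale /= mulrCA mulVf// mulr1.
have cF : continuous F.
  move=> x; apply: differentiable_continuous; apply/derivable1_diffP.
  by have [] := dF x.
have cc : continuous (fun x : R => cos (k%:~R * x)).
  move=> x; apply: (continuous_comp (f := fun y : R => k%:~R * y)); last exact: continuous_cos.
  by apply: mulrl_continuous.
have := @continuous_FTC2 R (fun x => cos (k%:~R * x)) F 0 (2 * pi) (twopi_gt0 R).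
rewrite -domE => H.
have I : rmi (fun x : R => cos (k%:~R * x)).
  apply: (rmi_le _ _ (rmi_cst 1)); first exact: meas_continuous.
  apply: aedW => x _; rewrite ler_norml; by rewrite cos_geN1 cos_le1.
have : (\int[lebesgue_measure]_(x in D) (cos (k%:~R * x))%:E = (F (2 * pi))%:E - (F 0)%:E)%E.
  apply: H.
  - by apply: continuous_subspaceT.
  - split.
    + by move=> x _; have [] := dF x.
    + by apply: cvg_at_right_filter; exact: cF.
    + by apply: cvg_at_left_filter; exact: cF.
  - by move=> x _; rewrite derive1E; have [_ ->] := dF x.
rewrite rint_EFin// -EFinB => -[->].
rewrite /F !mulr0 sin0 mulr0 subr0.
(* sin (2 pi k) = 0, read off from periodicity at the point 0. *)
have := @tpow_shift R k 0; rewrite subr0 !tpowE mulr0 sin0 => -[_ ->].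
by rewrite mulr0.
Qed.

Lemma cint_tpow k : cint (tpow k : fT R) = if k == 0 then Complex (2 * pi) 0 else 0.
Proof.
case: eqP => [->|/eqP k0].
  have -> : tpow 0 = (fun=> 1) :> fT R by apply/funext => x; rewrite tpow0.
  by rewrite cint_cst mulr1.
have Lk : Lp 1 (tpow k : fT R).
  apply: Linf_Lp => //; apply: (@Linf_intro _ _ 1); first exact: cmeas_tpow.
  by apply: aedW => x _; rewrite cabs_tpow.
have E1 : rint (fun x => complex.Re (tpow k x : C)) = 0 :> R.
  by rewrite -(rint_cos_int k0); congr rint.
(* The sine is odd under x -> 2 pi - x, so its integral is its own opposite. *)
have E2 : rint (fun x => complex.Im (tpow k x : C)) = 0 :> R.
  have := rint_refl (rmi_Im Lk).
  have -> : (fun x => complex.Im (tpow k (refl x) : C)) =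
    (fun x => -1 * complex.Im (tpow k x : C)) :> (R -> R).
    by apply/funext => x; rewrite tpow_shift -conj_tpow ImJ mulN1r.
  rewrite rintZ; last exact: rmi_Im.
  lra.
have -> : cint (tpow k : fT R) =
    Complex (rint (fun x => complex.Re (tpow k x : C))) (rint (fun x => complex.Im (tpow k x : C))).
  by [].
by rewrite E1 E2.
Qed.

Lemma Linf_tpow k : Linf (tpow k : fT R).
Proof.
apply: (@Linf_intro _ _ 1); first exact: cmeas_tpow.
by apply: aedW => x _; rewrite cabs_tpow.
Qed.

Lemma fc_tpow k n : fc (tpow k : fT R) n = (k == n)%:R.
Proof.
rewrite fcE (_ : (fun x => _) = tpow (k - n)); last first.
  by apply/funext => x; rewrite tpowD.
rewrite cint_tpow subr_eq0; case: eqP => _; last by rewrite mulr0.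
apply: complexP; rewrite ?ReM ?ImM /= ?mulr0 ?mul0r ?subr0 ?addr0//.
by rewrite mulVf// gt_eqF// twopi_gt0.
Qed.

(** A list of frequencies with coefficients. A frequency may occur several times, the coefficients
    then add up; this keeps sums and products of polynomials simple. *)
Definition tp (s : seq (int * C)) : fT R := fun x => \sum_(kc <- s) kc.2 * tpow kc.1 x.

Lemma trigpolyP f : trigpoly f <-> exists s, f = tp s.
Proof.
split=> -[s h]; exists s; first by apply/funext => x; rewrite h.
by move=> x; rewrite h.
Qed.

Lemma Linf_cst (z : C) : Linf ((fun=> z) : fT R).
Proof.
by apply: (@Linf_intro _ _ (cabs z)); [exact: cmeas_cst|apply: aedW].
Qed.

Lemma LinfD f g : Linf f -> Linf g -> Linf (fun x => f x + g x).
Proof.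
move=> Hf Hg; have [M M0 h] := Linf_bound Hf; have [N N0 k] := Linf_bound Hg.
apply: (@Linf_intro _ _ (M + N)).
  by apply: cmeasD; exact: Linf_cmeas.
by apply: (aedS2 _ h k) => x _ h1 h2; apply: (le_trans (cabsD _ _)); exact: lerD.
Qed.

Lemma LinfM f g : Linf f -> Linf g -> Linf (fun x => f x * g x).
Proof.
move=> Hf Hg; have [M M0 h] := Linf_bound Hf; have [N N0 k] := Linf_bound Hg.
apply: (@Linf_intro _ _ (M * N)).
  by apply: cmeasM; exact: Linf_cmeas.
by apply: (aedS2 _ h k) => x _ h1 h2; rewrite cabsM; apply: ler_pM; rewrite ?cabs_ge0.
Qed.

Lemma Linf_conj f : Linf f -> Linf (conjf f).
Proof.
move=> Hf; have [M M0 h] := Linf_bound Hf; apply: (@Linf_intro _ _ M).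
  by apply: cmeas_conj; exact: Linf_cmeas.
by apply: aedS h => x _; rewrite /conjf cabsJ.
Qed.

Lemma Linf_tilde f : Linf f -> Linf (tilde f).
Proof.
move=> Hf; have [M M0 h] := Linf_bound Hf; apply: (@Linf_intro _ _ M).
  by apply: cmeas_refl; exact: Linf_cmeas.
exact: (aed_refl h).
Qed.

Lemma Linf_ae f g : cmeas g -> aeq f g -> Linf f -> Linf g.
Proof.
move=> mg /aeqP fg Hf; have [M M0 h] := Linf_bound Hf.
by apply: (@Linf_intro _ _ M) => //; apply: (aedS2 _ fg h) => x _ ->.
Qed.

Lemma Linf_tp s : Linf (tp s).
Proof.
rewrite /tp; elim: s => [|i s IH].
  by under eq_fun do rewrite big_nil; exact: Linf_cst.
under eq_fun do rewrite big_cons.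
apply: LinfD; last exact: IH.
by apply: LinfM; [exact: Linf_cst|exact: Linf_tpow].
Qed.

Lemma Lp_tp r s : 0 <= r -> Lp r (tp s).
Proof. by move=> r0; apply: Linf_Lp => //; exact: Linf_tp. Qed.
Lemma tp_nil : tp [::] = @f0 R.
Proof. by apply/funext => x; rewrite /tp big_nil. Qed.
Lemma tp_cons kc s : tp (kc :: s) = fadd (fscale kc.2 (tpow kc.1)) (tp s).
Proof. by apply/funext => x; rewrite /tp big_cons. Qed.
Lemma tp_cat s1 s2 : tp (s1 ++ s2) = fadd (tp s1) (tp s2).
Proof. by apply/funext => x; rewrite /tp big_cat. Qed.
Lemma Lp_tpow1 k r : 0 <= r -> Lp r (tpow k : fT R).
Proof. by move=> r0; apply: Linf_Lp => //; exact: Linf_tpow. Qed.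
Lemma fc_tp s n : fc (tp s) n = \sum_(kc <- s | kc.1 == n) kc.2.
Proof.
elim: s => [|kc s IH]; first by rewrite tp_nil fc0 big_nil.
rewrite tp_cons fcD; last 2 first.
- by have [] := LpZ kc.2 (Lp_tpow1 kc.1 ler01).
- exact: Lp_tp.
rewrite fcZ; last exact: Lp_tpow1.
rewrite fc_tpow big_cons IH; case: eqP => _; first by rewrite mulr1.
by rewrite mulr0 add0r.
Qed.

(** The Riesz projection at the level of lists. *)
Definition tpP (s : seq (int * C)) := [seq kc <- s | 0 <= kc.1].
Lemma fc_tpP s n : fc (tp (tpP s)) n = if 0 <= n then fc (tp s) n else 0.
Proof.
rewrite !fc_tp /tpP big_filter_cond; case: ifP => hn.
  by apply: eq_bigl => kc; case: eqP => [->|_]; rewrite ?hn ?andbF.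
by apply: big1 => kc /andP[h /eqP e]; rewrite e hn in h.
Qed.

Definition tpopp (s : seq (int * C)) (z : C) := [seq (kc.1, z * kc.2) | kc <- s].
Lemma tp_scale s z : tp (tpopp s z) = fscale z (tp s).
Proof.
apply/funext => x; rewrite /tp big_map /fscale mulr_sumr.
by apply: eq_bigr => kc _ /=; rewrite mulrA.
Qed.

Lemma tpP_scale s z : tpP (tpopp s z) = tpopp (tpP s) z.
Proof. by rewrite /tpP filter_map. Qed.
Lemma tpP_cat s1 s2 : tpP (s1 ++ s2) = tpP s1 ++ tpP s2.
Proof. by rewrite /tpP filter_cat. Qed.

(** An analytic polynomial with value [m] at the centre of the disc. The class is closed under sums
    and products, compatibly with [m], so the mean value property holds for every polynomial
    expression in such functions without any theory of holomorphic functions. *)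
Definition atp (f : fT R) (m : C) := exists s : seq (int * C),
  (forall kc, kc \in s -> 0 < kc.1) /\ (forall x, f x = m + tp s x).
Lemma atp_cint f m : atp f m -> cint f = Complex (2 * pi) 0 * m.
Proof.
move=> [s [hs E]].
have -> : f = fadd (fun=> m) (tp s) by apply/funext.
rewrite cint_fc fcD; [|exact/Linf_Lp/Linf_cst|exact: Lp_tp].
rewrite fc_tp big1_seq ?addr0; last first.
  by move=> kc /andP[/eqP h /hs]; rewrite h ltxx.
by rewrite -cint_fc cint_cst.
Qed.

Lemma atp_cst (z : C) : atp (fun=> z) z.
Proof. by exists [::]; split=> // x; rewrite /tp big_nil addr0. Qed.
Lemma atpD f g m m' : atp f m -> atp g m' -> atp (fun x => f x + g x) (m + m').
Proof.
move=> [s [hs Ef]] [s' [hs' Eg]]; exists (s ++ s'); split.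
  by move=> kc; rewrite mem_cat => /orP[/hs|/hs'].
by move=> x; rewrite Ef Eg tp_cat /fadd addrACA.
Qed.

Lemma atpM f g m m' : atp f m -> atp g m' -> atp (fun x => f x * g x) (m * m').
Proof.
move=> [s [hs Ef]] [s' [hs' Eg]].
exists (tpopp s' m ++ tpopp s m' ++
        [seq (a.1 + b.1, a.2 * b.2) | a <- s, b <- s']); split.
  move=> kc; rewrite !mem_cat => /or3P[/mapP[a /hs' ha ->]|/mapP[a /hs ha ->]|] //.
  by move=> /allpairsP[[a b] /= [/hs ha /hs' hb ->]] /=; rewrite addr_gt0.
move=> x; rewrite Ef Eg !tp_cat /fadd !tp_scale /fscale.
have -> : tp [seq (a.1 + b.1, a.2 * b.2) | a <- s, b <- s'] x = tp s x * tp s' x.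
  rewrite /tp big_allpairs_dep /= mulr_suml; apply: eq_bigr => a _.
  rewrite mulr_sumr; apply: eq_bigr => b _ /=; rewrite tpowD; ring.
ring.
Qed.

Lemma atpX f m (n : nat) : atp f m -> atp (fun x => f x ^+ n) (m ^+ n).
Proof.
move=> h; elim: n => [|n IH].
  by under eq_fun do rewrite expr0; rewrite expr0; exact: atp_cst.
by under eq_fun do rewrite exprS; rewrite exprS; exact: atpM.
Qed.

Lemma atp_Linf f m : atp f m -> Linf f.
Proof.
move=> [s [_ E]]; have -> : f = fun x => m + tp s x by apply/funext.
by apply: LinfD; [exact: Linf_cst|exact: Linf_tp].
Qed.

(** [Pr f] is a choice, so an integrable witness [g] must be exhibited before anything is known
    about it. *)
Lemma PrP f g : Lp 1 g -> (forall n, fc g n = if 0 <= n then fc f n else 0) ->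
  Lp 1 (Pr f) /\ forall n, fc (Pr f) n = if 0 <= n then fc f n else 0.
Proof.
move=> Hg Eg.
exact: (xgetPex (P := [set h : fT R | Lp 1 h /\
  forall n : int, fc h n = if 0 <= n then fc f n else 0]) (@f0 R)
  (ex_intro _ g (conj Hg Eg))).
Qed.
End Fourier.
#[global] Opaque fc Pr.

(** * Fejer means and density *)
Section Fejer.
Variable R : realType.
Notation C := (R[i]).
Notation D := (@dom R).

Lemma cos_sep (d y : R) : 0 < d -> d <= `|y| -> `|y| <= 2 * pi - d ->
  cos y <= cos d.
Proof.
move=> d0 h1 h2; rewrite -(cos_norm y); move: h1 h2; move: (`|y| : R) => z h1 h2.
have mono (a b : R) : 0 <= a -> a <= b -> b <= pi -> cos b <= cos a.
  move=> a0 ab bp; rewrite leNgt ltr_cos -?leNgt// in_itv/=.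
    by rewrite bp (le_trans a0).
  by rewrite a0 (le_trans ab).
case: (leP z pi) => zp; first by apply: mono => //; exact: ltW.
have -> : cos z = cos (2 * pi - z).
  by rewrite -[2 * pi - z]addrC mulr_natl cosD2pi cosN.
by apply: mono; lra.
Qed.

Lemma cos_lt1 (d : R) : 0 < d -> d <= pi -> cos d < 1.
Proof.
move=> d0 dp; rewrite -[ltRHS]cos0 ltr_cos ?in_itv/= ?lexx ?pi_ge0//.
by rewrite (ltW d0).
Qed.

Lemma tpow_sub k (x y : R) : tpow k (x - y) = tpow k x * tpow (- k) y :> C.
Proof.
rewrite !tpowE mulrBr cosB sinB intrN mulNr cosN sinN.
apply: complexP; rewrite ?ReM ?ImM /=; ring.
Qed.

Definition Dk (n : nat) (y : R) : C := \sum_(j < n) tpow j%:Z y.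
(** The Fejer kernel, in the form |1 + t + ... + t^(n-1)|^2 / n, where positivity is visible. *)
Definition Kf (n : nat) (y : R) : R := cabs (Dk n y) ^+ 2 / n%:R.

Lemma Kf_ge0 n y : 0 <= Kf n y.
Proof. by rewrite divr_ge0// sqr_ge0. Qed.

Lemma natC (n : nat) : n%:R = Complex n%:R 0 :> C.
Proof. by rewrite -[RHS]/(real_complex R n%:R) rmorph_nat. Qed.
Lemma cabs_sqrC (z : C) : Complex (cabs z ^+ 2) 0 = z * conjc z.
Proof.
rewrite cabs_sqr; case: z => u v; apply: complexP; rewrite ?ReM ?ImM /=; ring.
Qed.

Lemma conj_Dk n y : conjc (Dk n y) = \sum_(j < n) tpow (- j%:Z) y.
Proof.
rewrite /Dk; elim/big_rec2: _ => [|i a b _ <-]; first by rewrite conjc0.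
by rewrite conjcD conj_tpow.
Qed.

Lemma Kf_sum n x s : Complex (Kf n (x - s)) 0 =
  \sum_(j < n) \sum_(k < n)
    (Complex n%:R^-1 0 * tpow (j%:Z - k%:Z) x) * tpow (- (j%:Z - k%:Z)) s :> C.
Proof.
have -> : Complex (Kf n (x - s)) 0 = Complex n%:R^-1 0 * Complex (cabs (Dk n (x - s)) ^+ 2) 0 :> C.
  apply: complexP; rewrite ?ReM ?ImM /= /Kf; ring.
rewrite cabs_sqrC conj_Dk /Dk mulr_suml mulr_sumr; apply: eq_bigr => j _.
rewrite mulr_sumr mulr_sumr; apply: eq_bigr => k _.
rewrite !tpow_sub -[j%:Z - k%:Z]/(j%:Z + - k%:Z) opprD !tpowD; ring.
Qed.

Lemma Dk_tele n y : (1 - tpow 1 y) * Dk n y = 1 - tpow n y.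
Proof.
elim: n => [|n IH]; first by rewrite /Dk big_ord0 mulr0 tpow0 subrr.
rewrite /Dk big_ord_recr /= -/(Dk n y) mulrDr IH -[in RHS]addn1 PoszD tpowD; ring.
Qed.

Lemma cabs_1tpow y : cabs (1 - tpow 1 y : C) ^+ 2 = 2 - 2 * cos y.
Proof.
rewrite cabs_sqr tpowE mul1r ReD ImD ReN ImN /=.
have := cos2Dsin2 y; nra.
Qed.

(** With t = e^(i y) and D = 1 + ... + t^(n-1), |1 - t|^2 |D|^2 = |1 - t^n|^2 <= 4, whereas |1 -
    t|^2 = 2 - 2 cos y >= 2 k. *)
Lemma Kf_bound n y (k : R) : (0 < n)%N -> 0 < k -> cos y <= 1 - k ->
  Kf n y <= 2 / k / n%:R.
Proof.
move=> n0 k0 hy; rewrite /Kf ler_pM2r ?invr_gt0 ?ltr0n//.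
have h2 : cabs (1 - tpow 1 y : C) ^+ 2 * cabs (Dk n y) ^+ 2 <= 4.
  rewrite -exprMn -cabsM Dk_tele.
  have : cabs (1 - tpow n y : C) <= 2.
    by apply: (le_trans (cabsB _ _)); rewrite cabs1 cabs_tpow.
  have := cabs_ge0 (1 - tpow n y : C); move: (cabs _) => z; nra.
rewrite cabs_1tpow in h2; rewrite ler_pdivlMr//.
have := sqr_ge0 (cabs (Dk n y)); move: h2; move: (_ ^+ 2) => z; nra.
Qed.

(** The double sum visits the frequency m exactly n - |m| times, which is the Cesaro weight. *)
Definition fej (n : nat) (g : fT R) : fT R :=
  fun x => \sum_(j < n) \sum_(k < n)
    (Complex n%:R^-1 0 * fc g (j%:Z - k%:Z)) * tpow (j%:Z - k%:Z) x.
Definition fejs (n : nat) (g : fT R) : seq (int * C) :=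
  [seq (j%:Z - k%:Z, Complex n%:R^-1 0 * fc g (j%:Z - k%:Z)) | j <- iota 0 n, k <- iota 0 n].
Lemma fej_tp n g : fej n g = tp (fejs n g).
Proof.
apply/funext => x; rewrite /fej /tp /fejs big_allpairs_dep /=.
rewrite -(big_mkord xpredT (fun j : nat => \sum_(k < n) (n%:R^-1 +i* 0)%C * fc g (j%:Z - k%:Z) * tpow (j%:Z - k%:Z) x)).
rewrite /index_iota subn0; apply: eq_bigr => j _.
by rewrite -(big_mkord xpredT (fun k : nat => (n%:R^-1 +i* 0)%C * fc g (j%:Z - k%:Z) * tpow (j%:Z - k%:Z) x)) /index_iota subn0.
Qed.

Definition rc (h : R -> R) : fT R := fun x => Complex (h x) 0.

Lemma fej_cint n g x : Lp 1 g ->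
  fej n g x = Complex (2 * pi)^-1 0 * cint (fun s => g s * Complex (Kf n (x - s)) 0).
Proof.
move=> Hg.
have -> : (fun s => g s * Complex (Kf n (x - s)) 0) =
  (fun s => \sum_(j <- index_enum 'I_n) \sum_(k <- index_enum 'I_n)
    (Complex n%:R^-1 0 * tpow (j%:Z - k%:Z) x) * (g s * tpow (- (j%:Z - k%:Z)) s)).
  apply/funext => s; rewrite Kf_sum mulr_sumr; apply: eq_bigr => j _.
  rewrite mulr_sumr; apply: eq_bigr => k _; ring.
have L (j k : 'I_n) : Lp 1 (fun s => (Complex n%:R^-1 0 * tpow (j%:Z - k%:Z) x) *
    (g s * tpow (- (j%:Z - k%:Z)) s)).
  by have [] := LpZ (Complex n%:R^-1 0 * tpow (j%:Z - k%:Z) x) (Lp_mtpow (- (j%:Z - k%:Z)) Hg).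
rewrite cint_sum; last by move=> j; apply: Lp_sum; [exact: ltr01|exact: L].
rewrite /fej mulr_sumr; apply: eq_bigr => j _.
rewrite cint_sum; last by move=> k; exact: L.
rewrite mulr_sumr; apply: eq_bigr => k _.
rewrite cintZ; last exact: Lp_mtpow.
rewrite fcE; ring.
Qed.

Lemma rc_Linf (h : R -> R) (B : R) : measurable_fun D h ->
  (forall x, D x -> `|h x| <= B) -> Linf (rc h).
Proof.
move=> mh hB; apply: (@Linf_intro _ _ B); first exact: cmeas_real.
by apply: aedW => x dx; rewrite cabs_real hB.
Qed.

Lemma meas_Kf n x : measurable_fun D (fun s => Kf n (x - s)).
Proof.
rewrite /Kf; under eq_fun do rewrite mulrC.
apply: measurable_funM; first exact: measurable_cst.
apply: meas_sqr; apply: meas_cabs.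
have -> : (fun s => Dk n (x - s)) = (fun s => \sum_(j <- index_enum 'I_n) tpow j%:Z x * tpow (- j%:Z) s).
  by apply/funext => s; apply: eq_bigr => j _; rewrite tpow_sub.
apply: cmeas_sum => j; apply: cmeasM; [exact: cmeas_cst|exact: cmeas_tpow].
Qed.

Lemma Kf_le n y : (0 < n)%N -> Kf n y <= n%:R.
Proof.
move=> n0; rewrite /Kf ler_pdivrMr ?ltr0n// -expr2.
have : cabs (Dk n y) <= n%:R.
  apply: (le_trans (cabs_sum _ _ _)).
  by under eq_bigr do rewrite cabs_tpow; rewrite sumr_const card_ord.
have := cabs_ge0 (Dk n y); move: (cabs _) => z; move: n%:R => w; nra.
Qed.

Lemma rmi_Kf n x : (0 < n)%N -> rmi (fun s => Kf n (x - s)).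
Proof.
move=> n0; apply: (rmi_le _ _ (rmi_cst n%:R)); first exact: meas_Kf.
by apply: aedW => s _; rewrite ger0_norm ?Kf_ge0// Kf_le.
Qed.

Lemma rmi_hKf (h : R -> R) (B : R) n x : (0 < n)%N -> measurable_fun D h ->
  (forall x, D x -> `|h x| <= B) -> rmi (fun s => h s * Kf n (x - s)).
Proof.
move=> n0 mh hB; apply: (rmi_le _ _ (rmiZ B (rmi_Kf x n0))).
  by apply: measurable_funM => //; exact: meas_Kf.
apply: aedW => s ds; rewrite normrM (ger0_norm (Kf_ge0 _ _)).
by rewrite ler_wpM2r ?Kf_ge0// hB.
Qed.

Lemma fej_rc (h : R -> R) (B : R) n x : (0 < n)%N -> measurable_fun D h ->
  (forall x, D x -> `|h x| <= B) ->
  fej n (rc h) x = Complex ((2 * pi)^-1 * rint (fun s => h s * Kf n (x - s))) 0.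
Proof.
move=> n0 mh hB; rewrite fej_cint; last by apply: Linf_Lp => //; exact: rc_Linf hB.
have -> : cint (fun s => rc h s * Complex (Kf n (x - s)) 0) =
  Complex (rint (fun s => h s * Kf n (x - s))) 0.
  rewrite cintE; congr Complex.
    by congr rint; apply/funext => s; rewrite ReM /= mulr0 subr0.
  rewrite (_ : (fun s => _) = fun=> 0) ?rint_cst ?mul0r//.
  by apply/funext => s; rewrite ImM /= mulr0 mul0r addr0.
apply: complexP; rewrite ?ReM ?ImM /=; ring.
Qed.

(** The Fejer mean of the constant 1 is computed twice: from the integral formula, and from the
    Fourier coefficients, where only the n diagonal terms survive. *)
Lemma Kf_mean n x : (0 < n)%N -> (2 * pi)^-1 * rint (fun s => Kf n (x - s)) = 1.
Proof.
move=> n0.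
have H1 (y : R) : D y -> `|(1 : R)| <= 1 by rewrite normr1.
have := @fej_rc (fun=> 1) 1 n x n0 (measurable_cst _) H1.
have -> : (fun s => 1 * Kf n (x - s)) = (fun s => Kf n (x - s)).
  by apply/funext => s; rewrite mul1r.
have -> : rc (fun=> 1) = tpow 0 by apply/funext => s; rewrite tpow0.
have -> : fej n (tpow 0) x = 1.
  rewrite /fej; under eq_bigr => j _.
    rewrite (bigD1 j)//= subrr fc_tpow eqxx mulr1 tpow0 mulr1 big1 ?addr0; last first.
      move=> k kj; rewrite fc_tpow eq_sym subr_eq0 eqz_nat.
      have -> : (nat_of_ord j == nat_of_ord k) = false.
        by apply/negbTE; rewrite eq_sym; exact: kj.
      by rewrite mulr0 mul0r.
    over.
  have n1 : n%:R != 0 :> R by rewrite pnatr_eq0 -lt0n.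
  have E : (n%:R : C) * Complex n%:R^-1 0 = 1.
    rewrite natC; apply: complexP; rewrite ?ReM ?ImM /= ?mulr0 ?mul0r ?subr0 ?addr0//.
    by rewrite divff.
  by rewrite -[RHS]E [RHS]mulr_natl [LHS]sumr_const card_ord.
by move=> [].
Qed.

Definition fejr (n : nat) (h : R -> R) (x : R) :=
  (2 * pi)^-1 * rint (fun s => h s * Kf n (x - s)).
Lemma ltr_inv_archi (c e : R) : 0 <= c -> 0 < e ->
  exists N : nat, (0 < N)%N /\ forall n, (N <= n)%N -> c / n%:R < e.
Proof.
move=> c0 e0; have [N hN] : exists N : nat, c / e < N%:R.
  exists (Num.truncn (c / e)).+1; exact: truncnS_gt.
have ce : 0 <= c / e by rewrite divr_ge0// ltW.
have N0 : (0 < N)%N by rewrite -(ltr0n R) (le_lt_trans ce).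
exists N; split=> // n Nn.
rewrite ltr_pdivrMr ?ltr0n ?(leq_trans N0)// mulrC -ltr_pdivrMr//.
by apply: (lt_le_trans hN); rewrite ler_nat.
Qed.

(** The approximate identity argument. The end points 0 and 2 pi are left out because [h] is not
    assumed to be periodic; they form a null set. *)
Lemma fejr_cvg (h : R -> R) (B x : R) : measurable_fun D h ->
  (forall x, D x -> `|h x| <= B) -> 0 < x -> x < 2 * pi ->
  (forall e : R, 0 < e -> exists2 d : R, 0 < d & forall s : R, D s -> `|s - x| < d -> `|h s - h x| < e) ->
  forall e : R, 0 < e -> exists N : nat, forall n : nat, (N <= n)%N -> `|fejr n h x - h x| < e.
Proof.
move=> mh hB x0 x1 ch e e0.
have dx : D x by rewrite /dom /= !ltW.
have B0 : 0 <= B by apply: le_trans (hB _ dx).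
have [d0 d00 hd0] := ch (e / 2) (divr_gt0 e0 (ltr0Sn _ _)).
(* Keeping [d] below the distance from [x] to both end points ensures |s - x| <= 2 pi - d on the
   whole domain, so [cos_sep] applies as soon as |s - x| >= d. *)
pose d := Num.min d0 (Num.min x (2 * pi - x)).
have dgt0 : 0 < d by rewrite !lt_min d00 x0 subr_gt0 x1.
have dx1 : d <= x by rewrite /d !ge_min lexx orbT.
have dx2 : d <= 2 * pi - x by rewrite /d !ge_min lexx !orbT.
have dd0 : d <= d0 by rewrite /d !ge_min lexx.
have dpi : d <= pi by clear -dx1 dx2; lra.
pose k := 1 - cos d; have k0 : 0 < k by rewrite subr_gt0 cos_lt1.
have c0 : 0 <= 2 * B * (2 / k) by rewrite !mulr_ge0// invr_ge0 ltW.
have [N [N0 hN]] := ltr_inv_archi c0 (divr_gt0 e0 (ltr0Sn _ 1)).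
exists N => n Nn; have n0 : (0 < n)%N by exact: leq_trans Nn.
have I1 := rmi_hKf x n0 mh hB.
have I2 : rmi (fun s => h x * Kf n (x - s)) by apply: rmiZ; exact: rmi_Kf.
have E : fejr n h x - h x = (2 * pi)^-1 * rint (fun s => h s * Kf n (x - s) - h x * Kf n (x - s)).
  rewrite rintB// rintZ; last exact: rmi_Kf.
  rewrite mulrBr [_ * (h x * _)]mulrCA Kf_mean// mulr1 /fejr.
  by [].
rewrite E normrM ger0_norm; last by rewrite invr_ge0 ltW// twopi_gt0.
set w := 2 * B * (2 / k) / n%:R.
have I3 : rmi (fun s => e / 2 * Kf n (x - s) + w).
  by apply: rmiD; [apply: rmiZ; exact: rmi_Kf|exact: rmi_cst].
have le1 : `|rint (fun s => h s * Kf n (x - s) - h x * Kf n (x - s))| <=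
           rint (fun s => e / 2 * Kf n (x - s) + w).
  apply: (le_trans (rint_abs (rmiB I1 I2))); apply: rint_le => //.
    by apply: rmi_abs; exact: rmiB.
  apply: aedW => s ds; rewrite -mulrBl normrM (ger0_norm (Kf_ge0 _ _)).
  have K0 := Kf_ge0 n (x - s).
  have w0 : 0 <= w by rewrite divr_ge0.
  case: (ltP `|s - x| d) => sd.
    apply: (@le_trans _ _ (e / 2 * Kf n (x - s))); last by rewrite lerDl.
    by rewrite ler_wpM2r// ltW// hd0// (lt_le_trans sd).
  apply: (@le_trans _ _ w); last by rewrite lerDr mulr_ge0// divr_ge0// ltW.
  have Kb : Kf n (x - s) <= 2 / k / n%:R.
    apply: Kf_bound => //; rewrite /k subKr.
    apply: cos_sep => //; rewrite distrC// ler_norml.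
    move: ds => /andP[s0 s1]; clear -dx1 dx2 s0 s1; lra.
  have hb : `|h s - h x| <= 2 * B.
    apply: (le_trans (ler_normB _ _)); rewrite mulr_natl mulr2n.
    by apply: lerD; exact: hB.
  by rewrite /w -mulrA; apply: ler_pM.
have I4 := rmi_Kf x n0.
have R1 : (2 * pi)^-1 * rint (fun s => e / 2 * Kf n (x - s) + w) = e / 2 + w.
  rewrite rintD; [|exact: rmiZ|exact: rmi_cst].
  rewrite rintZ// rint_cst mulrDr mulrCA Kf_mean// mulr1; congr (_ + _).
  by rewrite mulrCA mulVf ?mulr1// gt_eqF// twopi_gt0.
apply: (@le_lt_trans _ _ (e / 2 + w)).
  rewrite -R1 ler_wpM2l//; last by rewrite invr_ge0 ltW// twopi_gt0.
have := hN n Nn; rewrite -/w; clear; lra.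
Qed.

Lemma fejr_bound (h : R -> R) (B x : R) (n : nat) : (0 < n)%N -> measurable_fun D h ->
  (forall x, D x -> `|h x| <= B) -> `|fejr n h x| <= B.
Proof.
move=> n0 mh hB; rewrite /fejr normrM ger0_norm; last by rewrite invr_ge0 ltW// twopi_gt0.
apply: (@le_trans _ _ ((2 * pi)^-1 * (B * rint (fun s => Kf n (x - s))))).
  rewrite ler_wpM2l//; first by rewrite invr_ge0 ltW// twopi_gt0.
  have I := rmi_hKf x n0 mh hB.
  apply: (le_trans (rint_abs I)); rewrite -rintZ; last exact: rmi_Kf.
  apply: rint_le; [exact: rmi_abs|by apply: rmiZ; exact: rmi_Kf|].
  apply: aedW => s ds; rewrite normrM (ger0_norm (Kf_ge0 _ _)).
  by rewrite ler_wpM2r ?Kf_ge0// hB.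
by rewrite mulrCA Kf_mean// mulr1.
Qed.

Lemma fejr_ge0 (h : R -> R) (x : R) (n : nat) : (forall x, D x -> 0 <= h x) -> 0 <= fejr n h x.
Proof.
move=> h0; rewrite /fejr mulr_ge0//; first by rewrite invr_ge0 ltW// twopi_gt0.
by apply: rint_ge0 => s ds; rewrite mulr_ge0 ?Kf_ge0 ?h0.
Qed.
End Fejer.

(** * Density of trigonometric polynomials and uniqueness of Fourier coefficients *)

Section Density.
Variable R : realType.
Notation C := (R[i]).
Notation D := (@dom R).
Notation mu0 := (@lebesgue_measure R).

Lemma cvgn_eps (u : nat -> R) (l : R) :
  (forall e : R, 0 < e -> exists N : nat, forall n : nat, (N <= n)%N -> `|u n - l| < e) ->
  u n @[n --> \oo] --> l.
Proof.
move=> h; apply/cvgrPdist_lt => e e0; have [N hN] := h e e0.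
by exists N => // n /= Nn; rewrite distrC; exact: hN.
Qed.

Lemma eps_cvgn (u : nat -> R) (l : R) : u n @[n --> \oo] --> l ->
  (forall e : R, 0 < e -> exists N : nat, forall n : nat, (N <= n)%N -> `|u n - l| < e).
Proof.
move=> /cvgrPdist_lt h e e0; have [N _ hN] := h e e0.
by exists N => n Nn; rewrite distrC; exact: hN.
Qed.

Lemma rint_dct (h_ : nat -> R -> R) (h k : R -> R) :
  (forall n, measurable_fun D (h_ n)) -> measurable_fun D h -> rmi k ->
  aed (fun x => forall e : R, 0 < e ->
    exists N : nat, forall n : nat, (N <= n)%N -> `|h_ n x - h x| < e) ->
  aed (fun x => forall n, `|h_ n x| <= k x) ->
  [/\ rmi h, (forall n, rmi (h_ n)) & forall e : R, 0 < e ->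
    exists N : nat, forall n : nat, (N <= n)%N -> rint (fun x => `|h_ n x - h x|) < e].
Proof.
move=> mh_ mh K cv bd.
have I_ n : rmi (h_ n) by apply: (rmi_le _ _ K) => //; apply: aedS bd.
have h1 : {ae mu0, forall x, D x -> (EFin \o h_ n) x @[n --> \oo] --> (EFin \o h) x}.
  apply: aedE; apply: aedS cv => x _ hx.
  by apply: cvg_EFin; [exact: nearW|exact: cvgn_eps].
have h2 : {ae mu0, forall x n, D x -> (`|(EFin \o h_ n) x| <= (EFin \o k) x)%E}.
  have := aedE bd; have F := @ae_filter R; apply: filterS => x hx n dx /=.
  by rewrite lee_fin hx.
have [] := @dominated_convergence _ _ _ _ _ (@mdom R) (fun n => EFin \o h_ n)
  (EFin \o h) (EFin \o k) (fun n => (measurable_EFinP _ _).2 (mh_ n))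
  ((measurable_EFinP _ _).2 mh) h1 (rmi_integrable K) h2.
move=> H1 H2 _; have I : rmi h by exact: integrable_rmi.
split=> // e e0.
have E n : (\int[mu0]_(x in D) `|(EFin \o h_ n) x - (EFin \o h) x| =
   (rint (fun x => `|h_ n x - h x|))%:E)%E.
  by rewrite -rint_EFin//; apply: rmi_abs; exact: rmiB.
have c : (fun n => rint (fun x => `|h_ n x - h x|)) n @[n --> \oo] --> (0 : R).
  move: H2 => /fine_cvgP[_]; apply: cvg_trans; apply: near_eq_cvg; apply: nearW => n /=.
  by have := E n; rewrite /= => ->.
have [N hN] := eps_cvgn c e0; exists N => n Nn.
by apply: le_lt_trans (hN n Nn); rewrite subr0 ler_norm.
Qed.

Lemma nr_rc (r : R) (h : R -> R) : nr r (rc h) = rint (fun x => `|h x| `^ r).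
Proof. by rewrite nrE; congr rint; apply/funext => x; rewrite cabs_real. Qed.

Lemma powR_lt_eps (r e : R) : 0 < r -> 0 < e ->
  exists2 d : R, 0 < d & forall y : R, 0 <= y -> y < d -> y `^ r < e.
Proof.
move=> r0 e0; exists (e `^ r^-1); first by rewrite powR_gt0.
move=> y y0 yd; have -> : e = (e `^ r^-1) `^ r.
  by rewrite -powRrM mulVf ?gt_eqF// powRr1// ltW.
by apply: gt0_ltr_powR; rewrite ?nnegrE// powR_ge0.
Qed.

Lemma aed_interior (P : R -> Prop) : (forall x : R, 0 < x -> x < 2 * pi -> P x) -> aed P.
Proof.
move=> h; apply: aed_ae; exists ([set 0] `|` [set 2 * pi]); split.
- by apply: measurableU; exact: measurable_set1.
- have S (y : R) : mu0 [set y] = 0 by rewrite lebesgue_measure_set1.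
  apply/eqP; rewrite -measure_le0.
  have M (y : R) : measurable ([set y] : set (measurableTypeR R)) by exact: measurable_set1.
  have := measureU2 mu0 (M 0) (M (2 * pi)).
  move=> H; apply: (le_trans H).
  by rewrite [X in (X + _)%E](S 0) [X in (_ + X)%E](S (2 * pi)) adde0.
- move=> x /= nx; apply: contrapT => nx2; apply: nx => /andP[x0 x1].
  apply: h; rewrite lt_neqAle ?x0 ?x1 andbT; apply/eqP => e; apply: nx2.
    by left.
  by right.
Qed.

Definition cont_at (h : R -> R) (x : R) := forall e : R, 0 < e ->
  exists2 d : R, 0 < d & forall s : R, D s -> `|s - x| < d -> `|h s - h x| < e.
Lemma continuous_cont_at (h : R -> R) x : {for x, continuous h} -> cont_at h x.
Proof.
move=> ch e e0; move: ch => /cvgrPdist_lt /(_ e e0).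
rewrite -nbhs_nearE => /nbhs_ballP[d /= d0 hd]; exists d => // s _ sx.
by rewrite distrC; apply: hd; rewrite /ball /= distrC.
Qed.

Lemma fej_fejr (h : R -> R) (B : R) (n : nat) : (0 < n)%N -> measurable_fun D h ->
  (forall x, D x -> `|h x| <= B) -> fej n (rc h) = rc (fejr n h).
Proof. by move=> n0 mh hB; apply/funext => x; rewrite (fej_rc x n0 mh hB). Qed.
Lemma meas_fejr (h : R -> R) (B : R) (n : nat) : (0 < n)%N -> measurable_fun D h ->
  (forall x, D x -> `|h x| <= B) -> measurable_fun D (fejr n h).
Proof.
move=> n0 mh hB; have := fej_fejr n0 mh hB; rewrite fej_tp => E.
have -> : fejr n h = (fun x => complex.Re (tp (fejs n (rc h)) x)).
  by apply/funext => x; rewrite E.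
by have [] := Linf_cmeas (Linf_tp (fejs n (rc h))).
Qed.

Lemma fej_Lp (h : R -> R) (B r : R) : measurable_fun D h -> 0 < r ->
  (forall x, D x -> `|h x| <= B) -> (forall x : R, 0 < x -> x < 2 * pi -> cont_at h x) ->
  forall e : R, 0 < e -> exists N : nat, forall n : nat, (N <= n)%N ->
    nr r (fsub (fej n (rc h)) (rc h)) < e.
Proof.
move=> mh r0 hB ch e e0.
(* Orders start at 1, since the kernel of order 0 does not have mean 1. *)
have mF n : measurable_fun D (fun x => `|fejr n.+1 h x - h x| `^ r).
  apply: (measurableT_comp (f := fun x : R => x `^ r)); first exact: measurable_powR.
  apply: (measurableT_comp (f := fun x : R => `|x|)); first exact: normr_measurable.
  by apply: measurable_funB => //; exact: meas_fejr hB.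
have c1 : aed (fun x => forall e : R, 0 < e -> exists N : nat, forall n : nat, (N <= n)%N ->
    `| `|fejr n.+1 h x - h x| `^ r - 0| < e).
  apply: aed_interior => x x0 x1 e1 e10.
  have [d d0 hd] := powR_lt_eps r0 e10.
  have [N hN] := fejr_cvg mh hB x0 x1 (ch x x0 x1) d0.
  exists N => n Nn; rewrite subr0 ger0_norm ?powR_ge0//.
  by apply: hd => //; apply: hN; rewrite (leq_trans Nn).
have c2 : aed (fun x => forall n : nat, `| `|fejr n.+1 h x - h x| `^ r| <= (2 * B) `^ r).
  apply: aedW => x dx n; rewrite ger0_norm ?powR_ge0//.
  apply: ler_powR2 => //; first exact: ltW.
  apply: (le_trans (ler_normB _ _)); rewrite mulr_natl mulr2n.
  by apply: lerD; [exact: fejr_bound|exact: hB].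
have [_ _ /(_ e e0)[N hN]] := rint_dct mF (@measurable_cst _ _ _ _ D (0 : R)) (rmi_cst _) c1 c2.
exists N.+1 => -[//|n] Nn; apply: le_lt_trans (hN n Nn).
rewrite (fej_fejr _ mh hB)//.
have -> : fsub (rc (fejr n.+1 h)) (rc h) = rc (fun x => fejr n.+1 h x - h x).
  by apply/funext => x; rewrite /fsub /rc; apply: complexP; rewrite ?ReD ?ImD ?ReN ?ImN /= ?subr0.
rewrite nr_rc le_eqVlt; apply/orP; left; apply/eqP; congr rint.
by apply/funext => x; rewrite /cst subr0 [RHS]ger0_norm// powR_ge0.
Qed.

Definition clip (N y : R) := Num.max (- N) (Num.min y N).
Lemma clip_bound (N y : R) : 0 <= N -> `|clip N y| <= N.
Proof.
by move=> N0; rewrite ler_norml /clip le_max lexx /= ge_max ge_min lexx orbT andbT; lra.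
Qed.

Lemma clip_lip (N a b : R) : 0 <= N -> `|clip N a - clip N b| <= `|a - b|.
Proof.
move=> N0.
have cl (z : R) : [\/ z <= - N /\ clip N z = - N, - N <= z <= N /\ clip N z = z
  | N <= z /\ clip N z = N].
  rewrite /clip; case: (lerP z N) => h1.
    case: (lerP (- N) z) => h2; first by apply: Or32.
    by apply: Or31; split=> //; exact: ltW.
  apply: Or33; split; first exact: ltW.
  by rewrite max_r//; clear -N0; lra.
case: (cl a) => -[ha ->]; case: (cl b) => -[hb ->]; rewrite ler_norml;
  case: (ger0P (a - b)) => hab; lra.
Qed.

Lemma clip_id (N y : R) : `|y| <= N -> clip N y = y.
Proof. by rewrite ler_norml => /andP[h1 h2]; rewrite /clip min_l// max_r. Qed.
Lemma clip0 (N : R) : 0 <= N -> clip N 0 = 0.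
Proof. by move=> N0; rewrite clip_id// normr0. Qed.
Lemma continuous_clip (N : R) : 0 <= N -> continuous (clip N).
Proof.
move=> N0 x; apply/cvgrPdist_lt => e e0; near=> y.
apply: (le_lt_trans (clip_lip _ _ N0)); near: y.
by apply: (@cvgr_dist_lt _ _ _ _ _ _ x); [exact: cvg_id|].
Unshelve. all: end_near.
Qed.

Lemma LpcB (g h : R -> R) : fsub (rc g) (rc h) = rc (fun x => g x - h x).
Proof.
by apply/funext => x; rewrite /fsub /rc; apply: complexP;
  rewrite ?ReD ?ImD ?ReN ?ImN /= ?subr0.
Qed.

Lemma clip_abs_le (N y : R) : 0 <= N -> `|y - clip N y| <= `|y|.
Proof.
move=> N0; have : `|clip N y| <= `|y|.
  by have := clip_lip y 0 N0; rewrite clip0// !subr0.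
rewrite /clip; case: (lerP y N) => h1.
  case: (lerP (- N) y) => h2; rewrite ?subrr ?normr0// => _.
  by rewrite !ler0_norm; clear -N0 h1 h2; lra.
rewrite max_r => [|]; last by clear -N0; lra.
by move=> _; rewrite !ger0_norm; clear -N0 h1; lra.
Qed.

Lemma meas_clip (N : R) (h : R -> R) : 0 <= N -> measurable_fun D h ->
  measurable_fun D (fun x => clip N (h x)).
Proof.
move=> N0 mh; apply: (measurableT_comp (f := clip N)) => //.
by apply: continuous_measurable_fun; exact: continuous_clip.
Qed.

Lemma meas_powR_norm (r : R) (h : R -> R) : measurable_fun D h ->
  measurable_fun D (fun x => `|h x| `^ r).
Proof.
move=> mh; apply: (measurableT_comp (f := fun x : R => x `^ r)); first exact: measurable_powR.
by apply: (measurableT_comp (f := fun x : R => `|x|)) => //; exact: normr_measurable.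
Qed.

Lemma rc_Lp_rmi (r : R) (h : R -> R) : Lp r (rc h) -> rmi (fun x => `|h x| `^ r).
Proof.
by move=> /Lp_rmi; congr rmi; apply/funext => x; rewrite cabs_real.
Qed.

Lemma rc_meas (r : R) (h : R -> R) : Lp r (rc h) -> measurable_fun D h.
Proof. by move=> /Lp_cmeas[]. Qed.

Lemma cont_dens1 (h : R -> R) (e : R) : rmi h -> 0 < e ->
  exists g : R -> R, [/\ continuous g, rmi g & rint (fun x => `|h x - g x|) < e].
Proof.
move=> I e0.
have mud : (mu0 D < +oo)%E by rewrite mudom ltry.
have [g_ [cg ig]] := approximation_continuous_integrable (@mdom R) mud (rmi_integrable I).
have E n : (\int[mu0]_(z in D) `|(h z - g_ n z)%:E| = (rint (fun x => `|h x - g_ n x|))%:E)%E.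
  rewrite -rint_EFin//; apply: rmi_abs; apply: rmiB => //; exact: integrable_rmi.
move=> c; have {}c : (fun n => rint (fun x => `|h x - g_ n x|)) n @[n --> \oo] --> (0 : R).
  move: c => /fine_cvgP[_]; apply: cvg_trans; apply: near_eq_cvg; apply: nearW => n /=.
  by have := E n; rewrite /= => ->.
have [N hN] := eps_cvgn c e0; exists (g_ N); split=> //; first exact: integrable_rmi.
by apply: le_lt_trans (hN N (leqnn _)); rewrite subr0 ler_norm.
Qed.

Lemma clip_dens (r : R) (h : R -> R) (e : R) : 0 < r -> Lp r (rc h) -> 0 < e ->
  exists2 N : R, 0 < N & nr r (fsub (rc (fun x => clip N (h x))) (rc h)) < e.
Proof.
move=> r0 Hh e0; have mh := rc_meas Hh.
have mF n : measurable_fun D (fun x => `|clip n.+1%:R (h x) - h x| `^ r).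
  by apply: meas_powR_norm; apply: measurable_funB => //; exact: meas_clip.
have c1 : aed (fun x => forall e : R, 0 < e -> exists N : nat, forall n : nat, (N <= n)%N ->
    `| `|clip n.+1%:R (h x) - h x| `^ r - 0| < e).
  apply: aedW => x _ e1 e10.
  exists (Num.truncn `|h x|).+1 => n Nn; rewrite clip_id ?subrr ?normr0.
    by rewrite powR0 ?subrr ?normr0// gt_eqF.
  apply: (@le_trans _ _ (Num.truncn `|h x|).+1%:R); first exact/ltW/truncnS_gt.
  by rewrite ler_nat (leq_trans Nn).
have c2 : aed (fun x => forall n : nat, `| `|clip n.+1%:R (h x) - h x| `^ r| <= `|h x| `^ r).
  apply: aedW => x dx n; rewrite ger0_norm ?powR_ge0//.
  apply: ler_powR2 => //; first exact: ltW.
  by rewrite distrC; exact: clip_abs_le.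
have [_ _ /(_ e e0)[N hN]] := rint_dct mF (@measurable_cst _ _ _ _ D (0 : R)) (rc_Lp_rmi Hh) c1 c2.
exists N.+1%:R => //; apply: le_lt_trans (hN N (leqnn _)).
rewrite LpcB nr_rc le_eqVlt; apply/orP; left; apply/eqP; congr rint.
by apply/funext => x; rewrite /cst subr0 [RHS]ger0_norm// powR_ge0.
Qed.

(** Turns smallness in L^1 of a function bounded by [M] into smallness in L^r. *)
Lemma powR_lip_bound (r y M : R) : 1 <= r -> 0 <= y -> y <= M ->
  y `^ r <= M `^ (r - 1) * y.
Proof.
move=> r1 y0 yM; have [->|ny0] := eqVneq y 0; first by rewrite powR0 ?mulr0// gt_eqF// (lt_le_trans ltr01).
have y1 : 0 < y by rewrite lt_neqAle eq_sym ny0.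
have -> : y `^ r = y `^ (r - 1) * y.
  by rewrite -[X in _ * X](powRr1 y0) -powRD ?subrK// ny0 implybT.
by rewrite ler_wpM2r//; apply: ler_powR2 => //; rewrite subr_ge0.
Qed.

Lemma quasi_triangle_lt (c z A1 A2 A3 A4 : R) : 1 <= c -> 0 < z -> A1 < z -> A3 < z -> A2 < z ->
  A4 <= c * (A3 + A2) -> c * (A1 + A4) < z * (4 * c ^+ 2).
Proof.
move=> c1 z0 h1 h3 h2 h4.
have h5 : A4 < 2 * (c * z).
  apply: (le_lt_trans h4); rewrite mulrCA ltr_pM2l; lra.
have h6 : z <= c * z by rewrite ler_peMl// ltW.
have h7 : 0 < c * z by rewrite mulr_gt0// (lt_le_trans ltr01).
have -> : z * (4 * c ^+ 2) = c * (4 * (c * z)) by ring.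
rewrite ltr_pM2l; lra.
Qed.

(** The function is truncated, its truncation is approximated in L^1 by a continuous function, which
    is truncated at the same level; the common bound converts the L^1 error into an L^r error. A
    Fejer mean of the result is the polynomial. *)
Lemma rc_dens (r : R) (h : R -> R) (e : R) : 1 <= r -> Lp r (rc h) -> 0 < e ->
  exists s, nr r (fsub (tp s) (rc h)) < e.
Proof.
move=> r1 Hh e0; have r0 : 0 < r by exact: lt_le_trans r1.
have mh := rc_meas Hh.
pose c : R := 2 `^ r; have c0 : 0 < c by rewrite powR_gt0.
(* Three errors are joined by two uses of the triangle inequality, each with the factor c = 2^r. *)
pose e' := e / (4 * c ^+ 2); have e'0 : 0 < e'.
  by rewrite divr_gt0// mulr_gt0// exprn_gt0.
have [N N0 hN] := clip_dens r0 Hh e'0.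
have N0' := ltW N0.
set hN' := fun x => clip N (h x) in hN.
have mhN : measurable_fun D hN' by exact: meas_clip.
have hNb x : D x -> `|hN' x| <= N by move=> _; exact: clip_bound.
have LN : Linf (rc hN') by exact: (rc_Linf mhN hNb).
have IN : rmi hN' by have := rmi_Re (Linf_Lp ler01 LN).
pose M := (2 * N) `^ (r - 1); have M0 : 0 < M by rewrite powR_gt0// mulr_gt0.
have [g [cg Ig hg]] := cont_dens1 IN (divr_gt0 e'0 M0).
pose g' := fun x => clip N (g x).
have mg : measurable_fun D g by exact: rmi_meas Ig.
have mg' : measurable_fun D g' by exact: meas_clip.
have g'b x : D x -> `|g' x| <= N by move=> _; exact: clip_bound.
have Lg : Linf (rc g') by exact: (rc_Linf mg' g'b).
have cg' x : 0 < x -> x < 2 * pi -> cont_at g' x.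
  move=> _ _; apply: continuous_cont_at.
  by apply: continuous_comp; [exact: cg|exact: continuous_clip].
have [K hK] := fej_Lp mg' r0 g'b cg' e'0.
have {hK} := hK K (leqnn _); rewrite fej_tp; set s := fejs _ _ => hs.
exists s.
have h2 : nr r (fsub (rc g') (rc hN')) < e'.
  rewrite LpcB nr_rc.
  have I1 : rmi (fun x => `|hN' x - g x|) by apply: rmi_abs; exact: rmiB.
  apply: (@le_lt_trans _ _ (rint (fun x => M * `|hN' x - g x|))).
    apply: rint_le; [|exact: rmiZ|].
      have Lgh : Lp r (rc (fun x => g' x - hN' x)).
        have [] := LpB (ltW r0) (Linf_Lp (ltW r0) Lg) (Linf_Lp (ltW r0) LN).
        by rewrite LpcB.
      exact: rc_Lp_rmi Lgh.
    apply: aedW => x dx; apply: (le_trans (@powR_lip_bound r _ (2 * N) r1 _ _)) => //.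
      apply: (le_trans (ler_normB _ _)); rewrite mulr_natl mulr2n.
      by apply: lerD; [exact: g'b|exact: hNb].
    rewrite ler_pM2l// distrC.
    have -> : hN' x - g' x = clip N (hN' x) - clip N (g x) by rewrite clip_id// hNb.
    exact: clip_lip.
  by rewrite rintZ// mulrC -ltr_pdivlMr.
have L1 : Lp r (tp s) by apply: Lp_tp; exact: ltW.
have L2 := Linf_Lp (ltW r0) Lg; have L3 := Linf_Lp (ltW r0) LN.
have [La Ea] := LpD (ltW r0) (LpB (ltW r0) L2 L3).1 (LpB (ltW r0) L3 Hh).1.
have [Lb Eb] := LpD (ltW r0) (LpB (ltW r0) L1 L2).1 La.
have -> : fsub (tp s) (rc h) = fadd (fsub (tp s) (rc g')) (fadd (fsub (rc g') (rc hN')) (fsub (rc hN') (rc h))).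
  apply/funext => x; rewrite /fadd /fsub; ring.
have c1 : 1 <= c.
  rewrite /c -[leLHS](powRr0 2); apply: ler_powR => //; first by rewrite ler1n.
  exact: ltW.
have He : e = e' * (4 * c ^+ 2) by rewrite /e' divfK// gt_eqF// mulr_gt0// exprn_gt0.
apply: (le_lt_trans Eb); rewrite -/c in Ea *.
have nn1 := nr_ge0 r (fsub (rc g') (rc hN')).
move: Ea hs h2 hN nn1; move: (nr _ _) (nr _ _) (nr _ _) (nr _ _) => A1 A2 A3 A4.
move: He e'0 c1; move: (e') => z He z0 c1 h1 h3 h4 h5 h6; clear -He z0 c1 h1 h3 h4 h5 h6.
rewrite {}He; exact: (quasi_triangle_lt c1 z0 h3 h4 h5 h1).
Qed.

Lemma Lp_Re (r : R) (f : fT R) : 0 <= r -> Lp r f -> Lp r (rc (fun x => complex.Re (f x))).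
Proof.
move=> r0 H; have m : cmeas (rc (fun x => complex.Re (f x))).
  by apply: cmeas_real; case: (Lp_cmeas H).
have hk : aed (fun x => cabs (rc (fun x => complex.Re (f x)) x) `^ r <= cabs (f x) `^ r).
  by apply: aedW => x _; rewrite cabs_real; apply: ler_powR2 => //; exact: Re_le_cabs.
by have [] := Lp_le m (Lp_rmi H) hk.
Qed.

Lemma Lp_Im (r : R) (f : fT R) : 0 <= r -> Lp r f -> Lp r (rc (fun x => complex.Im (f x))).
Proof.
move=> r0 H; have m : cmeas (rc (fun x => complex.Im (f x))).
  by apply: cmeas_real; case: (Lp_cmeas H).
have hk : aed (fun x => cabs (rc (fun x => complex.Im (f x)) x) `^ r <= cabs (f x) `^ r).
  by apply: aedW => x _; rewrite cabs_real; apply: ler_powR2 => //; exact: Im_le_cabs.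
by have [] := Lp_le m (Lp_rmi H) hk.
Qed.

Lemma ReIm_decomp (f : fT R) :
  f = fadd (rc (fun x => complex.Re (f x))) (fscale (Complex 0 1) (rc (fun x => complex.Im (f x)))).
Proof.
apply/funext => x; rewrite /fadd /fscale /rc; apply: complexP;
  rewrite ?ReD ?ImD ?ReM ?ImM /=; ring.
Qed.

Lemma tp_dense (r : R) (f : fT R) (e : R) : 1 <= r -> Lp r f -> 0 < e ->
  exists s, nr r (fsub (tp s) f) < e.
Proof.
move=> r1 H e0; have r0 : 0 < r by exact: lt_le_trans r1.
have r0' := ltW r0.
have H1 := Lp_Re r0' H; have H2 := Lp_Im r0' H.
pose c : R := 2 `^ r; have c0 : 0 < c by rewrite powR_gt0.
have e'0 : 0 < e / (2 * c) by rewrite divr_gt0// mulr_gt0.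
have [s1 h1] := rc_dens r1 H1 e'0; have [s2 h2] := rc_dens r1 H2 e'0.
exists (s1 ++ tpopp s2 (Complex 0 1)).
have L1 := (LpB r0' (Lp_tp s1 r0') H1).1; have L2 := (LpB r0' (Lp_tp s2 r0') H2).1.
have [L3 E3] := LpZ (Complex 0 1) L2.
have [L4 E4] := LpD r0' L1 L3.
have -> : fsub (tp (s1 ++ tpopp s2 (Complex 0 1))) f =
  fadd (fsub (tp s1) (rc (fun x => complex.Re (f x))))
   (fscale (Complex 0 1) (fsub (tp s2) (rc (fun x => complex.Im (f x))))).
  rewrite {1}[f]ReIm_decomp tp_cat tp_scale; apply/funext => x.
  rewrite /fadd /fscale /fsub; ring.
apply: (le_lt_trans E4); rewrite E3.
have -> : cabs (Complex 0 1 : C) = 1.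
  have : cabs (Complex 0 1 : C) ^+ 2 = 1 ^+ 2 by rewrite cabs_sqr /= expr0n /= add0r.
  by move/eqP; rewrite eqrXn2 ?cabs_ge0// => /eqP.
rewrite powR1 mul1r -/c mulrC -ltr_pdivlMr//.
move: h1 h2; have -> : e / c = e / (2 * c) + e / (2 * c).
  have cn : c != 0 by rewrite gt_eqF.
  by field.
by move=> h1 h2; exact: (ltrD h1 h2).
Qed.

(** The test function is g / (|g| + d), a continuous substitute for the sign of [h], where g is an
    L^1 approximation of [h]. *)
Lemma rint_cont_eq0 (h : R -> R) : rmi h ->
  (forall g : R -> R, continuous g -> (forall x, `|g x| <= 1) ->
    rint (fun x => h x * g x) = 0) -> rint (fun x => `|h x|) = 0.
Proof.
move=> I H.
suff S (e : R) : 0 < e -> rint (fun x => `|h x|) <= e.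
  apply/eqP; rewrite eq_le rint_ge0// andbT leNgt; apply/negP => h0.
  have := S _ (divr_gt0 h0 (ltr0Sn _ 1)); rewrite leNgt => /negP; apply.
  by rewrite ltr_pdivrMr// ltr_pMr// ltr1n.
move=> e0; pose d := e / (3 * (2 * pi)).
have d0 : 0 < d by rewrite divr_gt0// mulr_gt0// twopi_gt0.
have e30 : 0 < e / 3 by rewrite divr_gt0.
have [g [cg Ig hg]] := cont_dens1 I e30.
pose w x := g x / (`|g x| + d).
have den x : 0 < `|g x| + d by rewrite ltr_wpDl.
have cw : continuous w.
  move=> x; apply: cvgM; first exact: cg.
  apply: cvgV; first by rewrite gt_eqF.
  by apply: cvgD; [apply: cvg_norm; exact: cg|exact: cvg_cst].
have w1 x : `|w x| <= 1.
  rewrite normrM normfV (gtr0_norm (den x)) ler_pdivrMr// mul1r lerDl; exact: ltW.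
have mw : measurable_fun D w by exact: meas_continuous.
have Ihw : rmi (fun x => h x * w x).
  apply: (rmi_le _ _ (rmi_abs I)); first by apply: measurable_funM => //; exact: rmi_meas.
  by apply: aedW => x _; rewrite normrM ler_piMr.
have Ihg : rmi (fun x => `|h x - g x|) by apply: rmi_abs; exact: rmiB.
have le x : `|h x| <= h x * w x + (2 * `|h x - g x| + d).
  have h1 : `|g x| - d <= g x * w x.
    rewrite /w mulrA -expr2 -[X in X / _]real_normK ?num_real// ler_pdivlMr//.
    have := d0; have := normr_ge0 (g x); move: `|g x| => z; clear; nra.
  have h2 : `|h x| <= `|g x| + `|h x - g x|.
    have -> : h x = g x + (h x - g x) by ring.
    by apply: (le_trans (ler_normD _ _)); rewrite [g x + _ - _]addrAC subrr add0r.
  have h3 : - ((h x - g x) * w x) <= `|h x - g x|.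
    apply: (le_trans (ler_norm _)); rewrite normrN normrM ler_piMr//.
  have -> : h x * w x = g x * w x + (h x - g x) * w x by ring.
  move: h1 h2 h3; move: (_ * w x) (_ * w x) `|h x| `|g x| `|h x - g x| (d) => a1 a2 a3 a4 a5 a6.
  clear; lra.
have Id : rmi (fun x => 2 * `|h x - g x| + d) by apply: rmiD; [exact: rmiZ|exact: rmi_cst].
apply: (@le_trans _ _ (rint (fun x => h x * w x + (2 * `|h x - g x| + d)))).
  by apply: rint_le; [exact: rmi_abs|exact: rmiD|apply: aedW].
rewrite rintD// H// add0r rintD; [|exact: rmiZ|exact: rmi_cst].
rewrite rintZ// rint_cst.
have -> : d * (2 * pi) = e / 3.
  have p0 : 2 * pi != 0 :> R by rewrite gt_eqF// twopi_gt0.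
  rewrite /d; move: (2 * pi : R) p0 => t t0; clear -t0.
  by field.
by move: hg; move: (rint _) => z; clear; lra.
Qed.

(** [f] annihilates all polynomials, in particular the Fejer means of [g]. These are bounded by 1
    and converge to [g] almost everywhere, so dominated convergence applies. *)
Lemma fc_eq0_rint (f : fT R) (g : R -> R) : Lp 1 f -> (forall n, fc f n = 0) ->
  continuous g -> (forall x, `|g x| <= 1) ->
  rint (fun x => complex.Re (f x) * g x) = 0 /\ rint (fun x => complex.Im (f x) * g x) = 0.
Proof.
move=> H f0 cg g1.
have mg : measurable_fun D g by exact: meas_continuous.
have gb x : D x -> `|g x| <= 1 by [].
have tp0 s : cint (fun x => f x * tp s x) = 0.
  have -> : (fun x => f x * tp s x) = (fun x => \sum_(kc <- s) kc.2 * (f x * tpow kc.1 x)).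
    apply/funext => x; rewrite /tp mulr_sumr; apply: eq_bigr => kc _; ring.
  rewrite cint_sum; last first.
    by move=> kc; have [] := LpZ kc.2 (Lp_mtpow kc.1 H).
  apply: big1 => kc _; rewrite cintZ; last exact: Lp_mtpow.
  rewrite cint_fc (_ : (fun x => _) = fmul (tpow kc.1) f); last first.
    by apply/funext => x; rewrite mulrC.
  by rewrite fc_shift f0 !mulr0.
have E n : rint (fun x => complex.Re (f x) * fejr n.+1 g x) = 0 /\
           rint (fun x => complex.Im (f x) * fejr n.+1 g x) = 0.
  have := tp0 (fejs n.+1 (rc g)); rewrite -fej_tp (fej_fejr _ mg gb)//.
  rewrite cintE => -[E1 E2]; split.
    by rewrite -[RHS]E1; congr rint; apply/funext => x; rewrite ReM /= mulr0 subr0.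
  by rewrite -[RHS]E2; congr rint; apply/funext => x; rewrite ImM /= mulr0 add0r.
have key (h : R -> R) : rmi h -> (forall n, rint (fun x => h x * fejr n.+1 g x) = 0) ->
    rint (fun x => h x * g x) = 0.
  move=> I E0; have mh := rmi_meas I.
  have m1 n : measurable_fun D (fun x => h x * fejr n.+1 g x).
    by apply: measurable_funM => //; exact: meas_fejr gb.
  have m2 : measurable_fun D (fun x => h x * g x) by exact: measurable_funM.
  have c1 : aed (fun x => forall e : R, 0 < e -> exists N : nat, forall n : nat, (N <= n)%N ->
      `|h x * fejr n.+1 g x - h x * g x| < e).
    apply: aed_interior => x x0 x1 e e0.
    have d0 : 0 < e / (`|h x| + 1) by rewrite divr_gt0// ltr_wpDl.
    have [N hN] := fejr_cvg mg gb x0 x1 (continuous_cont_at (cg x)) d0.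
    exists N => n Nn; rewrite -mulrBr normrM.
    have := hN n.+1 (leqW Nn); rewrite ltr_pdivlMr ?ltr_wpDl// => h1.
    apply: le_lt_trans h1; rewrite mulrC ler_wpM2l//; by rewrite lerDl.
  have c2 : aed (fun x => forall n : nat, `|h x * fejr n.+1 g x| <= `|h x|).
    apply: aedW => x dx n; rewrite normrM ler_piMr//.
    exact: fejr_bound.
  have [I1 I2 cv] := rint_dct m1 m2 (rmi_abs I) c1 c2.
  apply/eqP; rewrite -normr_eq0 eq_le normr_ge0 andbT leNgt; apply/negP => p.
  have [N hN] := cv _ p; have := hN N (leqnn _); apply/negP; rewrite -leNgt.
  rewrite -normrN -[X in `|X|]add0r -{1}(E0 N) -rintB//.
  by apply: rint_abs; exact: rmiB.
by split; apply: key; [exact: rmi_Re|move=> n; exact: (E n).1|exact: rmi_Im|move=> n; exact: (E n).2].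
Qed.

Lemma rint_abs_eq0 (h : R -> R) : rmi h -> rint (fun x => `|h x|) = 0 -> aed (fun x => h x = 0).
Proof.
move=> I E; have := rint_EFin (rmi_abs I); rewrite E => E'.
have mh := rmi_meas I.
have := (ae_eq_integral_abs mu0 (@mdom R) ((measurable_EFinP _ _).2 mh)).1 E'.
move=> A; apply: aed_ae; have F := @ae_filter R; apply: filterS A => x hx dx.
by have [] := hx dx.
Qed.

Lemma fc_uniq0 (f : fT R) : Lp 1 f -> (forall n, fc f n = 0) -> aeq f (@f0 R).
Proof.
move=> H E.
have h1 := rint_abs_eq0 (rmi_Re H) (rint_cont_eq0 (rmi_Re H)
  (fun g cg g1 => (fc_eq0_rint H E cg g1).1)).
have h2 := rint_abs_eq0 (rmi_Im H) (rint_cont_eq0 (rmi_Im H)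
  (fun g cg g1 => (fc_eq0_rint H E cg g1).2)).
by apply/aeqP; apply: (aedS2 _ h1 h2) => x _ e1 e2; exact: complexP.
Qed.

Lemma fc_uniq (f g : fT R) : Lp 1 f -> Lp 1 g -> (forall n, fc f n = fc g n) -> aeq f g.
Proof.
move=> Hf Hg E; have [L _] := LpB ler01 Hf Hg.
have /aeqP h : aeq (fsub f g) (@f0 R).
  by apply: fc_uniq0 => // n; rewrite fcB// E subrr.
by apply/aeqP; apply: aedS h => x _ /eqP; rewrite subr_eq0 => /eqP.
Qed.
End Density.

(** * Completeness of L^r and extension by continuity *)

Section Complete.
Variable R : realType.
Notation C := (R[i]).
Notation D := (@dom R).
Notation mu0 := (@lebesgue_measure R).

Lemma bv_cvg (u : nat -> R) (M : R) :
  (forall n, \sum_(0 <= k < n) `|u k.+1 - u k| <= M) -> cvgn u.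
Proof.
move=> h.
have c : cvgn [normed series (telescope u)].
  apply: nondecreasing_is_cvgn.
    by apply: nondecreasing_series => n _ _; exact: normr_ge0.
  by exists M => _ [n _ <-]; exact: h.
have {}c := normed_cvg c; rewrite telescopeK in c.
have -> : u = (fun n => (u n - u 0%N) + u 0%N) by apply/funext => n; rewrite subrK.
apply: is_cvgD; [exact: c|exact: is_cvg_cst].
Qed.

Lemma limn_einf_le (u : nat -> \bar R) (c : \bar R) :
  (forall n, (u n <= c)%E) -> (limn_einf u <= c)%E.
Proof.
move=> h; apply: (le_trans (limn_einf_sup _)).
rewrite limn_esup_lim; apply: lime_le; first exact: is_cvg_esups.
by apply: nearW => n; apply: ge_ereal_sup => _ [k _ <-]; exact: h.
Qed.

Lemma rint_fatou (h_ : nat -> R -> R) (h : R -> R) (c : R) :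
  (forall n, rmi (h_ n)) -> (forall n x, D x -> 0 <= h_ n x) ->
  measurable_fun D h -> (forall n, rint (h_ n) <= c) ->
  aed (fun x => h_ n x @[n --> \oo] --> h x) -> (forall x, 0 <= h x) ->
  rmi h /\ rint h <= c.
Proof.
move=> I_ h_0 mh hc cv h0.
have mh_ n : measurable_fun D (EFin \o h_ n).
  by apply/measurable_EFinP; exact: rmi_meas.
have F := @fatou _ _ _ mu0 D (@mdom R) (fun n => EFin \o h_ n) mh_ h_0.
have E : (\int[mu0]_(x in D) limn_einf ((fun n => EFin \o h_ n)^~ x) =
          \int[mu0]_(x in D) (h x)%:E)%E.
  apply: ae_eq_integral => //.
  - rewrite /limn_einf; apply: measurableT_comp => //.
    apply: (measurable_fun_limn_esup (f := fun n x => (- (EFin \o h_ n) x)%E)) => n.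
    by apply: (measurableT_comp _ (mh_ n)).
  - exact/measurable_EFinP.
  - have Fi := @ae_filter R; have := aedE cv; apply: filterS => x hx dx.
    have c' : (fun n => (h_ n x)%:E) n @[n --> \oo] --> (h x)%:E.
      by apply: cvg_EFin; [exact: nearW|exact: hx].
    by have [-> _] := cvg_limn_einf_sup c'.
rewrite E in F.
have le : (\int[mu0]_(x in D) (h x)%:E <= c%:E)%E.
  apply: (le_trans F); apply: limn_einf_le => n.
  by rewrite rint_EFin// lee_fin.
have I : rmi h.
  apply: integrable_rmi; apply/integrableP; split; first exact/measurable_EFinP.
  apply: (le_lt_trans _ (ltry c)); apply: le_trans le.
  rewrite le_eqVlt; apply/orP; left; apply/eqP; apply: eq_integral => x _ /=.
  by rewrite ger0_norm.
by split=> //; rewrite -lee_fin -rint_EFin.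
Qed.

Transparent powR.
Lemma cvg_powR (r : R) (v : nat -> R) (l : R) : 0 < r -> (forall n, 0 <= v n) ->
  v n @[n --> \oo] --> l -> v n `^ r @[n --> \oo] --> l `^ r.
Proof.
move=> r0 v0 c; have l0 : 0 <= l.
  rewrite leNgt; apply/negP => lneg.
  have ln : 0 < - l by rewrite oppr_gt0.
  have [N hN] := eps_cvgn c ln; have := hN N (leqnn _); have := v0 N.
  by move=> vN; rewrite ger0_norm; clear -vN lneg; lra.
have [l1|ln0] := eqVneq l 0.
  rewrite l1 powR0 ?gt_eqF//; apply: cvgn_eps => e e0.
  have [d d0 hd] := powR_lt_eps r0 e0.
  have [N hN] := eps_cvgn c d0; exists N => n Nn.
  rewrite subr0 ger0_norm ?powR_ge0//; apply: hd => //.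
  by have := hN n Nn; rewrite l1 subr0 ger0_norm.
have lp : 0 < l by rewrite lt_neqAle eq_sym ln0.
rewrite {2}/powR (negbTE ln0).
have c2 : expR (r * ln (v n)) @[n --> \oo] --> expR (r * ln l).
  apply: continuous_cvg; first exact: continuous_expR.
  apply: cvgMr; apply: continuous_cvg => //; exact: continuous_ln.
apply: cvg_trans c2; apply: near_eq_cvg; near=> n.
rewrite /powR gt_eqF//; near: n; exact: (cvgr_gt l).
Unshelve. all: end_near. Qed.
Opaque powR.
Lemma powR_split (r a x : R) : 1 <= r -> 0 < a -> 0 <= x -> x <= a + a `^ (1 - r) * x `^ r.
Proof.
move=> r1 a0 x0; case: (leP x a) => xa.
  by apply: (le_trans xa); rewrite lerDl mulr_ge0 ?powR_ge0.
have x1 : 0 < x by exact: lt_trans xa.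
apply: (@le_trans _ _ (a `^ (1 - r) * x `^ r)); last by rewrite lerDr ltW.
have E : x = x `^ (1 - r) * x `^ r.
  by rewrite -powRD ?subrK ?powRr1// gt_eqF// implybT.
rewrite {1}E ler_wpM2r ?powR_ge0//.
rewrite -opprB !powRN lef_pV2 ?posrE ?powR_gt0//.
by apply: ler_powR2; rewrite ?subr_ge0// ltW.
Qed.

(** A form of Hoelder's inequality with a free threshold [a]. The choice of the L^r norm of [f] for
    [a] gives [nr1_powR]; a choice of 2^-n is used for completeness. *)
Lemma nr_split (r a : R) (f : fT R) : 1 <= r -> 0 < a -> Lp r f ->
  Lp 1 f /\ nr 1 f <= a * (2 * pi) + a `^ (1 - r) * nr r f.
Proof.
move=> r1 a0 H; have [H1 _] := Lp_sub ler01 r1 H; split=> //.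
have I : rmi (fun x => a `^ (1 - r) * cabs (f x) `^ r) by apply: rmiZ; exact: Lp_rmi.
rewrite nrE.
apply: (@le_trans _ _ (rint (fun x => a + a `^ (1 - r) * cabs (f x) `^ r))).
  apply: rint_le; [exact: Lp_rmi|by apply: rmiD => //; exact: rmi_cst|].
  apply: aedW => x _; rewrite powRr1 ?cabs_ge0//.
  by apply: powR_split => //; exact: cabs_ge0.
rewrite rintD//; last exact: rmi_cst.
by rewrite rint_cst rintZ ?nrE//; exact: Lp_rmi.
Qed.

Lemma cabs_dist (z w : C) : `|cabs z - cabs w| <= cabs (z - w).
Proof.
rewrite ler_norml lerBlDr lerNl opprB lerBlDr.
have := cabsD (z - w) w; rewrite subrK => h1.
have := cabsD (w - z) z; rewrite subrK -[in cabs (w - z)]opprB cabsN => h2.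
by apply/andP; split.
Qed.

(** The Riesz-Fischer argument for a geometric rate: the increments have an integrable sum, so the
    sequence converges almost everywhere, and Fatou's lemma gives both membership in L^r and the
    rate of the limit. *)
Lemma Lp_complete (r : R) (G : nat -> fT R) : 1 <= r -> (forall n, Lp r (G n)) ->
  (forall n m, (n <= m)%N -> nr r (fsub (G m) (G n)) <= (2^-1 ^+ n) `^ r) ->
  exists2 g, Lp r g & forall n, nr r (fsub g (G n)) <= (2^-1 ^+ n) `^ r.
Proof.
move=> r1 L Ca.
have r0 : 0 < r by exact: lt_le_trans r1.
have LB n m : Lp r (fsub (G m) (G n)) by have [] := LpB (ltW r0) (L m) (L n).
pose a n : R := 2^-1 ^+ n.
have a0 n : 0 < a n by rewrite exprn_gt0.
pose u n x := cabs (G n.+1 x - G n x).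
have L1 n : Lp 1 (fsub (G n.+1) (G n)) by have [] := nr_split r1 ltr01 (LB n n.+1).
have Iu n : rmi (u n) by exact: (Lp1_rmi (L1 n)).
(* At the threshold a n both terms of [nr_split] are of order a n. *)
have bu n : rint (u n) <= a n * (2 * pi + 1).
  have [_] := nr_split r1 (a0 n) (LB n n.+1); rewrite nr1E => h; apply: (le_trans h).
  rewrite [leRHS]mulrDr mulr1 lerD2l.
  apply: (@le_trans _ _ (a n `^ (1 - r) * a n `^ r)).
    by rewrite ler_wpM2l ?powR_ge0//; apply: Ca.
  rewrite -powRD; last by rewrite (gt_eqF (a0 n)) implybT.
  by rewrite subrK powRr1// ltW.
have mu_ n : measurable_fun D (fun x => (u n x)%:E) by apply/measurable_EFinP; exact: rmi_meas.
have u0 n x : D x -> (0 <= (u n x)%:E)%E by move=> _; rewrite lee_fin cabs_ge0.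
have IS : mu0.-integrable D (fun x => \big[+%E/0%E]_(0 <= n <oo) (u n x)%:E)%E.
  apply/integrableP; split.
    by apply: (ge0_emeasurable_sum (P := xpredT)) => [n x dx _|n _]; [exact: u0|exact: mu_].
  have -> : (\int[mu0]_(x in D) `|\big[+%E/0%R]_(0 <= n <oo) (u n x)%:E| =
     \int[mu0]_(x in D) \big[+%E/0%R]_(0 <= n <oo) (u n x)%:E)%E.
    apply: eq_integral => x /set_mem dx; rewrite gee0_abs//; apply: nneseries_ge0 => n _ _; exact: u0.
  rewrite integral_nneseries//.
  apply: (@le_lt_trans _ _ (\big[+%E/0%E]_(0 <= n <oo) ((2 * (2 * pi + 1)) / (2 ^ (n + 1))%:R)%:E)%E).
    apply: lee_nneseries => [n _ _|n _].
      by rewrite rint_EFin// lee_fin; apply: rint_ge0 => x _; exact: cabs_ge0.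
    rewrite rint_EFin// lee_fin; apply: (le_trans (bu n)).
    have -> : 2 * (2 * pi + 1) / (2 ^ (n + 1))%:R = a n * (2 * pi + 1) :> R; last by [].
    rewrite /a natrX exprVn addn1 exprS.
    have : 2 ^+ n != 0 :> R by rewrite expf_neq0// pnatr_eq0.
    by move: (2 ^+ n : R) (2 * pi + 1 : R) => y z y0; field.
  have := @cvg_geometric_eseries_half R (2 * (2 * pi + 1)) 0.
  by move/cvg_lim => -> //; rewrite ltry.
have fin : aed (fun x => (\big[+%E/0%E]_(0 <= n <oo) (u n x)%:E)%E \is a fin_num).
  by apply: aed_ae; exact: (integrable_ae (@mdom R) IS).
(* An upper limit is always measurable and coincides with the limit wherever the sequence
   converges. *)
pose gr x : R := fine (limn_esup (fun n => (complex.Re (G n x))%:E)).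
pose gi x : R := fine (limn_esup (fun n => (complex.Im (G n x))%:E)).
have cvG : aed (fun x => (complex.Re (G n x) @[n --> \oo] --> gr x) /\ (complex.Im (G n x) @[n --> \oo] --> gi x)).
  apply: aedS fin => x dx /fineK fx.
  have bd n : \sum_(0 <= k < n) u k x <= fine (\big[+%E/0%E]_(0 <= n <oo) (u n x)%:E)%E.
    rewrite -lee_fin fx -sumEFin; apply: nneseries_lim_ge => k _ _; exact: u0.
  have key (F : C -> R) : (forall z w, `|F z - F w| <= cabs (z - w)) ->
      F (G n x) @[n --> \oo] --> fine (limn_esup (fun n => (F (G n x))%:E)).
    move=> hF; have c : cvgn (fun n => F (G n x)).
      apply: (bv_cvg (M := fine (\big[+%E/0%E]_(0 <= n <oo) (u n x)%:E)%E)) => n.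
      apply: le_trans (bd n); apply: ler_sum => k _; exact: hF.
    have c' : (fun n => (F (G n x))%:E) n @[n --> \oo] --> (limn (fun n => F (G n x)))%:E.
      by apply: cvg_EFin; [exact: nearW|exact: c].
    by have [_ ->] := cvg_limn_einf_sup c'.
  split; apply: key => z w.
    by have := Re_le_cabs (z - w); rewrite ReD ReN.
  by have := Im_le_cabs (z - w); rewrite ImD ImN.
have mG n := Lp_cmeas (L n).
have mg : cmeas (fun x => Complex (gr x) (gi x)).
  split; (apply: (measurableT_comp (f := fine)); [exact: fine_measurable|]);
  apply: measurable_fun_limn_esup => n; apply/measurable_EFinP; by case: (mG n).
pose g : fT R := fun x => Complex (gr x) (gi x).
have fat n : rmi (fun x => cabs (g x - G n x) `^ r) /\
   rint (fun x => cabs (g x - G n x) `^ r) <= (2^-1 ^+ n) `^ r.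
  apply: (@rint_fatou (fun m x => cabs (G (n + m)%N x - G n x) `^ r)).
  - by move=> m; exact: (Lp_rmi (LB n (n + m)%N)).
  - by move=> m x _; exact: powR_ge0.
  - by apply: meas_cabs_powR; apply: cmeasB.
  - by move=> m; have := Ca n (n + m)%N (leq_addr _ _); rewrite nrE.
  - apply: aedS cvG => x _ [c1 c2]; apply: cvg_powR => // [m|]; first exact: cabs_ge0.
    apply: cvgn_eps => e e0; have e2 : 0 < e / 2 by rewrite divr_gt0.
    have [N1 h1] := eps_cvgn c1 e2; have [N2 h2] := eps_cvgn c2 e2.
    exists (maxn N1 N2) => m; rewrite geq_max => /andP[m1 m2].
    apply: (le_lt_trans (cabs_dist _ _)).
    have -> : G (n + m)%N x - G n x - (g x - G n x) = G (n + m)%N x - g x by ring.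
    apply: (le_lt_trans (cabs_le_ReIm _)); rewrite [ltRHS]splitr ReD ImD ReN ImN.
    have h1' := h1 (n + m)%N (leq_trans m1 (leq_addl _ _)).
    have h2' := h2 (n + m)%N (leq_trans m2 (leq_addl _ _)).
    exact: (ltrD h1' h2').
  - by move=> x; exact: powR_ge0.
have LgG : Lp r (fsub g (G 0%N)).
  by apply: rmi_Lp; [exact: cmeasB|exact: (fat 0%N).1].
exists g; last by move=> n; rewrite nrE; exact: (fat n).2.
have [] := LpD (ltW r0) LgG (L 0%N).
by have -> : fadd (fsub g (G 0%N)) (G 0%N) = g by apply/funext => x; rewrite /fadd /fsub subrK.
Qed.

Lemma half_pow_lt (r e : R) : 0 < r -> 0 < e -> exists n : nat, (2^-1 ^+ n) `^ r < e.
Proof.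
move=> r0 e0; have [d d0 hd] := powR_lt_eps r0 e0.
have c : geometric (1 : R) 2^-1 n @[n --> \oo] --> (0 : R).
  by apply: cvg_geometric; rewrite ger0_norm// invf_lt1// ltr1n.
have [N hN] := eps_cvgn c d0; exists N; apply: hd; first by rewrite exprn_ge0.
by have := hN N (leqnn _); rewrite subr0 /geometric /= mul1r ger0_norm// exprn_ge0.
Qed.

Lemma nr_sym (r : R) (f g : fT R) : nr r (fsub f g) = nr r (fsub g f).
Proof.
rewrite !nrE; congr rint; apply/funext => x; congr (_ `^ _).
by rewrite /fsub -opprB cabsN.
Qed.

Lemma nr_tri (r : R) (f g h : fT R) : 0 <= r -> Lp r f -> Lp r g -> Lp r h ->
  nr r (fsub f h) <= 2 `^ r * (nr r (fsub f g) + nr r (fsub g h)).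
Proof.
move=> r0 Hf Hg Hh.
have [_] := LpD r0 (LpB r0 Hf Hg).1 (LpB r0 Hg Hh).1.
have -> // : fadd (fsub f g) (fsub g h) = fsub f h.
by apply/funext => x; rewrite /fadd /fsub; ring.
Qed.

Lemma nr_le_sub (r : R) (f g : fT R) : 0 <= r -> Lp r f -> Lp r g ->
  nr r f <= 2 `^ r * (nr r (fsub f g) + nr r g).
Proof.
move=> r0 Hf Hg; have [_] := LpD r0 (LpB r0 Hf Hg).1 Hg.
have -> // : fadd (fsub f g) g = f.
by apply/funext => x; rewrite /fadd /fsub subrK.
Qed.

Lemma le_eps_lin (x y K : R) : 0 <= K -> (forall e : R, 0 < e -> x <= y + K * e) -> x <= y.
Proof.
move=> K0 h; rewrite leNgt; apply/negP => yx.
have e0 : 0 < (x - y) / (2 * (K + 1)).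
  by rewrite divr_gt0 ?subr_gt0// mulr_gt0// ltr_wpDl.
have := h _ e0; have := ltr_wpDl K0 (@ltr01 R).
set z := _ / _; move: e0; rewrite -/z => z0 K1.
have E : x - y = z * (2 * (K + 1)) by rewrite /z divfK// gt_eqF// mulr_gt0.
clearbody z; move: E; nra.
Qed.

(** [S] acts on lists, and the estimate on differences takes the place of linearity. The joint
    approximation of [f] and [g] in the conclusion is what carries identities from polynomials to
    the limit. *)
Lemma ext_op (r : R) (S : seq (int * C) -> fT R) (c : R) : 1 <= r -> 0 <= c ->
  (forall s, Lp r (S s)) ->
  (forall s, nr r (S s) <= c * nr r (tp s)) ->
  (forall s s', nr r (fsub (S s) (S s')) <= c * nr r (fsub (tp s) (tp s'))) ->
  forall f, Lp r f -> exists g, [/\ Lp r g, nr r g <= c * (2 `^ r * 2 `^ r) * nr r f &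
    forall e : R, 0 < e -> exists s, nr r (fsub (tp s) f) < e /\ nr r (fsub (S s) g) < e].
Proof.
move=> r1 c0 LS bS bS2 f Hf; have r0 : 0 < r by exact: lt_le_trans r1.
have r0' := ltW r0.
pose k : R := 2 `^ r; have k0 : 0 < k by rewrite powR_gt0.
(* An error a n / A in the data becomes at most a n after [S]: [k] for the triangle inequality, 2
   for two errors, [c] for the bound of [S]. *)
pose A := k * 2 * (c + 1); have A0 : 0 < A by rewrite !mulr_gt0// ltr_wpDl.
have k1 : 1 <= k.
  rewrite /k -[leLHS](powRr0 2); apply: ler_powR => //; by rewrite ler1n.
have A1 : 1 <= A by rewrite /A; nra.
pose a n : R := (2^-1 ^+ n) `^ r.
have a0 n : 0 < a n by rewrite powR_gt0// exprn_gt0.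
have d0 n : 0 < a n / A by rewrite divr_gt0.
have [s_ hs] := choice (fun n => tp_dense r1 Hf (d0 n)).
have an n m : (n <= m)%N -> a m <= a n.
  move=> nm; have p : 0 <= 2^-1 ^+ m :> R by rewrite exprn_ge0.
  apply: (ler_powR2 r0' p).
  by rewrite ler_wiXn2l// invf_le1// ler1n.
have [n m nm|g Hg hg] := @Lp_complete r (fun n => S (s_ n)) r1 (fun n => LS _).
  apply: (le_trans (bS2 _ _)).
  have h := nr_tri r0' (Lp_tp (s_ m) r0') Hf (Lp_tp (s_ n) r0').
  apply: (le_trans (ler_wpM2l c0 h)); rewrite (nr_sym r f).
  have h1 := hs n; have h2 := hs m; have h3 := an n m nm.
  have h4 : a m / A <= a n / A by rewrite ler_pM2r// invr_gt0.
  rewrite -/(a n) -[leRHS](divfK (lt0r_neq0 A0)) -/k.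
  have h5 := ltW (d0 n).
  move: h1 h2 h4 h5; move: (nr _ _) (nr _ _) (a n / A) (a m / A) => x y z w h1 h2 h4 h5.
  have h6 : x + y <= 2 * z by clear -h1 h2 h4; lra.
  rewrite /A mulrCA; apply: (@le_trans _ _ (k * (c * (2 * z)))).
    by rewrite ler_pM2l// ler_wpM2l.
  clear -h5 c0 k0; nra.
have cv e : 0 < e -> exists s, nr r (fsub (tp s) f) < e /\ nr r (fsub (S s) g) < e.
  move=> e0; have [n hn] := half_pow_lt r0 e0; exists (s_ n); split.
    apply: (lt_trans (hs n)); apply: le_lt_trans hn.
    by rewrite ler_pdivrMr// ler_peMr// ltW.
  rewrite nr_sym; apply: le_lt_trans hn; exact: hg.
exists g; split=> //; rewrite -/k.
apply: (@le_eps_lin _ _ (k + k * c * k)).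
  by rewrite addr_ge0 ?mulr_ge0// ltW.
move=> e e0; have [s [h1 h2]] := cv e e0.
have h3 := nr_le_sub r0' Hg (LS s); have h4 := nr_le_sub r0' (Lp_tp s r0') Hf.
have h5 := bS s.
rewrite nr_sym in h3; rewrite -/k in h3 h4.
have n1 := nr_ge0 r f; have n2 := nr_ge0 r (fsub (tp s) f).
have n3 := nr_ge0 r (fsub (S s) g).
move: h1 h2 h3 h4 h5 n1 n2 n3.
move: (nr r f) (nr r g) (nr r (S s)) (nr r (tp s)) (nr r (fsub (tp s) f)) (nr r (fsub (S s) g)).
move=> F G SS T x y h1 h2 h3 h4 h5 n1 n2 n3; clear -h1 h2 h3 h4 h5 k0 c0.
apply: (le_trans h3).
have h6 : SS <= c * (k * (e + F)).
  apply: (le_trans h5); rewrite ler_wpM2l//; apply: (le_trans h4).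
  by rewrite ler_pM2l// lerD2r ltW.
have h7 : y + SS <= e + c * (k * (e + F)) by apply: lerD => //; exact: ltW.
apply: (@le_trans _ _ (k * (e + c * (k * (e + F))))); first by rewrite ler_pM2l.
by rewrite le_eqVlt; apply/orP; left; apply/eqP; ring.
Qed.
End Complete.

(** * The Riesz projection *)
Section RieszBase.
Variable R : realType.
Notation C := (R[i]).
Notation D := (@dom R).

Lemma tp_bound s : exists2 K : R, 0 <= K & forall x, cabs (tp s x : C) <= K.
Proof.
exists (\sum_(kc <- s) cabs kc.2); first by apply: sumr_ge0 => *; exact: cabs_ge0.
move=> x; apply: (le_trans (cabs_sum _ _ _)); apply: ler_sum => kc _.
by rewrite cabsM cabs_tpow mulr1.
Qed.

Lemma atp_bound (f : fT R) m : atp f m -> exists2 K : R, 0 <= K & forall x, cabs (f x) <= K.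
Proof.
move=> [s [_ E]]; have [K K0 h] := tp_bound s; exists (cabs m + K).
  by rewrite addr_ge0 ?cabs_ge0.
by move=> x; rewrite E; apply: (le_trans (cabsD _ _)); rewrite lerD2l.
Qed.

Lemma nr1_bound (f : fT R) (B : R) : cmeas f -> 0 <= B -> aed (fun x => cabs (f x) <= B) ->
  Lp 1 f /\ nr 1 f <= B * (2 * pi).
Proof.
move=> mf B0 h; rewrite -rint_cst.
have hk : aed (fun x => cabs (f x) `^ 1 <= B).
  by apply: aedS h => x _; rewrite powRr1// cabs_ge0.
by have := Lp_le mf (rmi_cst B) hk.
Qed.

Lemma real_small_eq0 (y K t : R) : 0 <= y -> 0 <= K -> 0 <= t -> t < 1 ->
  (forall n : nat, y <= K * t ^+ n) -> y = 0.
Proof.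
move=> y0 K0 t0 t1 h; apply/eqP; rewrite eq_le y0 andbT leNgt; apply/negP => yp.
have c : geometric K t n @[n --> \oo] --> (0 : R).
  by apply: cvg_geometric; rewrite ger0_norm.
have [N hN] := eps_cvgn c yp; have := hN N (leqnn _).
rewrite subr0 /geometric /= ger0_norm ?mulr_ge0 ?exprn_ge0//.
by rewrite ltNge h.
Qed.

(* Expanding 1/F in a geometric series around a large real M: F takes values in a
   half plane Re >= l, so |F - M| < M uniformly once M is large. *)
Lemma mean_inv (F : fT R) (m : C) (l : R) : atp F m -> 0 < l ->
  aed (fun x => l <= complex.Re (F x)) ->
  m * cint (fun x => (F x)^-1) = Complex (2 * pi) 0.
Proof.
move=> aF l0 hl; have [K K0 hK] := atp_bound aF.
(* M l = K^2 + 1 gives |M - F|^2 <= M^2 - 2 (K^2 + 1) + K^2, which is M^2 times the number [th]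
   below. *)
pose M := (K ^+ 2 + 1) / l.
have M0 : 0 < M by rewrite divr_gt0// ltr_wpDl ?sqr_ge0.
pose MC : C := Complex M 0.
have MC0 : MC != 0 by rewrite -cabs_eq0 cabs_real normr_eq0 gt_eqF.
pose q (x : R) : C := 1 + (- MC^-1) * F x.
pose q0 : C := 1 + (- MC^-1) * m.
have aq : atp q q0 by apply: atpD; [exact: atp_cst|apply: atpM => //; exact: atp_cst].
pose th := 1 - (K ^+ 2 + 2) / M ^+ 2.
have th1 : th < 1 by rewrite ltrBlDr ltrDl divr_gt0 ?exprn_gt0// ltr_wpDl ?sqr_ge0.
have hq : aed (fun x => cabs (q x) ^+ 2 <= th).
  apply: aedS hl => x _ hx.
  have -> : cabs (q x) ^+ 2 = (M ^+ 2 - 2 * M * complex.Re (F x) + cabs (F x) ^+ 2) / M ^+ 2.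
    have -> : q x = MC^-1 * (MC - F x) by rewrite /q mulrBr mulVf// mulNr.
    rewrite cabsM cabsV cabs_real exprMn exprVn mulrC; congr (_ * _).
      by rewrite !cabs_sqr ReD ImD ReN ImN /=; ring.
    by rewrite -normrX ger0_norm// sqr_ge0.
  rewrite ler_pdivrMr ?exprn_gt0// /th mulrBl mul1r divfK ?expf_neq0 ?gt_eqF//.
  have h1 : K ^+ 2 + 1 <= M * complex.Re (F x).
    apply: (@le_trans _ _ (M * l)); first by rewrite /M divfK ?gt_eqF.
    by rewrite ler_pM2l.
  have h2 : cabs (F x) ^+ 2 <= K ^+ 2 by rewrite lerXn2r ?nnegrE ?cabs_ge0.
  move: h1 h2; rewrite -mulrA; move: (M * complex.Re _) (cabs _ ^+ 2) (K ^+ 2) (M ^+ 2).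
  by move=> y1 y2 y3 y4; lra.
pose t := Num.max th 0.
have t0 : 0 <= t by rewrite le_max lexx orbT.
have t1 : t < 1 by rewrite gt_max th1 ltr01.
have {}hq (n : nat) : aed (fun x => cabs (q x ^+ (2 * n)) <= t ^+ n).
  apply: aedS hq => x _ h; rewrite exprM cabsX; apply: lerXn2r; rewrite ?nnegrE ?cabs_ge0//.
  by rewrite cabsX; apply: (le_trans h); rewrite le_max lexx.
have Fn0 : aed (fun x => F x != 0 /\ cabs (F x)^-1 <= l^-1).
  apply: aedS hl => x _ h; have h1 : l <= cabs (F x).
    by apply: (le_trans h); apply: le_trans (Re_le_cabs _); exact: ler_norm.
  have h2 : 0 < cabs (F x) by exact: lt_le_trans h1.
  by split; [rewrite -cabs_eq0 gt_eqF|rewrite cabsV lef_pV2 ?posrE].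
have mF : cmeas F by exact: Linf_cmeas (atp_Linf aF).
have mFV : cmeas (fun x => (F x)^-1) by exact: cmeas_inv.
pose P : C := Complex (2 * pi) 0.
have P0 : cabs P = 2 * pi by rewrite cabs_real ger0_norm// ltW// twopi_gt0.
have key (n : nat) : cabs (m * cint (fun x => (F x)^-1) - P) <=
    (2 * (2 * pi) + cabs m * (2 * (2 * pi) / l)) * t ^+ n.
  set N := (2 * n)%N.
  have tn0 : 0 <= t ^+ n by rewrite exprn_ge0.
  have aqN : atp (fun x => q x ^+ N) (q0 ^+ N) by exact: atpX.
  have mqN : cmeas (fun x => q x ^+ N) by exact: Linf_cmeas (atp_Linf aqN).
  have e1 : cabs (P * q0 ^+ N) <= 2 * (2 * pi) * t ^+ n.
    rewrite -(atp_cint aqN); have [L le] := nr1_bound mqN tn0 (hq n).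
    apply: (le_trans (cint_abs L)); rewrite -mulrA ler_pM2l//.
    by rewrite mulrC.
  have mB : cmeas (fun x => q x ^+ N * (F x)^-1) by exact: cmeasM.
  have tl0 : 0 <= t ^+ n * l^-1 by rewrite mulr_ge0// invr_ge0 ltW.
  have hB : aed (fun x => cabs (q x ^+ N * (F x)^-1) <= t ^+ n * l^-1).
    apply: (aedS2 _ (hq n) Fn0) => x _ h1 [_ h2]; rewrite cabsM.
    by apply: ler_pM; rewrite ?cabs_ge0.
  have [LB leB] := nr1_bound mB tl0 hB.
  have e2 : cabs (cint (fun x => q x ^+ N * (F x)^-1)) <= 2 * (2 * pi) / l * t ^+ n.
    apply: (le_trans (cint_abs LB)).
    apply: (@le_trans _ _ (2 * (t ^+ n / l * (2 * pi)))); first by rewrite ler_pM2l.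
    by rewrite le_eqVlt; apply/orP; left; apply/eqP; ring.
  have aS : atp (fun x => MC^-1 * \sum_(k < N) q x ^+ k) (MC^-1 * \sum_(k < N) q0 ^+ k).
    apply: atpM; first exact: atp_cst.
    elim: (N) => [|j IH].
      by under eq_fun do rewrite big_ord0; rewrite big_ord0; exact: atp_cst.
    under eq_fun do rewrite big_ord_recr /=; rewrite big_ord_recr /=.
    by apply: atpD => //; exact: atpX.
  have LS : Lp 1 (fun x => MC^-1 * \sum_(k < N) q x ^+ k).
    by apply: Linf_Lp => //; exact: atp_Linf aS.
  (* The finite geometric sum 1/F = M^-1 (1 + q + ... + q^(N-1)) + q^N / F. Its first part is an
     analytic polynomial, so its mean is known. *)
  have E : cint (fun x => (F x)^-1) =
      P * (MC^-1 * \sum_(k < N) q0 ^+ k) + cint (fun x => q x ^+ N * (F x)^-1).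
    rewrite -(atp_cint aS) -cintD//; apply: cint_ae => //.
      by apply: cmeasD; [exact: Lp_cmeas LS|].
    apply: aedS Fn0 => x _ [Fx _].
    have h1 : F x = MC * (1 - q x) by rewrite /q opprD addrA subrr add0r mulNr opprK mulVKf.
    have h2 : (1 - q x) * \sum_(k < N) q x ^+ k = 1 - q x ^+ N.
      by rewrite -[1 - q x]opprB mulNr -subrX1 opprB.
    apply: (mulfI Fx); rewrite divff// mulrDr [F x * (q x ^+ N * _)]mulrCA divff// mulr1.
    by rewrite {1}h1 mulrACA divff// mul1r h2 subrK.
  have -> : m * cint (fun x => (F x)^-1) - P =
      m * cint (fun x => q x ^+ N * (F x)^-1) - P * q0 ^+ N.
    have h1 : m = MC * (1 - q0) by rewrite /q0 opprD addrA subrr add0r mulNr opprK mulVKf.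
    have h2 : (1 - q0) * \sum_(k < N) q0 ^+ k = 1 - q0 ^+ N.
      by rewrite -[1 - q0]opprB mulNr -subrX1 opprB.
    rewrite E mulrDr [in X in X + _ - _]mulrCA [X in P * (X * _)]h1.
    by rewrite mulrACA divff// mul1r h2; ring.
  apply: (le_trans (cabsB _ _)); rewrite cabsM [leRHS]mulrDl [leRHS]addrC.
  apply: lerD => //; rewrite -mulrA; apply: ler_wpM2l => //; exact: cabs_ge0.
have K0' : 0 <= 2 * (2 * pi) + cabs m * (2 * (2 * pi) / l).
  have p0 := twopi_gt0 R; have c0 := cabs_ge0 m.
  have p1 := ltW p0; have l1 := ltW l0.
  by apply: addr_ge0; apply: mulr_ge0 => //; apply: divr_ge0 => //; apply: mulr_ge0.
have /eqP := real_small_eq0 (cabs_ge0 _) K0' t0 t1 key.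
by rewrite cabs_eq0 subr_eq0 => /eqP.
Qed.

Lemma rint_Linf_rmi (h : R -> R) (B : R) : measurable_fun D h ->
  aed (fun x => `|h x| <= B) -> rmi h.
Proof. by move=> mh hB; apply: (rmi_le mh hB); exact: rmi_cst. Qed.
Lemma meas_div (h k : R -> R) : measurable_fun D h -> measurable_fun D k ->
  (forall x, 0 <= k x) -> measurable_fun D (fun x => h x / k x).
Proof. by move=> mh mk k0; apply: measurable_funM => //; exact: meas_inv_ge0. Qed.

(** For F = u + i v this is l^2 times 1 / Re(F + l) - Re(1 / (F + l)). It detects [v] at scale [l]:
    it is comparable to [l] when u <= |v| and |v| is comparable to [l]. *)
Definition poisson_defect (l u v : R) : R := l ^+ 2 * v ^+ 2 / ((u + l) * ((u + l) ^+ 2 + v ^+ 2)).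
(** Equal to u - l + l^2 / (u + l), the part of the defect that does not involve [v], up to the
    affine term u - l. *)
Definition poisson_majorant (l u : R) : R := u ^+ 2 / (u + l).

Lemma TlE (l u v : R) : 0 < l -> 0 <= u ->
  poisson_defect l u v = l - u + poisson_majorant l u - l ^+ 2 * ((u + l) / ((u + l) ^+ 2 + v ^+ 2)).
Proof.
move=> l0 u0; have h1 : u + l != 0 by rewrite gt_eqF// ltr_wpDl.
have h2 : (u + l) ^+ 2 + v ^+ 2 != 0.
  by rewrite gt_eqF// ltr_wpDr ?sqr_ge0// exprn_gt0// ltr_wpDl.
by rewrite /poisson_defect /poisson_majorant; field; rewrite h1 h2.
Qed.

Lemma Tl_ge0 (l u v : R) : 0 < l -> 0 <= u -> 0 <= poisson_defect l u v.
Proof.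
move=> l0 u0; have h1 : 0 <= u + l by rewrite addr_ge0// ltW.
rewrite /poisson_defect; apply: divr_ge0; first by rewrite mulr_ge0 ?sqr_ge0.
by rewrite mulr_ge0// addr_ge0// sqr_ge0.
Qed.

Lemma Ul_ge0 (l u : R) : 0 < l -> 0 <= u -> 0 <= poisson_majorant l u.
Proof. by move=> l0 u0; rewrite /poisson_majorant divr_ge0 ?sqr_ge0// addr_ge0// ltW. Qed.

(* The real part of [mean_inv] for F + l, combined with mean(u) = m. *)
Lemma Tl_Ul (F : fT R) (m l : R) : atp F (Complex m 0) -> 0 < l ->
  aed (fun x => 0 <= complex.Re (F x)) ->
  let u x := Num.max (complex.Re (F x)) 0 in let v x := complex.Im (F x) in
  [/\ rmi (fun x => poisson_defect l (u x) (v x)), rmi (fun x => poisson_majorant l (u x)) &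
   rint (fun x => poisson_defect l (u x) (v x)) <= rint (fun x => poisson_majorant l (u x))].
Proof.
move=> aF l0 hu u v.
(* The real part is nonnegative only almost everywhere; [u] is nonnegative at every point. *)
have u0 x : 0 <= u x by rewrite le_max lexx orbT.
have LF := atp_Linf aF; have mF := Linf_cmeas LF.
have [K K0 hK] := atp_bound aF.
have mRe : measurable_fun D (fun x => complex.Re (F x)) by case: mF.
have mu_ : measurable_fun D u by apply: measurable_maxr => //; exact: measurable_cst.
have mv : measurable_fun D v by case: mF.
have hue : aed (fun x => u x = complex.Re (F x)).
  by apply: aedS hu => x _ h; rewrite /u max_l.
have ub x : `|u x| <= K.
  rewrite ger0_norm// ge_max K0 andbT; apply: le_trans (hK x).
  by apply: le_trans (Re_le_cabs _); exact: ler_norm.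
have Iu : rmi u by apply: (rint_Linf_rmi (B := K)) => //; exact: aedW.
have ul x : 0 < u x + l by rewrite ltr_wpDl.
have mul : measurable_fun D (fun x => u x + l) by apply: measurable_funD => //; exact: measurable_cst.
have mU : measurable_fun D (fun x => poisson_majorant l (u x)).
  by apply: meas_div => //; [exact: meas_sqr|move=> x; exact: ltW].
have UK x : `|poisson_majorant l (u x)| <= K.
  rewrite ger0_norm ?Ul_ge0// /poisson_majorant ler_pdivrMr// expr2.
  have := ub x; rewrite ger0_norm// => h; apply: ler_pM => //; by rewrite lerDl ltW.
have IU : rmi (fun x => poisson_majorant l (u x)) by apply: (rint_Linf_rmi (B := K)) => //; exact: aedW.
pose W x := (u x + l) / ((u x + l) ^+ 2 + v x ^+ 2).
have mW : measurable_fun D W.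
  apply: meas_div => // [|x]; last by rewrite addr_ge0 ?sqr_ge0.
  by apply: measurable_funD; exact: meas_sqr.
have Wb x : `|W x| <= l^-1.
  have p : 0 < (u x + l) ^+ 2 + v x ^+ 2 by rewrite ltr_wpDr ?sqr_ge0// exprn_gt0.
  rewrite ger0_norm; last by rewrite divr_ge0// ltW.
  rewrite /W ler_pdivrMr// mulrC ler_pdivlMr//.
  have := sqr_ge0 (v x); have := u0 x; move: (u x) (v x ^+ 2) => y z; clear -l0; nra.
have IW : rmi W by apply: (rint_Linf_rmi (B := l^-1)) => //; exact: aedW.
have aG : atp (fun x => F x + Complex l 0) (Complex (m + l) 0).
  have -> : Complex (m + l) 0 = Complex m 0 + Complex l 0 :> C by apply: complexP; rewrite ?ReD ?ImD /= ?addr0.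
  by apply: atpD => //; exact: atp_cst.
have hG : aed (fun x => l <= complex.Re (F x + Complex l 0)).
  by apply: aedS hu => x _ h; rewrite ReD /= lerDr.
have mi := mean_inv aG l0 hG.
have mean : (m + l) * rint W = 2 * pi.
  have := congr1 (@complex.Re R) mi; rewrite ReM /= mul0r subr0 => <-; congr (_ * _).
  rewrite cintE /=; apply: rint_ae => //.
    by have [] := cmeas_inv (Linf_cmeas (atp_Linf aG)).
  by apply: aedS hue => x _ h; rewrite /W ReV ReD ImD /= addr0 -h.
have mm : rint u = m * (2 * pi).
  have := congr1 (@complex.Re R) (atp_cint aF); rewrite ReM /= mul0r subr0 [in X in _ = X -> _]mulrC => <-.
  by rewrite cintE /=; apply: rint_ae.
have m0 : 0 <= m.
  by rewrite -(pmulr_lge0 _ (twopi_gt0 R)) -mm; apply: rint_ge0 => x _.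
have ET : (fun x => poisson_defect l (u x) (v x)) = (fun x => (l - u x + poisson_majorant l (u x)) - l ^+ 2 * W x).
  by apply/funext => x; rewrite TlE.
have I1 : rmi (fun x => l - u x) by apply: rmiB => //; exact: rmi_cst.
have I2 : rmi (fun x => l - u x + poisson_majorant l (u x)) by exact: rmiD.
have I3 : rmi (fun x => l ^+ 2 * W x) by exact: rmiZ.
rewrite ET; split=> //; first exact: rmiB.
rewrite rintB// rintD// rintB//; last exact: rmi_cst.
rewrite rintZ// rint_cst mm.
have ml : 0 < m + l by rewrite ltr_wpDl.
have -> : rint W = 2 * pi / (m + l) by rewrite -mean mulrC mulKf// gt_eqF.
suff h : l * (2 * pi) - m * (2 * pi) - l ^+ 2 * (2 * pi / (m + l)) <= 0.
  by rewrite addrAC -[leRHS]add0r lerD2r.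
(* The constant terms combine to - 2 pi times [poisson_majorant l m]. *)
have -> : l * (2 * pi) - m * (2 * pi) - l ^+ 2 * (2 * pi / (m + l)) = - (2 * pi * (m ^+ 2 / (m + l))).
  have n0 : m + l != 0 by rewrite gt_eqF.
  by move: (2 * pi : R) => y; field.
rewrite oppr_le0 mulr_ge0//; first exact: ltW (twopi_gt0 R).
by rewrite divr_ge0 ?sqr_ge0// ltW.
Qed.

(** For y = x^g and B = 2^g, the fraction y / ((1 + y) (1 + B y)) is the increment of [Psi g] from x
    to 2 x divided by B - 1. It is of order y near 0 and 1/y near infinity. *)
Lemma Psi_increment_bounds (B y : R) : 0 < B -> 0 < y ->
  (y <= 1 -> y <= 2 * (1 + B) * (y / ((1 + y) * (1 + B * y)))) /\
  (1 <= y -> y^-1 <= 2 * (1 + B) * (y / ((1 + y) * (1 + B * y)))).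
Proof.
move=> B0 y0; have By : 0 < B * y by rewrite mulr_gt0.
have yB : 0 < (1 + y) * (1 + B * y) by rewrite mulr_gt0// addr_gt0.
rewrite !mulrA !ler_pdivlMr//; split=> h.
  rewrite [leRHS]mulrC ler_pM2l//; apply: ler_pM; nra.
rewrite mulrC ler_pdivrMr//.
have h1 : 1 + y <= 2 * y by lra.
have h2 : 1 + B * y <= (1 + B) * y by nra.
have h3 : 0 <= 1 + y by lra.
have h4 : 0 <= 1 + B * y by rewrite addr_ge0 ?ltW.
apply: (le_trans (ler_pM h3 h4 h1 h2)).
by rewrite le_eqVlt; apply/orP; left; apply/eqP; ring.
Qed.

(** The left side is of order x^(r-1) near 0 and x^(r-2) near infinity; as [g] is at most r - 1 and
    2 - r, the powers x^g and x^(-g) dominate it on the two sides of 1. *)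
Lemma powR_frac_le (r g x : R) : 1 < r -> r < 2 -> 0 < g -> g <= r - 1 -> g <= 2 - r -> 0 < x ->
  x `^ (r - 1) / (1 + x) <=
  2 * (1 + 2 `^ g) * (x `^ g / ((1 + x `^ g) * (1 + 2 `^ g * x `^ g))).
Proof.
move=> r1 r2 g0 g1 g2 x0.
have B0 : 0 < 2 `^ g :> R by rewrite powR_gt0.
have y0 : 0 < x `^ g by rewrite powR_gt0.
have [f1 f2] := Psi_increment_bounds B0 y0.
have z0 : 0 <= x `^ (r - 1) by exact: powR_ge0.
have x1' : 0 < 1 + x by rewrite addr_gt0.
have [x1|x1] := leP x 1.
  have y1 : x `^ g <= 1 by have := ler_powR2 (ltW g0) (ltW x0) x1; rewrite powR1.
  apply: le_trans (f1 y1); rewrite ler_pdivrMr//.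
  apply: (@le_trans _ _ (x `^ g)); first by apply: ger_powR => //; rewrite x0 x1.
  by rewrite ler_peMr ?(ltW y0)// lerDl ltW.
have x1w := ltW x1.
have y1 : 1 <= x `^ g by rewrite -[leLHS](powRr0 x); apply: ler_powR => //; exact: ltW.
apply: le_trans (f2 y1); rewrite ler_pdivrMr//.
apply: (@le_trans _ _ ((x `^ g)^-1 * x)); last by rewrite ler_pM2l ?invr_gt0// lerDr.
rewrite mulrC ler_pdivlMr// -powRD; last by rewrite (gt_eqF x0) implybT.
by rewrite -[leRHS](powRr1 (ltW x0)); apply: ler_powR => //; clear -g2; lra.
Qed.

Definition Psi (g x : R) : R := x `^ g / (1 + x `^ g).
Lemma Psi_bound (g x : R) : 0 <= Psi g x <= 1.
Proof.
have h := powR_ge0 x g; have h1 : 0 < 1 + x `^ g by rewrite ltr_pwDl.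
by rewrite divr_ge0 ?(ltW h1)//= ler_pdivrMr// mul1r lerDr.
Qed.

Lemma Psi_step (g x : R) : 0 < x -> Psi g (2 * x) - Psi g x =
  (2 `^ g - 1) * (x `^ g / ((1 + x `^ g) * (1 + 2 `^ g * x `^ g))).
Proof.
move=> x0; rewrite /Psi powRM ?ltW//.
have y0 := powR_gt0 g x0; have B0 := powR_gt0 g (@ltr0Sn R 1).
have h1 : 1 + x `^ g != 0 by rewrite gt_eqF// addr_gt0.
have h2 : 1 + 2 `^ g * x `^ g != 0 by rewrite gt_eqF// addr_gt0// mulr_gt0.
by move: (2 `^ g) (x `^ g) h1 h2 => B y h1 h2; field; rewrite h1 h2.
Qed.

(* [u^r] majorizes the dyadic sum because [x^(r-1)/(1+x)] is dominated by the
   increments of [Psi] along x, 2x, 4x, ..., which telescope. *)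
Lemma Ul_sum (r : R) : 1 < r -> r < 2 -> exists2 K : R, 0 <= K &
  forall (l u : R) (n : nat), 0 < l -> 0 <= u ->
   \sum_(i < n) (l * 2 ^+ i) `^ (r - 1) * poisson_majorant (l * 2 ^+ i) u <= K * u `^ r.
Proof.
move=> r1 r2; pose g := Num.min (r - 1) (2 - r).
have g0 : 0 < g by rewrite lt_min !subr_gt0 r1 r2.
have g1 : g <= r - 1 by rewrite ge_min lexx.
have g2 : g <= 2 - r by rewrite ge_min lexx orbT.
pose B : R := 2 `^ g.
have B1 : 1 < B.
  have := @gt0_ltr_powR R g g0 1 2; rewrite !nnegrE ler01 ler0n powR1.
  by apply => //; rewrite ltr1n.
have B0 : 0 < B - 1 by rewrite subr_gt0.
pose K := 2 * (1 + B) / (B - 1).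
have K0 : 0 <= K.
  by apply: divr_ge0; [clear -B1; lra|exact: ltW].
exists K => // l u n l0 u0.
have [->|un] := eqVneq u 0.
  rewrite big1; first by apply: mulr_ge0 => //; exact: powR_ge0.
  by move=> i _; rewrite /poisson_majorant expr0n /= mul0r mulr0.
have up : 0 < u by rewrite lt_neqAle eq_sym un.
have step (i : nat) : (l * 2 ^+ i) `^ (r - 1) * poisson_majorant (l * 2 ^+ i) u <=
   u `^ r * K * (Psi g (l * 2 ^+ i.+1 / u) - Psi g (l * 2 ^+ i / u)).
  (* By homogeneity each term is u^r times a function of the ratio of the scale to [u]. *)
  set x := l * 2 ^+ i / u.
  have x0 : 0 < x by rewrite divr_gt0// mulr_gt0// exprn_gt0.
  have -> : l * 2 ^+ i.+1 / u = 2 * x by rewrite /x exprS; ring.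
  have -> : l * 2 ^+ i = u * x by rewrite /x [RHS]mulrC divfK.
  rewrite Psi_step// /K -/B.
  have -> : (u * x) `^ (r - 1) * poisson_majorant (u * x) u = u `^ r * (x `^ (r - 1) / (1 + x)).
    rewrite powRM ?ltW// /poisson_majorant.
    have -> : u `^ r = u `^ (r - 1) * u.
      rewrite -[X in _ * X](powRr1 (ltW up)) -powRD; last by rewrite un implybT.
      by rewrite subrK.
    have x10 : 1 + x != 0 by rewrite gt_eqF// addr_gt0.
    have -> : u + u * x = u * (1 + x) by ring.
    by move: (u `^ _) (x `^ _) => y z; field; rewrite un x10.
  rewrite -[leRHS]mulrA ler_wpM2l ?powR_ge0// mulrA divfK ?gt_eqF//.
  exact: powR_frac_le.
apply: (@le_trans _ _ (\sum_(i < n) u `^ r * K * (Psi g (l * 2 ^+ i.+1 / u) - Psi g (l * 2 ^+ i / u)))).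
  by apply: ler_sum => i _; exact: step.
rewrite -mulr_sumr -(big_mkord xpredT (fun i => Psi g (l * 2 ^+ i.+1 / u) - Psi g (l * 2 ^+ i / u))).
rewrite (telescope_sumr (fun i => Psi g (l * 2 ^+ i / u)))// [leRHS]mulrC.
apply: ler_piMr; first by rewrite mulr_ge0// powR_ge0.
have /andP[_ h1] := Psi_bound g (l * 2 ^+ n / u).
have /andP[h2 _] := Psi_bound g (l * 2 ^+ 0 / u).
by move: h1 h2; clear; lra.
Qed.

Lemma Tl_lower (r l u v : R) : 1 < r -> 0 < l -> 0 <= u -> u <= `|v| -> `|v| <= l -> l <= 2 * `|v| ->
  `|v| `^ r <= 40 * (l `^ (r - 1) * poisson_defect l u v).
Proof.
move=> r1 l0 u0 uv vl lv.
(* The denominator is at most 2 l times 5 l^2 and the numerator at least l^4 / 4, whence 1/40. *)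
have h1 : l / 40 <= poisson_defect l u v.
  rewrite /poisson_defect -[v ^+ 2]real_normK ?num_real//; move: (`|v| : R) uv vl lv => w uw wl lw.
  have p : 0 < (u + l) * ((u + l) ^+ 2 + w ^+ 2).
    have q : 0 < u + l by rewrite ltr_wpDl.
    by apply: mulr_gt0 => //; rewrite ltr_wpDr ?sqr_ge0// exprn_gt0.
  rewrite ler_pdivlMr//.
  have a1 : u + l <= 2 * l by lra.
  have a2 : (u + l) ^+ 2 + w ^+ 2 <= 5 * l ^+ 2 by nra.
  have a3 : (u + l) * ((u + l) ^+ 2 + w ^+ 2) <= 2 * l * (5 * l ^+ 2).
    by apply: ler_pM => //; [clear -u0 l0; lra|rewrite addr_ge0// sqr_ge0].
  have a4 : l ^+ 2 <= 4 * w ^+ 2 by nra.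
  apply: (@le_trans _ _ (l / 40 * (2 * l * (5 * l ^+ 2)))).
    by rewrite ler_wpM2l// divr_ge0// ltW.
  have -> : l / 40 * (2 * l * (5 * l ^+ 2)) = l ^+ 2 * (l ^+ 2 / 4) by field.
  rewrite ler_wpM2l ?sqr_ge0//; lra.
apply: (@le_trans _ _ (l `^ r)); first by apply: ler_powR2 => //; lra.
have -> : l `^ r = 40 * (l `^ (r - 1) * (l / 40)).
  have -> : l `^ r = l `^ (r - 1) * l.
    rewrite -[X in _ * X](powRr1 (ltW l0)) -powRD; last by rewrite (gt_eqF l0) implybT.
    by rewrite subrK.
  by field.
by rewrite ler_pM2l// ler_wpM2l// powR_ge0.
Qed.

(** If |v| exceeds both [u] and the smallest scale, some scale l has |v| <= l <= 2 |v|, and its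
    defect alone controls |v|^r. The 2 N + 1 scales run from 2^-N to 2^N. *)
Lemma v_pointwise (r u v : R) (N : nat) : 1 < r -> 0 <= u -> `|v| <= 2 ^+ N ->
  `|v| `^ r <= u `^ r + (2^-1 ^+ N) `^ r +
    40 * \sum_(i < (2 * N).+1) (2^-1 ^+ N * 2 ^+ i) `^ (r - 1) * poisson_defect (2^-1 ^+ N * 2 ^+ i) u v.
Proof.
move=> r1 u0 vN; have r0 : 0 < r by exact: lt_trans r1.
pose a : R := 2^-1 ^+ N; have a0 : 0 < a by rewrite exprn_gt0.
have li (i : nat) : 0 < a * 2 ^+ i by rewrite mulr_gt0// exprn_gt0.
have S0 : 0 <= \sum_(i < (2 * N).+1) (a * 2 ^+ i) `^ (r - 1) * poisson_defect (a * 2 ^+ i) u v.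
  by apply: sumr_ge0 => i _; rewrite mulr_ge0 ?powR_ge0// Tl_ge0.
have p1 := powR_ge0 u r; have p2 := powR_ge0 a r.
rewrite -/a; case: (leP `|v| u) => vu.
  have : `|v| `^ r <= u `^ r by apply: ler_powR2 => //; exact: ltW.
  by move: S0 p1 p2; move: (\sum_(_ < _) _) (u `^ r) (a `^ r) (`|v| `^ r); clear; move=> *; lra.
case: (leP `|v| a) => va.
  have : `|v| `^ r <= a `^ r by apply: ler_powR2 => //; exact: ltW.
  by move: S0 p1 p2; move: (\sum_(_ < _) _) (u `^ r) (a `^ r) (`|v| `^ r); clear; move=> *; lra.
have ex : exists i : nat, `|v| <= a * 2 ^+ i.
  exists (2 * N)%N; rewrite mulnC exprM expr2 /a exprVn mulKf//.
case: (ex_minnP ex) => i hi mini.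
have iN : (i < (2 * N).+1)%N.
  rewrite ltnS; apply: mini; rewrite mulnC exprM expr2 /a exprVn mulKf//.
have i0 : (0 < i)%N.
  rewrite lt0n; apply/eqP => i0; move: hi; rewrite i0 expr0 mulr1 leNgt va //.
have hlow : a * 2 ^+ i <= 2 * `|v|.
  have : ~~ (`|v| <= a * 2 ^+ i.-1) by apply/negP => /mini; rewrite leqNgt ltn_predL i0.
  rewrite -ltNge => h; rewrite -(prednK i0) exprS mulrCA ler_pM2l//; exact: ltW.
have h := @Tl_lower r (a * 2 ^+ i) u v r1 (li i) u0 (ltW vu) hi hlow.
have h2 : (a * 2 ^+ i) `^ (r - 1) * poisson_defect (a * 2 ^+ i) u v <=
   \sum_(i < (2 * N).+1) (a * 2 ^+ i) `^ (r - 1) * poisson_defect (a * 2 ^+ i) u v.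
  rewrite (bigD1 (Ordinal iN))//= lerDl; apply: sumr_ge0 => j _.
  by rewrite mulr_ge0 ?powR_ge0// Tl_ge0.
move: h h2 p1 p2; move: (\sum_(_ < _) _) (u `^ r) (a `^ r) (`|v| `^ r) (_ * poisson_defect _ _ _); clear.
by move=> *; lra.
Qed.

(** Integrating [v_pointwise] and exchanging defects for majorants scale by scale leaves a multiple
    of the integral of u^r and an error 2 pi a^r, where a is the smallest scale and tends to 0. *)
Lemma riesz_lt2 (r : R) : 1 < r -> r < 2 -> exists2 K : R, 0 <= K &
  forall (F : fT R) (m : R), atp F (Complex m 0) -> aed (fun x => 0 <= complex.Re (F x)) ->
  rint (fun x => `|complex.Im (F x)| `^ r) <= K * rint (fun x => `|complex.Re (F x)| `^ r).
Proof.
move=> r1 r2; have [K K0 hK] := Ul_sum r1 r2; exists (1 + 40 * K).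
  by rewrite addr_ge0// mulr_ge0.
move=> F m aF hu; have r0 : 0 < r by exact: lt_trans r1.
set u := fun x => Num.max (complex.Re (F x)) 0; set v := fun x => complex.Im (F x).
have u0 x : 0 <= u x by rewrite le_max lexx orbT.
have LF := atp_Linf aF.
have Iv : rmi (fun x => `|v x| `^ r).
  exact: (rc_Lp_rmi (Lp_Im (ltW r0) (Linf_Lp (ltW r0) LF))).
have IRe : rmi (fun x => `|complex.Re (F x)| `^ r).
  exact: (rc_Lp_rmi (Lp_Re (ltW r0) (Linf_Lp (ltW r0) LF))).
have mRe : measurable_fun D (fun x => complex.Re (F x)) by case: (Linf_cmeas LF).
have mu_ : measurable_fun D u by apply: measurable_maxr => //; exact: measurable_cst.
have hue : aed (fun x => u x `^ r = `|complex.Re (F x)| `^ r).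
  by apply: aedS hu => x _ h; rewrite /u max_l// ger0_norm.
have mur : measurable_fun D (fun x => u x `^ r).
  by apply: (measurableT_comp (f := fun x : R => x `^ r)) => //; exact: measurable_powR.
have Iu : rmi (fun x => u x `^ r).
  by apply: (rmi_le mur _ IRe); apply: aedS hue => x _ <-; rewrite ger0_norm// powR_ge0.
have Eu : rint (fun x => `|complex.Re (F x)| `^ r) = rint (fun x => u x `^ r).
  by apply: rint_ae => //; [exact: rmi_meas IRe|apply: aedS hue].
rewrite Eu.
have [B B0 hB] := atp_bound aF.
(* [N0] puts the values of [v] below the largest scale; the additional [n] makes the smallest scale
   negligible. *)
pose N0 := (Num.truncn B).+1.
have BN : B <= 2 ^+ N0.
  apply: (@le_trans _ _ N0%:R); first exact/ltW/truncnS_gt.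
  by rewrite -natrX ler_nat ltnW// ltn_expl.
apply: (@le_eps_lin _ _ _ (2 * pi)); first exact: ltW (twopi_gt0 R).
move=> e e0; have [n hn] := half_pow_lt r0 e0.
pose N := (N0 + n)%N; pose a : R := 2^-1 ^+ N.
have a0 : 0 < a by rewrite exprn_gt0.
have l0 (i : nat) : 0 < a * 2 ^+ i by rewrite mulr_gt0// exprn_gt0.
have ae : a `^ r <= e.
  apply: le_trans (ltW hn); apply: (ler_powR2 (ltW r0) (ltW a0)).
  have p1 : 0 <= 2^-1 ^+ n :> R by rewrite exprn_ge0.
  have p2 : 2^-1 ^+ N0 <= 1 :> R by rewrite exprn_ile1// invf_le1// ler1n.
  by rewrite /a /N exprD; exact: ler_piMl.
have vN x : `|v x| <= 2 ^+ N.
  apply: (le_trans (Im_le_cabs _)); apply: (le_trans (hB x)); apply: (le_trans BN).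
  by apply: ler_weXn2l; rewrite ?ler1n// leq_addr.
have IT (i : nat) : rmi (fun x => poisson_defect (a * 2 ^+ i) (u x) (v x)) by have [] := Tl_Ul aF (l0 i) hu.
have IU (i : nat) : rmi (fun x => poisson_majorant (a * 2 ^+ i) (u x)) by have [] := Tl_Ul aF (l0 i) hu.
have TU (i : nat) : rint (fun x => poisson_defect (a * 2 ^+ i) (u x) (v x)) <= rint (fun x => poisson_majorant (a * 2 ^+ i) (u x)).
  by have [] := Tl_Ul aF (l0 i) hu.
pose c (i : nat) : R := (a * 2 ^+ i) `^ (r - 1).
have IST : rmi (fun x => \sum_(i < (2 * N).+1) c i * poisson_defect (a * 2 ^+ i) (u x) (v x)).
  by apply: rmi_sum => i; exact: rmiZ.
have ISU : rmi (fun x => \sum_(i < (2 * N).+1) c i * poisson_majorant (a * 2 ^+ i) (u x)).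
  by apply: rmi_sum => i; exact: rmiZ.
have le1 : rint (fun x => \sum_(i < (2 * N).+1) c i * poisson_defect (a * 2 ^+ i) (u x) (v x)) <=
           K * rint (fun x => u x `^ r).
  apply: (@le_trans _ _ (rint (fun x => \sum_(i < (2 * N).+1) c i * poisson_majorant (a * 2 ^+ i) (u x)))).
    rewrite !rint_sum; [|by move=> i; exact: rmiZ|by move=> i; exact: rmiZ].
    by apply: ler_sum => i _; rewrite !rintZ// ler_wpM2l ?powR_ge0.
  rewrite -rintZ//; apply: rint_le => //; first exact: rmiZ.
  by apply: aedW => x _; exact: hK.
have I1 : rmi (fun x => u x `^ r + a `^ r) by apply: rmiD => //; exact: rmi_cst.
have I2 := rmiZ 40 IST.
apply: (@le_trans _ _ (rint (fun x => u x `^ r + a `^ r +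
   40 * \sum_(i < (2 * N).+1) c i * poisson_defect (a * 2 ^+ i) (u x) (v x)))).
  apply: rint_le => //; first exact: rmiD.
  by apply: aedW => x _; exact: (v_pointwise r1 (u0 x) (vN x)).
rewrite rintD// rintD//; last exact: rmi_cst.
rewrite rintZ// rint_cst.
have p0 := ltW (twopi_gt0 R); have h3 := ler_wpM2r p0 ae.
move: le1 h3; move: (rint _) (rint _) (a `^ r * _) => x y z.
by rewrite [2 * pi * e]mulrC; move: (e * (2 * pi)) => w; clear; lra.
Qed.

(** The mean of F^2 is m^2 >= 0 because [m] is real, and its real part is the mean of u^2 - v^2. *)
Lemma riesz_eq2 (F : fT R) (m : R) : atp F (Complex m 0) ->
  rint (fun x => `|complex.Im (F x)| `^ 2) <= rint (fun x => `|complex.Re (F x)| `^ 2).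
Proof.
move=> aF; have LF := atp_Linf aF; have r0 : 0 <= 2 :> R by [].
have Iv := rc_Lp_rmi (Lp_Im r0 (Linf_Lp r0 LF)).
have Iu := rc_Lp_rmi (Lp_Re r0 (Linf_Lp r0 LF)).
have := congr1 (@complex.Re R) (atp_cint (atpM aF aF)).
rewrite cintE !ReM !ImM /= !(mulr0, mul0r, subr0, addr0) => E.
have {E} : rint (fun x => `|complex.Re (F x)| `^ 2 - `|complex.Im (F x)| `^ 2) = 2 * pi * (m * m).
  rewrite -E; congr rint; apply/funext => x; rewrite ReM.
  rewrite !powR_mulrn// !real_normK ?num_real// !expr2; ring.
rewrite rintB// => E; rewrite -subr_ge0 E mulr_ge0//; first exact: ltW (twopi_gt0 R).
by rewrite -expr2 sqr_ge0.
Qed.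

Lemma riesz_base (r : R) : 1 < r -> r <= 2 -> exists2 K : R, 0 <= K &
  forall (F : fT R) (m : R), atp F (Complex m 0) -> aed (fun x => 0 <= complex.Re (F x)) ->
  nr r F <= K * nr r (rc (fun x => complex.Re (F x))).
Proof.
move=> r1 r2; have r0 : 0 < r by exact: lt_trans r1.
have [K K0 hK] : exists2 K : R, 0 <= K &
  forall (F : fT R) (m : R), atp F (Complex m 0) -> aed (fun x => 0 <= complex.Re (F x)) ->
  rint (fun x => `|complex.Im (F x)| `^ r) <= K * rint (fun x => `|complex.Re (F x)| `^ r).
  have [->|rn2] := eqVneq r 2.
    by exists 1 => // F m aF _; rewrite mul1r; exact: riesz_eq2 aF.
  by apply: riesz_lt2 => //; rewrite lt_neqAle rn2.
exists (2 `^ r * (1 + K)); first by rewrite mulr_ge0 ?powR_ge0// addr_ge0.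
move=> F m aF hu; have LF := Linf_Lp (ltW r0) (atp_Linf aF).
have Iv := rc_Lp_rmi (Lp_Im (ltW r0) LF).
have Iu := rc_Lp_rmi (Lp_Re (ltW r0) LF).
rewrite nr_rc nrE.
apply: (@le_trans _ _ (rint (fun x => 2 `^ r * (`|complex.Re (F x)| `^ r + `|complex.Im (F x)| `^ r)))).
  apply: rint_le; [exact: Lp_rmi|by apply: rmiZ; exact: rmiD|].
  apply: aedW => x _; apply: le_trans (powR_Dle (ltW r0) (normr_ge0 _) (normr_ge0 _)).
  by apply: ler_powR2; [exact: ltW|exact: cabs_ge0|exact: cabs_le_ReIm].
rewrite rintZ; last exact: rmiD.
rewrite rintD// -mulrA ler_wpM2l ?powR_ge0// mulrDl mul1r lerD2l.
exact: hK aF hu.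
Qed.
End RieszBase.

(** * From nonnegative polynomials to all trigonometric polynomials *)

Section Riesz.
Variable R : realType.
Notation C := (R[i]).
Notation D := (@dom R).

(** [nr_split] with the L^r norm as threshold; norm 0 is separate since a threshold is positive. *)
Lemma nr1_powR (r : R) (f : fT R) : 1 <= r -> Lp r f ->
  nr 1 f `^ r <= (2 * pi + 1) `^ r * nr r f.
Proof.
move=> r1 H; have r0 : 0 < r by exact: lt_le_trans r1.
have p0 := ltW (twopi_gt0 R).
have n0 := nr_ge0 r f; have n1 := nr_ge0 1 f.
have [N0|Nn] := eqVneq (nr r f) 0.
  have -> : nr 1 f = 0.
    apply/eqP; rewrite eq_le n1 andbT; apply: (@le_eps_lin _ _ _ (2 * pi)) => // e e0.
    have [_] := nr_split r1 e0 H; rewrite N0 mulr0 addr0 add0r mulrC //.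
  by rewrite powR0 ?gt_eqF// mulr_ge0 ?powR_ge0.
have Np : 0 < nr r f by rewrite lt_neqAle eq_sym Nn.
pose a := nr r f `^ r^-1; have a0 : 0 < a by rewrite powR_gt0.
have ar : a `^ r = nr r f by rewrite /a -powRrM mulVf ?gt_eqF// powRr1.
have [_] := nr_split r1 a0 H; rewrite -ar -powRD; last by rewrite (gt_eqF a0) implybT.
rewrite subrK powRr1 ?(ltW a0)// => h.
rewrite -powRM ?(ltW a0) ?addr_ge0//; apply: ler_powR2 => //; first exact: ltW.
by apply: (le_trans h); rewrite [leRHS]mulrDl mul1r mulrC.
Qed.

Lemma fc_powR (r : R) (f : fT R) n : 1 <= r -> Lp r f ->
  cabs (fc f n) `^ r <= (2 * pi + 1) `^ r * nr r f.
Proof.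
move=> r1 H; apply: le_trans (nr1_powR r1 H); apply: ler_powR2.
- by rewrite (le_trans ler01).
- exact: cabs_ge0.
- by apply: fc_abs; have [] := Lp_sub ler01 r1 H.
Qed.

Lemma fc_small (r e : R) : 1 <= r -> 0 < e -> exists2 d : R, 0 < d &
  forall f, Lp r f -> nr r f < d -> forall n, cabs (fc f n) < e.
Proof.
move=> r1 e0; have r0 : 0 < r by exact: lt_le_trans r1.
have c0 : 0 < (2 * pi + 1) `^ r :> R.
  by rewrite powR_gt0// ltr_wpDl// ltW// twopi_gt0.
exists (e `^ r / (2 * pi + 1) `^ r); first by rewrite divr_gt0// powR_gt0.
move=> f H; rewrite ltr_pdivlMr// mulrC => h n.
rewrite ltNge; apply/negP => h2.
have h3 := fc_powR n r1 H.
have h4 := ler_powR2 (ltW r0) (ltW e0) h2.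
by have := le_lt_trans (le_trans h4 h3) h; rewrite ltxx.
Qed.

Lemma cabs_eps0 (z : C) : (forall e : R, 0 < e -> cabs z < e) -> z = 0.
Proof.
move=> h; apply/eqP; rewrite -cabs_eq0 eq_le cabs_ge0 andbT leNgt; apply/negP => p.
by have := h _ p; rewrite ltxx.
Qed.

Lemma tp_tpP s (x : R) : tp (tpP s) x = \sum_(kc <- s) (if 0 <= kc.1 then kc.2 * tpow kc.1 x else 0) :> C.
Proof. by rewrite /tp /tpP big_filter big_mkcond. Qed.

Lemma atp_tpP s : atp (tp (tpP s) : fT R) (fc (tp s) 0).
Proof.
exists [seq kc <- s | 0 < kc.1]; split; first by move=> kc; rewrite mem_filter => /andP[].
move=> x; rewrite fc_tp tp_tpP /tp big_filter.
rewrite [X in _ = X + _]big_mkcond [X in _ = _ + X]big_mkcond -big_split /=.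
apply: eq_bigr => kc _; case: (ltgtP 0 kc.1) => [h|h|<-].
- by rewrite add0r.
- by rewrite add0r.
- by rewrite tpow0 mulr1 addr0.
Qed.

(** For a real polynomial the coefficients at n and -n are conjugate, so P h + conj(P h) recovers h
    except that the constant term is counted twice. *)
Lemma real_tp_ReP s (h : R -> R) : tp s = rc h ->
  complex.Im (fc (tp s) 0) = 0 /\
  aed (fun x => h x = complex.Re (2 * tp (tpP s) x - fc (tp s) 0)).
Proof.
move=> E; have Ls : Lp 1 (tp s : fT R) by exact: Lp_tp.
have LP : Lp 1 (tp (tpP s) : fT R) by exact: Lp_tp.
have cs : conjf (tp s) = tp s by rewrite E; apply/funext => x; rewrite /conjf conjcR.
have fcs n : fc (tp s) n = conjc (fc (tp s) (- n)) by rewrite -{1}cs fc_conj.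
have c0 : complex.Im (fc (tp s) 0) = 0.
  have := congr1 (@complex.Im R) (fcs 0); rewrite oppr0 ImJ; clear; lra.
split=> //; set c := fc (tp s) 0 in c0 *.
have cc : conjc c = c by apply: complexP; rewrite ?ReJ ?ImJ ?c0 ?oppr0.
have [LPc _] := Lp_conj LP.
have Lc : Lp 1 ((fun=> c) : fT R) by apply: Linf_Lp => //; exact: Linf_cst.
have L1 := (LpD ler01 LP LPc).1; have L2 := (LpB ler01 L1 Lc).1.
have fcc n : fc ((fun=> c) : fT R) n = if n == 0 then c else 0.
  have -> : (fun=> c) = fscale c (tpow 0) :> fT R by apply/funext => x; rewrite /fscale tpow0 mulr1.
  by rewrite fcZ ?fc_tpow 1?eq_sym; [case: eqP => _; rewrite ?mulr1 ?mulr0|exact: Lp_tpow1].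
have /aeqP A : aeq (fsub (fadd (tp (tpP s)) (conjf (tp (tpP s)))) (fun=> c)) (tp s).
  apply: (fc_uniq L2 Ls) => n.
  rewrite (fcB n L1 Lc) (fcD n LP LPc) (fc_conj n LP) !fc_tpP fcc.
  case: (ltgtP n 0) => [n0|n0|->].
  - by rewrite oppr_ge0 ltW// add0r subr0 -fcs.
  - rewrite (_ : (0 <= - n) = false); last by clear -n0; lia.
    by rewrite conjc0 addr0 subr0.
  - by rewrite oppr0 lexx cc -/c addrK.
apply: aedS A => x _; rewrite E /fsub /fadd /rc => /(congr1 (@complex.Re R)) /= <-.
by rewrite mulr_natl mulr2n !ReD !ReN ReJ.
Qed.

Lemma nr_ae (r : R) (f g : fT R) : cmeas f -> cmeas g -> aeq f g -> nr r f = nr r g.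
Proof.
move=> mf mg /aeqP h; rewrite !nrE; apply: rint_ae; try exact: meas_cabs_powR.
by apply: aedS h => x _ ->.
Qed.

Lemma Lp_ae (r : R) (f g : fT R) : cmeas g -> aeq f g -> Lp r f -> Lp r g.
Proof.
move=> mg /aeqP h Hf; have hk : aed (fun x => cabs (g x) `^ r <= cabs (f x) `^ r).
  by apply: aedS h => x _ ->.
by have [] := Lp_le mg (Lp_rmi Hf) hk.
Qed.

Lemma cabs_i : cabs (Complex 0 1 : C) = 1.
Proof.
have : cabs (Complex 0 1 : C) ^+ 2 = 1 ^+ 2 by rewrite cabs_sqr /= expr0n /= add0r.
by move/eqP; rewrite eqrXn2 ?cabs_ge0// => /eqP.
Qed.

Lemma half_mul2 : Complex 2^-1 0 * 2 = 1 :> C.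
Proof.
rewrite (natC R 2); apply: complexP; rewrite ?ReM ?ImM /= ?(mulr0, mul0r) ?subr0 ?addr0//.
by rewrite mulVf// pnatr_eq0.
Qed.

(** F = 2 P h - c, with c the constant term of h, is analytic with real part h >= 0 and real mean,
    as [riesz_base] requires. P h is then (F + c) / 2, and c is bounded by the norm of h. *)
Lemma riesz_pos (r : R) : 1 < r -> r <= 2 -> exists2 K : R, 0 <= K &
  forall s (h : R -> R), tp s = rc h -> (forall x, 0 <= h x) ->
  nr r (tp (tpP s)) <= K * nr r (tp s).
Proof.
move=> r1 r2; have [K K0 hK] := riesz_base r1 r2.
have r0 : 0 < r by exact: lt_trans r1.
have r0' := ltW r0.
pose k := (2 * pi + 1) `^ r * (2 * pi) : R.
have k0 : 0 <= k by rewrite mulr_ge0 ?powR_ge0// ltW// twopi_gt0.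
exists (2 `^ r * (K + k)); first by rewrite mulr_ge0 ?powR_ge0// addr_ge0.
move=> s h E h0; have [c0 hRe] := real_tp_ReP E.
set c := fc (tp s) 0 in c0 hRe.
have aP := atp_tpP s; rewrite -/c in aP.
have aF : atp (fun x => 2 * tp (tpP s) x + (- c)) (Complex (complex.Re c) 0).
  have -> : Complex (complex.Re c) 0 = 2 * c + (- c).
    by transitivity c; [case: (c) c0 => a b /= ->|ring].
  by apply: atpD; [apply: atpM => //; exact: atp_cst|exact: atp_cst].
have hF := hK _ _ aF.
have /hF {hF} hF : aed (fun x => 0 <= complex.Re (2 * tp (tpP s) x + (- c))).
  by apply: aedS hRe => x _ <-.
have LF := atp_Linf aF; have LrF := Linf_Lp r0' LF.
have Es : nr r (rc (fun x => complex.Re (2 * tp (tpP s) x + (- c)))) = nr r (tp s).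
  apply: nr_ae.
  - by apply: cmeas_real; case: (Linf_cmeas LF).
  - exact: Linf_cmeas (Linf_tp s).
  - by apply/aeqP; apply: aedS hRe => x _ hx; rewrite E /rc hx.
rewrite Es in hF.
have Lc : Lp r ((fun=> c) : fT R) by exact: (Linf_Lp r0' (Linf_cst c)).
have nc : nr r ((fun=> c) : fT R) <= k * nr r (tp s).
  have h1 := fc_powR 0 (ltW r1) (Lp_tp s r0'); rewrite -/c in h1.
  have h2 := ler_wpM2r (ltW (twopi_gt0 R)) h1.
  by rewrite nrE rint_cst; apply: (le_trans h2); rewrite /k mulrAC.
have [L1 e1] := LpD r0' LrF Lc.
have [L2 e2] := LpZ (Complex 2^-1 0) L1.
have -> : tp (tpP s) = fscale (Complex 2^-1 0) (fadd (fun x => 2 * tp (tpP s) x + (- c)) (fun=> c)).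
  apply/funext => x; rewrite /fscale /fadd subrK mulrA.
  by rewrite half_mul2 mul1r.
rewrite e2 cabs_real.
apply: (@le_trans _ _ (nr r (fadd (fun x => 2 * tp (tpP s) x + (- c)) (fun=> c)))).
  have h2 : `|2^-1| <= 1 :> R by clear; rewrite ger0_norm; lra.
  have h3 := @ler_powR2 R `|2^-1| 1 r r0' (normr_ge0 _) h2; rewrite powR1 in h3.
  exact: (ler_piMl (nr_ge0 _ _) h3).
apply: (le_trans e1); rewrite -mulrA mulrDl.
exact: (ler_wpM2l (powR_ge0 _ _) (lerD hF nc)).
Qed.

(** The projection of a Fejer mean, an explicit polynomial that is available for every integrable
    function before [Pr] is known to be bounded. *)
Definition FP (n : nat) (g : fT R) : fT R := tp (tpP (fejs n g)).
Lemma FPE (n : nat) (g : fT R) (x : R) : FP n g x = \sum_(j <- iota 0 n) \sum_(k <- iota 0 n)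
  (if 0 <= j%:Z - k%:Z then (Complex n%:R^-1 0 * fc g (j%:Z - k%:Z)) * tpow (j%:Z - k%:Z) x else 0).
Proof. by rewrite /FP tp_tpP /fejs big_allpairs_dep. Qed.
Lemma fejE (n : nat) (g : fT R) (x : R) : fej n g x = \sum_(j <- iota 0 n) \sum_(k <- iota 0 n)
  (Complex n%:R^-1 0 * fc g (j%:Z - k%:Z)) * tpow (j%:Z - k%:Z) x.
Proof. by rewrite fej_tp /tp /fejs big_allpairs_dep. Qed.
Lemma FPD (n : nat) (f g : fT R) : Lp 1 f -> Lp 1 g -> FP n (fadd f g) = fadd (FP n f) (FP n g).
Proof.
move=> Hf Hg; apply/funext => x; rewrite /fadd !FPE -big_split /=; apply: eq_bigr => j _.
rewrite -big_split /=; apply: eq_bigr => k _; case: ifP => _; last by rewrite addr0.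
by rewrite (fcD _ Hf Hg); ring.
Qed.

Lemma FPZ (n : nat) (z : C) (f : fT R) : Lp 1 f -> FP n (fscale z f) = fscale z (FP n f).
Proof.
move=> Hf; apply/funext => x; rewrite /fscale !FPE mulr_sumr; apply: eq_bigr => j _.
rewrite mulr_sumr; apply: eq_bigr => k _; case: ifP => _; last by rewrite mulr0.
by rewrite (fcZ z _ Hf); ring.
Qed.

Lemma fejD (n : nat) (f g : fT R) : Lp 1 f -> Lp 1 g -> fej n (fadd f g) = fadd (fej n f) (fej n g).
Proof.
move=> Hf Hg; apply/funext => x; rewrite /fadd !fejE -big_split /=; apply: eq_bigr => j _.
rewrite -big_split /=; apply: eq_bigr => k _.
by rewrite (fcD _ Hf Hg); ring.
Qed.

Lemma fejZ (n : nat) (z : C) (f : fT R) : Lp 1 f -> fej n (fscale z f) = fscale z (fej n f).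
Proof.
move=> Hf; apply/funext => x; rewrite /fscale !fejE mulr_sumr; apply: eq_bigr => j _.
rewrite mulr_sumr; apply: eq_bigr => k _.
by rewrite (fcZ z _ Hf); ring.
Qed.

Lemma FP_fej (n : nat) (f g : fT R) : (forall m, fc g m = if 0 <= m then fc f m else 0) -> FP n f = fej n g.
Proof.
move=> E; apply/funext => x; rewrite FPE fejE; apply: eq_bigr => j _; apply: eq_bigr => k _.
by rewrite E; case: ifP => // _; rewrite mulr0 mul0r.
Qed.

Lemma tp_cont s : continuous (fun x => complex.Re (tp s x : C)) /\ continuous (fun x => complex.Im (tp s x : C)).
Proof.
have ck k : continuous (fun x : R => cos (k%:~R * x)) /\ continuous (fun x : R => sin (k%:~R * x)).
  split=> x.
    apply: (continuous_comp (f := fun y : R => k%:~R * y)); last exact: continuous_cos.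
    exact: mulrl_continuous.
  apply: (continuous_comp (f := fun y : R => k%:~R * y)); last exact: continuous_sin.
  exact: mulrl_continuous.
elim: s => [|kc s [IH1 IH2]].
  by rewrite tp_nil /f0; split=> x; exact: cvg_cst.
have [c1 c2] := ck kc.1; rewrite tp_cons; split=> x.
  have -> : (fun x => complex.Re (fadd (fscale kc.2 (tpow kc.1)) (tp s) x)) =
     (fun x => (complex.Re kc.2 * cos (kc.1%:~R * x) - complex.Im kc.2 * sin (kc.1%:~R * x)) + complex.Re (tp s x)).
    by apply/funext => y; rewrite /fadd /fscale ReD ReM tpowE.
  apply: cvgD; last exact: IH1.
  by apply: cvgB; (apply: cvgM; [exact: cvg_cst|]); [exact: c1|exact: c2].
have -> : (fun x => complex.Im (fadd (fscale kc.2 (tpow kc.1)) (tp s) x)) =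
   (fun x => (complex.Re kc.2 * sin (kc.1%:~R * x) + complex.Im kc.2 * cos (kc.1%:~R * x)) + complex.Im (tp s x)).
  by apply/funext => y; rewrite /fadd /fscale ImD ImM tpowE.
apply: cvgD; last exact: IH2.
by apply: cvgD; (apply: cvgM; [exact: cvg_cst|]); [exact: c2|exact: c1].
Qed.

Definition cont_bounded (h : R -> R) := continuous h /\ exists B : R, forall x, `|h x| <= B.
Lemma cont_bounded_Lp (r : R) h : 0 <= r -> cont_bounded h -> Lp r (rc h).
Proof.
move=> r0 [ch [B hB]]; apply: Linf_Lp => //.
by apply: (rc_Linf (B := B)) => //; exact: meas_continuous.
Qed.

Lemma cont_bounded_fej (r : R) h : 0 < r -> cont_bounded h -> forall e : R, 0 < e ->
  exists N : nat, forall n : nat, (N <= n)%N -> nr r (fsub (fej n (rc h)) (rc h)) < e.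
Proof.
move=> r0 [ch [B hB]]; apply: (@fej_Lp R h B r) => //; first exact: meas_continuous.
by move=> x _ _; apply: continuous_cont_at; exact: ch.
Qed.

Lemma fej_tp_cvg (r : R) s : 1 <= r -> forall e : R, 0 < e ->
  exists N : nat, forall n : nat, (N <= n)%N -> nr r (fsub (fej n (tp s)) (tp s)) < e.
Proof.
move=> r1 e e0; have r0 : 0 < r by exact: lt_le_trans r1.
have r0' := ltW r0.
have [K K0 hK] := @tp_bound R s.
have [c1 c2] := tp_cont s.
have n1 : cont_bounded (fun x => complex.Re (tp s x : C)).
  by split=> //; exists K => x; apply: (le_trans (Re_le_cabs _)).
have n2 : cont_bounded (fun x => complex.Im (tp s x : C)).
  by split=> //; exists K => x; apply: (le_trans (Im_le_cabs _)).
pose k : R := 2 `^ r; have k0 : 0 < k by rewrite powR_gt0.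
have e'0 : 0 < e / (2 * k) by rewrite divr_gt0// mulr_gt0.
have [N1 h1] := cont_bounded_fej r0 n1 e'0; have [N2 h2] := cont_bounded_fej r0 n2 e'0.
exists (maxn N1 N2) => n; rewrite geq_max => /andP[/h1 {}h1 /h2 {}h2].
set f1 := rc _ in h1; set f2 := rc _ in h2.
have L1 : Lp 1 f1 by exact: cont_bounded_Lp n1.
have L2 : Lp 1 f2 by exact: cont_bounded_Lp n2.
have E : tp s = fadd f1 (fscale (Complex 0 1) f2) := ReIm_decomp (tp s).
have -> : fsub (fej n (tp s)) (tp s) =
   fadd (fsub (fej n f1) f1) (fscale (Complex 0 1) (fsub (fej n f2) f2)).
  have L2' := (LpZ (Complex 0 1) L2).1.
  rewrite {1}E (fejD n L1 L2') (fejZ n _ L2) {1}E; apply/funext => x.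
  by rewrite /fsub /fadd /fscale; ring.
have M1 : Lp r (fsub (fej n f1) f1).
  by rewrite fej_tp; have [] := LpB r0' (Lp_tp (fejs n f1) r0') (cont_bounded_Lp r0' n1).
have M2 : Lp r (fsub (fej n f2) f2).
  by rewrite fej_tp; have [] := LpB r0' (Lp_tp (fejs n f2) r0') (cont_bounded_Lp r0' n2).
have [M3 E3] := LpZ (Complex 0 1) M2.
have [_ le] := LpD r0' M1 M3; apply: (le_lt_trans le); rewrite E3.
rewrite cabs_i powR1 mul1r -/k mulrC -ltr_pdivlMr//.
have -> : e / k = e / (2 * k) + e / (2 * k).
  have cn : k != 0 by rewrite gt_eqF.
  by field.
exact: (ltrD h1 h2).
Qed.

Lemma LpZ1 (r : R) (z : C) (g : fT R) : cabs z = 1 -> Lp r g ->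
  Lp r (fscale z g) /\ nr r (fscale z g) = nr r g.
Proof.
move=> z1 Lg; have [H1 H2] := LpZ z Lg; rewrite z1 powR1 mul1r in H2.
exact: (conj H1 H2).
Qed.

Lemma sum4_le (a1 a2 a3 a4 x : R) : a1 <= x -> a2 <= x -> a3 <= x -> a4 <= x ->
  a1 + a2 + (a3 + a4) <= 4 * x.
Proof. by move=> *; lra. Qed.
(** The positive and negative parts of the real and imaginary parts are no longer polynomials, but
    their Fejer means are, and these stay nonnegative. [riesz_pos] applies to each of the four, and
    the order of the means tends to infinity. *)
Lemma riesz_tp (r : R) : 1 < r -> r <= 2 -> exists2 K : R, 0 <= K &
  forall s, nr r (tp (tpP s)) <= K * nr r (tp s : fT R).
Proof.
move=> r1 r2; have [K K0 hK] := riesz_pos r1 r2.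
have r0 : 0 < r by exact: lt_trans r1.
have r0' := ltW r0.
pose k : R := 2 `^ r; have k0 : 0 < k by rewrite powR_gt0.
have part s (g : R -> R) : cont_bounded g -> (forall x, 0 <= g x) -> (forall x, g x <= cabs (tp s x : C)) ->
    forall e : R, 0 < e -> exists N : nat, forall n : nat, (N <= n)%N ->
    nr r (FP n (rc g)) <= K * (k * (e + nr r (tp s))).
  move=> ng g0 gs e e0; have [N hN] := cont_bounded_fej r0 ng e0.
  exists N.+1 => -[//|n] Nn; have [cg [B hB]] := ng.
  have E := @fej_fejr R g B n.+1 isT (meas_continuous cg) (fun x _ => hB x).
  have h1 : nr r (FP n.+1 (rc g)) <= K * nr r (fej n.+1 (rc g)).
    rewrite /FP [in X in _ <= X]fej_tp; apply: (hK _ (fejr n.+1 g)); first by rewrite -fej_tp.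
    by move=> x; apply: fejr_ge0 => y _; exact: g0.
  apply: (le_trans h1); apply: (ler_wpM2l K0).
  have Lg := cont_bounded_Lp r0' ng.
  have Lf : Lp r (fej n.+1 (rc g)) by rewrite fej_tp; exact: Lp_tp.
  have h2 := nr_le_sub r0' Lf Lg; have h4 := ltW (hN n.+1 (ltnW Nn)).
  apply: (le_trans h2); apply: (ler_wpM2l (ltW k0)); apply: (lerD h4).
  rewrite !nrE; apply: rint_le; [exact: (Lp_rmi Lg)|exact: (Lp_rmi (Lp_tp s r0'))|].
  apply: aedW => x _; apply: ler_powR2 => //; first exact: cabs_ge0.
  by rewrite cabs_real ger0_norm.
pose pos (y : R) := (`|y| + y) / 2; pose neg (y : R) := (`|y| - y) / 2.
have pos0 y : 0 <= pos y by rewrite /pos; case: (ger0P y) => h; lra.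
have neg0 y : 0 <= neg y by rewrite /neg; case: (ger0P y) => h; lra.
have posle y : pos y <= `|y| by rewrite /pos; case: (ger0P y) => h; lra.
have negle y : neg y <= `|y| by rewrite /neg; case: (ger0P y) => h; lra.
have cpos (g : R -> R) : continuous g -> continuous (fun x => pos (g x)).
  move=> cg x; apply: cvgM; last exact: cvg_cst.
  by apply: cvgD; [apply: cvg_norm; exact: cg|exact: cg].
have cneg (g : R -> R) : continuous g -> continuous (fun x => neg (g x)).
  move=> cg x; apply: cvgM; last exact: cvg_cst.
  by apply: cvgB; [apply: cvg_norm; exact: cg|exact: cg].
exists (k * (k * (k * (4 * (K * k))))).
  by apply: mulr_ge0; [exact: ltW|apply: mulr_ge0; [exact: ltW|apply: mulr_ge0; [exact: ltW|apply: mulr_ge0 => //; apply: mulr_ge0 => //; exact: ltW]]].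
move=> s; have [c1 c2] := tp_cont s; have [B B0 hB] := @tp_bound R s.
pose u x := complex.Re (tp s x : C); pose v x := complex.Im (tp s x : C).
have ub x : `|u x| <= cabs (tp s x : C) by exact: Re_le_cabs.
have vb x : `|v x| <= cabs (tp s x : C) by exact: Im_le_cabs.
have mknice (P : R -> R) (w : R -> R) : (forall y, 0 <= P y) -> (forall y, P y <= `|y|) ->
   continuous (fun x => P (w x)) -> (forall x, `|w x| <= cabs (tp s x : C)) ->
   cont_bounded (fun x => P (w x)) /\ forall x, P (w x) <= cabs (tp s x : C).
  move=> P0 Pl cP wb; split; last by move=> x; exact: le_trans (Pl _) (wb _).
  split=> //; exists B => x; rewrite ger0_norm//.
  by apply: (le_trans (Pl _)); apply: (le_trans (wb _)).
have [n1 l1] := mknice pos u pos0 posle (cpos _ c1) ub.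
have [n2 l2] := mknice neg u neg0 negle (cneg _ c1) ub.
have [n3 l3] := mknice pos v pos0 posle (cpos _ c2) vb.
have [n4 l4] := mknice neg v neg0 negle (cneg _ c2) vb.
set A1 := rc (fun x => pos (u x)); set A2 := rc (fun x => neg (u x)).
set A3 := rc (fun x => pos (v x)); set A4 := rc (fun x => neg (v x)).
have L1 : Lp 1 A1 by exact: cont_bounded_Lp ler01 n1.
have L2 : Lp 1 A2 by exact: cont_bounded_Lp ler01 n2.
have L3 : Lp 1 A3 by exact: cont_bounded_Lp ler01 n3.
have L4 : Lp 1 A4 by exact: cont_bounded_Lp ler01 n4.
have L2' := (LpZ (-1) L2).1; have L4' := (LpZ (-1) L4).1.
have L12 := (LpD ler01 L1 L2').1; have L34 := (LpD ler01 L3 L4').1.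
have L34' := (LpZ (Complex 0 1) L34).1.
have Ef : tp s = fadd (fadd A1 (fscale (-1) A2)) (fscale (Complex 0 1) (fadd A3 (fscale (-1) A4))).
  apply/funext => x; rewrite /fadd /fscale /A1 /A2 /A3 /A4 /rc.
  have pn y : pos y - neg y = y by rewrite /pos /neg; lra.
  apply: complexP; rewrite ?ReD ?ImD ?ReM ?ImM /= ?ReD ?ImD ?ReM ?ImM /=.
    by rewrite -[LHS](pn (u x)); ring.
  by rewrite -[LHS](pn (v x)); ring.
apply: (@le_eps_lin _ _ _ (k + k * (k * (k * (4 * (K * k)))))).
  apply: addr_ge0; first exact: ltW.
  by apply: mulr_ge0; [exact: ltW|apply: mulr_ge0; [exact: ltW|apply: mulr_ge0; [exact: ltW|apply: mulr_ge0 => //; apply: mulr_ge0 => //; exact: ltW]]].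
move=> e e0.
have [N1 h1] := part s _ n1 (fun x => pos0 _) l1 e e0.
have [N2 h2] := part s _ n2 (fun x => neg0 _) l2 e e0.
have [N3 h3] := part s _ n3 (fun x => pos0 _) l3 e e0.
have [N4 h4] := part s _ n4 (fun x => neg0 _) l4 e e0.
have [N5 h5] := fej_tp_cvg (tpP s) (ltW r1) e0.
pose n := maxn N1 (maxn N2 (maxn N3 (maxn N4 N5))).
have {}h1 := h1 n (leq_maxl _ _).
have {}h2 := h2 n (leq_trans (leq_maxl _ _) (leq_maxr _ _)).
have {}h3 := h3 n (leq_trans (leq_trans (leq_maxl _ _) (leq_maxr _ _)) (leq_maxr _ _)).
have {}h4 := h4 n (leq_trans (leq_trans (leq_trans (leq_maxl _ _) (leq_maxr _ _)) (leq_maxr _ _)) (leq_maxr _ _)).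
have {}h5 := h5 n (leq_trans (leq_trans (leq_trans (leq_maxr _ _) (leq_maxr _ _)) (leq_maxr _ _)) (leq_maxr _ _)).
have LFP g : Lp r (FP n g) by exact: Lp_tp.
have EF : fej n (tp (tpP s)) = fadd (fadd (FP n A1) (fscale (-1) (FP n A2)))
   (fscale (Complex 0 1) (fadd (FP n A3) (fscale (-1) (FP n A4)))).
  (* Projection commutes with Fejer means, both being coefficientwise; the four pieces then
     recombine. *)
  rewrite -(FP_fej n (fun m => fc_tpP s m)).
  by rewrite Ef (FPD n L12 L34') (FPD n L1 L2') (FPZ n _ L2) (FPZ n _ L34) (FPD n L3 L4') (FPZ n _ L4).
have m1 : cabs (-1 : C) = 1 by rewrite cabsN cabs1.
have [P2 Q2] := LpZ1 m1 (LFP A2); have [P4 Q4] := LpZ1 m1 (LFP A4).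
have [P12 Q12] := LpD r0' (LFP A1) P2; have [P34 Q34] := LpD r0' (LFP A3) P4.
have [P34' Q34'] := LpZ1 cabs_i P34.
have [P5 Q5] := LpD r0' P12 P34'.
rewrite -EF in P5 Q5.
have Q6 := nr_le_sub r0' (Lp_tp (tpP s) r0') P5.
rewrite nr_sym in Q6.
rewrite Q2 -/k in Q12; rewrite Q4 -/k in Q34; rewrite Q34' -/k in Q5; rewrite -/k in Q6.
apply: (le_trans Q6).
have Q7 : nr r (fej n (tp (tpP s))) <= k * (k * (4 * (K * (k * (e + nr r (tp s)))))).
  apply: (le_trans Q5); apply: (ler_wpM2l (ltW k0)).
  apply: (le_trans (lerD Q12 Q34)); rewrite -mulrDr; apply: (ler_wpM2l (ltW k0)).
  exact: (sum4_le h1 h2 h3 h4).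
apply: (@le_trans _ _ (k * (e + k * (k * (4 * (K * (k * (e + nr r (tp s))))))))).
  exact: (ler_wpM2l (ltW k0) (lerD (ltW h5) Q7)).
by rewrite le_eqVlt; apply/orP; left; apply/eqP; ring.
Qed.
End Riesz.

(** * Conjugate exponents, duality and products of Hardy functions *)

Section Duality.
Variable R : realType.
Notation C := (R[i]).
Notation D := (@dom R).

Lemma hconj_gt1 (r : R) : 1 < r -> 1 < hconj r.
Proof. by move=> r1; rewrite /hconj ltr_pdivlMr ?subr_gt0// mul1r; lra. Qed.
Lemma hconjK (r : R) : 1 < r -> hconj (hconj r) = r.
Proof. by move=> r1; rewrite /hconj; field; lra. Qed.
Lemma hconjE (r : R) : 1 < r -> hconj r = 1 + (r - 1)^-1.
Proof. by move=> r1; rewrite /hconj; field; lra. Qed.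
Lemma hconjM (r : R) : 1 < r -> (r - 1) * hconj r = r.
Proof. by move=> r1; rewrite /hconj; field; lra. Qed.
Lemma hconj_le2 (r : R) : 2 <= r -> hconj r <= 2.
Proof. by move=> r2; rewrite /hconj ler_pdivrMr ?subr_gt0; lra. Qed.

(** According to which of y and x^(r-1) is larger, the product is at most one of the two powers; the
    sharp constants 1/r and 1/q are irrelevant here. *)
Lemma young (r x y : R) : 1 < r -> 0 <= x -> 0 <= y -> x * y <= x `^ r + y `^ hconj r.
Proof.
move=> r1 x0 y0.
have [h|h] := leP y (x `^ (r - 1)).
  have [->|xn] := eqVneq x 0; first by rewrite mul0r addr_ge0 ?powR_ge0.
  have xp : 0 < x by rewrite lt_neqAle eq_sym xn.
  have E : x * x `^ (r - 1) = x `^ r.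
    rewrite -{1}(powRr1 x0) -powRD; last by rewrite xn implybT.
    by congr powR; ring.
  apply: (le_trans (ler_wpM2l x0 h)); rewrite E; rewrite lerDl; exact: powR_ge0.
have yp : 0 < y by exact: le_lt_trans (powR_ge0 _ _) h.
have rp : 0 < r - 1 by rewrite subr_gt0.
have xy : x <= y `^ (r - 1)^-1.
  have e : x = (x `^ (r - 1)) `^ (r - 1)^-1.
    by rewrite -powRrM mulfV ?gt_eqF// powRr1.
  rewrite e; apply: ler_powR2; [by rewrite invr_ge0 ltW|exact: powR_ge0|exact: ltW].
have E : y `^ (r - 1)^-1 * y = y `^ hconj r.
  rewrite -{2}(powRr1 y0) -powRD; last by rewrite (gt_eqF yp) implybT.
  by rewrite hconjE//; congr powR; ring.
apply: (le_trans (ler_wpM2r y0 xy)); rewrite E; rewrite lerDr; exact: powR_ge0.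
Qed.

(** Young's inequality with the factors rescaled by 1/d and d: a small [d] makes the second term
    small, at the expense of the first. *)
Lemma LpM_hconj (r d : R) (f g : fT R) : 1 < r -> 0 < d -> Lp r f -> Lp (hconj r) g ->
  Lp 1 (fmul f g) /\ nr 1 (fmul f g) <= d^-1 `^ r * nr r f + d `^ hconj r * nr (hconj r) g.
Proof.
move=> r1 d0 Hf Hg.
have I1 := rmiZ (d^-1 `^ r) (Lp_rmi Hf); have I2 := rmiZ (d `^ hconj r) (Lp_rmi Hg).
have [] := @Lp_le R 1 (fmul f g) _ (cmeasM (Lp_cmeas Hf) (Lp_cmeas Hg)) (rmiD I1 I2).
  apply: aedW => x _; rewrite powRr1 ?cabs_ge0// /fmul cabsM.
  have dn : d != 0 by rewrite gt_eqF.
  have -> : cabs (f x) * cabs (g x) = (d^-1 * cabs (f x)) * (d * cabs (g x)).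
    by rewrite mulrACA mulVf// mul1r.
  have h1 : 0 <= d^-1 by rewrite invr_ge0 ltW.
  rewrite -(powRM _ h1 (cabs_ge0 _)) -(powRM _ (ltW d0) (cabs_ge0 _)).
  apply: young => //; apply: mulr_ge0 => //; [exact: cabs_ge0|exact: ltW|exact: cabs_ge0].
by move=> L; rewrite (rintD I1 I2) (rintZ _ (Lp_rmi Hf)) (rintZ _ (Lp_rmi Hg)) -!nrE.
Qed.

Lemma Lp1M_hconj (r : R) (f g : fT R) : 1 < r -> Lp r f -> Lp (hconj r) g -> Lp 1 (fmul f g).
Proof. by move=> r1 Hf Hg; case: (LpM_hconj r1 ltr01 Hf Hg). Qed.
Lemma lt_div_mul (p x e : R) : 0 < p -> x < e / p -> p * x < e.
Proof. by move=> p0; rewrite ltr_pdivlMr// mulrC. Qed.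
Lemma nrM_small (r : R) (g : fT R) : 1 < r -> Lp (hconj r) g -> forall e : R, 0 < e ->
  exists2 d : R, 0 < d & forall f, Lp r f -> nr r f < d -> nr 1 (fmul f g) < e.
Proof.
move=> r1 Hg e e0; pose N := nr (hconj r) g + 1.
have N0 : 0 < N by rewrite ltr_wpDl// nr_ge0.
have q0 : 0 < hconj r by rewrite (lt_trans ltr01)// hconj_gt1.
have en : 0 < e / 2 / N by rewrite !divr_gt0.
have [t t0 ht] := powR_lt_eps q0 en.
pose d := t / 2; have d0 : 0 < d by rewrite divr_gt0.
have h1 : d `^ hconj r * nr (hconj r) g < e / 2.
  have h : d `^ hconj r < e / 2 / N by apply: ht; [exact: ltW|rewrite /d; lra].
  have h2 : d `^ hconj r * N < e / 2 by rewrite -ltr_pdivlMr.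
  apply: le_lt_trans h2; apply: (ler_wpM2l (powR_ge0 _ _)); rewrite /N; clear; lra.
have p0 : 0 < d^-1 `^ r by rewrite powR_gt0// invr_gt0.
exists (e / 2 / d^-1 `^ r); first by rewrite !divr_gt0.
move=> f Hf h; have h2 := lt_div_mul p0 h.
have [_ h3] := LpM_hconj r1 d0 Hf Hg; apply: (le_lt_trans h3).
have h4 := ltrD h2 h1; rewrite -splitr in h4; exact: h4.
Qed.

Lemma fcM_small (r : R) (g : fT R) : 1 < r -> Lp (hconj r) g -> forall e : R, 0 < e ->
  exists2 d : R, 0 < d & forall f, Lp r f -> nr r f < d -> forall n, cabs (fc (fmul f g) n) < e.
Proof.
move=> r1 Hg e e0; have [d d0 hd] := nrM_small r1 Hg e0; exists d => // f Hf h n.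
exact: (le_lt_trans (fc_abs n (Lp1M_hconj r1 Hf Hg)) (hd f Hf h)).
Qed.

Definition riesz_bounded (r K : R) := forall f : fT R, Lp r f ->
  [/\ Lp r (Pr f), nr r (Pr f) <= K * nr r f & forall n, fc (Pr f) n = if 0 <= n then fc f n else 0].

Lemma Lp_Lp1 (r : R) (f : fT R) : 1 <= r -> Lp r f -> Lp 1 f.
Proof. by move=> r1 H; case: (Lp_sub ler01 r1 H). Qed.

Lemma riesz_ext (r K : R) : 1 < r -> 0 <= K ->
  (forall s, nr r (tp (tpP s)) <= K * nr r (tp s : fT R)) -> riesz_bounded r (K * (2 `^ r * 2 `^ r)).
Proof.
move=> r1 K0 hK f Hf; have r1' := ltW r1; have r0 : 0 <= r by exact: le_trans r1'.
have E s s' : fsub (tp (tpP s)) (tp (tpP s')) = tp (tpP (s ++ tpopp s' (-1))) :> fT R.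
  rewrite tpP_cat tp_cat tpP_scale tp_scale; apply/funext => x.
  by rewrite /fsub /fadd /fscale mulN1r.
have E' s s' : fsub (tp s) (tp s') = tp (s ++ tpopp s' (-1)) :> fT R.
  by rewrite tp_cat tp_scale; apply/funext => x; rewrite /fsub /fadd /fscale mulN1r.
have bS2 (s s' : seq (int * C)) : nr r (fsub (tp (tpP s)) (tp (tpP s'))) <= K * nr r (fsub (tp s) (tp s')).
  by rewrite E E'; exact: hK.
have [g [Lg ng hg]] := ext_op r1' K0 (fun s => Lp_tp (tpP s) r0) hK bS2 Hf.
have L1g := Lp_Lp1 r1' Lg; have L1f := Lp_Lp1 r1' Hf.
have fcg n : fc g n = if 0 <= n then fc f n else 0.
  apply/eqP; rewrite -subr_eq0; apply/eqP/cabs_eps0 => e e0.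
  have e20 : 0 < e / 2 by rewrite divr_gt0.
  have [d d0 hd] := fc_small r1' e20; have [s [h1 h2]] := hg d d0.
  have Ls := Lp_tp s r0; have LP := Lp_tp (tpP s) r0.
  have {}h1 := hd _ (LpB r0 Ls Hf).1 h1 n; have {}h2 := hd _ (LpB r0 LP Lg).1 h2 n.
  rewrite (fcB n (Lp_Lp1 r1' Ls) L1f) in h1.
  rewrite (fcB n (Lp_Lp1 r1' LP) L1g) fc_tpP in h2.
  case: ifP h2 => hn h2.
    have -> : fc g n - fc f n = (fc (tp s) n - fc f n) - (fc (tp s) n - fc g n) by ring.
    by rewrite (splitr e); apply: (le_lt_trans (cabsB _ _)); exact: (ltrD h1 h2).
  rewrite sub0r cabsN in h2; rewrite subr0; apply: (lt_trans h2).
  by clear -e0; lra.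
have [LP fP] := PrP L1g fcg.
have ae : aeq g (Pr f) by apply: (fc_uniq L1g LP) => n; rewrite fcg fP.
have mP := Lp_cmeas LP.
split; [exact: (Lp_ae mP ae Lg)|by rewrite -(nr_ae r (Lp_cmeas Lg) mP ae)|exact: fP].
Qed.

Lemma cint_tpow_conj (f : fT R) n : Lp 1 f ->
  cint (fmul (tpow n) (conjf f)) = Complex (2 * pi) 0 * conjc (fc f n).
Proof. by move=> H; rewrite cint_fc fc_shift fc_conj// sub0r opprK. Qed.
Lemma cint_tp_conj (f : fT R) s : Lp 1 f ->
  cint (fmul (tp s) (conjf f)) = \sum_(kc <- s) kc.2 * (Complex (2 * pi) 0 * conjc (fc f kc.1)).
Proof.
move=> H; have Hc := (Lp_conj H).1.
have E : fmul (tp s) (conjf f) = fun x => \sum_(kc <- s) kc.2 * (fmul (tpow kc.1) (conjf f)) x.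
  by apply/funext => x; rewrite /fmul /tp mulr_suml; apply: eq_bigr => kc _; rewrite mulrA.
have L k : Lp 1 (fmul (tpow k) (conjf f)) by case: (Lp_tpow k Hc).
have LL (kc : int * C) : Lp 1 (fun x => kc.2 * (fmul (tpow kc.1) (conjf f)) x).
  exact: (LpZ kc.2 (L kc.1)).1.
rewrite E (cint_sum s LL).
by apply: eq_bigr => kc _; rewrite (cintZ _ (L _)) (cint_tpow_conj _ H).
Qed.

Lemma mul_conjc (z : C) : z * conjc z = Complex (cabs z ^+ 2) 0.
Proof. by apply: complexP; rewrite ?ReM ?ImM ?ReJ ?ImJ /= ?cabs_sqr; ring. Qed.
Lemma powR_mulX (x r s : R) : 0 <= x -> r + s != 0 -> s != 0 -> x `^ r * x `^ s = x `^ (r + s).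
Proof.
move=> x0 rs s0; have [->|xn] := eqVneq x 0; first by rewrite (powR0 rs) (powR0 s0) mulr0.
by rewrite -powRD// xn implybT.
Qed.

Lemma absorb_half (c a b B y t : R) : c <= 2 * a -> a <= y + t * b -> t * b <= t * B * c ->
  2 * (t * B) * c <= 2^-1 * c -> c <= 4 * y.
Proof. by move=> *; lra. Qed.
Lemma split_le (K x y e : R) : 0 <= x -> 0 <= K -> y <= K * x -> (K + 1) * x < e -> x < e /\ y < e.
Proof. by move=> x0 K0 h1 h2; have := mulr_ge0 K0 x0 => h3; split; lra. Qed.
Lemma cabs_half (x y z : C) (e : R) : cabs (x - z) < e / 2 -> cabs (x - y) < e / 2 -> cabs (y - z) < e.
Proof.
move=> h1 h2; have -> : y - z = (x - z) - (x - y) by ring.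
by rewrite (splitr e); apply: (le_lt_trans (cabsB _ _)); exact: (ltrD h1 h2).
Qed.

(* Converse Hoelder inequality, tested with psi = h |h|^(r-2) damped by the factor
   n / (n + |h|^r) to make it bounded. *)
Lemma dualbound (r B : R) : 1 < r -> 0 <= B -> exists2 K : R, 0 <= K &
  forall (h phi : fT R), Lp 1 h -> Lp r phi ->
  (forall psi, Linf psi -> exists k, [/\ Lp (hconj r) k, nr (hconj r) k <= B * nr (hconj r) psi &
     cint (fmul h (conjf psi)) = cint (fmul phi (conjf k))]) ->
  Lp r h /\ nr r h <= K * nr r phi.
Proof.
move=> r1 B0; have q1 := hconj_gt1 r1; set q := hconj r in q1 *.
have q0 : 0 < q by exact: lt_trans q1.
have r0 : 0 < r by exact: lt_trans r1.
have e0 : 0 < (4 * (B + 1))^-1 by rewrite invr_gt0 mulr_gt0// ltr_wpDl.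
(* [d] is chosen so that 2 d^q B <= 1/2, which allows the absorption at the end. *)
have [t t0 ht] := powR_lt_eps q0 e0.
pose d := t / 2; have d0 : 0 < d by rewrite divr_gt0.
have hd : 2 * (d `^ q * B) <= 2^-1.
  have h1 : d `^ q < (4 * (B + 1))^-1 by apply: ht; [exact: ltW|rewrite /d; lra].
  have B1 : 0 < 4 * (B + 1) by rewrite mulr_gt0// ltr_wpDl.
  have h2 : d `^ q * (4 * (B + 1)) < 1 by rewrite -ltr_pdivlMr// mul1r.
  by move: (powR_ge0 d q) h2; move: (d `^ q) => y y0 h2; clear -y0 h2; lra.
exists (4 * d^-1 `^ r); first by rewrite mulr_ge0// powR_ge0.
move=> h phi Lh Lphi H; have mh := Lp_cmeas Lh.
pose m x := cabs (h x) `^ r.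
have m0 x : 0 <= m x by exact: powR_ge0.
have mm : measurable_fun D m by exact: meas_cabs_powR.
pose w (n : nat) x := n.+1%:R * (n.+1%:R + m x)^-1 : R.
have dp n x : 0 < n.+1%:R + m x :> R by rewrite ltr_wpDr.
have w0 n x : 0 <= w n x by rewrite /w mulr_ge0// invr_ge0 ltW.
have w1 n x : w n x <= 1 by rewrite /w ler_pdivrMr// mul1r lerDl.
have mw n : measurable_fun D (w n).
  apply: measurable_funM; first exact: measurable_cst.
  apply: meas_inv_ge0; first by move=> x; exact: ltW.
  by apply: measurable_funD => //; exact: measurable_cst.
have mwn n x : m x * w n x <= n.+1%:R.
  rewrite /w mulrCA ler_piMr// ler_pdivrMr// mul1r lerDr//.
have Iw n : rmi (fun x => m x * w n x).
  apply: (@rmi_le R _ (fun=> n.+1%:R)); last exact: rmi_cst.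
    exact: measurable_funM.
  by apply: aedW => x _; rewrite ger0_norm; [exact: mwn|apply: mulr_ge0].
pose psi n : fT R := fun x => Complex (cabs (h x) `^ (r - 2) * w n x) 0 * h x.
have mpsi n : cmeas (psi n).
  apply: cmeasM => //; apply: cmeas_real; apply: measurable_funM => //.
  exact: meas_cabs_powR.
have apsi n x : cabs (psi n x) = cabs (h x) `^ (r - 1) * w n x.
  rewrite /psi cabsM cabs_real ger0_norm; last by apply: mulr_ge0; [exact: powR_ge0|exact: w0].
  rewrite mulrAC; congr (_ * _).
  rewrite -{2}(powRr1 (cabs_ge0 (h x))) powR_mulX ?cabs_ge0//.
  - by congr powR; ring.
  - by rewrite gt_eqF//; clear -r1; lra.
have Linfpsi n : Linf (psi n).
  apply: (@Linf_intro R _ n.+1%:R) => //; apply: aedW => x _.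
  rewrite apsi /w mulrCA ler_piMr// ler_pdivrMr// mul1r.
  apply: (le_trans (@powR_le1D R (r - 1) r _ _ _ (cabs_ge0 _))); try (clear -r1; lra).
  by rewrite lerD2r ler1n.
pose X n := rint (fun x => m x * w n x).
have X0 n : 0 <= X n by apply: rint_ge0 => x _; apply: mulr_ge0.
have cX n : cint (fmul h (conjf (psi n))) = Complex (X n) 0.
  have -> : fmul h (conjf (psi n)) = fun x => Complex (m x * w n x) 0.
    apply/funext => x; rewrite /fmul /conjf /psi conjcM conjcR mulrCA mul_conjc.
    have -> : m x = cabs (h x) `^ (r - 2) * cabs (h x) ^+ 2.
      rewrite -powR_mulrn ?cabs_ge0// powR_mulX ?cabs_ge0//.
        by rewrite subrK.
      by rewrite subrK gt_eqF.
    by apply: complexP; rewrite ?ReM ?ImM /=; ring.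
  by rewrite cintE /= rint_cst mul0r.
(* (r - 1) q = r, and w^q <= w because 0 <= w <= 1. *)
have npsi n : nr q (psi n) <= X n.
  have [] := @Lp_le R q (psi n) _ (mpsi n) (Iw n) => //.
  apply: aedW => x _; rewrite apsi powRM ?powR_ge0// -powRrM hconjM//.
  apply: (ler_wpM2l (m0 x)).
  have := powR_lip_bound (ltW q1) (w0 n x) (w1 n x).
  by rewrite powR1 mul1r.
(* X n reappears on the right with a factor at most 1/2; being finite thanks to the damping, it
   moves to the left. *)
have XK n : X n <= 4 * d^-1 `^ r * nr r phi.
  have [k [Lk nk ck]] := H _ (Linfpsi n).
  have [Lkc nkc] := Lp_conj Lk.
  have [L1 n1] := LpM_hconj r1 d0 Lphi Lkc; rewrite nkc in n1.
  have h1 := cint_abs L1; rewrite -ck cX cabs_real (ger0_norm (X0 n)) in h1.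
  have h2 : d `^ q * nr q k <= d `^ q * B * X n.
    rewrite -mulrA; apply: (ler_wpM2l (powR_ge0 _ _)).
    exact: (le_trans nk (ler_wpM2l B0 (npsi n))).
  have h3 := ler_wpM2r (X0 n) hd.
  rewrite -[4 * _ * _]mulrA; exact: (absorb_half h1 n1 h2 h3).
have [] := @rint_fatou R (fun n x => m x * w n x) m _ Iw _ mm XK _ m0.
- by move=> n x _; apply: mulr_ge0.
- apply: aedW => x _; apply: cvgn_eps => e e_gt0.
  pose N := Num.bound (m x ^+ 2 / e); exists N => n Nn.
  have hN : m x ^+ 2 / e < n.+1%:R.
    apply: (lt_le_trans (archi_boundP _)); first by rewrite divr_ge0 ?exprn_ge0// ltW.
    by rewrite ler_nat leqW.
  have -> : m x * w n x - m x = - (m x ^+ 2 / (n.+1%:R + m x)).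
    rewrite /w; move: (gt_eqF (dp n x)); move: (n.+1%:R : R) => y yn.
    by field; rewrite yn.
  rewrite normrN ger0_norm; last by rewrite divr_ge0 ?exprn_ge0// ltW.
  rewrite ltr_pdivrMr// mulrC -ltr_pdivrMr//; apply: (lt_le_trans hN).
  by rewrite lerDl.
by move=> I1 I2; split; [exact: (rmi_Lp mh I1)|rewrite nrE].
Qed.

Lemma riesz (r : R) : 1 < r -> exists2 K : R, 0 <= K & riesz_bounded r K.
Proof.
move=> r1; have c0 (s : R) : 0 <= 2 `^ s * 2 `^ s by rewrite mulr_ge0 ?powR_ge0.
have small (s : R) : 1 < s -> s <= 2 -> exists2 K : R, 0 <= K & riesz_bounded s K.
  move=> s1 s2; have [K K0 hK] := riesz_tp s1 s2.
  by exists (K * (2 `^ s * 2 `^ s)); [exact: mulr_ge0|exact: riesz_ext].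
have [r2|r2] := leP r 2; first exact: small.
have q1 := hconj_gt1 r1; have [B B0 hB] := small _ q1 (hconj_le2 (ltW r2)).
have [K K0 hK] := dualbound r1 B0.
exists (K * (2 `^ r * 2 `^ r)); first exact: mulr_ge0.
apply: riesz_ext => // s; have r0 : 0 <= r by rewrite ltW// (lt_trans ltr01).
have [] := hK (tp (tpP s)) (tp s) (Lp_tp (tpP s) ler01) (Lp_tp s r0) => //.
move=> psi Lpsi; have q0 : 0 <= hconj r by rewrite ltW// (lt_trans ltr01).
have Lq := Linf_Lp q0 Lpsi; have [LP nP fP] := hB _ Lq.
exists (Pr psi); split => //.
(* P is self-adjoint: both pairings are finite sums over the nonnegative frequencies of [s]. *)
rewrite (cint_tp_conj _ (Lp_Lp1 (ltW q1) Lq)) (cint_tp_conj _ (Lp_Lp1 (ltW q1) LP)).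
rewrite /tpP big_filter big_mkcond; apply: eq_bigr => kc _; rewrite fP.
by case: ifP => // _; rewrite conjc0 !mulr0.
Qed.

Lemma riesz_Lp (r : R) (f : fT R) : 1 < r -> Lp r f -> Lp r (Pr f).
Proof. by move=> r1 H; have [K _ /(_ _ H)[]] := riesz r1. Qed.
Lemma riesz_fc (r : R) (f : fT R) n : 1 < r -> Lp r f -> fc (Pr f) n = if 0 <= n then fc f n else 0.
Proof. by move=> r1 H; have [K _ /(_ _ H)[]] := riesz r1. Qed.

Lemma Pr_uniq (r : R) (f g : fT R) : 1 < r -> Lp r f -> Lp 1 g ->
  (forall n, fc g n = if 0 <= n then fc f n else 0) -> aeq (Pr f) g.
Proof.
move=> r1 Hf Hg h; apply: (fc_uniq (Lp_Lp1 (ltW r1) (riesz_Lp r1 Hf)) Hg) => n.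
by rewrite (riesz_fc _ r1 Hf) h.
Qed.

Lemma Pr_approx (r e : R) (f : fT R) : 1 < r -> Lp r f -> 0 < e ->
  exists s, nr r (fsub (tp s) f) < e /\ nr r (fsub (tp (tpP s)) (Pr f)) < e.
Proof.
move=> r1 Hf e0; have [K K0 hK] := riesz r1.
have r0 : 0 <= r by rewrite ltW// (lt_trans ltr01).
have r1' := ltW r1.
have d0 : 0 < e / (K + 1) by rewrite divr_gt0// ltr_wpDl.
have [s hs] := tp_dense r1' Hf d0; exists s.
have Ls := Lp_tp s r0; have LPs := Lp_tp (tpP s) r0.
have [LP _ fP] := hK _ Hf.
have [Ld _] := LpB r0 Ls Hf; have [_ nd _] := hK _ Ld.
have [Lx _] := LpB r0 LPs LP.
have ae : aeq (Pr (fsub (tp s) f)) (fsub (tp (tpP s)) (Pr f)).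
  apply: (Pr_uniq r1 Ld (Lp_Lp1 r1' Lx)) => n.
  rewrite (fcB _ (Lp_Lp1 r1' LPs) (Lp_Lp1 r1' LP)) (fcB _ (Lp_Lp1 r1' Ls) (Lp_Lp1 r1' Hf)) fc_tpP fP.
  by case: ifP => // _; rewrite subr0.
have E := nr_ae r (Lp_cmeas (riesz_Lp r1 Ld)) (Lp_cmeas Lx) ae.
have K1 : 0 < K + 1 by rewrite ltr_wpDl.
have h2 := lt_div_mul K1 hs; have n0 := nr_ge0 r (fsub (tp s) f).
rewrite E in nd; exact: (split_le n0 K0 nd h2).
Qed.

Lemma cint_small (r : R) (g : fT R) : 1 < r -> Lp (hconj r) g -> forall e : R, 0 < e ->
  exists2 d : R, 0 < d & forall f, Lp r f -> nr r f < d -> cabs (cint (fmul f g)) < e.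
Proof.
move=> r1 Hg e e0; have e2 : 0 < e / 2 by rewrite divr_gt0.
have [d d0 hd] := nrM_small r1 Hg e2; exists d => // f Hf h.
apply: (le_lt_trans (cint_abs (Lp1M_hconj r1 Hf Hg))).
by have h2 := hd f Hf h; rewrite mulrC -ltr_pdivlMr.
Qed.

Lemma fmulBl (f g h : fT R) : fmul (fsub f g) h = fsub (fmul f h) (fmul g h).
Proof. by apply/funext => x; rewrite /fmul /fsub mulrBl. Qed.
Lemma cintB (f g : fT R) : Lp 1 f -> Lp 1 g -> cint (fsub f g) = cint f - cint g.
Proof.
move=> Hf Hg; have Hg' := (LpZ (-1) Hg).1.
have -> : fsub f g = fun x => f x + fscale (-1) g x.
  by apply/funext => x; rewrite /fsub /fscale mulN1r.
by rewrite (cintD Hf Hg') (cintZ _ Hg) mulN1r.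
Qed.

(** For a polynomial [f] the two sides are the same finite sum; in general [f] and [Pr f] are
    approximated by one list and its projection. *)
Lemma Pr_pair (r : R) (f g : fT R) : 1 < r -> Lp r f -> Lp (hconj r) g ->
  cint (fmul (Pr f) (conjf g)) = cint (fmul f (conjf (Pr g))).
Proof.
move=> r1 Hf Hg; have q1 := hconj_gt1 r1; have r1' := ltW r1.
have r0 : 0 <= r by rewrite ltW// (lt_trans ltr01).
have LPg := riesz_Lp q1 Hg; have LPf := riesz_Lp r1 Hf.
have Hgc := (Lp_conj Hg).1; have LPgc := (Lp_conj LPg).1.
apply/eqP; rewrite -subr_eq0; apply/eqP/cabs_eps0 => e e0.
have e2 : 0 < e / 2 by rewrite divr_gt0.
have [d1 d10 h1] := cint_small r1 Hgc e2; have [d2 d20 h2] := cint_small r1 LPgc e2.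
have d0 : 0 < Num.min d1 d2 by rewrite lt_min d10.
have [s [k1 k2]] := Pr_approx r1 Hf d0.
rewrite lt_min in k1; case/andP: k1 => _ k1.
rewrite lt_min in k2; case/andP: k2 => k2 _.
have Ls := Lp_tp s r0; have LPs := Lp_tp (tpP s) r0.
have {}k1 := h2 _ (LpB r0 Ls Hf).1 k1; have {}k2 := h1 _ (LpB r0 LPs LPf).1 k2.
rewrite fmulBl (cintB (Lp1M_hconj r1 Ls LPgc) (Lp1M_hconj r1 Hf LPgc)) in k1.
rewrite fmulBl (cintB (Lp1M_hconj r1 LPs Hgc) (Lp1M_hconj r1 LPf Hgc)) in k2.
have E : cint (fmul (tp (tpP s)) (conjf g)) = cint (fmul (tp s) (conjf (Pr g))).
  rewrite (cint_tp_conj _ (Lp_Lp1 (ltW q1) Hg)) (cint_tp_conj _ (Lp_Lp1 (ltW q1) LPg)).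
  rewrite /tpP big_filter big_mkcond; apply: eq_bigr => kc _; rewrite (riesz_fc _ q1 Hg).
  by case: ifP => // _; rewrite conjc0 !mulr0.
rewrite E in k2; exact: (cabs_half k1 k2).
Qed.

Lemma Pr_Hp (r : R) (f : fT R) : 1 < r -> Hp r f -> aeq (Pr f) f.
Proof.
move=> r1 [Hf h]; apply: (Pr_uniq r1 Hf (Lp_Lp1 (ltW r1) Hf)) => n.
by case: (leP 0 n) => // n0; exact: h.
Qed.

Lemma Hp_Pr (r : R) (f : fT R) : 1 < r -> Lp r f -> Hp r (Pr f).
Proof.
move=> r1 Hf; split; first exact: riesz_Lp.
by move=> n n0; rewrite (riesz_fc _ r1 Hf) leNgt n0.
Qed.

Lemma fc_mul_tp s (g : fT R) n : Lp 1 g ->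
  fc (fmul (tp s) g) n = \sum_(kc <- s) kc.2 * fc g (n - kc.1).
Proof.
move=> Hg; elim: s => [|kc s IH].
  rewrite big_nil tp_nil; have -> : fmul (@f0 R) g = @f0 R by apply/funext => x; rewrite /fmul /f0 mul0r.
  exact: fc0.
have L1 := (LpZ kc.2 (Lp_tpow kc.1 Hg).1).1.
have [L M0 hM] := LpMinf ler01 (Linf_tp s); have [L2 _] := hM _ Hg.
have -> : fmul (tp (kc :: s)) g = fadd (fscale kc.2 (fmul (tpow kc.1) g)) (fmul (tp s) g).
  by rewrite tp_cons; apply/funext => x; rewrite /fmul /fadd /fscale; ring.
by rewrite big_cons (fcD _ L1 L2) IH (fcZ _ _ (Lp_tpow kc.1 Hg).1) fc_shift.
Qed.

Lemma sum_tpP s (F : int -> C) (n : int) : (forall k : int, k < 0 -> F k = 0) -> n <= 0 ->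
  \sum_(kc <- tpP s) kc.2 * F (n - kc.1) =
     if n == 0 then (\sum_(kc <- tpP s | kc.1 == 0) kc.2) * F 0 else 0.
Proof.
move=> hF n0; rewrite mulr_suml; case: (eqVneq n 0) => [->|nn].
  rewrite [RHS]big_mkcond /= /tpP !big_filter; apply: eq_bigr => kc kp.
  case: eqP => [->|/eqP kn]; first by rewrite subrr.
  by rewrite hF ?mulr0// sub0r oppr_lt0 lt_neqAle eq_sym kn.
rewrite /tpP big_filter; apply: big1 => kc kp; rewrite hF ?mulr0//.
by rewrite subr_lt0; apply: lt_le_trans kp; rewrite lt_neqAle nn.
Qed.

(** Since P f = f, [f] is a limit of analytic polynomials. For these, the coefficients of the
    product at n <= 0 are finite sums in which only the constant terms survive. *)
Lemma Hp_mul (r : R) (f g : fT R) : 1 < r -> Hp r f -> Hp (hconj r) g ->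
  Hp 1 (fmul f g) /\ fc (fmul f g) 0 = fc f 0 * fc g 0.
Proof.
move=> r1 Hf Hg; have [Lf f_] := Hf; have [Lg g_] := Hg.
have q1 := hconj_gt1 r1; have Lfg := Lp1M_hconj r1 Lf Lg.
have r0 : 0 <= r by rewrite ltW// (lt_trans ltr01).
have key (n : int) : n <= 0 -> fc (fmul f g) n = if n == 0 then fc f 0 * fc g 0 else 0.
  move=> n0; apply/eqP; rewrite -subr_eq0; apply/eqP/cabs_eps0 => e e0.
  have e2 : 0 < e / 2 by rewrite divr_gt0.
  have G0 : 0 < cabs (fc g 0) + 1 by rewrite ltr_wpDl// cabs_ge0.
  have e3 : 0 < e / 2 / (cabs (fc g 0) + 1) by rewrite divr_gt0.
  have [d1 d10 h1] := fcM_small r1 Lg e2; have [d2 d20 h2] := fc_small (ltW r1) e3.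
  have d0 : 0 < Num.min d1 d2 by rewrite lt_min d10.
  have [s [_ k1]] := Pr_approx r1 Lf d0.
  have LPs := Lp_tp (tpP s) r0.
  have Es : nr r (fsub (tp (tpP s)) (Pr f)) = nr r (fsub (tp (tpP s)) f).
    apply: nr_ae; [exact: (cmeasB (Lp_cmeas LPs) (Lp_cmeas (riesz_Lp r1 Lf)))|exact: (cmeasB (Lp_cmeas LPs) (Lp_cmeas Lf))|].
    by apply/aeqP; move/aeqP: (Pr_Hp r1 Hf); apply: aedS => x _ E; rewrite /fsub E.
  rewrite Es lt_min in k1; case/andP: k1 => k1 k2.
  have [Ld _] := LpB r0 LPs Lf.
  have {}k1 := h1 _ Ld k1 n; have {}k2 := h2 _ Ld k2 0.
  have LPg := Lp1M_hconj r1 LPs Lg.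
  rewrite fmulBl (fcB _ LPg Lfg) (fc_mul_tp _ _ (Lp_Lp1 (ltW q1) Lg)) in k1.
  rewrite (fcB _ (Lp_Lp1 (ltW r1) LPs) (Lp_Lp1 (ltW r1) Lf)) fc_tp in k2.
  have E : \sum_(kc <- tpP s) kc.2 * fc g (n - kc.1) =
     if n == 0 then (\sum_(kc <- tpP s | kc.1 == 0) kc.2) * fc g 0 else 0.
    exact: (sum_tpP s g_ n0).
  rewrite E in k1; move: k1 k2; case: (eqVneq n 0) => nn; last first.
    rewrite subr0 sub0r cabsN => k1 _; apply: (lt_trans k1); clear -e0; lra.
  move: (\sum_(kc <- _ | _) _) => t k1 k2.
  have k3 := lt_div_mul G0 k2.
  have -> : fc (fmul f g) n - fc f 0 * fc g 0 = (t - fc f 0) * fc g 0 - (t * fc g 0 - fc (fmul f g) n) by ring.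
  apply: (le_lt_trans (cabsB _ _)); rewrite cabsM (splitr e); apply: (ltrD _ k1).
  apply: le_lt_trans k3; rewrite mulrC; apply: (ler_wpM2r (cabs_ge0 _)).
  by rewrite lerDl.
split; last by rewrite key// eqxx.
by split => // n n0; rewrite key ?ltW// lt_eqF.
Qed.
End Duality.

(** * Wiener-Hopf factorization and Toeplitz operators *)
Section Fact.
Variable R : realType.
Notation C := (R[i]).
Notation D := (@dom R).
Implicit Types f g h k u v : fT R.

(* P f = P g *)
Definition peq f g := forall n : int, 0 <= n -> fc f n = fc g n.

Lemma gt1_ge0 (r : R) : 1 < r -> 0 <= r.
Proof. by move=> h; rewrite ltW// (lt_trans ltr01). Qed.
Lemma Linf_mul_Lp (r : R) g f : 0 <= r -> Linf g -> Lp r f -> Lp r (fmul g f).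
Proof. by move=> r0 Hg Hf; have [M _ /(_ _ Hf)[]] := LpMinf r0 Hg. Qed.
Lemma HpD (r : R) f g : 1 <= r -> Hp r f -> Hp r g -> Hp r (fadd f g).
Proof.
move=> r1 [Lf hf] [Lg hg]; split; first exact: (LpD (le_trans ler01 r1) Lf Lg).1.
by move=> n n0; rewrite (fcD _ (Lp_Lp1 r1 Lf) (Lp_Lp1 r1 Lg)) hf// hg// addr0.
Qed.

Lemma HpZ (r : R) z f : 1 <= r -> Hp r f -> Hp r (fscale z f).
Proof.
move=> r1 [Lf hf]; split; first exact: (LpZ z Lf).1.
by move=> n n0; rewrite (fcZ _ _ (Lp_Lp1 r1 Lf)) hf// mulr0.
Qed.

Lemma HpB (r : R) f g : 1 <= r -> Hp r f -> Hp r g -> Hp r (fsub f g).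
Proof.
move=> r1 [Lf hf] [Lg hg]; split; first exact: (LpB (le_trans ler01 r1) Lf Lg).1.
by move=> n n0; rewrite (fcB _ (Lp_Lp1 r1 Lf) (Lp_Lp1 r1 Lg)) hf// hg// subr0.
Qed.

Lemma Hp_tpow (r : R) (m : int) f : 0 <= m -> Hp r f -> Hp r (fmul (tpow m) f).
Proof.
move=> m0 [Lf hf]; split; first exact: (Lp_tpow m Lf).1.
by move=> n n0; rewrite fc_shift hf//; clear -m0 n0; lia.
Qed.

Lemma Hp_Hp1 (r : R) f : 1 <= r -> Hp r f -> Hp 1 f.
Proof. by move=> r1 [Lf hf]; split => //; exact: (Lp_Lp1 r1). Qed.
Lemma Hp_f0 (r : R) : 0 < r -> Hp r (@f0 R).
Proof. by move=> r0; split; [exact: (Lp_f0 r0).1|move=> n _; exact: fc0]. Qed.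

Lemma JopK f : Jop (Jop f) = f.
Proof.
apply/funext => x; rewrite /Jop tpow_shift opprK mulrA -tpowD addNr tpow0 mul1r.
by congr (f _); ring.
Qed.

Lemma tildeK f : tilde (tilde f) = f.
Proof. by apply/funext => x; rewrite /tilde; congr (f _); ring. Qed.
Lemma Jop_mul u f : Jop (fmul u f) = fmul (tilde u) (Jop f).
Proof. by apply/funext => x; rewrite /Jop /fmul /tilde; ring. Qed.
Lemma JopD f g : Jop (fadd f g) = fadd (Jop f) (Jop g).
Proof. by apply/funext => x; rewrite /Jop /fadd; ring. Qed.
Lemma JopZ z f : Jop (fscale z f) = fscale z (Jop f).
Proof. by apply/funext => x; rewrite /Jop /fscale; ring. Qed.
Lemma Jop_aeq f g : aeq f g -> aeq (Jop f) (Jop g).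
Proof.
move/aeqP/aed_refl => h; apply/aeqP; apply: aedS h => x _.
by rewrite /refl /Jop => ->.
Qed.

Lemma tilde_aed (P : R -> Prop) : aed P -> aed (fun x => P (2 * pi - x)).
Proof. exact: aed_refl. Qed.

(** [J] interchanges H^r and the kernel of P, so P f = 0 can be written f = J k with k in H^r. *)
Lemma peq_Jop (r : R) f : 1 <= r -> Lp r f -> peq f (@f0 R) -> Hp r (Jop f).
Proof.
move=> r1 Lf h; split; first exact: (Lp_Jop Lf).1.
move=> n n0; rewrite (fc_Jop _ (Lp_Lp1 r1 Lf)) h ?fc0//; clear -n0; lia.
Qed.

Lemma Jop_peq k : Hp 1 k -> peq (Jop k) (@f0 R).
Proof.
move=> [Lk hk] n n0; rewrite (fc_Jop _ Lk) fc0 hk//; clear -n0; lia.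
Qed.

Lemma peq_uniq f g : Hp 1 f -> Hp 1 g -> peq f g -> aeq f g.
Proof.
move=> [Lf hf] [Lg hg] h; apply: (fc_uniq Lf Lg) => n.
by case: (leP 0 n) => [/h//|n0]; rewrite hf// hg.
Qed.

Lemma Hbar_tilde (r : R) f : 1 <= r -> Hbar r f -> Hp r (tilde f).
Proof.
move=> r1 [Lf hf]; split; first exact: (Lp_refl Lf).1.
by move=> n n0; rewrite (fc_tilde _ (Lp_Lp1 r1 Lf)) hf// oppr_gt0.
Qed.

Lemma Hbar_conj (r : R) f : 1 <= r -> Hbar r f -> Hp r (conjf f).
Proof.
move=> r1 [Lf hf]; split; first exact: (Lp_conj Lf).1.
by move=> n n0; rewrite (fc_conj _ (Lp_Lp1 r1 Lf)) hf ?conjc0// oppr_gt0.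
Qed.

Lemma Hp_conj (r : R) f : 1 <= r -> Hp r f -> Hbar r (conjf f).
Proof.
move=> r1 [Lf hf]; split; first exact: (Lp_conj Lf).1.
by move=> n n0; rewrite (fc_conj _ (Lp_Lp1 r1 Lf)) hf ?conjc0// oppr_lt0.
Qed.

(** u J k = J (k u~) with u~ in H^q, and k u~ lies in H^1. *)
Lemma Hbar_mulJ (r : R) u k : 1 < r -> Hbar (hconj r) u -> Hp r k ->
  Lp 1 (fmul u (Jop k)) /\ peq (fmul u (Jop k)) (@f0 R).
Proof.
move=> r1 Hu Hk; have q1 := hconj_gt1 r1.
have [H _] := Hp_mul r1 Hk (Hbar_tilde (ltW q1) Hu).
have E : fmul u (Jop k) = Jop (fmul k (tilde u)).
  rewrite -{1}[u]tildeK -Jop_mul; congr Jop; apply/funext => x.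
  by rewrite /fmul mulrC.
by rewrite E; split; [exact: (Lp_Jop H.1).1|exact: Jop_peq].
Qed.

Lemma fcg_small (r : R) g : 1 < r -> Linf g -> forall e : R, 0 < e ->
  exists2 d : R, 0 < d & forall f, Lp r f -> nr r f < d -> forall n, cabs (fc (fmul g f) n) < e.
Proof.
move=> r1 Hg e e0; have [d d0 hd] := fc_small (ltW r1) e0.
have [M M0 hM] := LpMinf (gt1_ge0 r1) Hg.
have M1 : 0 < M + 1 by rewrite ltr_wpDl.
exists (d / (M + 1)); first by rewrite divr_gt0.
move=> f Hf h n; have [L1 n1] := hM _ Hf.
apply: (hd _ L1 _ n); have h2 := lt_div_mul M1 h.
apply: le_lt_trans h2; apply: (le_trans n1); apply: (ler_wpM2r (nr_ge0 _ _)).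
by rewrite lerDl.
Qed.

Lemma finv_conj f : finv (conjf f) = conjf (finv f).
Proof.
apply/funext => x; rewrite /finv /conjf; move: (f x) => z.
by apply: complexP; rewrite ?ReV ?ImV ?ReJ ?ImJ ?ReV ?ImV sqrrN// !mulNr.
Qed.

(* T(g) is bijective on H^r with bounded inverse. *)
Definition Inv (r : R) g := [/\ Linf g,
  forall f, Hp r f -> peq (fmul g f) (@f0 R) -> aeq f (@f0 R) &
  exists2 K : R, 0 <= K & forall G, Lp r G -> exists f, [/\ Hp r f, nr r f <= K * nr r G & peq (fmul g f) G]].

(** A factorization with m = 0, the power of t being multiplied into [g]. Nonvanishing is recorded
    because [finv] is total with value 0 at 0, so that membership of [finv gp] in H^r does not
    express it. *)
Definition Fac (r : R) g gm gp := [/\ [/\ Linf g, Linf (finv g) & aeq g (fmul gm gp)],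
  Hp (hconj r) gp /\ Hp r (finv gp), Hbar r gm /\ Hbar (hconj r) (finv gm) &
  aed (fun x => gp x != 0) /\ aed (fun x => gm x != 0)].

(** The boundedness clause is kept apart from [Fac]: conjugation carries [Fac] to the dual exponent
    formally, [Bd] only by way of the inverse of T(g). *)
Definition Bd (r : R) gp := exists2 c : R, 0 <= c & forall s,
  Lp r (fmul (finv gp) (Pr (fmul gp (tp s)))) /\
  nr r (fmul (finv gp) (Pr (fmul gp (tp s)))) <= c * nr r (tp s).

Lemma Fac_dual (r : R) g gm gp : 1 < r -> Fac r g gm gp -> Fac (hconj r) (conjf g) (conjf gp) (conjf gm).
Proof.
move=> r1 [[Lg Lig /aeqP E] [Hgp Higp] [Hgm Higm] [gp0 gm0]].
have q1 := hconj_gt1 r1.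
split; rewrite ?hconjK//.
- split; [exact: Linf_conj|by rewrite finv_conj; exact: Linf_conj|].
  by apply/aeqP; apply: aedS E => x _; rewrite /conjf => ->; rewrite /fmul conjcM mulrC.
- by split; [exact: (Hbar_conj (ltW r1))|rewrite finv_conj; exact: (Hbar_conj (ltW q1))].
- by split; [exact: (Hp_conj (ltW q1))|rewrite finv_conj; exact: (Hp_conj (ltW r1))].
- by split; [apply: aedS gm0|apply: aedS gp0] => x _; rewrite /conjf conjc_eq0.
Qed.

(** If g f = J k, then gp f = gm^-1 J k, with coefficients only at n >= 0 on the left and only at n
    < 0 on the right. *)
Lemma Fac_inj (r : R) g gm gp f : 1 < r -> Fac r g gm gp -> Hp r f ->
  peq (fmul g f) (@f0 R) -> aeq f (@f0 R).
Proof.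
move=> r1 [[Lg Lig /aeqP E] [Hgp Higp] [Hgm Higm] [gp0 gm0]] Hf h.
have Lgf := Linf_mul_Lp (gt1_ge0 r1) Lg Hf.1.
have Hk := peq_Jop (ltW r1) Lgf h.
have [H1 _] := Hp_mul r1 Hf Hgp.
have [L2 p2] := Hbar_mulJ r1 Higm Hk; rewrite JopK in L2 p2.
have ae : aed (fun x => fmul f gp x = fmul (finv gm) (fmul g f) x).
  apply: aedS2 E gm0 => x _ e g0; rewrite /fmul e /fmul /finv.
  by field.
have /aeqP z : aeq (fmul f gp) (@f0 R).
  apply: (peq_uniq H1 (Hp_f0 ltr01)) => n n0.
  by rewrite -(p2 n n0); apply: fc_ae; [exact: (Lp_cmeas H1.1)|exact: (Lp_cmeas L2)|apply/aeqP].
apply/aeqP; apply: aedS2 z gp0 => x _; rewrite /fmul /f0 => /eqP; rewrite mulf_eq0.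
by case/orP => /eqP -> //; rewrite eqxx.
Qed.

Lemma fmulD f g h : fmul f (fadd g h) = fadd (fmul f g) (fmul f h).
Proof. by apply/funext => x; rewrite /fmul /fadd mulrDr. Qed.
Lemma fmulBr f g h : fmul f (fsub g h) = fsub (fmul f g) (fmul f h).
Proof. by apply/funext => x; rewrite /fmul /fsub mulrBr. Qed.
Lemma fmulZ z f g : fmul f (fscale z g) = fscale z (fmul f g).
Proof. by apply/funext => x; rewrite /fmul /fscale mulrCA. Qed.

(** gp^-1 P(gp phi) solves T(g) S = P(g phi), because g S - g phi = gm (P - I)(gp phi) has only
    negative frequencies. *)
Lemma Fac_tp (r : R) g gm gp s : 1 < r -> Fac r g gm gp ->
  let S := fmul (finv gp) (Pr (fmul gp (tp s))) in
  Lp r S -> Hp r S /\ peq (fmul g S) (fmul g (tp s)).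
Proof.
move=> r1 [[Lg Lig /aeqP E] [Hgp Higp] [Hgm Higm] [gp0 gm0]] S LS.
have q1 := hconj_gt1 r1; have q0 := gt1_ge0 q1; have r0 := gt1_ge0 r1.
have Lgt : Lp (hconj r) (fmul gp (tp s)).
  have -> : fmul gp (tp s) = fmul (tp s) gp by apply/funext => x; rewrite /fmul mulrC.
  exact: (Linf_mul_Lp q0 (Linf_tp s) Hgp.1).
have Hu := Hp_Pr q1 Lgt; pose u := Pr (fmul gp (tp s)); rewrite -/u in Hu.
have [HS _] := Hp_mul r1 Higp Hu; rewrite -/S in HS.
have HrS : Hp r S by split=> //; exact: HS.2.
split=> //; have LF := (LpB q0 Hu.1 Lgt).1.
have pF : peq (fsub u (fmul gp (tp s))) (@f0 R).
  move=> n n0; rewrite (fcB _ (Lp_Lp1 (ltW q1) Hu.1) (Lp_Lp1 (ltW q1) Lgt)) fc0.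
  by rewrite (riesz_fc _ q1 Lgt) n0 subrr.
have Hv := peq_Jop (ltW q1) LF pF.
have Hgm' : Hbar (hconj (hconj r)) gm by rewrite hconjK.
have [L2 p2] := Hbar_mulJ q1 Hgm' Hv; rewrite JopK in L2 p2.
have Lgs := Lp_Lp1 (ltW r1) (Linf_mul_Lp r0 Lg (Lp_tp s r0)); have LgS := Lp_Lp1 (ltW r1) (Linf_mul_Lp r0 Lg LS).
move=> n n0; apply/eqP; rewrite -subr_eq0 -(fcB _ LgS Lgs); apply/eqP.
rewrite -(fc0 R n) -(p2 n n0); apply: fc_ae; [exact: (Lp_cmeas (LpB ler01 LgS Lgs).1)|exact: (Lp_cmeas L2)|].
apply/aeqP; apply: aedS2 E gp0 => x _ e g0; rewrite /fsub /S -/u; move: (u) => w; rewrite /fmul e /fmul /finv.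
by field.
Qed.

(** T(g)^-1 P G = gp^-1 P(gp phi) for phi = g^-1 G; the right side is bounded on polynomials by [Bd]
    and extended by continuity. *)
Lemma Fac_solve (r : R) g gm gp : 1 < r -> Fac r g gm gp -> Bd r gp -> Inv r g.
Proof.
move=> r1 F [c c0 hc]; have [[Lg Lig Ea] [Hgp Higp] [Hgm Higm] [gp0 gm0]] := F.
have q1 := hconj_gt1 r1; have q0 := gt1_ge0 q1; have r0 := gt1_ge0 r1; have r1' := ltW r1.
split=> //; first by move=> f; exact: (Fac_inj r1 F).
pose S s := fmul (finv gp) (Pr (fmul gp (tp s))).
have LS s : Lp r (S s) := (hc s).1.
have nS s : nr r (S s) <= c * nr r (tp s) := (hc s).2.
have Lgt s : Lp (hconj r) (fmul gp (tp s)).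
  have -> : fmul gp (tp s) = fmul (tp s) gp by apply/funext => x; rewrite /fmul mulrC.
  exact: (Linf_mul_Lp q0 (Linf_tp s) Hgp.1).
have bS2 (s s' : seq (int * C)) : nr r (fsub (S s) (S s')) <= c * nr r (fsub (tp s) (tp s')).
  have E' : fsub (tp s) (tp s') = tp (s ++ tpopp s' (-1)) :> fT R.
    by rewrite tp_cat tp_scale; apply/funext => x; rewrite /fsub /fadd /fscale mulN1r.
  rewrite E'; apply: le_trans (nS _); rewrite le_eqVlt; apply/orP; left; apply/eqP.
  have LP s1 := riesz_Lp q1 (Lgt s1); have LP1 s1 := Lp_Lp1 (ltW q1) (LP s1).
  apply: nr_ae; [exact: (Lp_cmeas (LpB r0 (LS s) (LS s')).1)|exact: (Lp_cmeas (LS _))|].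
  have /aeqP ae : aeq (Pr (fmul gp (tp (s ++ tpopp s' (-1))))) (fsub (Pr (fmul gp (tp s))) (Pr (fmul gp (tp s')))).
    apply: (Pr_uniq q1 (Lgt _) (LpB ler01 (LP1 s) (LP1 s')).1) => n.
    rewrite (fcB _ (LP1 s) (LP1 s')) (riesz_fc _ q1 (Lgt s)) (riesz_fc _ q1 (Lgt s')).
    rewrite -E' fmulBr (fcB _ (Lp_Lp1 (ltW q1) (Lgt s)) (Lp_Lp1 (ltW q1) (Lgt s'))).
    by case: ifP => _; rewrite ?subr0.
  by apply/aeqP; apply: aedS ae => x _; rewrite /S /fmul /fsub => ->; rewrite mulrBr.
have [M M0 hM] := LpMinf r0 Lig.
have k0 : 0 <= c * (2 `^ r * 2 `^ r) by rewrite !mulr_ge0 ?powR_ge0.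
exists (c * (2 `^ r * 2 `^ r) * M); first exact: mulr_ge0.
move=> G LG; have [Lphi nphi] := hM _ LG; set phi := fmul (finv g) G in Lphi nphi.
have [f [Lf nf hf]] := ext_op r1' c0 LS nS bS2 Lphi.
exists f; split.
- split=> // n n0; apply: cabs_eps0 => e e0.
  have [d d0 hd] := fc_small r1' e0; have [s [_ h2]] := hf d d0.
  have [[_ hS] _] := Fac_tp r1 F (LS s).
  have := hd _ (LpB r0 (LS s) Lf).1 h2 n.
  by rewrite (fcB _ (Lp_Lp1 r1' (LS s)) (Lp_Lp1 r1' Lf)) hS// sub0r cabsN.
- apply: (le_trans nf); rewrite -[leRHS]mulrA; exact: (ler_wpM2l k0 nphi).
(* G = g phi almost everywhere because [g], the product of the two factors, does not vanish. *)
- move=> n n0; have -> : fc G n = fc (fmul g phi) n.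
    apply: fc_ae; [exact: (Lp_cmeas LG)|exact: (Lp_cmeas (Linf_mul_Lp r0 Lg Lphi))|].
    move/aeqP: Ea => Ea; apply/aeqP; apply: aedS3 Ea gp0 gm0 => x _ e h1 h2.
    have gn : g x != 0 by rewrite e /fmul mulf_neq0.
    by rewrite /phi /fmul /finv mulrA mulfV// mul1r.
  apply/eqP; rewrite -subr_eq0; apply/eqP/cabs_eps0 => e e0.
  have e2 : 0 < e / 2 by rewrite divr_gt0.
  have [d d0 hd] := fcg_small r1 Lg e2; have [s [h1 h2]] := hf d d0.
  have [_ pS] := Fac_tp r1 F (LS s).
  have {}h1 := hd _ (LpB r0 (Lp_tp s r0) Lphi).1 h1 n.
  have {}h2 := hd _ (LpB r0 (LS s) Lf).1 h2 n.
  have L1 h : Lp r h -> Lp 1 (fmul g h) by move=> Lh; exact: (Lp_Lp1 r1' (Linf_mul_Lp r0 Lg Lh)).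
  rewrite fmulBr (fcB _ (L1 _ (Lp_tp s r0)) (L1 _ Lphi)) in h1.
  rewrite fmulBr (fcB _ (L1 _ (LS s)) (L1 _ Lf)) (pS n n0) in h2.
  exact: (cabs_half h1 h2).
Qed.

(* The adjoint of phi |-> conj(gm)^-1 P(conj(gm) phi) is
   psi |-> gm P(gm^-1 psi), which equals g f where T(g) f = P psi. *)
Lemma Fac_Bd_dual (r : R) g gm gp : 1 < r -> Fac r g gm gp -> Inv r g -> Bd (hconj r) (conjf gm).
Proof.
move=> r1 F [Lg _ [K K0 hK]]; have [[_ Lig Ea] [Hgp Higp] [Hgm Higm] [gp0 gm0]] := F.
move/aeqP: Ea => Ea.
have q1 := hconj_gt1 r1; have q0 := gt1_ge0 q1; have r0 := gt1_ge0 r1; have r1' := ltW r1.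
have [M M0 hM] := LpMinf r0 Lg.
have B0 : 0 <= M * K by exact: mulr_ge0.
have [c c0 hc] := dualbound q1 B0; rewrite hconjK// in hc.
exists c => // s; have Lcgm := (Lp_conj Hgm.1).1.
have Lu0 : Lp r (fmul (conjf gm) (tp s)).
  have -> : fmul (conjf gm) (tp s) = fmul (tp s) (conjf gm) by apply/funext => x; rewrite /fmul mulrC.
  exact: (Linf_mul_Lp r0 (Linf_tp s) Lcgm).
have Lu := riesz_Lp r1 Lu0; set u := Pr _ in Lu *.
have Lic := (Lp_conj Higm.1).1.
apply: hc; [|exact: (Lp_tp s q0)|].
  have -> : fmul (finv (conjf gm)) u = fmul u (conjf (finv gm)).
    by rewrite finv_conj; apply/funext => x; rewrite /fmul mulrC.
  exact: (Lp1M_hconj r1 Lu Lic).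
move=> psi Lpsi; have Lr := Linf_Lp r0 Lpsi.
have [f [Hf nf pf]] := hK _ Lr; have [Lgf ngf] := hM _ Hf.1.
exists (fmul g f); split; first exact: Lgf.
  by apply: (le_trans ngf); rewrite -[leRHS]mulrA; exact: (ler_wpM2l M0 nf).
have Lip : Lp (hconj r) (fmul (finv gm) psi).
  have -> : fmul (finv gm) psi = fmul psi (finv gm) by apply/funext => x; rewrite /fmul mulrC.
  exact: (Linf_mul_Lp q0 Lpsi Higm.1).
have LPi := riesz_Lp q1 Lip.
have -> : fmul (fmul (finv (conjf gm)) u) (conjf psi) = fmul u (conjf (fmul (finv gm) psi)).
  by rewrite finv_conj; apply/funext => x; rewrite /fmul /conjf conjcM; ring.
rewrite (Pr_pair r1 Lu0 Lip).
have [H1 _] := Hp_mul r1 Hf Hgp.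
have LF := (LpB r0 Lr Lgf).1.
have pF : peq (fsub psi (fmul g f)) (@f0 R).
  by move=> n n0; rewrite (fcB _ (Lp_Lp1 r1' Lr) (Lp_Lp1 r1' Lgf)) fc0 (pf n n0) subrr.
have Hv := peq_Jop r1' LF pF.
have [L2 p2] := Hbar_mulJ r1 Higm Hv; rewrite JopK in L2 p2.
(* P(gm^-1 psi) = gp f: the difference of gm^-1 psi and gp f is gm^-1 (psi - g f), which has only
   negative frequencies. *)
have /aeqP ae : aeq (Pr (fmul (finv gm) psi)) (fmul f gp).
  apply: (Pr_uniq q1 Lip H1.1) => n; case: (leP 0 n) => n0; last exact: H1.2.
  apply/eqP; rewrite eq_sym -subr_eq0 -(fcB _ (Lp_Lp1 (ltW q1) Lip) H1.1); apply/eqP.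
  rewrite -(fc0 R n) -(p2 n n0).
  apply: fc_ae; [exact: (Lp_cmeas (LpB ler01 (Lp_Lp1 (ltW q1) Lip) H1.1).1)|exact: (Lp_cmeas L2)|].
  apply/aeqP; apply: aedS2 Ea gm0 => x _ e h0; rewrite /fsub /fmul e /fmul /finv.
  by field.
apply: cint_ae.
- exact: (cmeasM (Lp_cmeas Lu0) (cmeas_conj (Lp_cmeas LPi))).
- exact: (cmeasM (Lp_cmeas (Lp_tp s r0)) (cmeas_conj (Lp_cmeas Lgf))).
apply: aedS2 ae Ea => x _ e1 e2; rewrite /fmul /conjf e1 e2 /fmul !conjcM.
by ring.
Qed.

(** The transfer between exponents: a factorization of g in L^r inverts T(conj g) on H^q. *)
Lemma Fac_Inv_dual (r : R) g gm gp : 1 < r -> Fac r g gm gp -> Bd r gp -> Inv (hconj r) (conjf g).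
Proof.
move=> r1 F B; have I := Fac_solve r1 F B.
exact: (Fac_solve (hconj_gt1 r1) (Fac_dual r1 F) (Fac_Bd_dual r1 F I)).
Qed.
End Fact.

(** * Toeplitz plus Hankel operators, their inverses and adjoints *)

Section Operators.
Variable R : realType.
Notation C := (R[i]).
Notation D := (@dom R).
Implicit Types a b f g h k u v : fT R.

(** T(a) f + H(b) f before the projection, with J f in place of Q J f, which is the same on H^r by
    [Qr_Jop]. *)
Definition Eop a b f := fadd (fmul a f) (fmul b (Jop f)).
(* Up to null sets, Op f = P (a f + b J f). *)
Definition OpOf (r : R) a b (Op : fT R -> fT R) := exists2 K : R, 0 <= K &
  forall f, Hp r f -> [/\ Hp r (Op f), nr r (Op f) <= K * nr r f & peq (Op f) (Eop a b f)].

Lemma EopD a b f g : Eop a b (fadd f g) = fadd (Eop a b f) (Eop a b g).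
Proof. by apply/funext => x; rewrite /Eop /fadd /fmul /Jop; ring. Qed.
Lemma EopB a b f g : Eop a b (fsub f g) = fsub (Eop a b f) (Eop a b g).
Proof. by apply/funext => x; rewrite /Eop /fsub /fadd /fmul /Jop; ring. Qed.
Lemma EopZ a b z f : Eop a b (fscale z f) = fscale z (Eop a b f).
Proof. by apply/funext => x; rewrite /Eop /fscale /fadd /fmul /Jop; ring. Qed.
Lemma Eop_aeq a b f g : aeq f g -> aeq (Eop a b f) (Eop a b g).
Proof.
move=> h; have /aeqP h2 := Jop_aeq h; move/aeqP: h => h; apply/aeqP.
by apply: aedS2 h h2 => x _ e1 e2; rewrite /Eop /fadd /fmul e1 e2.
Qed.

Lemma Eop_Lp (r : R) a b : 1 < r -> Linf a -> Linf b -> exists2 K : R, 0 <= K &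
  forall f, Lp r f -> Lp r (Eop a b f) /\ nr r (Eop a b f) <= K * nr r f.
Proof.
move=> r1 La Lb; have r0 := gt1_ge0 r1.
have [M1 M10 h1] := LpMinf r0 La; have [M2 M20 h2] := LpMinf r0 Lb.
exists (2 `^ r * (M1 + M2)); first by rewrite mulr_ge0 ?powR_ge0 ?addr_ge0.
move=> f Lf; have [LJ nJ] := Lp_Jop Lf; have [L1 n1] := h1 _ Lf; have [L2 n2] := h2 _ LJ.
rewrite nJ in n2; have [L3 n3] := LpD r0 L1 L2; split; first exact: L3.
apply: (le_trans n3); rewrite -mulrA mulrDl.
exact: (ler_wpM2l (powR_ge0 _ _) (lerD n1 n2)).
Qed.

Lemma peq_trans g f h : peq f g -> peq g h -> peq f h.
Proof. by move=> h1 h2 n n0; rewrite h1// h2. Qed.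
Lemma peq_sym f g : peq f g -> peq g f.
Proof. by move=> h1 n n0; rewrite h1. Qed.
Lemma peq_ae f g : cmeas f -> cmeas g -> aeq f g -> peq f g.
Proof. by move=> mf mg h n _; exact: fc_ae. Qed.
Lemma peqD f1 f2 g1 g2 : Lp 1 f1 -> Lp 1 f2 -> Lp 1 g1 -> Lp 1 g2 ->
  peq f1 g1 -> peq f2 g2 -> peq (fadd f1 f2) (fadd g1 g2).
Proof. by move=> L1 L2 L3 L4 h1 h2 n n0; rewrite (fcD _ L1 L2) (fcD _ L3 L4) h1// h2. Qed.
Lemma peqB f1 f2 g1 g2 : Lp 1 f1 -> Lp 1 f2 -> Lp 1 g1 -> Lp 1 g2 ->
  peq f1 g1 -> peq f2 g2 -> peq (fsub f1 f2) (fsub g1 g2).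
Proof. by move=> L1 L2 L3 L4 h1 h2 n n0; rewrite (fcB _ L1 L2) (fcB _ L3 L4) h1// h2. Qed.
Lemma peqZ z f g : Lp 1 f -> Lp 1 g -> peq f g -> peq (fscale z f) (fscale z g).
Proof. by move=> L1 L2 h n n0; rewrite (fcZ _ _ L1) (fcZ _ _ L2) h. Qed.
Lemma Hp_uniq (r : R) f g : 1 < r -> Hp r f -> Hp r g -> peq f g -> aeq f g.
Proof. by move=> r1 Hf Hg; apply: peq_uniq; exact: (Hp_Hp1 (ltW r1)). Qed.

Lemma Eop_Lp1 (r : R) a b f : 1 < r -> Linf a -> Linf b -> Hp r f -> Lp 1 (Eop a b f).
Proof.
move=> r1 La Lb [Lf _]; have [K _ /(_ _ Lf)[L _]] := Eop_Lp r1 La Lb.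
exact: (Lp_Lp1 (ltW r1) L).
Qed.

Lemma OpOf_intro (r : R) a b Op : 1 < r -> Linf a -> Linf b ->
  (forall f, Hp r f -> Hp r (Op f) /\ peq (Op f) (Eop a b f)) -> OpOf r a b Op.
Proof.
move=> r1 La Lb h; have [K K0 hK] := Eop_Lp r1 La Lb; have [P P0 hP] := riesz r1.
exists (P * K); first exact: mulr_ge0.
move=> f Hf; have [H1 p1] := h f Hf; have [LE nE] := hK _ Hf.1.
have [LP nP fP] := hP _ LE; split; [exact: H1| |exact: p1].
have ae : aeq (Op f) (Pr (Eop a b f)).
  apply: (Hp_uniq r1 H1 (Hp_Pr r1 LE)) => n n0.
  by rewrite (p1 n n0) fP n0.
rewrite (nr_ae r (Lp_cmeas H1.1) (Lp_cmeas LP) ae); apply: (le_trans nP).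
rewrite -[leRHS]mulrA; exact: (ler_wpM2l P0 nE).
Qed.

(** [J] maps H^r into the kernel of P, where Q is the identity. *)
Lemma Qr_Jop (r : R) f : 1 < r -> Hp r f -> Lp r (Qr (Jop f)) /\ aeq (Qr (Jop f)) (Jop f).
Proof.
move=> r1 Hf; have LJ := (Lp_Jop Hf.1).1.
have pJ := Jop_peq (Hp_Hp1 (ltW r1) Hf).
have /aeqP z : aeq (Pr (Jop f)) (@f0 R).
  apply: (Pr_uniq r1 LJ (Lp_f0 ltr01).1) => n; rewrite fc0.
  by case: ifP => // n0; rewrite (pJ n n0) fc0.
split; first exact: (LpB (gt1_ge0 r1) LJ (riesz_Lp r1 LJ)).1.
by apply/aeqP; apply: aedS z => x _; rewrite /Qr /fsub => ->; rewrite /f0 subr0.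
Qed.

Lemma Top_peq (r : R) g f : 1 < r -> Linf g -> Lp r f ->
  Hp r (Top g f) /\ peq (Top g f) (fmul g f).
Proof.
move=> r1 Lg Lf; have Lgf := Linf_mul_Lp (gt1_ge0 r1) Lg Lf; split; first exact: Hp_Pr.
by move=> n n0; rewrite /Top (riesz_fc _ r1 Lgf) n0.
Qed.

Lemma Hop_peq (r : R) b f : 1 < r -> Linf b -> Hp r f ->
  Hp r (Hop b f) /\ peq (Hop b f) (fmul b (Jop f)).
Proof.
move=> r1 Lb Hf; have [LQ /aeqP ae] := Qr_Jop r1 Hf; have LJ := (Lp_Jop Hf.1).1.
have Lbq := Linf_mul_Lp (gt1_ge0 r1) Lb LQ; have LbJ := Linf_mul_Lp (gt1_ge0 r1) Lb LJ.
split; first exact: Hp_Pr.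
move=> n n0; rewrite /Hop (riesz_fc _ r1 Lbq) n0.
apply: fc_ae; [exact: (Lp_cmeas Lbq)|exact: (Lp_cmeas LbJ)|].
by apply/aeqP; apply: aedS ae => x _; rewrite /fmul => ->.
Qed.

Lemma OpOf_THop (r : R) a b : 1 < r -> Linf a -> Linf b -> OpOf r a b (THop a b).
Proof.
move=> r1 La Lb; apply: (OpOf_intro r1 La Lb) => f Hf.
have [H1 p1] := Top_peq r1 La Hf.1; have [H2 p2] := Hop_peq r1 Lb Hf.
have r1' := ltW r1; have r0 := gt1_ge0 r1.
split; first exact: (HpD r1' H1 H2).
apply: (peqD (Lp_Lp1 r1' H1.1) (Lp_Lp1 r1' H2.1) _ _ p1 p2).
  exact: (Lp_Lp1 r1' (Linf_mul_Lp r0 La Hf.1)).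
exact: (Lp_Lp1 r1' (Linf_mul_Lp r0 Lb (Lp_Jop Hf.1).1)).
Qed.

Definition fopp b : fT R := fscale (-1) b.
Lemma OpOf_THmop (r : R) a b : 1 < r -> Linf a -> Linf b -> OpOf r a (fopp b) (THmop a b).
Proof.
move=> r1 La Lb; have Lb' : Linf (fopp b) by apply: LinfM => //; exact: Linf_cst.
apply: (OpOf_intro r1 La Lb') => f Hf.
have [H1 p1] := Top_peq r1 La Hf.1; have [H2 p2] := Hop_peq r1 Lb Hf.
have r1' := ltW r1; have r0 := gt1_ge0 r1.
split; first exact: (HpB r1' H1 H2).
have -> : Eop a (fopp b) f = fsub (fmul a f) (fmul b (Jop f)).
  by apply/funext => x; rewrite /Eop /fopp /fscale /fmul /fsub /fadd; ring.
apply: (peqB (Lp_Lp1 r1' H1.1) (Lp_Lp1 r1' H2.1) _ _ p1 p2).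
  exact: (Lp_Lp1 r1' (Linf_mul_Lp r0 La Hf.1)).
exact: (Lp_Lp1 r1' (Linf_mul_Lp r0 Lb (Lp_Jop Hf.1).1)).
Qed.

Lemma Eop_f0 g f : Eop g (@f0 R) f = fmul g f.
Proof. by apply/funext => x; rewrite /Eop /fadd /fmul /f0 mul0r addr0. Qed.
Lemma Linf_f0 : Linf (@f0 R).
Proof. exact: Linf_cst. Qed.
Lemma OpOf_Top (r : R) g : 1 < r -> Linf g -> OpOf r g (@f0 R) (Top g).
Proof.
move=> r1 Lg; apply: (OpOf_intro r1 Lg Linf_f0) => f Hf; rewrite Eop_f0.
exact: (Top_peq r1 Lg Hf.1).
Qed.

Lemma OpOf_bop (r : R) a b Op : 1 < r -> Linf a -> Linf b -> OpOf r a b Op -> bop r Op.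
Proof.
move=> r1 La Lb [K K0 hK]; have r1' := ltW r1.
have HO f : Hp r f -> Hp r (Op f) by move=> Hf; case: (hK f Hf).
have pO f : Hp r f -> peq (Op f) (Eop a b f) by move=> Hf; case: (hK f Hf).
have LE f : Hp r f -> Lp 1 (Eop a b f) := @Eop_Lp1 r a b f r1 La Lb.
have LO f : Hp r f -> Lp 1 (Op f) by move=> Hf; exact: (Lp_Lp1 r1' (HO f Hf).1).
split=> //.
- move=> f g Hf Hg; have Hfg := HpD r1' Hf Hg.
  apply: (Hp_uniq r1 (HO _ Hfg) (HpD r1' (HO _ Hf) (HO _ Hg))).
  apply: (peq_trans (pO _ Hfg)); rewrite EopD; apply: peq_sym.
  exact: (peqD (LO _ Hf) (LO _ Hg) (LE _ Hf) (LE _ Hg) (pO _ Hf) (pO _ Hg)).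
- move=> z f Hf; have Hz := HpZ z r1' Hf.
  apply: (Hp_uniq r1 (HO _ Hz) (HpZ z r1' (HO _ Hf))).
  apply: (peq_trans (pO _ Hz)); rewrite EopZ; apply: peq_sym.
  exact: (peqZ z (LO _ Hf) (LE _ Hf) (pO _ Hf)).
- move=> f g Hf Hg h; apply: (Hp_uniq r1 (HO _ Hf) (HO _ Hg)).
  apply: (peq_trans (pO _ Hf)); apply: peq_sym; apply: (peq_trans (pO _ Hg)).
  apply: (peq_ae (Lp_cmeas (LE _ Hg)) (Lp_cmeas (LE _ Hf))).
  exact: (Eop_aeq a b (aeq_sym h)).
- exists K => f Hf; have [H1 n1 _] := hK f Hf.
  by rewrite (pintE H1.1) (pintE Hf.1) -EFinM lee_fin.
Qed.

Definition Einj (r : R) a b := forall f, Hp r f -> peq (Eop a b f) (@f0 R) -> aeq f (@f0 R).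
Definition Esurj (r : R) a b := forall psi, Hp r psi -> exists2 f, Hp r f & peq (Eop a b f) psi.

Lemma Einj_uniq (r : R) a b f g : 1 < r -> Linf a -> Linf b -> Einj r a b ->
  Hp r f -> Hp r g -> peq (Eop a b f) (Eop a b g) -> aeq f g.
Proof.
move=> r1 La Lb inj Hf Hg h; have r1' := ltW r1.
have /aeqP z : aeq (fsub f g) (@f0 R).
  apply: (inj _ (HpB r1' Hf Hg)) => n n0.
  by rewrite EopB (fcB _ (Eop_Lp1 r1 La Lb Hf) (Eop_Lp1 r1 La Lb Hg)) h// subrr fc0.
by apply/aeqP; apply: aedS z => x _ /eqP; rewrite /fsub /f0 subr_eq0 => /eqP.
Qed.

(** The inverse is a choice of solution. Injectivity makes it unique up to null sets, and from this
    uniqueness come linearity, compatibility with almost everywhere equality and the bound. *)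
Lemma OpOf_invertible (r : R) a b Op : 1 < r -> Linf a -> Linf b -> OpOf r a b Op ->
  Einj r a b ->
  (exists2 K : R, 0 <= K & forall psi, Hp r psi ->
     exists f, [/\ Hp r f, nr r f <= K * nr r psi & peq (Eop a b f) psi]) ->
  invertible r Op.
Proof.
move=> r1 La Lb [K K0 hK] inj [M M0 hM]; have r1' := ltW r1.
pose B psi := xget (@f0 R) [set f | Hp r f /\ peq (Eop a b f) psi].
have BP psi : Hp r psi -> Hp r (B psi) /\ peq (Eop a b (B psi)) psi.
  move=> H; have [f [H1 _ H2]] := hM _ H.
  by have := @xgetPex _ (@f0 R) [set f | Hp r f /\ peq (Eop a b f) psi]; apply; exists f.
have HB psi : Hp r psi -> Hp r (B psi) by move=> H; case: (BP _ H).
have pB psi : Hp r psi -> peq (Eop a b (B psi)) psi by move=> H; case: (BP _ H).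
have U f g := @Einj_uniq r a b f g r1 La Lb inj.
have LE f : Hp r f -> Lp 1 (Eop a b f) := @Eop_Lp1 r a b f r1 La Lb.
have L1 f : Hp r f -> Lp 1 f by move=> H; exact: (Lp_Lp1 r1' H.1).
exists B; split; last first.
  move=> f Hf; have [H1 _ p1] := hK f Hf; split.
    by apply: (U _ _ (HB _ H1) Hf); exact: (peq_trans (pB _ H1) p1).
  have [H2 _ p2] := hK _ (HB _ Hf).
  by apply: (Hp_uniq r1 H2 Hf); exact: (peq_trans p2 (pB _ Hf)).
split=> //.
- move=> f g Hf Hg; have Hfg := HpD r1' Hf Hg.
  apply: (U _ _ (HB _ Hfg) (HpD r1' (HB _ Hf) (HB _ Hg))).
  apply: (peq_trans (pB _ Hfg)); rewrite EopD; apply: peq_sym.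
  exact: (peqD (LE _ (HB _ Hf)) (LE _ (HB _ Hg)) (L1 _ Hf) (L1 _ Hg) (pB _ Hf) (pB _ Hg)).
- move=> z f Hf; have Hz := HpZ z r1' Hf.
  apply: (U _ _ (HB _ Hz) (HpZ z r1' (HB _ Hf))).
  apply: (peq_trans (pB _ Hz)); rewrite EopZ; apply: peq_sym.
  exact: (peqZ z (LE _ (HB _ Hf)) (L1 _ Hf) (pB _ Hf)).
- move=> f g Hf Hg h; apply: (U _ _ (HB _ Hf) (HB _ Hg)).
  apply: (peq_trans (pB _ Hf)); apply: peq_sym; apply: (peq_trans (pB _ Hg)).
  exact: (peq_ae (Lp_cmeas Hg.1) (Lp_cmeas Hf.1) (aeq_sym h)).
- exists M => f Hf; have [g [Hg ng pg]] := hM _ Hf.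
  have ae : aeq (B f) g by apply: (U _ _ (HB _ Hf) Hg); exact: (peq_trans (pB _ Hf) (peq_sym pg)).
  rewrite (pintE (HB _ Hf).1) (pintE Hf.1) -EFinM lee_fin.
  by rewrite (nr_ae r (Lp_cmeas (HB _ Hf).1) (Lp_cmeas Hg.1) ae).
Qed.

Lemma Inv_Top (r : R) g : 1 < r -> Inv r g -> invertible r (Top g).
Proof.
move=> r1 [Lg inj [K K0 hK]].
apply: (OpOf_invertible r1 Lg Linf_f0 (OpOf_Top r1 Lg)).
  by move=> f; rewrite Eop_f0; exact: inj.
by exists K => // psi [Lpsi _]; have [f hf] := hK _ Lpsi; exists f; rewrite Eop_f0.
Qed.

Lemma left_Einj (r : R) a b Op : 1 < r -> Linf a -> Linf b -> OpOf r a b Op ->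
  left_invertible r Op -> Einj r a b.
Proof.
move=> r1 La Lb [K K0 hK] [L [[L1 L2 L3 L4 _] LO]] f Hf h.
have [H1 _ p1] := hK f Hf; have H0 := Hp_f0 (lt_trans ltr01 r1).
have z : aeq (Op f) (@f0 R) by apply: (Hp_uniq r1 H1 H0); exact: (peq_trans p1 h).
apply: (aeq_trans (aeq_sym (LO f Hf))).
apply: (aeq_trans (L4 _ _ H1 H0 z)).
(* L 0 = 0 is drawn from homogeneity with the scalar 0. *)
have E : fscale 0 (@f0 R) = @f0 R by apply/funext => x; rewrite /fscale mul0r.
have /aeqP := L3 0 _ H0; rewrite E => z2; apply/aeqP; apply: aedS z2 => x _ ->.
by rewrite /fscale mul0r.
Qed.

Lemma right_Esurj (r : R) a b Op : 1 < r -> OpOf r a b Op -> right_invertible r Op -> Esurj r a b.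
Proof.
move=> r1 [K K0 hK] [B [[B1 _ _ _ _] hB]] psi H; exists (B psi); first exact: B1.
have [H1 _ p1] := hK _ (B1 _ H); apply: (peq_trans (peq_sym p1)).
exact: (peq_ae (Lp_cmeas H1.1) (Lp_cmeas H.1) (hB _ H)).
Qed.

Lemma invertible_left (r : R) Op : invertible r Op -> left_invertible r Op.
Proof. by move=> [B [h1 h2]]; exists B; split=> // f /h2[]. Qed.
Lemma invertible_right (r : R) Op : invertible r Op -> right_invertible r Op.
Proof. by move=> [B [h1 h2]]; exists B; split=> // f /h2[]. Qed.

(** The symbol of the adjoint of H(b). *)
Definition adjb b : fT R := tilde (conjf b).
Lemma conjfK f : conjf (conjf f) = f.
Proof. by apply/funext => x; rewrite /conjf conjcK. Qed.
Lemma adjbK b : adjb (adjb b) = b.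
Proof. by rewrite -[RHS]tildeK -[X in tilde (tilde X)]conjfK. Qed.

(** The Hankel term is moved across by the substitution t -> 1/t in the integral. *)
Lemma Eop_adj (r : R) a b f g : 1 < r -> Linf a -> Linf b -> Hp r f -> Hp (hconj r) g ->
  cint (fmul (Eop a b f) (conjf g)) = cint (fmul f (conjf (Eop (conjf a) (adjb b) g))).
Proof.
move=> r1 La Lb Hf Hg; have r0 := gt1_ge0 r1; have q0 := gt1_ge0 (hconj_gt1 r1).
have L1 := Linf_mul_Lp r0 La Hf.1; have L2 := Linf_mul_Lp r0 Lb (Lp_Jop Hf.1).1.
have Lgc := (Lp_conj Hg.1).1.
have L3 := Linf_mul_Lp q0 (Linf_conj La) Hg.1.
have L4 := Linf_mul_Lp q0 (Linf_tilde (Linf_conj Lb)) (Lp_Jop Hg.1).1.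
have -> : fmul (Eop a b f) (conjf g) = fun x => fmul (fmul a f) (conjf g) x + fmul (fmul b (Jop f)) (conjf g) x.
  by apply/funext => x; rewrite /Eop /fadd /fmul mulrDl.
have -> : fmul f (conjf (Eop (conjf a) (adjb b) g)) =
  fun x => fmul f (conjf (fmul (conjf a) g)) x + fmul f (conjf (fmul (adjb b) (Jop g))) x.
  by apply/funext => x; rewrite /Eop /fadd /fmul /conjf conjcD mulrDr.
rewrite (cintD (Lp1M_hconj r1 L1 Lgc) (Lp1M_hconj r1 L2 Lgc)).
rewrite (cintD (Lp1M_hconj r1 Hf.1 (Lp_conj L3).1) (Lp1M_hconj r1 Hf.1 (Lp_conj L4).1)).
congr (_ + _).
  congr cint; apply/funext => x; rewrite /fmul /conjf conjcM conjcK; ring.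
rewrite -(cint_refl (Lp1M_hconj r1 L2 Lgc)); congr cint; apply/funext => x.
rewrite /tilde /adjb /fmul /conjf /tilde /Jop !conjcM conjcK conj_tpow tpow_shift opprK.
have -> : 2 * pi - (2 * pi - x) = x by ring.
by ring.
Qed.

(** Up to 2 pi, the coefficient of [f] at n is its pairing with t^n, which is the adjoint operator
    applied to some g. Moving the operator back onto [f] gives the pairing of P(a f + b J f) = 0
    with g. *)
Lemma Esurj_adj_inj (r : R) a b : 1 < r -> Linf a -> Linf b ->
  Esurj (hconj r) (conjf a) (adjb b) -> Einj r a b.
Proof.
move=> r1 La Lb S f Hf h; have q1 := hconj_gt1 r1; have r1' := ltW r1.
have q0 := gt1_ge0 q1.
have [K _ hK] := Eop_Lp r1 La Lb; have [LE _] := hK _ Hf.1.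
have [K' _ hK'] := Eop_Lp q1 (Linf_conj La) (Linf_tilde (Linf_conj Lb)).
have z : aeq (Pr (Eop a b f)) (@f0 R).
  apply: (Pr_uniq r1 LE (Lp_f0 ltr01).1) => n; rewrite fc0.
  by case: ifP => // n0; rewrite (h n n0) fc0.
apply: (Hp_uniq r1 Hf (Hp_f0 (lt_trans ltr01 r1))) => n n0; rewrite fc0.
have Ht : Hp (hconj r) (tpow n : fT R).
  split; first exact: Lp_tpow1.
  by move=> m m0; rewrite fc_tpow (_ : n == m = false)//; apply/negbTE; rewrite gt_eqF// (lt_le_trans m0).
have [g Hg pg] := S _ Ht; have [LE' _] := hK' _ Hg.1.
have e1 : cint (fmul (Eop a b f) (conjf g)) = 0.
  have -> : cint (fmul (Eop a b f) (conjf g)) = cint (fmul (Eop a b f) (conjf (Pr g))).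
    have /aeqP ae := Pr_Hp q1 Hg.
    apply: cint_ae; [exact: (cmeasM (Lp_cmeas LE) (cmeas_conj (Lp_cmeas Hg.1)))|exact: (cmeasM (Lp_cmeas LE) (cmeas_conj (Lp_cmeas (riesz_Lp q1 Hg.1))))|].
    by apply: aedS ae => x _ e; rewrite /fmul /conjf e.
  rewrite -(Pr_pair r1 LE Hg.1) -[RHS](mulr0 (Complex (2 * pi) 0)) -(fc0 R 0) -cint_fc.
  apply: cint_ae; [exact: (cmeasM (Lp_cmeas (riesz_Lp r1 LE)) (cmeas_conj (Lp_cmeas Hg.1)))|exact: cmeas_cst|].
  by move/aeqP: z; apply: aedS => x _ e; rewrite /fmul e /f0 mul0r.
have e2 : cint (fmul f (conjf (Eop (conjf a) (adjb b) g))) = cint (fmul f (conjf (tpow n))).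
  have /aeqP ae : aeq (Pr (Eop (conjf a) (adjb b) g)) (tpow n).
    apply: (Pr_uniq q1 LE' (Lp_Lp1 (ltW q1) Ht.1)) => m.
    by case: (leP 0 m) => m0; [rewrite pg|rewrite Ht.2].
  transitivity (cint (fmul f (conjf (Pr (Eop (conjf a) (adjb b) g))))).
    rewrite -(Pr_pair r1 Hf.1 LE'); have /aeqP ae2 := Pr_Hp r1 Hf.
    apply: cint_ae; [exact: (cmeasM (Lp_cmeas Hf.1) (cmeas_conj (Lp_cmeas LE')))|exact: (cmeasM (Lp_cmeas (riesz_Lp r1 Hf.1)) (cmeas_conj (Lp_cmeas LE')))|].
    by apply: aedS ae2 => x _ e; rewrite /fmul e.
  apply: cint_ae; [exact: (cmeasM (Lp_cmeas Hf.1) (cmeas_conj (Lp_cmeas (riesz_Lp q1 LE'))))|exact: (cmeasM (Lp_cmeas Hf.1) (cmeas_conj (Lp_cmeas Ht.1)))|].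
  by apply: aedS ae => x _ e; rewrite /fmul /conjf e.
have e3 : fmul f (conjf (tpow n)) = fmul (tpow (- n)) f.
  by apply/funext => x; rewrite /fmul /conjf conj_tpow mulrC.
have := Eop_adj r1 La Lb Hf Hg; rewrite e1 e2 e3 cint_fc fc_shift sub0r opprK => /esym/eqP.
rewrite mulf_eq0 => /orP[/eqP/(congr1 (@complex.Re R)) /= h2|/eqP//].
by have := twopi_gt0 R; rewrite h2 ltxx.
Qed.
End Operators.

(** * Toeplitz operators of index 2 and -2 *)

Section Fredholm.
Variable R : realType.
Notation C := (R[i]).
Implicit Types a b f g h k u v : fT R.

Lemma Hp_tpow1 (r : R) (n : int) : 1 < r -> 0 <= n -> Hp r (tpow n : fT R).
Proof.
move=> r1 n0; split; first exact: (Lp_tpow1 n (gt1_ge0 r1)).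
by move=> m m0; rewrite fc_tpow (_ : n == m = false)//; apply/negbTE; rewrite gt_eqF// (lt_le_trans m0).
Qed.

Lemma Hp_shift1 (r : R) h : Hp r h -> fc h 0 = 0 -> Hp r (fmul (tpow (-1)) h).
Proof.
move=> [Lh hh] h0; split; first exact: (Lp_tpow _ Lh).1.
move=> n n0; rewrite fc_shift opprK; have [->|n1] := eqVneq n (-1); first by rewrite addNr.
by apply: hh; clear -n0 n1; lia.
Qed.

Lemma Hp_shift2 (r : R) h : Hp r h -> fc h 0 = 0 -> fc h 1 = 0 -> Hp r (fmul (tpow (-2)) h).
Proof.
move=> [Lh hh] h0 h1; split; first exact: (Lp_tpow _ Lh).1.
move=> n n0; rewrite fc_shift opprK; have [->//|n1] := eqVneq n (-1).
have [->//|n2] := eqVneq n (-2).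
by apply: hh; clear -n0 n1 n2; lia.
Qed.

Lemma tpow_mulC (m n : int) f : fmul (tpow m) (fmul (tpow n) f) = fmul (tpow (m + n)) f.
Proof. by apply/funext => x; rewrite /fmul mulrA -tpowD. Qed.
Lemma tpow0_mul f : fmul (tpow 0) f = f.
Proof. by apply/funext => x; rewrite /fmul tpow0 mul1r. Qed.
Lemma fmulA f g h : fmul f (fmul g h) = fmul (fmul f g) h.
Proof. by apply/funext => x; rewrite /fmul mulrA. Qed.

Definition lc2 (z w : C) f g := fadd (fscale z f) (fscale w g).
Definition pair2 f g (i : nat) : fT R := if i is 0%N then f else g.
Lemma sum2E (cs : 'I_2 -> C) f g (x : R) :
  \sum_(i < 2) cs i * pair2 f g i x = lc2 (cs ord0) (cs ord_max) f g x.
Proof.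
rewrite !big_ord_recr big_ord0 /= add0r /lc2 /fadd /fscale.
by congr (cs _ * _ + cs _ * _); apply: val_inj.
Qed.

Lemma Hp_lc2 (r : R) z w f g : 1 < r -> Hp r f -> Hp r g -> Hp r (lc2 z w f g).
Proof. by move=> r1 Hf Hg; apply: (HpD (ltW r1)); exact: (HpZ _ (ltW r1)). Qed.
Lemma fc_lc2 z w f g n : Lp 1 f -> Lp 1 g -> fc (lc2 z w f g) n = z * fc f n + w * fc g n.
Proof.
by move=> Lf Lg; rewrite /lc2 (fcD _ (LpZ z Lf).1 (LpZ w Lg).1) (fcZ _ _ Lf) (fcZ _ _ Lg).
Qed.

Lemma fmul_lc2 u z w f g : fmul u (lc2 z w f g) = lc2 z w (fmul u f) (fmul u g).
Proof. by apply/funext => x; rewrite /lc2 /fmul /fadd /fscale; ring. Qed.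
Lemma ord2_case (P : 'I_2 -> Prop) : P ord0 -> P ord_max -> forall i, P i.
Proof.
move=> h0 h1 [[|[|//]] i2]; first by have -> : Ordinal i2 = ord0 by exact: val_inj.
by have -> : Ordinal i2 = ord_max by exact: val_inj.
Qed.

Lemma Top_eq0 (r : R) g f : 1 < r -> Linf g -> Hp r f ->
  aeq (Top g f) (@f0 R) <-> peq (fmul g f) (@f0 R).
Proof.
move=> r1 Lg Hf; have [H1 p1] := Top_peq r1 Lg Hf.1; have H0 := Hp_f0 (lt_trans ltr01 r1).
split=> h; last by apply: (Hp_uniq r1 H1 H0); exact: (peq_trans p1 h).
exact: (peq_trans (peq_sym p1) (peq_ae (Lp_cmeas H1.1) (Lp_cmeas H0.1) h)).
Qed.

(** With G = g t^2, the identity T(g) (t^2 f) = T(G) f gives surjectivity. A kernel element is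
    determined by its coefficients at 0 and 1: if both vanish it is t^2 h with T(G) h = 0. *)
Lemma fredholm_p2 (r : R) g : 1 < r -> Linf g -> Inv r (fmul g (tpow 2)) -> fredholm_index r (Top g) 2.
Proof.
move=> r1 Lg [LG inj [K K0 hK]]; have r1' := ltW r1; have r0 := gt1_ge0 r1.
have H0 := Hp_f0 (lt_trans ltr01 r1).
have Lm f : Hp r f -> Lp 1 (fmul g f) by move=> H; exact: (Lp_Lp1 r1' (Linf_mul_Lp r0 Lg H.1)).
have surj psi : Hp r psi -> exists2 f, Hp r f & aeq (Top g f) psi.
  move=> Hpsi; have [f [Hf _ pf]] := hK _ Hpsi.1.
  have Hf2 := Hp_tpow (isT : 0 <= 2 :> int) Hf; exists (fmul (tpow 2) f) => //.
  have [H1 p1] := Top_peq r1 Lg Hf2.1; apply: (Hp_uniq r1 H1 Hpsi).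
  by apply: (peq_trans p1); rewrite fmulA.
split.
- exact: (OpOf_bop r1 Lg (@Linf_f0 R) (OpOf_Top r1 Lg)).
- by move=> psi Hpsi _; have [f Hf hf] := surj _ Hpsi; exists f.
exists 2%N, 0%N; split; last by rewrite subr0.
  have Ht (n : int) : 0 <= n -> Hp r (tpow n : fT R) by exact: Hp_tpow1.
  (* The basis vector is t^n - t^2 h with T(G) h = P(g t^n); the correction does not touch the
     coefficients at 0 and 1. *)
  have mk (n : int) : 0 <= n -> n < 2 -> exists v, [/\ Hp r v, peq (fmul g v) (@f0 R),
     fc v 0 = (n == 0)%:R & fc v 1 = (n == 1)%:R].
    move=> n0 n2; have [h [Hh _ ph]] := hK _ (Linf_mul_Lp r0 Lg (Ht n n0).1).
    have Hh2 := Hp_tpow (isT : 0 <= 2 :> int) Hh.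
    have Lt1 := Lp_Lp1 r1' (Ht n n0).1; have Lh1 := Lp_Lp1 r1' Hh2.1.
    exists (fsub (tpow n) (fmul (tpow 2) h)); split.
    - exact: (HpB r1' (Ht n n0) Hh2).
    - move=> m m0; rewrite fmulBr (fcB _ (Lm _ (Ht n n0)) (Lm _ Hh2)) fmulA (ph m m0).
      by rewrite subrr fc0.
    - by rewrite (fcB _ Lt1 Lh1) fc_tpow fc_shift Hh.2// subr0.
    - by rewrite (fcB _ Lt1 Lh1) fc_tpow fc_shift Hh.2// subr0.
  have [v0 [Hv0 pv0 v00 v01]] := mk 0 isT isT; have [v1 [Hv1 pv1 v10 v11]] := mk 1 isT isT.
  have L0 := Lp_Lp1 r1' Hv0.1; have L1 := Lp_Lp1 r1' Hv1.1.
  exists (fun i => pair2 v0 v1 i); split.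
  - by apply: ord2_case; split => //; apply/(Top_eq0 r1 Lg).
  - move=> cs; rewrite (_ : (fun x => _) = lc2 (cs ord0) (cs ord_max) v0 v1); last first.
      by apply/funext => x; exact: sum2E.
    have Hl := Hp_lc2 (cs ord0) (cs ord_max) r1 Hv0 Hv1.
    move=> h; have hn n := fc_ae n (Lp_cmeas Hl.1) (Lp_cmeas H0.1) h.
    apply: ord2_case.
      by have := hn 0; rewrite (fc_lc2 _ _ _ L0 L1) fc0 v00 v10 mulr1 mulr0 addr0.
    by have := hn 1; rewrite (fc_lc2 _ _ _ L0 L1) fc0 v01 v11 mulr1 mulr0 add0r.
  - move=> f Hf /(Top_eq0 r1 Lg Hf) pf; pose cs (i : 'I_2) := fc f (i : nat).
    exists cs; rewrite (_ : (fun x => _) = lc2 (fc f 0) (fc f 1) v0 v1); last first.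
      by apply/funext => x; exact: sum2E.
    have Hl := Hp_lc2 (fc f 0) (fc f 1) r1 Hv0 Hv1; set l := lc2 _ _ _ _ in Hl *.
    have HF := HpB r1' Hf Hl; have Lf1 := Lp_Lp1 r1' Hf.1; have Ll1 := Lp_Lp1 r1' Hl.1.
    have F0 : fc (fsub f l) 0 = 0.
      by rewrite (fcB _ Lf1 Ll1) (fc_lc2 _ _ _ L0 L1) v00 v10 mulr1 mulr0 addr0 subrr.
    have F1 : fc (fsub f l) 1 = 0.
      by rewrite (fcB _ Lf1 Ll1) (fc_lc2 _ _ _ L0 L1) v01 v11 mulr1 mulr0 add0r subrr.
    have Hh := Hp_shift2 HF F0 F1.
    have E2 : fmul (tpow 2) (fmul (tpow (-2)) (fsub f l)) = fsub f l.
      by rewrite tpow_mulC subrr tpow0_mul.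
    have /aeqP z : aeq (fmul (tpow (-2)) (fsub f l)) (@f0 R).
      apply: (inj _ Hh) => n n0; rewrite -fmulA E2 fmulBr (fcB _ (Lm _ Hf) (Lm _ Hl)) (pf n n0).
      rewrite fmul_lc2 (fc_lc2 _ _ _ (Lm _ Hv0) (Lm _ Hv1)) (pv0 n n0) (pv1 n n0) !fc0.
      by rewrite !mulr0 addr0 subr0.
    apply/aeqP; apply: aedS z => x _ /eqP; rewrite /fmul /f0 mulf_eq0.
    by rewrite (negbTE (tpow_neq0 _ _)) /fsub subr_eq0 => /eqP.
exists (fun=> @f0 R); split=> //.
- move=> psi Hpsi; have [f Hf /aeqP hf] := surj _ Hpsi; exists f, (fun=> 0); split=> //.
  by apply/aeqP; apply: aedS hf => x _ ->; rewrite big_ord0 addr0.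
- by move=> f cs _ _ [].
Qed.

(** With G = g t^-2, T(g) f = T(G) (t^2 f): the range is the image under the invertible T(G) of the
    functions whose coefficients at 0 and 1 vanish, and T(G) 1 and T(G) t span a complement. *)
Lemma fredholm_m2 (r : R) g : 1 < r -> Linf g -> Inv r (fmul g (tpow (-2))) -> fredholm_index r (Top g) (-2).
Proof.
move=> r1 Lg [LG inj [K K0 hK]]; have r1' := ltW r1; have r0 := gt1_ge0 r1.
have H0 := Hp_f0 (lt_trans ltr01 r1); pose G := fmul g (tpow (-2)).
have Ht (n : int) : 0 <= n -> Hp r (tpow n : fT R) by exact: Hp_tpow1.
have Lm f : Hp r f -> Lp 1 (fmul G f) by move=> H; exact: (Lp_Lp1 r1' (Linf_mul_Lp r0 LG H.1)).
have E f : fmul g f = fmul G (fmul (tpow 2) f).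
  by rewrite /G -fmulA tpow_mulC addNr tpow0_mul.
have uniq f h : Hp r f -> Hp r h -> peq (fmul G f) (fmul G h) -> aeq f h.
  move=> Hf Hh p; have /aeqP z : aeq (fsub f h) (@f0 R).
    apply: (inj _ (HpB r1' Hf Hh)) => n n0.
    by rewrite fmulBr (fcB _ (Lm _ Hf) (Lm _ Hh)) (p n n0) subrr fc0.
  by apply/aeqP; apply: aedS z => x _ /eqP; rewrite /fsub /f0 subr_eq0 => /eqP.
have H2 f : Hp r f -> Hp r (fmul (tpow 2) f) := @Hp_tpow R r 2 f isT.
have fc2 f n : Hp r f -> n < 2 -> fc (fmul (tpow 2) f) n = 0.
  by move=> Hf n2; rewrite fc_shift Hf.2// subr_lt0.
split.
- exact: (OpOf_bop r1 Lg (@Linf_f0 R) (OpOf_Top r1 Lg)).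
- move=> psi Hpsi hap; have [h [Hh _ ph]] := hK _ Hpsi.1.
  (* The range is closed: if psi is a limit of T(g) f, then h = T(G)^-1 psi is a limit of the
     functions t^2 f, whose coefficients at n < 2 vanish. *)
  have coef (n : int) : n < 2 -> fc h n = 0.
    move=> n2; apply: cabs_eps0 => e e0; have [d d0 hd] := fc_small r1' e0.
    have K1 : 0 < K + 1 by rewrite ltr_wpDl.
    have d1 : 0 < d / (K + 1) by rewrite divr_gt0.
    have [f [Hf hf]] := hap _ d1; have [H1 p1] := Top_peq r1 Lg Hf.1.
    have HF := HpB r1' H1 Hpsi; rewrite (pintE HF.1) lte_fin in hf.
    have [u [Hu nu pu]] := hK _ HF.1.
    have Hd := HpB r1' (H2 _ Hf) Hh.
    have ae : aeq u (fsub (fmul (tpow 2) f) h).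
      apply: (uniq _ _ Hu Hd) => m m0; rewrite (pu m m0) fmulBr.
      rewrite (fcB _ (Lp_Lp1 r1' H1.1) (Lp_Lp1 r1' Hpsi.1)) (fcB _ (Lm _ (H2 _ Hf)) (Lm _ Hh)).
      by rewrite (ph m m0) (p1 m m0) -E.
    have nd : nr r u < d.
      apply: (le_lt_trans nu); apply: le_lt_trans (lt_div_mul K1 hf).
      by apply: (ler_wpM2r (nr_ge0 _ _)); rewrite lerDl.
    have := hd _ Hu.1 nd n; rewrite (fc_ae n (Lp_cmeas Hu.1) (Lp_cmeas Hd.1) ae).
    by rewrite (fcB _ (Lp_Lp1 r1' (H2 _ Hf).1) (Lp_Lp1 r1' Hh.1)) fc2// sub0r cabsN.
  have Hf := Hp_shift2 Hh (coef 0 isT) (coef 1 isT).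
  exists (fmul (tpow (-2)) h); split=> //; have [H1 p1] := Top_peq r1 Lg Hf.1.
  apply: (Hp_uniq r1 H1 Hpsi); apply: (peq_trans p1); rewrite E tpow_mulC subrr tpow0_mul.
  exact: ph.
exists 0%N, 2%N; split; last by rewrite sub0r.
  exists (fun=> @f0 R); split; [by case|by move=> ? ? []|].
  move=> f Hf /(Top_eq0 r1 Lg Hf) pf; exists (fun=> 0); rewrite E in pf.
  have /aeqP z := inj _ (H2 _ Hf) pf; apply/aeqP; apply: aedS z => x _ /eqP.
  by rewrite /fmul /f0 mulf_eq0 (negbTE (tpow_neq0 _ _)) big_ord0 => /eqP.
pose w (n : int) := Top G (tpow n).
have [Hw0 pw0] := Top_peq r1 LG (Ht 0 isT).1; have [Hw1 pw1] := Top_peq r1 LG (Ht 1 isT).1.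
have W0 := Lp_Lp1 r1' Hw0.1; have W1 := Lp_Lp1 r1' Hw1.1.
exists (fun i => pair2 (w 0) (w 1) i); split;
  first exact: (@ord2_case (fun i => Hp r (pair2 (w 0) (w 1) i)) Hw0 Hw1).
- move=> psi Hpsi; have [h [Hh _ ph]] := hK _ Hpsi.1.
  pose l := lc2 (fc h 0) (fc h 1) (tpow 0) (tpow 1).
  have Hl : Hp r l by exact: (Hp_lc2 _ _ r1 (Ht 0 isT) (Ht 1 isT)).
  have T0 := Lp_Lp1 r1' (Ht 0 isT).1; have T1 := Lp_Lp1 r1' (Ht 1 isT).1.
  have HF := HpB r1' Hh Hl.
  have F0 : fc (fsub h l) 0 = 0.
    by rewrite (fcB _ (Lp_Lp1 r1' Hh.1) (Lp_Lp1 r1' Hl.1)) (fc_lc2 _ _ _ T0 T1) !fc_tpow mulr1 mulr0 addr0 subrr.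
  have F1 : fc (fsub h l) 1 = 0.
    by rewrite (fcB _ (Lp_Lp1 r1' Hh.1) (Lp_Lp1 r1' Hl.1)) (fc_lc2 _ _ _ T0 T1) !fc_tpow mulr1 mulr0 add0r subrr.
  have Hf := Hp_shift2 HF F0 F1; set f := fmul (tpow (-2)) _ in Hf.
  exists f, (fun i : 'I_2 => fc h (i : nat)); split=> //.
  have -> : (fun x => Top g f x + \sum_(i < 2) fc h (i : nat) * pair2 (w 0) (w 1) i x) =
     fadd (Top g f) (lc2 (fc h 0) (fc h 1) (w 0) (w 1)).
    by apply/funext => x; rewrite /fadd (sum2E (fun i : 'I_2 => fc h (i : nat))).
  have [H1 p1] := Top_peq r1 Lg Hf.1; have Hlw := Hp_lc2 (fc h 0) (fc h 1) r1 Hw0 Hw1.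
  apply: (Hp_uniq r1 Hpsi (HpD r1' H1 Hlw)) => n n0.
  rewrite (fcD _ (Lp_Lp1 r1' H1.1) (Lp_Lp1 r1' Hlw.1)) (fc_lc2 _ _ _ W0 W1).
  rewrite (p1 n n0) (pw0 n n0) (pw1 n n0) E /f tpow_mulC subrr tpow0_mul fmulBr.
  rewrite (fcB _ (Lm _ Hh) (Lm _ Hl)) /l fmul_lc2 (fc_lc2 _ _ _ (Lm _ (Ht 0 isT)) (Lm _ (Ht 1 isT))).
  by rewrite subrK (ph n n0).
- move=> f cs Hf.
  have -> : (fun x => \sum_(i < 2) cs i * pair2 (w 0) (w 1) i x) = lc2 (cs ord0) (cs ord_max) (w 0) (w 1).
    by apply/funext => x; exact: sum2E.
  have Hlw := Hp_lc2 (cs ord0) (cs ord_max) r1 Hw0 Hw1.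
  have Hl := Hp_lc2 (cs ord0) (cs ord_max) r1 (Ht 0 isT) (Ht 1 isT).
  have [H1 p1] := Top_peq r1 Lg Hf.1 => h.
  have ae : aeq (fmul (tpow 2) f) (lc2 (cs ord0) (cs ord_max) (tpow 0) (tpow 1)).
    apply: (uniq _ _ (H2 _ Hf) Hl) => n n0; rewrite -E -(p1 n n0).
    rewrite (fc_ae n (Lp_cmeas H1.1) (Lp_cmeas Hlw.1) h) (fc_lc2 _ _ _ W0 W1).
    by rewrite fmul_lc2 (fc_lc2 _ _ _ (Lm _ (Ht 0 isT)) (Lm _ (Ht 1 isT))) (pw0 n n0) (pw1 n n0).
  have T0 := Lp_Lp1 r1' (Ht 0 isT).1; have T1 := Lp_Lp1 r1' (Ht 1 isT).1.
  have hn n : n < 2 -> 0 = fc (lc2 (cs ord0) (cs ord_max) (tpow 0) (tpow 1)) n.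
    by move=> n2; rewrite -(fc_ae n (Lp_cmeas (H2 _ Hf).1) (Lp_cmeas Hl.1) ae) fc2.
  apply: ord2_case.
    by have := hn 0 isT; rewrite (fc_lc2 _ _ _ T0 T1) !fc_tpow mulr1 mulr0 addr0.
  by have := hn 1 isT; rewrite (fc_lc2 _ _ _ T0 T1) !fc_tpow mulr1 mulr0 add0r.
Qed.
End Fredholm.

(** * Decoupling of the Toeplitz plus Hankel equation *)
Section Main.
Variable R : realType.
Notation C := (R[i]).
Implicit Types a b f g h k u v w rho psi : fT R.

(** The matching relation together with the nonvanishing that pointwise division needs. *)
Definition regular_pair a b := [/\ Linf a, Linf b, Linf (finv (tilde a)) &
  aed (fun x => [/\ a x != 0, b x != 0 & a x * tilde a x = b x * tilde b x])].

Lemma regular_pair_pt a b : regular_pair a b -> aed (fun x => [/\ a x != 0, a (2 * pi - x) != 0, b x != 0,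
  b (2 * pi - x) != 0 & a x * a (2 * pi - x) = b x * b (2 * pi - x)]).
Proof.
case=> _ _ _ h; have h2 := tilde_aed h.
by apply: aedS2 h h2 => x _ [h1 h3 h4] [h5 h6 _]; split.
Qed.

Lemma tpow_m1E (x : R) : tpow (-1) x = (tpow 1 x)^-1 :> C.
Proof. exact: (tpowN 1 x). Qed.
Lemma tpow_2E (x : R) : tpow 2 x = tpow 1 x * tpow 1 x :> C.
Proof. by rewrite -tpowD. Qed.
Lemma tpow_m2E (x : R) : tpow (-2) x = (tpow 1 x * tpow 1 x)^-1 :> C.
Proof. by rewrite (tpowN 2 x) tpow_2E. Qed.
Lemma Jop_refl f (x : R) : Jop f x = (tpow 1 x)^-1 * f (2 * pi - x).
Proof. by rewrite /Jop tpow_m1E. Qed.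
Lemma Jop_at_refl f (x : R) : Jop f (2 * pi - x) = tpow 1 x * f x.
Proof.
rewrite /Jop tpow_shift opprK; congr (_ * f _); ring.
Qed.

Lemma tpow1Y (x : R) : tpow 1 (2 * pi - x) = (tpow 1 x)^-1 :> C.
Proof. by rewrite tpow_shift tpow_m1E. Qed.
Lemma reflY (x : R) : 2 * pi - (2 * pi - x) = x.
Proof. by ring. Qed.

Definition c1 a b := fmul (csub a b) (tpow (-2)).
Definition rhof a k psi := fmul (finv (tilde a)) (fadd k (Jop psi)).

Lemma rhof_Lp (r : R) a k psi : 1 < r -> Linf (finv (tilde a)) -> Lp r k -> Lp r psi ->
  Lp r (rhof a k psi).
Proof.
move=> r1 La Lk Lp'; have r0 := gt1_ge0 r1.
exact: (Linf_mul_Lp r0 La (LpD r0 Lk (Lp_Jop Lp').1).1).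
Qed.

Section Wsym.
Variables (r : R) (a b : fT R).
Hypotheses (r1 : 1 < r) (Gab : regular_pair a b) (Ic : Inv r (c1 a b)).
Let r1' : 1 <= r := ltW r1.
Let r0 : 0 <= r := gt1_ge0 r1.

Lemma Linf_c1 : Linf (c1 a b). Proof. by case: Ic. Qed.
Lemma c1_Lp1 f : Hp r f -> Lp 1 (fmul (c1 a b) f).
Proof. by move=> H; exact: (Lp_Lp1 r1' (Linf_mul_Lp r0 Linf_c1 H.1)). Qed.
Lemma c1_uniq f h : Hp r f -> Hp r h -> peq (fmul (c1 a b) f) (fmul (c1 a b) h) -> aeq f h.
Proof.
case: Ic => _ inj _ Hf Hh p; have /aeqP z : aeq (fsub f h) (@f0 R).
  apply: (inj _ (HpB r1' Hf Hh)) => n n0.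
  by rewrite fmulBr (fcB _ (c1_Lp1 Hf) (c1_Lp1 Hh)) (p n n0) subrr fc0.
by apply/aeqP; apply: aedS z => x _ /eqP; rewrite /fsub /f0 subr_eq0 => /eqP.
Qed.

(* Applying J to c1 w + J k = t^-1 rho shows that (k, w) solves the same equation,
   hence w = k by uniqueness. *)
Lemma w_sym rho w : Lp r rho -> aed (fun x => csub a b x * Jop rho x = rho x) -> Hp r w ->
  peq (fmul (c1 a b) w) (fmul (tpow (-1)) rho) ->
  aed (fun x => c1 a b x * w x + Jop w x = tpow (-1) x * rho x).
Proof.
move=> Lrho srho Hw pw; have L1 := (Lp_tpow (-1) Lrho).1; have L2 := Linf_mul_Lp r0 Linf_c1 Hw.1.
have L12 := (LpB r0 L1 L2).1; set F := fsub _ _ in L12.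
have pF : peq F (@f0 R).
  by move=> n n0; rewrite (fcB _ (Lp_Lp1 r1' L1) (Lp_Lp1 r1' L2)) (pw n n0) subrr fc0.
have Hk := peq_Jop r1' L12 pF; pose k := Jop F; rewrite -/k in Hk.
have LJw := (Lp_Jop Hw.1).1; have pJw := Jop_peq (Hp_Hp1 r1' Hw).
have ek : aed (fun x => fmul (c1 a b) k x = fsub (fmul (tpow (-1)) rho) (Jop w) x).
  apply: aedS2 (regular_pair_pt Gab) srho => x _ [A1 A2 B1 B2 e] s.
  rewrite /fmul /fsub -s /k Jop_refl /F /fsub /fmul /c1 /fmul /csub /fmul /finv.
  rewrite Jop_refl Jop_refl tpow_m1E tpow_m2E tpow_m1E tpow_m2E tpow1Y.
  have T0 : tpow 1 x != 0 :> C by exact: tpow_neq0.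
  move: (tpow 1 x) T0 (a x) (b x) A1 B1 e A2 B2; move: (a _) (b _) (rho _) (w _).
  move=> A B p q T T0 A' B' A1 B1 e A2 B2.
  have -> : A = B' * B / A' by apply: (mulfI A1); rewrite e; field.
  by field; rewrite ?A1 ?B1 ?B2 ?T0.
have ae : aeq k w.
  apply: (c1_uniq Hk Hw); apply: peq_trans (peq_sym pw) => n n0.
  rewrite (fc_ae n (Lp_cmeas (c1_Lp1 Hk)) (Lp_cmeas (LpB r0 L1 LJw).1)); last by apply/aeqP.
  by rewrite (fcB _ (Lp_Lp1 r1' L1) (Lp_Lp1 r1' LJw)) (pJw n n0) fc0 subr0.
have /aeqP aJ := Jop_aeq (aeq_sym ae).
by apply: aedS aJ => x _ ->; rewrite /k JopK /F /fsub /fmul; ring.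
Qed.

(** For f = t^-1 w one has J f = t J w, so t times the identity of [w_sym] reads c f + J f = rho.
    The condition on the zeroth coefficient is what keeps f in H^r. *)
Lemma w_shift rho w : Lp r rho -> aed (fun x => csub a b x * Jop rho x = rho x) -> Hp r w ->
  peq (fmul (c1 a b) w) (fmul (tpow (-1)) rho) -> fc w 0 = 0 ->
  let f := fmul (tpow (-1)) w in Hp r f /\ aed (fun x => csub a b x * f x + Jop f x = rho x).
Proof.
move=> Lrho srho Hw pw w0 f; split; first exact: (Hp_shift1 Hw w0).
apply: aedS (w_sym Lrho srho Hw pw) => x _ e.
have T0 : tpow 1 x != 0 :> C by exact: tpow_neq0.
have -> : rho x = tpow 1 x * (tpow (-1) x * rho x) by rewrite tpow_m1E; field.
rewrite -e /f /fmul Jop_refl Jop_refl tpow_m1E tpow_m1E tpow1Y /c1 /fmul tpow_m2E.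
by field.
Qed.

(** Any solution [f] makes t f a solution of the equation for w, so every w arising from an [f] has
    zeroth coefficient 0. *)
Lemma w_unique rho w f : Lp r rho -> Hp r w -> Hp r f ->
  peq (fmul (c1 a b) w) (fmul (tpow (-1)) rho) ->
  aed (fun x => csub a b x * f x + Jop f x = rho x) -> aeq w (fmul (tpow 1) f).
Proof.
move=> Lrho Hw Hf pw ef; have H1 := Hp_tpow (isT : 0 <= 1 :> int) Hf.
apply: (c1_uniq Hw H1); apply: (peq_trans pw) => n n0.
have L1 := (Lp_tpow (-1) Lrho).1; have LJ := (Lp_Jop H1.1).1.
have pJ := Jop_peq (Hp_Hp1 r1' H1).
rewrite (fc_ae n (Lp_cmeas (c1_Lp1 H1)) (Lp_cmeas (LpB r0 L1 LJ).1)).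
  by rewrite (fcB _ (Lp_Lp1 r1' L1) (Lp_Lp1 r1' LJ)) (pJ n n0) fc0 subr0.
apply/aeqP; apply: aedS ef => x _ e; rewrite /fsub /fmul -e !Jop_refl tpow1Y tpow_m1E /c1 /fmul tpow_m2E.
have T0 : tpow 1 x != 0 :> C by exact: tpow_neq0.
by field.
Qed.
End Wsym.

(** Converse of [Eop_rho]: the equation for [f] is taken at 1/t and multiplied by a, where a c~ = b
    by the matching relation. *)
Lemma Eop_of_rho (r : R) a b f k psi : 1 < r -> regular_pair a b -> Hp r f -> Hp r k -> Hp r psi ->
  aed (fun x => csub a b x * f x + Jop f x = rhof a k psi x) -> peq (Eop a b f) psi.
Proof.
move=> r1 Gab Hf Hk Hpsi ef; have [La Lb _ _] := Gab.
have LJ := (Lp_Jop Hk.1).1; have pJ := Jop_peq (Hp_Hp1 (ltW r1) Hk).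
have r0 := gt1_ge0 r1.
move=> n n0; rewrite (fc_ae n (Lp_cmeas (Eop_Lp1 r1 La Lb Hf)) (Lp_cmeas (LpD r0 Hpsi.1 LJ).1)).
  by rewrite (fcD _ (Lp_Lp1 (ltW r1) Hpsi.1) (Lp_Lp1 (ltW r1) LJ)) (pJ n n0) fc0 addr0.
apply/aeqP; apply: aedS2 (regular_pair_pt Gab) (tilde_aed ef) => x _ [A1 A2 B1 B2 e].
rewrite /csub /rhof /fmul /finv /tilde /fadd !Jop_at_refl !reflY /Eop /fadd /fmul !Jop_refl.
have T0 : tpow 1 x != 0 :> C by exact: tpow_neq0.
move: (tpow 1 x) T0 (a x) (b x) A1 B1 e A2 B2; move: (a _) (b _) (f _) (f x) (k _) (psi x).
move=> A B p q y z T T0 A' B' A1 B1 e A2 B2 h.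
have h2 : A' * (A / B * p + T * q) = y + T * z by rewrite h; field.
have h3 : B' * p + A' * (T * q) = y + T * z.
  by rewrite -h2; have -> : B' = A' * A / B by [rewrite e; field]; field.
have h4 : y = B' * p + A' * (T * q) - T * z by rewrite h3; ring.
by rewrite h4; field.
Qed.

(* Eliminating J f between a f + b J f = psi + J k and its image under J decouples
   the equation: first k is found from an equation with symbol d, then f from one
   with symbol c. *)
Lemma Eop_rho (r : R) a b f psi : 1 < r -> regular_pair a b -> Hp r f -> Hp r psi ->
  peq (Eop a b f) psi -> exists k, [/\ Hp r k,
    aed (fun x => csub a b x * f x + Jop f x = rhof a k psi x) &
    aed (fun x => dsub a b x * k x - Jop k x = psi x - dsub a b x * Jop psi x)].
Proof.
move=> r1 Gab Hf Hpsi pe; have [La Lb _ _] := Gab; have r0 := gt1_ge0 r1.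
have [K _ hK] := Eop_Lp r1 La Lb; have [LE _] := hK _ Hf.1.
have LF := (LpB r0 LE Hpsi.1).1.
have pF : peq (fsub (Eop a b f) psi) (@f0 R).
  by move=> n n0; rewrite (fcB _ (Lp_Lp1 (ltW r1) LE) (Lp_Lp1 (ltW r1) Hpsi.1)) (pe n n0) subrr fc0.
exists (Jop (fsub (Eop a b f) psi)); split; first exact: (peq_Jop (ltW r1) LF pF).
  apply: aedS (regular_pair_pt Gab) => x _ [A1 A2 B1 B2 e].
  rewrite /csub /rhof /fmul /finv /tilde /fadd !Jop_refl /fsub /Eop /fadd /fmul !Jop_at_refl.
  have T0 : tpow 1 x != 0 :> C by exact: tpow_neq0.
  move: (tpow 1 x) T0 (a x) (b x) A1 B1 e A2 B2; move: (a _) (b _) (f _) (f x) (psi _).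
  move=> A B p q z T T0 A' B' A1 B1 e A2 B2.
  have -> : A' = B' * B / A by rewrite -e; field.
  by field; rewrite ?A2 ?B1 ?T0.
apply: aedS (regular_pair_pt Gab) => x _ [A1 A2 B1 B2 e].
rewrite /dsub /fmul /finv /tilde !JopK !Jop_refl /fsub /Eop /fadd /fmul !Jop_at_refl !Jop_refl.
have T0 : tpow 1 x != 0 :> C by exact: tpow_neq0.
move: (tpow 1 x) T0 (a x) (b x) A1 B1 e A2 B2; move: (a _) (b _) (f _) (f x) (psi _) (psi x).
move=> A B p q z y T T0 A' B' A1 B1 e A2 B2.
have -> : B' = A' * A / B by rewrite e; field.
by field; rewrite ?B2 ?T0.
Qed.

(** c J rho = (J k + psi) / b and a~ / b = 1 / d, so c J rho = rho is the d-equation for [k] in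
    another form. *)
Lemma rho_sym a b k psi : regular_pair a b ->
  aed (fun x => dsub a b x * k x - Jop k x = psi x - dsub a b x * Jop psi x) ->
  aed (fun x => csub a b x * Jop (rhof a k psi) x = rhof a k psi x).
Proof.
move=> Gab ek; apply: aedS2 (regular_pair_pt Gab) ek => x _ [A1 A2 B1 B2 e].
rewrite /csub /dsub /rhof /fmul /finv /tilde !Jop_refl /fadd Jop_at_refl !Jop_refl reflY.
have T0 : tpow 1 x != 0 :> C by exact: tpow_neq0.
move: (tpow 1 x) T0 (a x) (b x) A1 B1 e A2 B2; move: (a _) (b _) (k _) (k x) (psi _) (psi x).
move=> A B p q z y T T0 A' B' A1 B1 e A2 B2 h.
have -> : y = A' / B * q - T^-1 * p + A' / B * (T^-1 * z) by rewrite h; ring.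
have -> : A = B' * B / A' by apply: (mulfI A1); rewrite e; field.
by field; rewrite ?A1 ?B1 ?B2 ?T0.
Qed.
End Main.

(** * The zeroth coefficient decides between invertibility and a kernel *)

Section Dichotomy.
Variable R : realType.
Notation C := (R[i]).
Implicit Types a b f g h k u v w rho psi : fT R.

Lemma le_mul_trans (A B x y z : R) : 0 <= A -> x <= A * y -> y <= B * z -> x <= A * B * z.
Proof. by move=> A0 h1 h2; apply: (le_trans h1); rewrite -mulrA; exact: ler_wpM2l. Qed.
Lemma le_add_mul (A B m x y z : R) : 0 <= m -> x <= A * z -> y <= B * z -> m * (x + y) <= m * (A + B) * z.
Proof. by move=> m0 h1 h2; rewrite -mulrA mulrDl; apply: ler_wpM2l => //; exact: lerD. Qed.

Lemma quot_bound (x y : C) (r q N : R) : cabs y `^ r <= q -> 0 <= N ->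
  cabs (- y / x) `^ r * N <= cabs x^-1 `^ r * N * q.
Proof.
move=> h N0; rewrite cabsM cabsN powRM ?cabs_ge0//.
have -> : cabs y `^ r * cabs x^-1 `^ r * N = cabs x^-1 `^ r * N * cabs y `^ r by ring.
by apply: ler_wpM2l => //; rewrite mulr_ge0 ?powR_ge0.
Qed.

(* G = psi - d J psi satisfies d J G = - G, so d k - J h = G implies d h - J k = G
   and the average of k and h solves the symmetric equation. *)
Lemma g0_solve (r : R) a b : 1 < r -> regular_pair a b -> Linf (dsub a b) -> Inv r (fmul (dsub a b) (tpow 2)) ->
  exists2 K : R, 0 <= K & forall psi, Hp r psi -> exists g, [/\ Hp r g, nr r g <= K * nr r psi &
    aed (fun x => dsub a b x * g x - Jop g x = psi x - dsub a b x * Jop psi x)].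
Proof.
move=> r1 Gab Ld [Ld2 _ [K K0 hK]]; have r0 := gt1_ge0 r1; have r1' := ltW r1.
have [M M0 hM] := LpMinf r0 Ld; pose m : R := 2 `^ r.
have m0 : 0 <= m by exact: powR_ge0.
pose KG := m * (1 + M); have KG0 : 0 <= KG by rewrite mulr_ge0// addr_ge0.
pose Kh := m * (M * (K * KG) + KG).
have Kh0 : 0 <= Kh by apply: mulr_ge0 => //; apply: addr_ge0 => //; do 2!apply: mulr_ge0 => //.
pose z : C := Complex 2^-1 0.
exists (cabs z `^ r * (m * (K * KG + Kh))).
  by rewrite !mulr_ge0 ?powR_ge0// addr_ge0// mulr_ge0.
move=> psi Hpsi; have [LJ nJ] := Lp_Jop Hpsi.1; have [LdJ ndJ] := hM _ LJ; rewrite nJ in ndJ.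
pose G := fsub psi (fmul (dsub a b) (Jop psi)).
have [LG nG] : Lp r G /\ nr r G <= KG * nr r psi.
  have [L1 n1] := LpB r0 Hpsi.1 LdJ; split; first exact: L1.
  apply: (le_trans n1); apply: (le_add_mul m0 _ ndJ).
  by rewrite mul1r.
have [f [Hf nf pf]] := hK _ LG.
have Hk := Hp_tpow (isT : 0 <= 2 :> int) Hf; have [_ nk] := Lp_tpow 2 Hf.1.
pose k := fmul (tpow 2) f; rewrite -/k in Hk nk.
have nk' : nr r k <= K * KG * nr r psi by rewrite nk; exact: (le_mul_trans K0 nf nG).
have [Ldk ndk] := hM _ Hk.1.
have pdk : peq (fmul (dsub a b) k) G by rewrite /k fmulA.
have [LF nF] := LpB r0 Ldk LG.
have pF : peq (fsub (fmul (dsub a b) k) G) (@f0 R).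
  by move=> n n0; rewrite (fcB _ (Lp_Lp1 r1' Ldk) (Lp_Lp1 r1' LG)) (pdk n n0) subrr fc0.
have Hh := peq_Jop r1' LF pF; have [_ nh] := Lp_Jop LF.
pose h := Jop (fsub (fmul (dsub a b) k) G); rewrite -/h in Hh nh.
have nh' : nr r h <= Kh * nr r psi.
  rewrite nh; apply: (le_trans nF); apply: (le_add_mul m0 _ nG).
  exact: (le_mul_trans M0 ndk nk').
have Hkh := HpD r1' Hk Hh; have [_ nkh] := LpD r0 Hk.1 Hh.1.
exists (fscale z (fadd k h)); split; first exact: (HpZ z r1' Hkh).
  have [_ ->] := LpZ z Hkh.1; apply: (le_mul_trans (powR_ge0 _ _) (lexx _)).
  exact: (le_trans nkh (le_add_mul m0 nk' nh')).
apply: aedS (regular_pair_pt Gab) => x _ [A1 A2 B1 B2 e].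
rewrite /fscale /fadd Jop_refl /h Jop_at_refl !Jop_refl /fsub /fmul /G /fsub /fmul Jop_at_refl !Jop_refl /dsub /fmul /finv /tilde reflY.
have T0 : tpow 1 x != 0 :> C by exact: tpow_neq0.
have z2 : z = 2^-1.
  have h2 := half_mul2 R; rewrite -/z in h2.
  have n2 : (2 : C) != 0 by rewrite pnatr_eq0.
  by apply: (mulIf n2); rewrite h2 mulVf.
rewrite z2.
move: (tpow 1 x) T0 (a x) (b x) A1 B1 e A2 B2; move: (a _) (b _) (k _) (k x) (psi _) (psi x).
move=> A B p q y t T T0 A' B' A1 B1 e A2 B2.
have -> : A = B' * B / A' by apply: (mulfI A1); rewrite e; field.
by field; rewrite ?A1 ?B1 ?B2 ?T0.
Qed.

(** Isolates what the dichotomy needs to know about the homogeneous d-equation, so that it is argued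
    once for both signs; [gker] provides the instance. *)
Definition kerspan (r : R) a b g1 := [/\ Hp r g1, ~ aeq g1 (@f0 R),
  aed (fun x => dsub a b x * g1 x = Jop g1 x) &
  forall g, Hp r g -> aed (fun x => dsub a b x * g x = Jop g x) -> exists z, aeq g (fscale z g1)].

Lemma Jop_f0 : Jop (@f0 R) = @f0 R.
Proof. by apply/funext => x; rewrite /Jop /f0 mulr0. Qed.

Section Setting.
Variables (r : R) (a b g1 W : fT R).
Hypotheses (r1 : 1 < r) (Gab : regular_pair a b) (Ld : Linf (dsub a b)) (Ic : Inv r (c1 a b)).
Hypothesis (Id : Inv r (fmul (dsub a b) (tpow 2))).
Hypotheses (G1 : kerspan r a b g1) (HW : Hp r W).
Hypothesis (pW : peq (fmul (c1 a b) W) (fmul (tpow (-1)) (fmul (finv (tilde a)) g1))).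
Let r1' : 1 <= r := ltW r1.
Let r0 : 0 <= r := gt1_ge0 r1.
Let Hf0 : Hp r (@f0 R) := Hp_f0 (lt_trans ltr01 r1).

Lemma rhof_g1 : rhof a g1 (@f0 R) = fmul (finv (tilde a)) g1.
Proof. by rewrite /rhof Jop_f0; congr fmul; apply/funext => x; rewrite /fadd /f0 addr0. Qed.

(** f = t^-1 W solves the homogeneous equation. Were it 0, then g1 / a~ = c f + J f would be 0 as
    well, and so would [g1]. *)
Lemma W_kernel : fc W 0 = 0 -> ~ Einj r a b.
Proof.
move=> W0 inj; have [Hg1 g1n dg1 _] := G1; have [La Lb Lia _] := Gab.
have Lrho := rhof_Lp r1 Lia Hg1.1 Hf0.1; have pW' := pW; rewrite -rhof_g1 in pW'.
have ek : aed (fun x => dsub a b x * g1 x - Jop g1 x = f0 x - dsub a b x * Jop (@f0 R) x).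
  by apply: aedS dg1 => x _ ->; rewrite Jop_f0 /f0 mulr0 !subrr.
have [Hf ef] := w_shift r1 Gab Ic Lrho (rho_sym Gab ek) HW pW' W0.
have z := inj _ Hf (Eop_of_rho r1 Gab Hf Hg1 Hf0 ef).
have /aeqP zJ := Jop_aeq z; move/aeqP: z => z; apply: g1n; apply/aeqP.
have za := aedS2 (fun x (_ : @dom R x) e1 e2 => conj e1 e2) z zJ.
apply: aedS3 ef za (regular_pair_pt Gab) => x _ e [e1 e2] [_ A2 _ _ _].
move: e; rewrite e1 e2 Jop_f0 rhof_g1 /f0 mulr0 addr0 /fmul /finv /tilde => /esym/eqP.
by rewrite mulf_eq0 invr_eq0 (negbTE A2) => /eqP.
Qed.

(** For [f] in the kernel, k = z g1 and hence t f = z W by uniqueness. As t f has no constant term,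
    z = 0. *)
Lemma W_inj : fc W 0 != 0 -> Einj r a b.
Proof.
move=> W0 f Hf pf; have [Hg1 g1n dg1 span] := G1; have [La Lb Lia _] := Gab.
have [k [Hk ef ek]] := Eop_rho r1 Gab Hf Hf0 pf.
have ek' : aed (fun x => dsub a b x * k x = Jop k x).
  apply: aedS ek => x _; rewrite Jop_f0 /f0 mulr0 subrr => /eqP.
  by rewrite subr_eq0 => /eqP.
have [z /aeqP ez] := span _ Hk ek'.
have Lrho := rhof_Lp r1 Lia Hk.1 Hf0.1.
have LWr := (Lp_tpow (-1) (Linf_mul_Lp r0 Lia Hg1.1)).1.
have Hz := HpZ z r1' HW.
have pz : peq (fmul (c1 a b) (fscale z W)) (fmul (tpow (-1)) (rhof a k (@f0 R))).
  rewrite fmulZ; apply: (peq_trans (peqZ z (c1_Lp1 r1 Ic HW) (Lp_Lp1 r1' LWr) pW)).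
  apply: (peq_ae (Lp_cmeas (LpZ z LWr).1) (Lp_cmeas (Lp_tpow (-1) Lrho).1)).
  apply/aeqP; apply: aedS ez => x _ e.
  by rewrite /rhof Jop_f0 /fscale /fmul /fadd e /f0 addr0 /fscale; ring.
have ae := w_unique r1 Ic Lrho Hz Hf pz ef.
have H1 := Hp_tpow (isT : 0 <= 1 :> int) Hf.
have /eqP := fc_ae 0 (Lp_cmeas Hz.1) (Lp_cmeas H1.1) ae.
rewrite (fcZ _ _ (Lp_Lp1 r1' HW.1)) fc_shift Hf.2// mulf_eq0 (negbTE W0) orbF => /eqP z0.
move/aeqP: ae => ae; apply/aeqP; apply: aedS ae => x _ /esym/eqP.
by rewrite /fscale z0 mul0r /fmul mulf_eq0 (negbTE (tpow_neq0 _ _)) => /eqP.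
Qed.

Lemma W_surj : fc W 0 != 0 -> exists2 K : R, 0 <= K & forall psi, Hp r psi ->
     exists f, [/\ Hp r f, nr r f <= K * nr r psi & peq (Eop a b f) psi].
Proof.
move=> W0; have [Hg1 g1n dg1 span] := G1; have [La Lb Lia _] := Gab.
have [K1 K10 hK1] := g0_solve r1 Gab Ld Id; have [_ _ [K2 K20 hK2]] := Ic.
have [M M0 hM] := LpMinf r0 Lia; pose m : R := 2 `^ r.
have m0 : 0 <= m by exact: powR_ge0.
pose Kw := K2 * (M * (m * (K1 + 1))).
have Kw0 : 0 <= Kw by rewrite !mulr_ge0// addr_ge0.
pose Q := (2 * pi + 1) `^ r * Kw; have Q0 : 0 <= Q by rewrite mulr_ge0 ?powR_ge0.
pose V := cabs (fc W 0)^-1 `^ r * nr r W.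
have V0 : 0 <= V by rewrite mulr_ge0 ?powR_ge0 ?nr_ge0.
exists (m * (Kw + V * Q)); first by rewrite mulr_ge0// addr_ge0// mulr_ge0.
move=> psi Hpsi; have [g0 [Hg0 ng0 eg0]] := hK1 _ Hpsi.
pose rho0 := rhof a g0 psi; have Lrho0 : Lp r rho0 by exact: (rhof_Lp r1 Lia Hg0.1 Hpsi.1).
have [LJ nJ] := Lp_Jop Hpsi.1; have [LgJ ngJ] := LpD r0 Hg0.1 LJ; rewrite nJ in ngJ.
have [_ nrho0] := hM _ LgJ; rewrite -/(rhof a g0 psi) -/rho0 in nrho0.
have nrho0' : nr r rho0 <= M * (m * (K1 + 1)) * nr r psi.
  apply: (le_mul_trans M0 nrho0); apply: (le_trans ngJ); apply: (le_add_mul m0 ng0).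
  by rewrite mul1r.
have [Lt nt] := Lp_tpow (-1) Lrho0.
have [w0 [Hw0 nw0 pw0]] := hK2 _ Lt; rewrite nt in nw0.
have nw0' : nr r w0 <= Kw * nr r psi by exact: (le_mul_trans K20 nw0 nrho0').
(* Adding z g1 to the particular k adds z W to the particular w; this z removes the zeroth
   coefficient. *)
pose z := - fc w0 0 / fc W 0; pose w := fadd w0 (fscale z W).
have HzW := HpZ z r1' HW; have Hw : Hp r w := HpD r1' Hw0 HzW.
have w00 : fc w 0 = 0.
  by rewrite (fcD _ (Lp_Lp1 r1' Hw0.1) (Lp_Lp1 r1' HzW.1)) (fcZ _ _ (Lp_Lp1 r1' HW.1)) /z; field.
pose k := fadd g0 (fscale z g1); have Hzg := HpZ z r1' Hg1.
have Hk : Hp r k := HpD r1' Hg0 Hzg.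
pose rho := rhof a k psi; have Lrho : Lp r rho by exact: (rhof_Lp r1 Lia Hk.1 Hpsi.1).
have ek : aed (fun x => dsub a b x * k x - Jop k x = psi x - dsub a b x * Jop psi x).
  apply: aedS2 eg0 dg1 => x _ <- e; rewrite /k JopD JopZ /fadd /fscale -e; ring.
have LWr := (Lp_tpow (-1) (Linf_mul_Lp r0 Lia Hg1.1)).1.
have pw : peq (fmul (c1 a b) w) (fmul (tpow (-1)) rho).
  have -> : fmul (tpow (-1)) rho = fadd (fmul (tpow (-1)) rho0)
     (fscale z (fmul (tpow (-1)) (fmul (finv (tilde a)) g1))).
    by apply/funext => x; rewrite /rho /rho0 /rhof /k /fmul /fadd /fscale; ring.
  rewrite /w fmulD fmulZ; apply: peqD.
  - exact: (c1_Lp1 r1 Ic Hw0).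
  - exact: (LpZ z (c1_Lp1 r1 Ic HW)).1.
  - exact: (Lp_Lp1 r1' Lt).
  - exact: (LpZ z (Lp_Lp1 r1' LWr)).1.
  - exact: pw0.
  - exact: (peqZ z (c1_Lp1 r1 Ic HW) (Lp_Lp1 r1' LWr) pW).
have [Hf ef] := w_shift r1 Gab Ic Lrho (rho_sym Gab ek) Hw pw w00.
exists (fmul (tpow (-1)) w); split; first exact: Hf.
  have [_ ->] := Lp_tpow (-1) Hw.1; have [_ nw] := LpD r0 Hw0.1 HzW.1.
  apply: (le_trans nw); apply: (le_add_mul m0 nw0').
  have [_ ->] := LpZ z HW.1.
  have h1 := fc_powR 0 r1' Hw0.1.
  have h2 := le_mul_trans (powR_ge0 _ _) h1 nw0'.
  rewrite -[leRHS]mulrA; exact: (@quot_bound (fc W 0) _ _ _ _ h2 (nr_ge0 r W)).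
exact: (Eop_of_rho r1 Gab Hf Hk Hpsi ef).
Qed.
End Setting.
End Dichotomy.

(** * The subordinated pair *)
Section Assembly.
Variable R : realType.
Notation C := (R[i]).
Implicit Types a b f g h k u v w : fT R.

Lemma fc_cst (z : C) n : fc ((fun=> z) : fT R) n = if n == 0 then z else 0.
Proof.
have -> : (fun=> z) = fscale z (tpow 0) :> fT R by apply/funext => x; rewrite /fscale tpow0 mulr1.
by rewrite (fcZ _ _ (Lp_tpow1 0 ler01)) fc_tpow eq_sym; case: eqP => _; rewrite ?mulr1 ?mulr0.
Qed.

Lemma Lp_cst (z : C) : Lp 1 ((fun=> z) : fT R).
Proof. exact: (Linf_Lp ler01 (Linf_cst z)). Qed.
Lemma aed_cst_eq (z w : C) : aed (fun _ : R => z = w) -> z = w.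
Proof.
move=> h; have := fc_ae 0 (cmeas_cst z) (cmeas_cst w) ((aeqP (fun=> z) (fun=> w)).2 h).
by rewrite !fc_cst.
Qed.

Lemma H1_real_cst f : Hp 1 f -> aed (fun x => conjc (f x) = f x) -> aeq f (fun=> fc f 0).
Proof.
move=> [Lf hf] h; apply: (fc_uniq Lf (Lp_cst _)) => n; rewrite fc_cst.
have hc m : fc f m = conjc (fc f (- m)).
  rewrite -(fc_conj _ Lf); apply: fc_ae; [exact: (Lp_cmeas Lf)|exact: (Lp_cmeas (Lp_conj Lf).1)|].
  by apply/aeqP; apply: aedS h => x _ e; rewrite /conjf e.
case: (ltgtP n 0) => [n0|n0|->//]; first exact: hf.
by rewrite hc hf ?conjc0// oppr_lt0.
Qed.

Lemma inv_mul01 (z : C) : z^-1 * z = if z == 0 then 0 else 1.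
Proof. by case: eqVneq => [->|z0]; [rewrite mulr0|rewrite mulVf]. Qed.

(* g^-1 g only takes the values 0 and 1 (the inverse of 0 being 0) and lies in H^1,
   so it is constant. *)
Lemma outer_neq0 (r : R) g : 1 < r -> Hp (hconj r) g -> Hp r (finv g) ->
  aed (fun x => g x != 0) \/ aeq g (@f0 R).
Proof.
move=> r1 Hg Hi; have [H _] := Hp_mul r1 Hi Hg.
have h : aed (fun x => conjc (fmul (finv g) g x) = fmul (finv g) g x).
  by apply: aedW => x _; rewrite /fmul /finv inv_mul01; case: ifP => _; rewrite ?conjc0 ?conjc1.
have /aeqP e := H1_real_cst H h; set z := fc _ 0 in e.
have [z1|z1] := eqVneq z 1; [left|right].
  apply: aedS e => x _; rewrite z1 /fmul /finv inv_mul01; case: eqP => // _ /eqP.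
  by rewrite eq_sym oner_eq0.
apply/aeqP; apply: aedS e => x _; rewrite /fmul /finv inv_mul01.
by case: eqVneq => // _ e; rewrite -e eqxx in z1.
Qed.

Definition gminus gp : fT R := fscale (fsig gp) (finv (tilde gp)).

(** The normalization g_-(oo) = 1 excludes both the zero alternative of [outer_neq0] and a zero
    signature, since either would make [gminus gp] vanish. *)
Lemma WHsig2_neq0 (r : R) g gp : 1 < r -> WHsig2 r g gp ->
  [/\ aed (fun x => gp x != 0), fsig gp != 0 & aed (fun x => g x != 0)].
Proof.
move=> r1 [[/aeqP E [Hgp Hi] [[Lgm _] _] _] n1].
have contra : ~ aeq (gminus gp) (@f0 R).
  move=> h; have := fc_ae 0 (Lp_cmeas Lgm) (Lp_cmeas (Lp_f0 ltr01).1) h.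
  by rewrite n1 fc0 => /eqP; rewrite oner_eq0.
have s0 : fsig gp != 0.
  apply/eqP => s0; apply: contra; apply/aeqP; apply: aedW => x _.
  by rewrite /gminus s0 /fscale mul0r.
have g0 : aed (fun x => gp x != 0).
  have [//|/aeqP/tilde_aed h] := outer_neq0 r1 Hgp Hi; case: contra.
  by apply/aeqP; apply: aedS h => x _; rewrite /gminus /fscale /finv /tilde => ->; rewrite /f0 invr0 mulr0.
split=> //; apply: aedS3 E g0 (tilde_aed g0) => x _ -> h1 h2.
apply: mulf_neq0 => //; apply: mulf_neq0; last exact: tpow_neq0.
by rewrite /fscale mulf_neq0// /finv invr_eq0.
Qed.

(** The right side of the extended real estimate is finite, so the estimate itself puts the function
    in L^r. The absolute value makes the constant nonnegative. *)
Lemma Bd_of_pint (r : R) gp : 1 < r -> Hp (hconj r) gp -> Hp r (finv gp) ->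
  (exists cp : R, forall phi, trigpoly phi ->
        (pint r (fmul (finv gp) (Pr (fmul gp phi))) <= cp%:E * pint r phi)%E) -> Bd r gp.
Proof.
move=> r1 Hgp Hi [cp h]; exists `|cp|; first exact: normr_ge0.
move=> s; have r0 := gt1_ge0 r1; have q1 := hconj_gt1 r1; have q0 := gt1_ge0 q1.
have Lgt : Lp (hconj r) (fmul gp (tp s)).
  have -> : fmul gp (tp s) = fmul (tp s) gp by apply/funext => x; rewrite /fmul mulrC.
  exact: (Linf_mul_Lp q0 (Linf_tp s) Hgp.1).
have hs := h (tp s) ((trigpolyP _).2 (ex_intro _ s erefl)).
rewrite (pintE (Lp_tp s r0)) -EFinM in hs.
have L : Lp r (fmul (finv gp) (Pr (fmul gp (tp s)))).
  apply/LpP; split; last exact: (le_lt_trans hs (ltry _)).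
  exact: (cmeasM (Lp_cmeas Hi.1) (Lp_cmeas (riesz_Lp q1 Lgt))).
split; first exact: L.
rewrite (pintE L) lee_fin in hs; apply: (le_trans hs).
exact: (ler_wpM2r (nr_ge0 _ _) (ler_norm _)).
Qed.

Lemma Linf_fmul f g : Linf f -> Linf g -> Linf (fmul f g).
Proof. exact: LinfM. Qed.

Lemma WHsig2_Fac (r : R) g gp : 1 < r -> Linf g -> Linf (finv g) -> WHsig2 r g gp ->
  Fac r (fmul g (tpow 2)) (gminus gp) gp /\ Bd r gp.
Proof.
move=> r1 Lg Lig W; have [gp0 s0 g0] := WHsig2_neq0 r1 W.
case: W => [[/aeqP E [Hgp Hi] [Hgm Higm] B] n1]; split; last exact: (Bd_of_pint r1 Hgp Hi B).
split=> //.
- split; first exact: (Linf_fmul Lg (@Linf_tpow R 2)).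
    have -> : finv (fmul g (tpow 2)) = fmul (tpow (-2)) (finv g).
      by apply/funext => x; rewrite /finv /fmul invfM mulrC (tpowN 2 x).
    exact: (Linf_fmul (@Linf_tpow R (-2)) Lig).
  apply/aeqP; apply: aedS E => x _; rewrite /fmul => ->; rewrite (tpowN 2 x) -/(gminus gp).
  have T0 : tpow 2 x != 0 :> C by exact: tpow_neq0.
  by field.
- split=> //; apply: aedS (tilde_aed gp0) => x _ h.
  by rewrite /gminus /fscale mulf_neq0// /finv invr_eq0.
Qed.

Lemma finv_csub a b : finv (csub a b) = fmul (finv a) b.
Proof. by apply/funext => x; rewrite /finv /csub /fmul invfM invrK. Qed.
Lemma finv_dsub a b : finv (dsub a b) = fmul (finv a) (tilde b).
Proof. by apply/funext => x; rewrite /finv /dsub /fmul /finv invfM invrK. Qed.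

(** As 0 has inverse 0, d(x) != 0 forces both a and b~ to be nonzero at x. Then b^-1 = b~ / (a a~)
    is bounded. *)
Lemma matching_regular_pair a b : matching a b -> aed (fun x => dsub a b x != 0) ->
  [/\ regular_pair a b, Linf (csub a b) /\ Linf (finv (csub a b)) & Linf (dsub a b) /\ Linf (finv (dsub a b))].
Proof.
move=> [[La Lia] Lb /aeqP e] h.
have Liat : Linf (finv (tilde a)) := Linf_tilde Lia.
have h2 := tilde_aed h.
have G : aed (fun x => [/\ a x != 0, b x != 0 & a x * tilde a x = b x * tilde b x]).
  apply: aedS3 e h h2 => x _; rewrite /dsub /fmul /finv /tilde reflY => e1 e2 e3.
  rewrite !mulf_eq0 !negb_or !invr_eq0 in e2 e3.
  by case/andP: e2 => e2 _; case/andP: e3 => _ e3; split.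
have gd : regular_pair a b by split.
have Lib : Linf (finv b).
  apply: (@Linf_ae R (fmul (tilde b) (fmul (finv a) (finv (tilde a))))).
  - exact: (cmeas_inv (Linf_cmeas Lb)).
  - apply/aeqP; apply: aedS (regular_pair_pt gd) => x _ [A1 A2 B1 B2 ex].
    rewrite /fmul /finv /tilde -[LHS]mul1r -{1}(mulVf B1).
    have -> : (b x)^-1 * b x * (b (2 * pi - x) * ((a x)^-1 / a (2 * pi - x))) =
       (b x)^-1 * (b x * b (2 * pi - x)) * ((a x)^-1 / a (2 * pi - x)) by ring.
    by rewrite -ex; field; rewrite A1 A2 B1.
  - exact: (Linf_fmul (Linf_tilde Lb) (Linf_fmul Lia Liat)).
split=> //; split.
- exact: (Linf_fmul La Lib).
- by rewrite finv_csub; exact: (Linf_fmul Lia Lb).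
- exact: (Linf_fmul La (Linf_tilde Lib)).
- by rewrite finv_dsub; exact: (Linf_fmul Lia (Linf_tilde Lb)).
Qed.

Definition sg (s : bool) : C := if s then 1 else -1.
(** T(a) - H(b) is treated as T(a) + H(-b). This only changes the signs of c and d, so one
    factorization serves both operators. *)
Definition bs b (s : bool) : fT R := fscale (sg s) b.
Lemma sg2 s : sg s * sg s = 1.
Proof. by case: s; rewrite /sg ?mul1r ?mulrNN ?mulr1. Qed.
Lemma sg_neq0 s : sg s != 0.
Proof. by case: s; rewrite /sg ?oppr_eq0 oner_eq0. Qed.
Lemma sgV s : (sg s)^-1 = sg s.
Proof. by apply: (mulfI (sg_neq0 s)); rewrite sg2 mulfV ?sg_neq0. Qed.
Lemma cabs_sg s : cabs (sg s) = 1.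
Proof. by case: s; rewrite /sg ?cabsN cabs1. Qed.
Lemma conj_sg s : conjc (sg s) = sg s.
Proof. by case: s; apply: complexP; rewrite ?ReJ ?ImJ /sg ?ReN ?ImN /= ?opprK ?oppr0. Qed.
Lemma bsT b : bs b true = b.
Proof. by apply/funext => x; rewrite /bs /fscale mul1r. Qed.
Lemma adjb_bs b s : adjb (bs b s) = bs (adjb b) s.
Proof. by apply/funext => x; rewrite /adjb /tilde /conjf /bs /fscale conjcM conj_sg. Qed.
Lemma csub_bs a b s : csub a (bs b s) = fscale (sg s) (csub a b).
Proof. by apply/funext => x; rewrite /csub /fmul /finv /bs /fscale invfM sgV; ring. Qed.
Lemma dsub_bs a b s : dsub a (bs b s) = fscale (sg s) (dsub a b).
Proof. by apply/funext => x; rewrite /dsub /fmul /finv /tilde /bs /fscale invfM sgV; ring. Qed.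
Lemma fscale_fmul z f g : fmul (fscale z f) g = fscale z (fmul f g).
Proof. by apply/funext => x; rewrite /fmul /fscale mulrA. Qed.
Lemma Linf_scale z f : Linf f -> Linf (fscale z f).
Proof. by move=> h; apply: (Linf_fmul (Linf_cst z) h). Qed.

Lemma regular_pair_bs a b s : regular_pair a b -> regular_pair a (bs b s).
Proof.
move=> [La Lb Lia h]; split=> //; first exact: Linf_scale.
apply: aedS h => x _ [A B e]; split=> //; first by rewrite /bs /fscale mulf_neq0// sg_neq0.
by rewrite e /tilde /bs /fscale mulrACA sg2 mul1r.
Qed.

Lemma Inv_sg (r : R) g s : 1 < r -> Inv r g -> Inv r (fscale (sg s) g).
Proof.
move=> r1 [Lg inj [K K0 hK]]; have r1' := ltW r1; have r0 := gt1_ge0 r1.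
have Lm f : Hp r f -> Lp 1 (fmul g f) by move=> H; exact: (Lp_Lp1 r1' (Linf_mul_Lp r0 Lg H.1)).
split; first exact: Linf_scale.
  move=> f Hf p; apply: (inj _ Hf) => n n0.
  have := p n n0; rewrite fscale_fmul (fcZ _ _ (Lm _ Hf)) !fc0 => /eqP.
  by rewrite mulf_eq0 (negbTE (sg_neq0 s)) => /eqP.
exists K => // G LG; have [LZ nZ] := LpZ1 (cabs_sg s) LG.
have [f [Hf nf pf]] := hK _ LZ; rewrite nZ in nf; exists f; split; [exact: Hf|exact: nf|move=> n n0].
by rewrite fscale_fmul (fcZ _ _ (Lm _ Hf)) (pf n n0) (fcZ _ _ (Lp_Lp1 r1' LG)) mulrA sg2 mul1r.
Qed.

Lemma c1_bs a b s : c1 a (bs b s) = fscale (sg s) (c1 a b).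
Proof. by rewrite /c1 csub_bs fscale_fmul. Qed.

(** * The kernel of the homogeneous d-equation and the function omega *)

Section Core.
Variables (r : R) (a b dp : fT R).
Hypotheses (r1 : 1 < r) (Mab : matching a b) (Wd : WHsig2 r (dsub a b) dp).
Let r1' : 1 <= r := ltW r1.
Let r0 : 0 <= r := gt1_ge0 r1.
Let sigma := fsig dp.

Lemma dp_neq0 : aed (fun x => dp x != 0).
Proof. by have [] := WHsig2_neq0 r1 Wd. Qed.
Lemma subordinated_Linf : [/\ regular_pair a b, Linf (csub a b) /\ Linf (finv (csub a b)) &
   Linf (dsub a b) /\ Linf (finv (dsub a b))].
Proof. by have [_ _ h] := WHsig2_neq0 r1 Wd; exact: matching_regular_pair. Qed.
Lemma d_formula : aed (fun x => [/\ dp x != 0, dp (2 * pi - x) != 0 &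
   dsub a b x = sigma * (dp (2 * pi - x))^-1 * (tpow 1 x * tpow 1 x)^-1 * dp x]).
Proof.
case: Wd => [[/aeqP E _ _ _] _]; apply: aedS3 E dp_neq0 (tilde_aed dp_neq0) => x _ -> h1 h2.
by split=> //; rewrite tpow_m2E.
Qed.

(** d d~ = 1, and in the product of the two factorizations everything except sigma^2 cancels. *)
Lemma sigma2 : sigma * sigma = 1.
Proof.
have [G _ _] := subordinated_Linf; apply: aed_cst_eq.
apply: aedS3 d_formula (tilde_aed d_formula) (regular_pair_pt G) => x _ [h1 h2 e1] [_ _ e2] [A1 A2 B1 B2 e].
have T0 : tpow 1 x != 0 :> C by exact: tpow_neq0.
have : dsub a b x * dsub a b (2 * pi - x) = 1.
  rewrite /dsub /fmul /finv /tilde reflY mulrACA e.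
  by field; rewrite B1 B2.
rewrite e1 e2 reflY tpow1Y => <-.
by field; rewrite h1 h2 T0.
Qed.

Lemma Inv_dsub_shift : Inv r (fmul (dsub a b) (tpow 2)).
Proof.
have [_ _ [L1 L2]] := subordinated_Linf; have [F B] := WHsig2_Fac r1 L1 L2 Wd.
exact: (Fac_solve r1 F B).
Qed.

Lemma Hp_finv_dp : Hp r (finv dp).
Proof. by case: Wd => [[_ []]]. Qed.
(** Constant terms are multiplicative on H^p times H^q, and d_+^-1 d_+ = 1. *)
Lemma fc_finv_dp_neq0 : fc (finv dp) 0 != 0.
Proof.
have Hdp : Hp (hconj r) dp by case: Wd => [[_ []]].
have [H e] := Hp_mul r1 Hp_finv_dp Hdp; apply/eqP => z; rewrite z mul0r in e.
have := fc_ae 0 (Lp_cmeas H.1) (cmeas_cst (1 : C)); rewrite e fc_cst eqxx.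
suff h : aeq (fmul (finv dp) dp) (fun=> 1) by move/(_ h)/eqP; rewrite eq_sym oner_eq0.
by apply/aeqP; apply: aedS dp_neq0 => x _ h; rewrite /fmul /finv mulVf.
Qed.

(* The argument of T(a~^-1 t^-1) in [omega_rhs]. *)
Definition gker (s : bool) : fT R :=
  fun x => (dp x)^-1 + (if s then 1 else -1) * fsig dp * (dp x)^-1 * tpow 1 x.
Lemma gkerE s : gker s = fadd (finv dp) (fscale (sg s * sigma) (fmul (tpow 1) (finv dp))).
Proof. by apply/funext => x; rewrite /gker /fadd /fscale /fmul /finv -/(sg s) -/sigma; ring. Qed.

(** With e = d_+^-1, the factorization gives d e = sigma J(t e) and d (t e) = sigma J e. A solution
    must be of the form z e + w t e, and comparing the two sides then fixes w in terms of z,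
    consistently because sigma^2 = 1. *)
Lemma gker_kerspan s : kerspan r a (bs b s) (gker s).
Proof.
have He := Hp_finv_dp; have Hte := Hp_tpow (isT : 0 <= 1 :> int) He.
have Le := Lp_Lp1 r1' He.1; have Lte := Lp_Lp1 r1' Hte.1.
set e := finv dp in He Hte Le Lte; set te := fmul (tpow 1) e in Hte Lte.
have e0 : fc e 0 != 0 := fc_finv_dp_neq0.
have te0 : fc te 0 = 0 by rewrite /te fc_shift He.2.
have te1 : fc te 1 = fc e 0 by rewrite /te fc_shift subrr.
pose t := sg s * sigma; have t2 : t * t = 1 by rewrite /t mulrACA sg2 sigma2 mulr1.
have [_ _ [Ld _]] := subordinated_Linf.
have st : sg s * t = sigma by rewrite /t mulrA sg2 mul1r.
split.
- by rewrite gkerE; exact: (HpD r1' He (HpZ _ r1' Hte)).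
- move=> h; have Hg : Hp r (gker s) by rewrite gkerE; exact: (HpD r1' He (HpZ _ r1' Hte)).
  have := fc_ae 0 (Lp_cmeas Hg.1) (Lp_cmeas (Lp_f0 ltr01).1) h.
  rewrite gkerE (fcD _ Le (LpZ _ Lte).1) (fcZ _ _ Lte) -/te te0 mulr0 addr0 fc0 => /eqP.
  by rewrite (negbTE e0).
- apply: aedS d_formula => x _ [h1 h2 E].
  rewrite dsub_bs /fscale E gkerE Jop_refl /fadd /fscale /fmul /finv tpow1Y -/t -st.
  have T0 : tpow 1 x != 0 :> C by exact: tpow_neq0.
  move: (tpow 1 x) (dp x) (dp (2 * pi - x)) T0 h1 h2 => T p q T0 h1 h2.
  have -> : sg s * (sg s * t * q^-1 * (T * T)^-1 * p) = t * q^-1 * (T * T)^-1 * p.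
    by rewrite -!mulrA mulrA sg2 mul1r.
  have -> : t * q^-1 * (T * T)^-1 * p * (p^-1 + t * (T * p^-1)) =
     q^-1 * (T * T)^-1 * (t + (t * t) * T) by field; rewrite h1 h2 T0.
  by rewrite t2; field; rewrite h2 T0.
- move=> g Hg dg; have Lg := Lp_Lp1 r1' Hg.1.
  (* Chosen so that g - l has vanishing coefficients at 0 and 1; the constant term of e is
     nonzero. *)
  pose z := fc g 0 / fc e 0; pose w := (fc g 1 - z * fc e 1) / fc e 0.
  pose l := lc2 z w e te; have Hl : Hp r l by exact: (Hp_lc2 _ _ r1 He Hte).
  have HF := HpB r1' Hg Hl.
  have F0 : fc (fsub g l) 0 = 0.
    by rewrite (fcB _ Lg (Lp_Lp1 r1' Hl.1)) (fc_lc2 _ _ _ Le Lte) te0 /z; field.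
  have F1 : fc (fsub g l) 1 = 0.
    by rewrite (fcB _ Lg (Lp_Lp1 r1' Hl.1)) (fc_lc2 _ _ _ Le Lte) te1 /w; field.
  have Hf := Hp_shift2 HF F0 F1.
  (* d (g - l) = J k with k in H^r, so T(d t^2) annihilates t^-2 (g - l). *)
  pose k := fsub (fscale (sg s) g) (fscale sigma (lc2 w z e te)).
  have Hk : Hp r k by exact: (HpB r1' (HpZ _ r1' Hg) (HpZ _ r1' (Hp_lc2 _ _ r1 He Hte))).
  have [_ inj _] := Inv_dsub_shift.
  have E2 : fmul (tpow 2) (fmul (tpow (-2)) (fsub g l)) = fsub g l.
    by rewrite tpow_mulC subrr tpow0_mul.
  have z0 : aeq (fmul (tpow (-2)) (fsub g l)) (@f0 R).
    apply: (inj _ Hf); rewrite -fmulA E2.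
    apply: (peq_trans _ (Jop_peq (Hp_Hp1 r1' Hk))).
    apply: (peq_ae (Lp_cmeas (Linf_mul_Lp r0 Ld HF.1)) (Lp_cmeas (Lp_Jop Hk.1).1)).
    apply/aeqP; apply: aedS2 d_formula dg => x _ [h1 h2 E].
    rewrite dsub_bs /fscale => /(congr1 (fun y => sg s * y)).
    rewrite !mulrA sg2 mul1r /fmul /fsub mulrBr => ->.
    rewrite tpow_m1E Jop_refl /k /l /lc2 /te /e /fsub /fadd /fscale /fmul /finv tpow1Y E.
    have T0 : tpow 1 x != 0 :> C by exact: tpow_neq0.
    by field; rewrite h1 h2 T0.
  have el : aeq g l.
    move/aeqP: z0 => z0; apply/aeqP; apply: aedS z0 => x _ /eqP; rewrite /fmul /f0 mulf_eq0.
    by rewrite (negbTE (tpow_neq0 _ _)) /fsub subr_eq0 => /eqP.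
  have /aeqP elJ := Jop_aeq el; move/aeqP: el => el.
  (* Inserting l into the equation and clearing denominators leaves a combination of the characters
     of index -1 and 0 that vanishes; its coefficient at -1 is the claim. *)
  have tz : w = t * z.
    have key : aed (fun x => lc2 (t * z - w) (- (t * (t * z - w))) (tpow (-1)) (tpow 0) x = f0 x).
      have eboth := aedS2 (fun x (_ : @dom R x) e1 e2 => conj e1 e2) el elJ.
      apply: aedS3 d_formula dg eboth => x _ [h1 h2 E] E1 [E3 E4].
      move: E1; rewrite E4 E3 dsub_bs /fscale E Jop_refl /l /lc2 /te /e /fadd /fscale /fmul /finv.
      rewrite tpow1Y tpow_m1E tpow0 /f0 -st.
      have T0 : tpow 1 x != 0 :> C by exact: tpow_neq0.
      move: (tpow 1 x) (dp x) (dp (2 * pi - x)) T0 h1 h2 => T p q T0 h1 h2.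
      have -> : sg s * (sg s * t * q^-1 * (T * T)^-1 * p) = t * q^-1 * (T * T)^-1 * p.
        by rewrite -!mulrA mulrA sg2 mul1r.
      move=> /(congr1 (fun y => q * T * y)).
      have -> : q * T * (t * q^-1 * (T * T)^-1 * p * (z * p^-1 + w * (T * p^-1))) = t * z * T^-1 + t * w.
        by field; rewrite h1 h2 T0.
      have -> : q * T * (T^-1 * (z * q^-1 + w * (T^-1 * q^-1))) = (t * t) * z + w * T^-1.
        by rewrite t2; field; rewrite h2 T0.
      move=> e1; have -> : (t * z - w) * T^-1 + - (t * (t * z - w)) * 1 =
         (t * z * T^-1 + t * w) - (t * t * z + w * T^-1) by ring.
      by rewrite e1 subrr.
    have Lt (n : int) : Lp 1 (tpow n : fT R) by exact: (Lp_tpow1 n ler01).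
    have Ll : Lp 1 (lc2 (t * z - w) (- (t * (t * z - w))) (tpow (-1)) (tpow 0) : fT R).
      exact: (LpD ler01 (LpZ _ (Lt _)).1 (LpZ _ (Lt _)).1).1.
    have := fc_ae (-1) (Lp_cmeas Ll) (Lp_cmeas (Lp_f0 ltr01).1) ((aeqP _ _).2 key).
    rewrite (fc_lc2 _ _ _ (Lt _) (Lt _)) !fc_tpow fc0 mulr1 mulr0 addr0 => /eqP.
    by rewrite subr_eq0 => /eqP <-.
  exists z; apply/aeqP; apply: aedS el => x _ ->.
  by rewrite gkerE /l /lc2 tz /te /e /fadd /fscale -/t; ring.
Qed.

(** [omega] is a choice, and solvability of its equation makes it meet its specification. *)
Lemma omega_spec s : Inv r (c1 a b) ->
  Hp r (omega r a b dp s) /\ peq (fmul (c1 a b) (omega r a b dp s))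
     (fmul (tpow (-1)) (fmul (finv (tilde a)) (gker s))).
Proof.
move=> [Lc _ [K _ hK]]; have [[_ _ Lia _] _ _] := subordinated_Linf.
have Hg : Hp r (gker s).
  by rewrite gkerE; exact: (HpD r1' Hp_finv_dp (HpZ _ r1' (Hp_tpow (isT : 0 <= 1 :> int) Hp_finv_dp))).
have La2 := Linf_fmul Lia (@Linf_tpow R (-1)).
have [H1 p1] := Top_peq r1 La2 Hg.1.
have ex : exists w, Hp r w /\ aeq (Top (fmul (csub a b) (tpow (-2))) w) (omega_rhs a b dp s).
  have [w [Hw _ pw]] := hK _ H1.1; exists w; split=> //.
  have [H2 p2] := Top_peq r1 Lc Hw.1.
  exact: (Hp_uniq r1 H2 H1 (peq_trans p2 pw)).
have [Hw ew] := @xgetPex _ (@f0 R) [set w | Hp r w /\ aeq (Top (fmul (csub a b) (tpow (-2))) w) (omega_rhs a b dp s)] ex.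
rewrite -/(omega r a b dp s) in Hw ew; split=> //.
have [H2 p2] := Top_peq r1 Lc Hw.1.
have -> : fmul (tpow (-1)) (fmul (finv (tilde a)) (gker s)) = fmul (fmul (finv (tilde a)) (tpow (-1))) (gker s).
  by apply/funext => x; rewrite /fmul; ring.
apply: (peq_trans (peq_sym p2)); apply: peq_trans p1.
exact: (peq_ae (Lp_cmeas H2.1) (Lp_cmeas H1.1) ew).
Qed.

Lemma omega_dichotomy s : Inv r (c1 a b) ->
  (fc (omega r a b dp s) 0 != 0 -> Einj r a (bs b s) /\
    exists2 K : R, 0 <= K & forall psi, Hp r psi ->
     exists f, [/\ Hp r f, nr r f <= K * nr r psi & peq (Eop a (bs b s) f) psi]) /\
  (Einj r a (bs b s) -> fc (omega r a b dp s) 0 != 0).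
Proof.
move=> Ic; have [Hw pw] := omega_spec s Ic; set W := omega r a b dp s in Hw pw *.
have [G _ [Ld _]] := subordinated_Linf.
have Gs := regular_pair_bs s G.
have Lds : Linf (dsub a (bs b s)) by rewrite dsub_bs; exact: Linf_scale.
have Ics : Inv r (c1 a (bs b s)) by rewrite c1_bs; exact: Inv_sg.
have Ids : Inv r (fmul (dsub a (bs b s)) (tpow 2)).
  by rewrite dsub_bs fscale_fmul; apply: (Inv_sg s r1); exact: Inv_dsub_shift.
(* [omega] is formed with the c of (a, b), while the signed pair has the signed c; multiplying by
   the sign repairs this and leaves the vanishing of the zeroth coefficient unchanged. *)
have KS := gker_kerspan s; have HW := HpZ (sg s) r1' Hw.
have pW : peq (fmul (c1 a (bs b s)) (fscale (sg s) W)) (fmul (tpow (-1)) (fmul (finv (tilde a)) (gker s))).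
  rewrite c1_bs (_ : fmul _ _ = fmul (c1 a b) W)//.
  by apply/funext => x; rewrite /fmul /fscale mulrACA sg2 mul1r.
have fW : fc (fscale (sg s) W) 0 = sg s * fc W 0 by rewrite (fcZ _ _ (Lp_Lp1 r1' Hw.1)).
split=> [W0|inj].
  have W0' : fc (fscale (sg s) W) 0 != 0 by rewrite fW mulf_neq0// sg_neq0.
  split; first exact: (W_inj r1 Gs Ics KS HW pW W0').
  exact: (W_surj r1 Gs Lds Ics Ids KS HW pW W0').
apply/eqP => W0; apply: (W_kernel r1 Gs Ics KS HW pW _ inj).
by rewrite fW W0 mulr0.
Qed.
End Core.
End Assembly.

(** * The adjoint pair and the conclusion *)

Section Equivalences.
Variable R : realType.
Implicit Types a b : fT R.

(** Passing to the adjoint conjugates and swaps the subordinated functions: (c, d) becomes (conj d,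
    conj c). *)
Lemma dsub_adj a b : dsub (conjf a) (adjb b) = conjf (csub a b).
Proof.
rewrite /dsub /adjb tildeK finv_conj.
by apply/funext => x; rewrite /csub /fmul /conjf conjcM.
Qed.

Lemma csub_adj a b : csub (conjf a) (adjb b) = conjf (dsub a b).
Proof.
rewrite /csub /adjb.
have -> : finv (tilde (conjf b)) = conjf (finv (tilde b)).
  by rewrite -finv_conj.
by apply/funext => x; rewrite /dsub /fmul /conjf conjcM.
Qed.

Lemma conjf_tpow (f : fT R) n : conjf (fmul f (tpow n)) = fmul (conjf f) (tpow (- n)).
Proof. by apply/funext => x; rewrite /conjf /fmul conjcM conj_tpow. Qed.

Lemma matching_adj a b : matching a b -> matching (conjf a) (adjb b).
Proof.
move=> [[La Lia] Lb /aeqP e]; split.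
- by split; [exact: Linf_conj|rewrite finv_conj; exact: Linf_conj].
- exact: (Linf_tilde (Linf_conj Lb)).
apply/aeqP; apply: aedS e => x _ /(congr1 (@conjc R)).
by rewrite /adjb tildeK /fmul /tilde /conjf !conjcM => ->; rewrite mulrC.
Qed.

(** The dichotomy is applied to the operator and to its adjoint. A nonzero w' makes the adjoint
    surjective, hence the operator injective, hence w nonzero; surjectivity of the operator likewise
    makes the adjoint injective and w' nonzero. *)
Lemma conditions_equiv (p : R) a b dp dq Op s : 1 < p -> matching a b ->
  WHsig2 p (dsub a b) dp -> WHsig2 (hconj p) (dsub (conjf a) (adjb b)) dq ->
  Inv p (c1 a b) -> Inv (hconj p) (c1 (conjf a) (adjb b)) ->
  OpOf p a (bs b s) Op ->
  let w := fc (omega p a b dp s) 0 in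
  let w' := fc (omega (hconj p) (conjf a) (adjb b) dq s) 0 in
  [/\ w != 0 -> invertible p Op, left_invertible p Op -> w != 0,
      w' != 0 -> w != 0 & right_invertible p Op -> w' != 0].
Proof.
move=> p1 M Wp Wq Ip Iq HOp w w'; have q1 := hconj_gt1 p1.
have [[_ _] Lb _] := M; have [[La _] _ _] := M.
have Lbs : Linf (bs b s) by exact: Linf_scale.
have [N1 N2] := omega_dichotomy p1 M Wp s Ip; have [N1' N2'] := omega_dichotomy q1 (matching_adj M) Wq s Iq.
split.
- by move=> /N1[inj surj]; exact: (OpOf_invertible p1 La Lbs HOp inj surj).
- by move=> L; exact: (N2 (left_Einj p1 La Lbs HOp L)).
- move=> /N1'[_ [K _ hK]]; apply: N2; apply: (Esurj_adj_inj p1 La Lbs).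
  rewrite adjb_bs => psi Hpsi; have [f [Hf _ pf]] := hK _ Hpsi.
  by exists f.
- move=> /(right_Esurj p1 HOp) S; apply: N2'.
  apply: (Esurj_adj_inj q1 (Linf_conj La)).
    exact: (Linf_scale _ (Linf_tilde (Linf_conj Lb))).
  by rewrite hconjK// conjfK -adjb_bs adjbK.
Qed.
End Equivalences.

Theorem theorem5p1 (R : realType) (p : R) (a b dp dq : fT R) :
  1 < p ->
  FTH p a b (-2) 2 ->
  (* d = sigma(d) d_+ t^{-2} d~_+^{-1}: WH factorization of d in L^p *)
  WHsig2 p (dsub a b) dp ->
  (* the same for the subordinated d of (conj a, (conj b)~) in L^q *)
  WHsig2 (hconj p) (dsub (conjf a) (tilde (conjf b))) dq ->
  let q := hconj p in
  let a' := conjf a in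
  let b' := tilde (conjf b) in
  let w0 (s : bool) := fc (omega p a b dp s) 0 in
  let w0' (s : bool) := fc (omega q a' b' dq s) 0 in
  [/\ invertible p (Top (fmul (csub a b) (tpow (-2)))) /\
      (FTH q a' b' (-2) 2 /\ invertible q (Top (fmul (csub a' b') (tpow (-2))))),
      (* (a) *)
      ((left_invertible p (THop a b) <-> w0 true != 0) /\
       (left_invertible p (THmop a b) <-> w0 false != 0)),
      (* (b) *)
      ((right_invertible p (THop a b) <-> w0' true != 0) /\
       (right_invertible p (THmop a b) <-> w0' false != 0)),
      (* (c) *)
      ((invertible p (THop a b) <-> w0 true != 0 /\ w0' true != 0) /\
       (invertible p (THmop a b) <-> w0 false != 0 /\ w0' false != 0))
    & (* (d) *)
      (w0 true != 0 -> w0 false != 0 ->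
         invertible p (THop a b) /\ invertible p (THmop a b))].
Proof.
move=> p1 [M _ _] Wp Wq q a' b' w0 w0'.
have q1 : 1 < q := hconj_gt1 p1; have M' : matching a' b' := matching_adj M.
have [_ [Lc Lic] [Ld Lid]] := subordinated_Linf p1 M Wp.
have [_ [Lc' Lic'] [Ld' Lid']] := subordinated_Linf q1 M' Wq.
have [Fp Bp] := WHsig2_Fac p1 Ld Lid Wp; have [Fq Bq] := WHsig2_Fac q1 Ld' Lid' Wq.
(* c' t^-2 is the conjugate of d t^2, so the factorization of d in L^p is dualized. *)
have Iq : Inv q (c1 a' b').
  by rewrite /c1 csub_adj -conjf_tpow; exact: (Fac_Inv_dual p1 Fp Bp).
(* c t^-2 is the conjugate of d' t^2, where d' = conj c is factored in L^q; the dual exponent of q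
   is p. *)
have Ip : Inv p (c1 a b).
  have := Fac_Inv_dual q1 Fq Bq; rewrite (hconjK p1) conjf_tpow.
  by rewrite (_ : conjf (dsub a' b') = csub a b)// [dsub _ _]dsub_adj conjfK.
have [[La _] Lb _] := M.
have O1 : OpOf p a (bs b true) (THop a b) by rewrite bsT; exact: (OpOf_THop p1 La Lb).
have O2 : OpOf p a (bs b false) (THmop a b) by exact: (OpOf_THmop p1 La Lb).
have [t1 t2 t3 t4] := conditions_equiv p1 M Wp Wq Ip Iq O1.
have [f1 f2 f3 f4] := conditions_equiv p1 M Wp Wq Ip Iq O2.
rewrite -[omega (hconj p) _ _ _ _]/(omega q a' b' dq _) in t3 t4 f3 f4.
split.
- split; first exact: (Inv_Top p1 Ip).
  split; last exact: (Inv_Top q1 Iq).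
  split; first exact: M'.
    exact: (fredholm_m2 q1 Lc' Iq).
  exact: (fredholm_p2 q1 Ld' (Fac_solve q1 Fq Bq)).
- split; split.
  + exact: t2.
  + by move=> /t1; exact: invertible_left.
  + exact: f2.
  + by move=> /f1; exact: invertible_left.
- split; split.
  + exact: t4.
  + by move=> /t3/t1; exact: invertible_right.
  + exact: f4.
  + by move=> /f3/f1; exact: invertible_right.
- split; split.
  + by move=> h; split; [exact: (t2 (invertible_left h))|exact: (t4 (invertible_right h))].
  + by case=> h _; exact: (t1 h).
  + by move=> h; split; [exact: (f2 (invertible_left h))|exact: (f4 (invertible_right h))].
  + by case=> h _; exact: (f1 h).
- by move=> h1 h2; exact: (conj (t1 h1) (f1 h2)).
Qed.
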